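(* Let $(A,\mathfrak m)$ be a non-regular complete intersection local ring of dimension $\ge 1$, let $N$ be a perfect $A$-module of dimension $\ge 1$, and let $I$ be an ideal of definition of $N$. Then there exists a 2-periodic maximal Cohen-Macaulay $A$-module $E$ (that is, $\Omega^2E\cong E$) such that $$r_1^{I,N}(E)=\inf\{\, r_\infty^{I,N}(M)\;:\; 0\ne M\in\underline{\operatorname{CM}}(A)\,\}.$$
   Context: All rings are commutative Noetherian and all modules are finitely generated. $\lambda(-)$ denotes length. Over a Cohen-Macaulay local ring, a non-zero module $N$ is perfect if and only if it is Cohen-Macaulay of finite projective dimension. An ideal of definition of $N$ is an ideal $I\subseteq\mathfrak m$ with $\lambda(N/IN)<\infty$. $\underline{\operatorname{CM}}(A)$ is the stable category of maximal Cohen-Macaulay (MCM) $A$-modules: its objects are the MCM $A$-modules, and its morphisms are $A$-linear maps modulo those factoring through a finitely generated free module; an object is zero in it if and only if it is a free $A$-module. For $i\ge0$, $\Omega^i$ is the $i$-th (minimal) syzygy; for an MCM module $X$, with $X^*=\operatorname{Hom}_A(X,A)$, the cosyzygy is $\Omega^{-1}X=(\Omega(X^* ))^*$, and $\Omega^{-i}X=\Omega^{-1}(\Omega^{-(i-1)}X)$. For an MCM $A$-module $M$, the function $n\mapsto\lambda(\operatorname{Tor}_1^A(M,N/I^nN))$ is known to agree with a polynomial for $n\gg0$, whose degree is denoted $r_1^{I,N}(M)$ (the zero polynomial has degree $-1$). Finally $r_\infty^{I,N}(M)=\sup\{r_1^{I,N}(\Omega^sM)\;:\; s\in\mathbb Z\}$.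 *)

(* Defs.v *)
From HB Require Import structures.
From mathcomp Require Import all_boot all_order all_algebra.
From mathcomp Require Import boolp classical_sets constructive_ereal.

Set Implicit Arguments.
Unset Strict Implicit.
Unset Printing Implicit Defensive.

Import Order.TTheory GRing.Theory Num.Theory.
Local Open Scope classical_set_scope.
Local Open Scope ring_scope.

(* Dimensions, depths, lengths and degrees are valued in the complete chain
   \bar int; the supremum of the empty set is -oo, its infimum +oo. *)
Definition supz (S : set (\bar int)) : \bar int := supremum -oo%E S.
Definition infz (S : set (\bar int)) : \bar int := infimum +oo%E S.

(* Supremum of the lengths n of the chains S_0 < S_1 < ... < S_n in P. *)
Definition max_chain (T : Type) (P : set (set T)) : \bar int :=
  supz [set n%:Z%:E | n in [set n : nat | exists S : nat -> set T,
    (forall i, (i <= n)%N -> P (S i)) /\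
    (forall i, (i < n)%N -> S i `<` S i.+1)]].

(** Modules *)

Definition submodule (A : comNzRingType) (M : lmodType A) (S : set M) : Prop :=
  S 0 /\ forall (a : A) (x y : M), S x -> S y -> S (a *: x + y).

Definition ideal (A : comNzRingType) (I : set A) : Prop :=
  submodule (I : set A^o).

(* J S = the finite sums of products a *: x with a in J and x in S; J need not
   be an ideal, so that smul [set` xs] setT is the submodule (x_1,...,x_r)M. *)
Definition smul (A : comNzRingType) (M : lmodType A) (J : set A) (S : set M) :
    set M :=
  [set y | exists (n : nat) (a : 'I_n -> A) (x : 'I_n -> M),
    (forall i, J (a i) /\ S (x i)) /\ y = \sum_i a i *: x i].

Definition ideal_gen (A : comNzRingType) (xs : seq A) : set A :=
  smul [set` xs] (setT : set A^o).

Definition ideal_pow (A : comNzRingType) (I : set A) (n : nat) : set A :=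
  iter n (fun J : set A^o => smul I J) setT.

Definition isomorphic (A : comNzRingType) (M M' : lmodType A) : Prop :=
  exists f : {linear M -> M'}, bijective f.

Definition fin_gen (A : comNzRingType) (M : lmodType A) : Prop :=
  exists (n : nat) (f : {linear 'rV[A]_n -> M}), range f = setT.

Definition ker (A : comNzRingType) (M M' : lmodType A) (f : {linear M -> M'}) :
    set M :=
  [set x | f x = 0].

Definition short_exact (A : comNzRingType) (K P M : lmodType A)
    (i : {linear K -> P}) (p : {linear P -> M}) : Prop :=
  [/\ injective i, range i = ker p & range p = setT].

Definition projective (A : comNzRingType) (P : lmodType A) : Prop :=
  forall (X Y : lmodType A) (g : {linear X -> Y}) (f : {linear P -> Y}),
    range g = setT -> exists h : {linear P -> X}, forall x, g (h x) = f x.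

Fixpoint pd_le (A : comNzRingType) (n : nat) (M : lmodType A) : Prop :=
  if n is n'.+1 then
    exists (K P : lmodType A) (i : {linear K -> P}) (p : {linear P -> M}),
      [/\ projective P, short_exact i p & pd_le n' K]
  else projective M.

(* Q is (isomorphic to) M / U. *)
Definition is_quotient (A : comNzRingType) (M : lmodType A) (U : set M)
    (Q : lmodType A) : Prop :=
  exists p : {linear M -> Q}, range p = setT /\ ker p = U.

Definition mod_length (A : comNzRingType) (M : lmodType A) : \bar int :=
  max_chain (@submodule A M).

(* D is (isomorphic to) Hom_A(X, A), through a perfect evaluation pairing. *)
Definition is_dual (A : comNzRingType) (X D : lmodType A) : Prop :=
  exists ev : D -> {linear X -> A^o},
    [/\ forall (a : A) (d e : D) (x : X),
          ev (a *: d + e) x = a * ev d x + ev e x,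
        forall d : D, (forall x : X, ev d x = 0) -> d = 0
      & forall f : {linear X -> A^o}, exists d : D, forall x, ev d x = f x].

(** Rings *)

Definition noetherian (A : comNzRingType) : Prop :=
  forall I : set A, ideal I -> exists xs : seq A, I = ideal_gen xs.

(* m is the unique maximal ideal of A. *)
Definition local_ring (A : comNzRingType) (m : set A) : Prop :=
  [/\ ideal m, ~ m 1 & forall J : set A, ideal J -> ~ J 1 -> J `<=` m].

Definition prime_ideal (A : comNzRingType) (p : set A) : Prop :=
  [/\ ideal p, ~ p 1 & forall a b : A, p (a * b) -> p a \/ p b].

Definition ann (A : comNzRingType) (M : lmodType A) : set A :=
  [set a | forall x : M, a *: x = 0].

Definition ring_dim (A : comNzRingType) : \bar int :=
  max_chain (@prime_ideal A).

(* The Krull dimension of A / ann M. *)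
Definition mod_dim (A : comNzRingType) (M : lmodType A) : \bar int :=
  max_chain [set p : set A | prime_ideal p /\ ann M `<=` p].

Definition regular_seq (A : comNzRingType) (M : lmodType A) (xs : seq A) :
    Prop :=
  smul [set` xs] (setT : set M) <> setT /\
  forall i, (i < size xs)%N -> forall y : M,
    smul [set` take i xs] setT (xs`_i *: y) -> smul [set` take i xs] setT y.

Definition depth (A : comNzRingType) (m : set A) (M : lmodType A) : \bar int :=
  supz [set (size xs)%:Z%:E | xs in
    [set xs : seq A | [set` xs] `<=` m /\ regular_seq M xs]].

Definition regular_local (A : comNzRingType) (m : set A) : Prop :=
  exists xs : seq A, m = ideal_gen xs /\ ring_dim A = (size xs)%:Z%:E.

(* B is (isomorphic to) the m-adic completion lim_n A / m^n, via the map
   sending b to the classes of the t b n modulo m^n. *)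
Definition is_completion (A : comNzRingType) (m : set A) (B : comNzRingType) :
    Prop :=
  exists t : B -> nat -> A,
    [/\ forall n, ideal_pow m n (t 1 n - 1),
        forall b c n, ideal_pow m n (t (b + c) n - (t b n + t c n)) /\
                      ideal_pow m n (t (b * c) n - t b n * t c n),
        forall b n, ideal_pow m n (t b n.+1 - t b n),
        forall b, (forall n, ideal_pow m n (t b n)) -> b = 0
      & forall a : nat -> A, (forall n, ideal_pow m n (a n.+1 - a n)) ->
          exists b, forall n, ideal_pow m n (t b n - a n)].

(* The completion is the quotient of a regular local ring by an ideal
   generated by a regular sequence. *)
Definition complete_intersection (A : comNzRingType) (m : set A) : Prop :=
  exists (B Q : comNzRingType) (mQ : set Q) (fs : seq Q)
         (g : {rmorphism Q -> B}),
    is_completion m B /\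
    [/\ noetherian Q, local_ring mQ & regular_local mQ] /\
    [/\ regular_seq Q^o fs, range g = setT
      & [set x | g x = 0] = ideal_gen fs].

(** Cohen-Macaulay modules and syzygies *)

(* The depth of the zero module is -oo, so MCM modules are non-zero. *)
Definition MCM (A : comNzRingType) (m : set A) (M : lmodType A) : Prop :=
  fin_gen M /\ depth m M = ring_dim A.

(* The identity of M is zero in the stable category: it factors through a
   finitely generated free module. *)
Definition stably_zero (A : comNzRingType) (M : lmodType A) : Prop :=
  exists (n : nat) (f : {linear M -> 'rV[A]_n}) (g : {linear 'rV[A]_n -> M}),
    forall x, g (f x) = x.

(* Over a Cohen-Macaulay local ring: Cohen-Macaulay, non-zero and of finite
   projective dimension. *)
Definition perfect (A : comNzRingType) (m : set A) (N : lmodType A) : Prop :=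
  [/\ fin_gen N, exists x : N, x <> 0, depth m N = mod_dim N
    & exists n, pd_le n N].

Definition ideal_of_definition (A : comNzRingType) (m : set A)
    (N : lmodType A) (I : set A) : Prop :=
  [/\ ideal I, I `<=` m
    & exists Q : lmodType A,
        is_quotient (smul I (setT : set N)) Q /\ (mod_length Q < +oo)%E].

(* K is (isomorphic to) the kernel of a minimal free cover of M. *)
Definition is_syzygy (A : comNzRingType) (m : set A) (M K : lmodType A) :
    Prop :=
  exists (n : nat) (i : {linear K -> 'rV[A]_n}) (p : {linear 'rV[A]_n -> M}),
    short_exact i p /\ forall v, p v = 0 -> forall j, m (v 0 j).

Definition is_cosyzygy (A : comNzRingType) (m : set A) (X Y : lmodType A) :
    Prop :=
  exists D K : lmodType A, [/\ is_dual X D, is_syzygy m D K & is_dual K Y].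

Fixpoint iter_rel (A : comNzRingType) (R : lmodType A -> lmodType A -> Prop)
    (n : nat) (M X : lmodType A) : Prop :=
  if n is n'.+1 then exists Y, iter_rel R n' M Y /\ R Y X
  else isomorphic M X.

(* X is (isomorphic to) the s-th syzygy of M; Negz n is - (n + 1). *)
Definition is_Omega (A : comNzRingType) (m : set A) (s : int)
    (M X : lmodType A) : Prop :=
  match s with
  | Posz n => iter_rel (is_syzygy m) n M X
  | Negz n => iter_rel (is_cosyzygy m) n.+1 M X
  end.

(** Tor *)

(* d (x) Q : Q^n1 -> Q^n0, where d : A^n1 -> A^n0 is the map u |-> u *m d. *)
Definition tensor_map (A : comNzRingType) (n1 n0 : nat) (d : 'M[A]_(n1, n0))
    (Q : lmodType A) (x : {ffun 'I_n1 -> Q}) : {ffun 'I_n0 -> Q} :=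
  [ffun j => \sum_i d i j *: x i].

(* T is (isomorphic to) Tor_1(M, Q): the homology at Q^n1 of F (x) Q, for
   A^n2 -> A^n1 -> A^n0 -> M -> 0 the beginning F of a free resolution. *)
Definition is_Tor1 (A : comNzRingType) (M Q T : lmodType A) : Prop :=
  exists (n0 n1 n2 : nat) (p : {linear 'rV[A]_n0 -> M})
         (d1 : 'M[A]_(n1, n0)) (d2 : 'M[A]_(n2, n1)),
    [/\ range p = setT,
        ker p = range (fun u : 'rV[A]_n1 => u *m d1)
      & [set u : 'rV[A]_n1 | u *m d1 = 0] =
        range (fun u : 'rV[A]_n2 => u *m d2)] /\
    exists (Z : lmodType A) (i : {linear Z -> {ffun 'I_n1 -> Q}}),
      [/\ injective i,
          range i = [set x | tensor_map d1 x = 0]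
        & is_quotient (i @^-1` range (@tensor_map A n2 n1 d2 Q)) T].

(* length Tor_1(M, N / I^n N) = l *)
Definition Tor1_length (A : comNzRingType) (I : set A) (N M : lmodType A)
    (n : nat) (l : int) : Prop :=
  exists Q T : lmodType A,
    [/\ is_quotient (smul (ideal_pow I n) (setT : set N)) Q,
        is_Tor1 M Q T & mod_length T = l%:E].

Definition is_Tor1_poly (A : comNzRingType) (I : set A) (N M : lmodType A)
    (P : {poly rat}) : Prop :=
  exists n0 : nat, forall n, (n0 <= n)%N ->
    exists l : int, Tor1_length I N M n l /\ P.[n%:R] = l%:~R.

Definition r1 (A : comNzRingType) (I : set A) (N M : lmodType A) : int :=
  (size (xget 0 [set P | is_Tor1_poly I N M P]))%:Z - 1.

Definition r_infty (A : comNzRingType) (m I : set A) (N M : lmodType A) :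
    \bar int :=
  supz [set r | exists (s : int) (X : lmodType A),
    is_Omega m s M X /\ r = (r1 I N X)%:E].

(* Main.v *)
Require Import Defs.
From HB Require Import structures.
From mathcomp Require Import all_boot all_order all_algebra.
From mathcomp Require Import boolp classical_sets constructive_ereal.
From mathcomp Require Import ring lra zify.

(** Let d be a square matrix over A with entries in m and ker d = im d, both
    taken for the action on row vectors u |-> u *m d. Then E = im d satisfies
    Omega E = E, and the dual of E is the image of the transpose of d, so that
    all syzygies and cosyzygies of E are isomorphic to E and r_infty E = r_1 E.
    As r_1 takes integral values >= -1, it is enough to find, for each non-free
    MCM module M, such an E with r_1 E <= r_infty M, and to know that some M exists.

    Write the completion of A as Q/(f_1, ..., f_c) and lift the differential of
    the minimal resolution of M to Q: its square is the sum of the f_j T_j, where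
    the T_j are Eisenbud's operators. Coning off chain maps over A that approximate
    T_1, ..., T_c one after the other makes these operators nilpotent on homology
    modulo m, and once all of them are nilpotent the complex is acyclic modulo m in
    high degrees, by descent along Q/(f_1, ..., f_i). Hence at some stage a complex
    that is not eventually acyclic modulo m has an eventually acyclic cone: the chain
    map that is coned off induces an isomorphism K_(n+2) = K_n between high minimal
    syzygies, and E = K_n + K_(n+1). A cone is an extension of shifted complexes and
    the lengths of Tor are subadditive, so their degrees never exceed r_infty M.

    A non-free MCM module is the d-th syzygy of the residue field, d = dim A: as A is
    not regular, m contains d + 1 elements that are linearly independent modulo m^2,
    whose Koszul complex embeds modulo m into the minimal resolution. *)

Set Implicit Arguments.
Unset Strict Implicit.
Unset Printing Implicit Defensive.

Import Order.TTheory GRing.Theory Num.Theory.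
Local Open Scope classical_set_scope.
Local Open Scope ring_scope.

(** * Submodules and relative length *)

(** A need not be complete, and Eisenbud's operators have coefficients in Q, so they give no
    periodicity over A directly. Three properties of the completion B bridge the gap: exactness over
    A of sequences of free modules persists over B, linear systems over A solvable over B are
    solvable over A, and A, B and Q have the same residue field. As only the action on homology
    modulo the maximal ideal matters, coefficients of a chain map in B may be replaced by elements
    of A with the same residue.

    Over Q nothing commutes strictly: d d and the commutators of the T_j with d vanish only modulo
    the f_j. Hence complexes, chain maps and nilpotency over Q are taken modulo m. The descent rests
    on the cone of T_i with the additional entry -f_i, which turns a complex modulo f_0, ..., f_i
    into one modulo f_0, ..., f_(i-1); over Q itself an exact complex is acyclic modulo m from
    degree dim Q on. The same descent shows that the dual of a periodic resolution is exact.

    Lengths are attached to pairs of submodules, so that quotient modules are rarely formed, and r_1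
    is read off from Hilbert-Samuel polynomials. *)

Lemma subset_transr (T : Type) (B X Y : set T) : B `<=` Y -> X `<=` B -> X `<=` Y.
Proof. by move=> h h'; exact: subset_trans h' h. Qed.

Section Submodules.
Variables (A : comNzRingType) (M : lmodType A).
Implicit Types (U V W P : set M).

Lemma sub0 U : submodule U -> U 0. Proof. by case. Qed.

Lemma subD U x y : submodule U -> U x -> U y -> U (x + y).
Proof. by case=> _ h Ux Uy; have := h 1 x y Ux Uy; rewrite scale1r. Qed.

Lemma subZ U a x : submodule U -> U x -> U (a *: x).
Proof. by case=> h0 h Ux; have := h a x 0 Ux h0; rewrite addr0. Qed.

Lemma subN U x : submodule U -> U x -> U (- x).
Proof. by move=> hU Ux; rewrite -scaleN1r; apply: subZ. Qed.

Lemma subB U x y : submodule U -> U x -> U y -> U (x - y).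
Proof. by move=> hU Ux Uy; apply: subD => //; apply: subN. Qed.

Lemma subBr U x y : submodule U -> U x -> U (y - x) -> U y.
Proof. by move=> hU Ux h; rewrite -(subrK x y); apply: subD. Qed.

Lemma subBC U x y : submodule U -> U (x - y) -> U (y - x).
Proof. by move=> hU h; rewrite -opprB; apply: subN. Qed.

Lemma sub_sum U (I : Type) (r : seq I) (p : pred I) (F : I -> M) :
  submodule U -> (forall i, p i -> U (F i)) -> U (\sum_(i <- r | p i) F i).
Proof.
move=> hU h; elim/big_rec: _ => [|i x pi Ux]; first exact: sub0.
by apply: subD => //; exact: h.
Qed.

Lemma submoduleI U V : submodule U -> submodule V -> submodule (U `&` V).
Proof.
move=> hU hV; split; first by split; exact: sub0.
move=> a x y [Ux Vx] [Uy Vy]; split.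
- by apply: subD => //; apply: subZ.
- by apply: subD => //; apply: subZ.
Qed.

Lemma submoduleT : submodule (setT : set M). Proof. by split. Qed.

Lemma submodule_zero : submodule ([set 0] : set M).
Proof. by split=> // a x y /= -> ->; rewrite scaler0 addr0. Qed.

Definition addS U V : set M := [set x | exists u v, [/\ U u, V v & x = u + v]].

Lemma submodule_addS U V : submodule U -> submodule V -> submodule (addS U V).
Proof.
move=> hU hV; split.
  by exists 0, 0; split; rewrite ?addr0 //; exact: sub0.
move=> a x y [u [v [Uu Vv ->]]] [u' [v' [Uu' Vv' ->]]].
exists (a *: u + u'), (a *: v + v'); split.
- by apply: subD => //; apply: subZ.
- by apply: subD => //; apply: subZ.
- by rewrite scalerDr addrACA.
Qed.

Lemma addSl U V : submodule V -> U `<=` addS U V.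
Proof. by move=> hV x Ux; exists x, 0; split=> //; rewrite ?addr0 //; exact: sub0. Qed.

Lemma addSr U V : submodule U -> V `<=` addS U V.
Proof. by move=> hV x Ux; exists 0, x; split=> //; rewrite ?add0r //; exact: sub0. Qed.

Lemma addS_sub U V P : submodule P -> U `<=` P -> V `<=` P -> addS U V `<=` P.
Proof. by move=> hP UP VP x [u [v [Uu Vv ->]]]; apply: subD => //; [exact: UP|exact: VP]. Qed.

Lemma addSS U V U' V' : U `<=` U' -> V `<=` V' -> addS U V `<=` addS U' V'.
Proof.
move=> h h' x [u [v [Uu Vv ->]]]; exists u, v; split=> //; [exact: h|exact: h'].
Qed.

(** The product of the ideal (a_0, ..., a_(r-1)) with [P]: when [P] is a submodule, it absorbs the
    coefficients. *)
Definition IP (a : nat -> A) (r : nat) P : set M :=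
  [set x | exists v : nat -> M, (forall i, P (v i)) /\ x = \sum_(i < r) a i *: v i].

Lemma submodule_IP a r P : submodule P -> submodule (IP a r P).
Proof.
move=> hP; split.
  exists (fun=> 0); split; first by move=> _; exact: sub0.
  by rewrite big1 // => i _; rewrite scaler0.
move=> c x y [v [Pv ->]] [v' [Pv' ->]]; exists (fun i => c *: v i + v' i); split.
  by move=> i; apply: subD => //; apply: subZ.
rewrite scaler_sumr -big_split /=; apply: eq_bigr => i _.
by rewrite scalerDr !scalerA mulrC.
Qed.

Lemma IP_in a r P i x : submodule P -> (i < r)%N -> P x -> IP a r P (a i *: x).
Proof.
move=> hP ir Px; exists (fun j => if j == i then x else 0); split.
  by move=> j; case: eqP => // _; exact: sub0.
rewrite (bigD1 (Ordinal ir)) //= eqxx big1 ?addr0 // => j /negbTE.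
by rewrite -val_eqE /= => ->; rewrite scaler0.
Qed.

Lemma IP_sub a r P U : submodule U ->
  (forall i x, (i < r)%N -> P x -> U (a i *: x)) -> IP a r P `<=` U.
Proof. by move=> hU h x [v [Pv ->]]; apply: sub_sum => // i _; exact: h. Qed.

Lemma IPS a r P P' : P `<=` P' -> IP a r P `<=` IP a r P'.
Proof. by move=> h x [v [Pv ->]]; exists v; split=> // i; exact: h. Qed.

(** Upper and lower bounds for the length of P/W, stated for the pair so that no quotient is formed.
    The recursion over intermediate submodules suits induction better than chains. *)
Fixpoint lenle W P (n : nat) : Prop :=
  if n is n'.+1 then
    forall U, submodule U -> W `<=` U -> U `<` P -> lenle W U n'
  else P `<=` W.

Fixpoint lenge W P (n : nat) : Prop :=
  if n is n'.+1 then
    exists U, [/\ submodule U, W `<=` U, U `<` P & lenge W U n']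
  else W `<=` P.

Definition fin W P := exists n, lenle W P n.
(** The value is 0 when P/W has infinite length; it is meaningful only together with [fin W P]. *)
Definition ell W P : nat := xget 0%N [set n | lenle W P n /\ lenge W P n].

Lemma lenle_monor W P P' n : P' `<=` P -> lenle W P n -> lenle W P' n.
Proof.
case: n => [|n] /= PP' h; first by refine (subset_transr h _).
move=> U hU WU UP'; apply: h => //.
by split; [move=> x /(UP'.1)/PP'|move=> PU; apply: UP'.2 => x /PP'/PU].
Qed.

Lemma lenge_monor W P P' n : P `<=` P' -> lenge W P n -> lenge W P' n.
Proof.
case: n => [|n] /= PP' h; first by move=> x /h/PP'.
case: h => U [hU WU [UP nPU] h]; exists U; split=> //; split.
  by move=> x /UP/PP'.
by move=> h'; apply: nPU => x /PP'/h'.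
Qed.

Lemma lenge_sub W P n : lenge W P n -> W `<=` P.
Proof. by case: n => //= n [U [_ WU [UP _] _]] x /WU/UP. Qed.

Lemma lenge_leq W P n m : lenge W P n -> lenle W P m -> (n <= m)%N.
Proof.
elim: n m P => // n IH [|m] P /= [U [hU WU UP h]] le; first by case: UP.2; by refine (subset_transr WU _).
by rewrite ltnS; apply: IH h _; exact: le.
Qed.

Lemma lenge_total W P n : submodule W -> W `<=` P -> ~ lenle W P n -> lenge W P n.+1.
Proof.
move=> hW; elim: n P => [|n IH] P WP /= h; first by exists W; split=> //; split.
move: h => /existsNP[U] /not_implyP[hU] /not_implyP[WU] /not_implyP[UP h].
by exists U; split=> //; exact: IH.
Qed.

Lemma ellP W P : submodule W -> W `<=` P -> fin W P ->
  lenle W P (ell W P) /\ lenge W P (ell W P).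
Proof.
move=> hW WP [n]; rewrite /ell => h.
case: xgetP => [x -> []//|/(_ _)]; case: (ex_minnP (P := fun n => `[< lenle W P n >])).
  by exists n; apply/asboolP.
case=> [|m] /asboolP hm min /(_ _) no; first by case: (no 0%N).
case: (no m.+1); split=> //; apply: lenge_total => // /asboolP /min.
by rewrite ltnn.
Qed.

Lemma ell_uniq W P n : lenle W P n -> lenge W P n -> ell W P = n.
Proof.
move=> le ge; rewrite /ell; case: xgetP => [x -> [le' ge']|/(_ n)]; last by case.
by apply/eqP; rewrite eqn_leq (lenge_leq ge le') (lenge_leq ge' le).
Qed.

Lemma lenge_add W U P a b : lenge W U a -> lenge U P b -> lenge W P (a + b).
Proof.
elim: b P => [|b IH] P hWU; first by rewrite addn0; move=> /lenge_monor; exact.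
rewrite addnS => -[U' [hU' UU' U'P h]]; exists U'; split=> //; last exact: IH.
exact: subset_trans (lenge_sub hWU) UU'.
Qed.

(* A proper submodule of P shrinks P `&` U or P + U, by the modular law. *)
Lemma lenle_add W U P a b : submodule U -> submodule P -> W `<=` U -> W `<=` P ->
  lenle W (P `&` U) a -> lenle U (addS P U) b -> lenle W P (a + b).
Proof.
move=> hU + WU; move: {-1}(a + b)%N (erefl (a + b)%N) => n.
elim: n a b P => [|n IH] a b P abn hP WP.
  have [-> ->] : a = 0%N /\ b = 0%N by lia.
  move=> /= h1 h2 x Px; apply: h1; split=> //; apply: h2; exact: addSl.
move=> la lb P' hP' WP' P'P.
have [sub|nsub] := pselect (P `&` U `<=` P').
- have lt : addS P' U `<` addS P U.
    split; first exact: addSS P'P.1 _.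
    move=> h; apply: P'P.2 => x Px.
    have [p [u [P'p Uu xE]]] := h x (addSl hU Px).
    rewrite xE; apply: subD => //; apply: sub; split=> //.
    have -> : u = x - p by rewrite xE addrC addKr.
    by apply: subB => //; exact: P'P.1.
  case: b lb abn => [|b] lb abn.
    by case: lt => _ []; move=> x /lb; exact: addSr.
  apply: (IH a b) => //; first lia.
    by apply: lenle_monor la; apply: setSI P'P.1.
  by apply: lb => //; [exact: submodule_addS|exact: addSr].
- case: a la abn => [|a] la abn.
    by case: nsub => x /la /WP'.
  apply: (IH a b) => //; first lia.
    apply: la; [exact: submoduleI| by move=> x Wx; split; [exact: WP'|exact: WU]|].
    split; first exact: setSI P'P.1.
    by move=> h; apply: nsub => x /h[].
  by apply: lenle_monor lb; apply: addSS P'P.1 _.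
Qed.

Lemma fin_add W U P : submodule U -> submodule P -> W `<=` U -> U `<=` P ->
  fin W U -> fin U P -> fin W P.
Proof.
move=> hU hP WU UP [a la] [b lb]; exists (a + b)%N; apply: (lenle_add hU) => //.
- by refine (subset_transr UP _).
- by apply: lenle_monor la => x [].
- by apply: lenle_monor lb; exact: addS_sub.
Qed.

Lemma fin_subr W U P : U `<=` P -> fin W P -> fin W U.
Proof. by move=> UP [n le]; exists n; exact: lenle_monor le. Qed.

Lemma lenle_subl W U P n : W `<=` U -> U `<=` P -> lenle W P n -> lenle U P n.
Proof.
elim: n P => [|n IH] P WU UP /= h; first by refine (subset_transr WU _).
move=> V hV UV VP; apply: IH => //; apply: h => //; by refine (subset_transr UV _).
Qed.

Lemma fin_subl W U P : W `<=` U -> U `<=` P -> fin W P -> fin U P.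
Proof. by move=> WU UP [n le]; exists n; exact: lenle_subl le. Qed.

Lemma ell_add W U P : submodule W -> submodule U -> submodule P ->
  W `<=` U -> U `<=` P -> fin W P -> ell W P = (ell W U + ell U P)%N.
Proof.
move=> hW hU hP WU UP f.
have [l1 g1] := ellP hW WU (fin_subr UP f).
have [l2 g2] := ellP hU UP (fin_subl WU UP f).
apply: ell_uniq; last exact: lenge_add g1 g2.
apply: (lenle_add hU) => //; first by refine (subset_transr UP _).
- by apply: lenle_monor l1 => x [].
- by apply: lenle_monor l2; exact: addS_sub.
Qed.

Lemma ell_same W : submodule W -> ell W W = 0%N.
Proof. by move=> hW; apply: ell_uniq. Qed.

Lemma ell_eq0 W P : submodule W -> W `<=` P -> fin W P -> ell W P = 0%N -> P `<=` W.
Proof. by move=> hW WP f e; have [] := ellP hW WP f; rewrite e. Qed.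

End Submodules.

(** The order embedding [G] carries strict inclusions between [W] and [P] to strict inclusions
    between [W'] and [P']. The two rings may differ, as in the comparison of A with Q. *)
Lemma lenle_embed (A A' : comNzRingType) (M : lmodType A) (M' : lmodType A')
    (W P : set M) (W' P' : set M') (G : set M -> set M') n :
  let good U := [/\ submodule U, W `<=` U & U `<=` P] in
  submodule W -> submodule P -> W `<=` P ->
  (forall U, good U -> [/\ submodule (G U), W' `<=` G U & G U `<=` P']) ->
  (forall U V, good U -> good V -> U `<=` V -> G U `<=` G V) ->
  (forall U V, good U -> good V -> G U `<=` G V -> U `<=` V) ->
  lenle W' P' n -> lenle W P n.
Proof.
move=> /= hW; elim: n P P' => [|n IH] P P' hP WP hG mono refl le.
  have gP : [/\ submodule P, W `<=` P & P `<=` P] by split.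
  have gW : [/\ submodule W, W `<=` W & W `<=` P] by split.
  apply: refl => //; have [_ _ h] := hG _ gP; have [_ h' _] := hG _ gW.
  by move=> x /h /le /h'.
move=> U hU WU UP.
have gU : [/\ submodule U, W `<=` U & U `<=` P] by split=> //; exact: UP.1.
have gP : [/\ submodule P, W `<=` P & P `<=` P] by split.
have [sGU W'GU GUP'] := hG _ gU.
have up V : [/\ submodule V, W `<=` V & V `<=` U] -> [/\ submodule V, W `<=` V & V `<=` P].
  by case=> hV WV VU; split=> // x /VU /(UP.1).
apply: (IH U (G U)) => //.
- by move=> V gV; have [] := hG _ (up _ gV); split=> //; apply: mono => //; [exact: up|case: gV].
- by move=> V V' gV gV'; apply: mono; exact: up.
- by move=> V V' gV gV'; apply: refl; exact: up.
- apply: le => //; split=> // h; apply: UP.2; apply: refl => //.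
  by have [_ _ h'] := hG _ gP; move=> x /h' /h.
Qed.

(** * Lengths under linear maps *)

Section LengthMaps.
Variables (A : comNzRingType) (M M' : lmodType A) (f : {linear M -> M'}).

Lemma submodule_preim (W' : set M') : submodule W' -> submodule (f @^-1` W').
Proof.
move=> hW'; split; first by rewrite /= linear0; exact: sub0.
by move=> a x y hx hy; rewrite /= linearP; apply: subD => //; apply: subZ.
Qed.

Lemma submodule_im (U : set M) : submodule U -> submodule (f @` U).
Proof.
move=> hU; split; first by exists 0; [exact: sub0|rewrite linear0].
move=> a _ _ [x Ux <-] [y Uy <-]; exists (a *: x + y); last by rewrite linearP.
by apply: subD => //; apply: subZ.
Qed.

(** As f induces an injection P/W -> P'/W', the submodules [U] embed by U |-> f(U) + W'. *)
Lemma lenle_inj (W P : set M) (W' P' : set M') (n : nat) : submodule W -> submodule P -> W `<=` P ->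
  submodule W' -> submodule P' -> W' `<=` P' ->
  (forall x, P x -> P' (f x)) -> (forall x, P x -> W' (f x) -> W x) ->
  lenle W' P' n -> lenle W P n.
Proof.
move=> hW hP WP hW' hP' WP' fP fW; apply: (lenle_embed (G := fun U => addS (f @` U) W')) => //.
- move=> U [hU WU UP]; split.
  + by apply: submodule_addS => //; exact: submodule_im.
  + by apply: addSr; exact: submodule_im.
  + by apply: addS_sub => // _ [x Ux <-]; apply: fP; exact: UP.
- by move=> U V _ _ UV; apply: addSS => // _ [x Ux <-]; exists x => //; exact: UV.
- move=> U V [hU WU UP] [hV WV VP] h x Ux.
  have [_ [w' [[v Vv <-] W'w' e]]] : addS (f @` V) W' (f x) by apply: h; apply: addSl => //; exists x.
  apply: (subBr hV Vv); apply: WV; apply: fW; first by apply: subB => //; [exact: UP|exact: VP].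
  by rewrite linearB e addrC addKr.
Qed.

(** [P] need not be mapped into [P']: it suffices that its image covers [P'] modulo [W']. Preimages
    within [P] embed the submodules. *)
Lemma lenle_surj (W P : set M) (W' P' : set M') (n : nat) : submodule W -> submodule P -> W `<=` P ->
  submodule W' -> submodule P' -> W' `<=` P' ->
  (forall x, W x -> W' (f x)) -> (forall y, P' y -> exists2 x, P x & W' (y - f x)) ->
  lenle W P n -> lenle W' P' n.
Proof.
move=> hW hP WP hW' hP' WP' fW fP.
apply: (lenle_embed (G := fun U' => P `&` f @^-1` U')) => //.
- move=> U' [hU' WU' UP']; split.
  + by apply: submoduleI => //; exact: submodule_preim.
  + by move=> x Wx; split; [exact: WP|apply: WU'; exact: fW].
  + by move=> x [].
- by move=> U V _ _ UV x [Px fx]; split=> //; exact: UV.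
- move=> U V [hU WU UP] [hV WV VP] h y Uy.
  have [x Px yx] := fP _ (UP _ Uy).
  have [_ Vfx] : (P `&` f @^-1` V) x.
    apply: h; split=> //=; have := subB hU Uy (WU _ yx).
    by rewrite opprB addrC subrK.
  by apply: (subBr hV Vfx); exact: WV.
Qed.

Lemma ell_inj (W P : set M) (W' P' : set M') : submodule W -> submodule P -> W `<=` P ->
  submodule W' -> submodule P' -> W' `<=` P' ->
  (forall x, P x -> P' (f x)) -> (forall x, P x -> W' (f x) -> W x) ->
  fin W' P' -> fin W P /\ (ell W P <= ell W' P')%N.
Proof.
move=> hW hP WP hW' hP' WP' fP fW f'.
have [le' _] := ellP hW' WP' f'.
have le := lenle_inj hW hP WP hW' hP' WP' fP fW le'.
have fWP : fin W P by exists (ell W' P').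
by split=> //; have [_ ge] := ellP hW WP fWP; exact: lenge_leq ge le.
Qed.

Lemma ell_surj (W P : set M) (W' P' : set M') : submodule W -> submodule P -> W `<=` P ->
  submodule W' -> submodule P' -> W' `<=` P' ->
  (forall x, W x -> W' (f x)) -> (forall y, P' y -> exists2 x, P x & W' (y - f x)) ->
  fin W P -> fin W' P' /\ (ell W' P' <= ell W P)%N.
Proof.
move=> hW hP WP hW' hP' WP' fP fW f'.
have [le' _] := ellP hW WP f'.
have le := lenle_surj hW hP WP hW' hP' WP' fP fW le'.
have fWP : fin W' P' by exists (ell W P).
by split=> //; have [_ ge] := ellP hW' WP' fWP; exact: lenge_leq ge le.
Qed.

Lemma ell_iso (W P : set M) (W' P' : set M') : submodule W -> submodule P -> W `<=` P ->
  submodule W' -> submodule P' -> W' `<=` P' ->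
  (forall x, P x -> P' (f x)) -> (forall x, P x -> W' (f x) <-> W x) ->
  (forall y, P' y -> exists2 x, P x & W' (y - f x)) ->
  fin W' P' -> fin W P /\ ell W P = ell W' P'.
Proof.
move=> hW hP WP hW' hP' WP' fP fW sf f'.
have [fn le] := ell_inj hW hP WP hW' hP' WP' fP (fun x Px => proj1 (fW x Px)) f'.
split=> //; apply/eqP; rewrite eqn_leq le /=.
have h : forall x, W x -> W' (f x) by move=> x Wx; apply/(fW x (WP _ Wx)).
by have [] := ell_surj hW hP WP hW' hP' WP' h sf fn.
Qed.

End LengthMaps.

(** * Noetherian modules and graded families of submodules *)

Definition mklin (A : comNzRingType) (M M' : lmodType A) (f : M -> M')
    (h : forall a x y, f (a *: x + y) = a *: f x + f y) : {linear M -> M'} :=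
  HB.pack f (GRing.isLinear.Build A M M' _ f h).

Definition noeth (A : comNzRingType) (M : lmodType A) : Prop :=
  forall S : nat -> set M, (forall i, submodule (S i)) ->
    (forall i, S i `<=` S i.+1) ->
    exists n, forall m, (n <= m)%N -> S m `<=` S n.

Lemma chain_leq (T : Type) (S : nat -> set T) : (forall i, S i `<=` S i.+1) ->
  forall i j, (i <= j)%N -> S i `<=` S j.
Proof.
move=> h i j /subnKC <-; elim: (j - i)%N => [|k IH]; first by rewrite addn0.
by rewrite addnS => x /IH /h.
Qed.

Lemma common_bound (n : nat) (Q : nat -> nat -> Prop) :
  (forall i, exists k, forall m, (k <= m)%N -> Q i m) ->
  exists k, forall i m, (i < n)%N -> (k <= m)%N -> Q i m.
Proof.
move=> /choice[f fP]; exists (\max_(i < n) f i)%N => i m ilt km; apply: fP.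
by apply: leq_trans km; exact: (@leq_bigmax _ (fun j : 'I_n => f j) (Ordinal ilt)).
Qed.

Section Noetherian.
Variable A : comNzRingType.

Section One.
Variable M : lmodType A.

Definition span (g : nat -> M) (r : nat) : set M :=
  [set x | exists c : nat -> A, x = \sum_(i < r) c i *: g i].

Lemma submodule_span g r : submodule (span g r).
Proof.
split; first by exists (fun=> 0); rewrite big1 // => i _; rewrite scale0r.
move=> a _ _ [c ->] [c' ->]; exists (fun i => a * c i + c' i).
by rewrite scaler_sumr -big_split; apply: eq_bigr => i _; rewrite /= scalerDl scalerA.
Qed.

Lemma span_in g r i : (i < r)%N -> span g r (g i).
Proof.
move=> ir; exists (fun j => (j == i)%:R); rewrite (bigD1 (Ordinal ir)) //= eqxx scale1r.
by rewrite big1 ?addr0 // => j /negbTE; rewrite -val_eqE /= => ->; rewrite scale0r.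
Qed.

Lemma span_sub g r (U : set M) : submodule U ->
  (forall i, (i < r)%N -> U (g i)) -> span g r `<=` U.
Proof. by move=> hU h _ [c ->]; apply: sub_sum => // i _; apply: subZ => //; exact: h. Qed.

Hypothesis hM : noeth M.

Lemma noeth_max (F : set (set M)) U0 : (forall U, F U -> submodule U) -> F U0 ->
  exists U, F U /\ forall V, F V -> U `<=` V -> V `<=` U.
Proof.
move=> sF FU0; apply: contrapT => no.
have nxt (U : set M) : exists V, F U -> [/\ F V, U `<=` V & ~ V `<=` U].
  have [FU|nFU] := pselect (F U); last by exists U.
  apply: contrapT => noV; apply: no; exists U; split=> // V FV UV.
  by apply: contrapT => nVU; apply: noV; exists V => _; split.
have [f fP] := choice nxt.
have FS i : F (iter i f U0) by elim: i => //= i IH; have [] := fP _ IH.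
have [n hn] := hM (fun i => sF _ (FS i)) (fun i => let: And3 _ h _ := fP _ (FS i) in h).
by have [_ _ []] := fP _ (FS n); apply: (hn n.+1).
Qed.

Lemma noeth_fg (U : set M) : submodule U ->
  exists (r : nat) (g : nat -> M), (forall i, U (g i)) /\ U = span g r.
Proof.
move=> hU.
pose F := [set V : set M | exists r g, (forall i, U (g i)) /\ V = span g r].
have [| |V [[r [g [Ug ->]]] mx]] := @noeth_max F (span (fun=> 0) 0).
- by move=> V [r [g [_ ->]]]; exact: submodule_span.
- by exists 0%N, (fun=> 0); split=> // _; exact: sub0.
exists r, g; split=> //; apply/seteqP; split; last by apply: span_sub.
move=> x Ux; pose g' i := if (i < r)%N then g i else x.
have : span g' r.+1 `<=` span g r.
  apply: mx; first by exists r.+1, g'; split=> // i; rewrite /g'; case: ifP.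
  apply: span_sub; first exact: submodule_span.
  by move=> i ir; have := @span_in g' r.+1 i (leqW ir); rewrite /g' ir.
by apply; have := @span_in g' r.+1 r (ltnSn r); rewrite /g' ltnn.
Qed.

(** Leading coefficients: [L i U] collects the i-th coordinates of the elements of [U] whose earlier
    coordinates vanish. Once these chains are stationary, an element of S_m is reduced to 0 by S_n,
    coordinate by coordinate. *)
Lemma noeth_ffun b : noeth {ffun 'I_b -> M}.
Proof.
move=> S hS inc.
pose L (i : nat) (U : set {ffun 'I_b -> M}) : set M :=
  [set y | exists x, [/\ U x, forall j : 'I_b, (j < i)%N -> x j = 0
                   & forall j : 'I_b, j = i :> nat -> x j = y]].
have hL i U : submodule U -> submodule (L i U).
  move=> hU; split.
    by exists 0; split; [exact: sub0|move=> j _; rewrite ffunE|move=> j _; rewrite ffunE].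
  move=> a y y' [x [Ux x0 xy]] [x' [Ux' x0' xy']]; exists (a *: x + x'); split.
  - by apply: subD => //; apply: subZ.
  - by move=> j ji; rewrite !ffunE x0 // x0' // scaler0 addr0.
  - by move=> j ji; rewrite !ffunE xy // xy'.
have [n nP] : exists n, forall i m, (i < b)%N -> (n <= m)%N -> L i (S m) `<=` L i (S n).
  have [n nP] : exists n, forall i m, (i < b)%N -> (n <= m)%N ->
      forall m', L i (S m') `<=` L i (S m).
    apply: (@common_bound b (fun i m => forall m', L i (S m') `<=` L i (S m))) => i.
    have Linc k : L i (S k) `<=` L i (S k.+1).
      by move=> y [x [Sx h1 h2]]; exists x; split=> //; exact: inc.
    have [k kP] := hM (fun k => hL i _ (hS k)) Linc.
    exists k => m km m' y Ly; have Lk : L i (S k) y.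
      have [h|h] := leqP k m'; first exact: (kP m').
      exact: (chain_leq Linc (ltnW h)).
    exact: (chain_leq Linc km).
  by exists n => i m ib _; exact: nP.
exists n => m nm x Sx.
have key k : (k <= b)%N -> exists2 z, S n z & forall j : 'I_b, (j < k)%N -> (x - z) j = 0.
  elim: k => [_|k IH kb]; first by exists 0 => //; exact: sub0.
  have [z Sz zP] := IH (ltnW kb).
  have Sxz : S m (x - z) by apply: subB => //; exact: (chain_leq inc nm).
  have [|w [Sw w0 wk]] := nP k m kb nm ((x - z) (Ordinal kb)).
    by exists (x - z); split=> // j jk; congr (_ _); apply: val_inj.
  exists (z + w); first exact: subD.
  move=> j; rewrite ltnS leq_eqVlt => /orP[/eqP jk|jk].
    have jE : j = Ordinal kb by apply: val_inj.
    by have := wk j jk; rewrite -jE !ffunE => ->; rewrite [z j + _]addrC subrK subrr.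
  by have := zP j jk; have := w0 j jk; rewrite !ffunE => ->; rewrite addr0.
have [z Sz zP] := key b (leqnn b).
suff -> : x = z by [].
by apply/subr0_eq/ffunP => j; rewrite zP // ffunE.
Qed.

End One.

Lemma noeth_surj (M M' : lmodType A) (f : {linear M -> M'}) :
  (forall y, exists x, f x = y) -> noeth M -> noeth M'.
Proof.
move=> sf hM S hS inc.
have [n nP] := hM (fun i => f @^-1` S i) (fun i => submodule_preim f (hS i))
  (fun i x => inc i (f x)).
by exists n => m nm y; have [x <-] := sf y; exact: nP.
Qed.

Lemma noeth_self : noetherian A -> noeth A^o.
Proof.
move=> hA S hS inc.
pose U : set A^o := [set x | exists i, S i x].
have hU : submodule U.
  split; first by exists 0%N; exact: sub0.
  move=> a x y [i Sx] [j Sy]; exists (maxn i j); apply: subD => //.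
    by apply: subZ => //; apply: (chain_leq inc (leq_maxl i j)).
  exact: (chain_leq inc (leq_maxr i j)).
have [xs Uxs] := hA U hU.
have [n nP] : exists n, forall x, x \in xs -> S n x.
  have : forall x, x \in xs -> U x.
    move=> x xin; rewrite Uxs; exists 1%N, (fun=> x), (fun=> 1); split=> //.
    by rewrite big_ord1; rewrite /GRing.scale /= mulr1.
  elim: xs {Uxs} => [|x s IH] h; first by exists 0%N.
  have [n1 h1] := IH (fun y ys => h y (mem_behead (s := x :: s) ys)).
  have [n2 h2] := h x (mem_head _ _).
  exists (maxn n1 n2) => y; rewrite inE => /orP[/eqP ->|ys].
    exact: (chain_leq inc (leq_maxr n1 n2)).
  by apply: (chain_leq inc (leq_maxl n1 n2)); exact: h1.
exists n => m _ x Sx; have : U x by exists m.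
rewrite Uxs => -[k [a [y [aP ->]]]]; apply: sub_sum => // i _.
have [ai _] := aP i; have := subZ (y i) (hS n) (nP _ ai).
by rewrite /GRing.scale /= mulrC.
Qed.

Lemma noeth_rV n : noetherian A -> noeth 'rV[A]_n.
Proof.
move=> /noeth_self/(@noeth_ffun _)/(_ n).
have lin (a : A) (x y : {ffun 'I_n -> A^o}) :
    \row_i (a *: x + y) i = a *: (\row_i x i) + \row_i y i :> 'rV[A]_n.
  by apply/rowP => i; rewrite !mxE !ffunE.
apply: (noeth_surj (f := mklin lin)) => y.
by exists [ffun i => y 0 i]; apply/rowP => i; rewrite !mxE ffunE.
Qed.

Lemma noeth_fin_gen (M : lmodType A) : noetherian A -> fin_gen M -> noeth M.
Proof.
move=> hA [n [f fT]]; apply: (noeth_surj (f := f)); last exact: noeth_rV.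
by move=> y; have : setT y by []; rewrite -fT => -[x _ <-]; exists x.
Qed.

Section Graded.
Variables (M : lmodType A) (hM : noeth M) (a : nat -> A).

(** The family [N] is a graded module over the polynomial ring A[X_0, ..., X_(r-1)], with X_i acting
    as multiplication by a_i. Rees modules are treated in this way without the Rees algebra. *)
Definition graded (r : nat) (N : nat -> set M) :=
  forall i n x, (i < r)%N -> N n x -> N n.+1 (a i *: x).

(** For noetherian M this amounts to finite generation of N/W over that polynomial ring. *)
Definition ev_gen (r : nat) (N W : nat -> set M) :=
  exists n0, forall n, (n0 <= n)%N -> N n.+1 `<=` addS (IP a r (N n)) (W n.+1).

Definition scS (x : A) (P : set M) : set M := [set y | exists2 p, P p & y = x *: p].

Lemma submodule_scS x P : submodule P -> submodule (scS x P).
Proof.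
move=> hP; split; first by exists 0; [exact: sub0|rewrite scaler0].
move=> c _ _ [p Pp ->] [q Pq ->]; exists (c *: p + q).
  by apply: subD => //; apply: subZ.
by rewrite scalerDr !scalerA mulrC.
Qed.

(* W + x P, where x has degree 1. *)
Definition addX (x : A) (P W : nat -> set M) (n : nat) : set M :=
  if n is n'.+1 then addS (W n) (scS x (P n')) else W n.

Lemma submodule_addX x P W : (forall n, submodule (P n)) ->
  (forall n, submodule (W n)) -> forall n, submodule (addX x P W n).
Proof. by move=> hP hW [|n] //=; apply: submodule_addS => //; exact: submodule_scS. Qed.

Lemma addX_ge x P W : (forall n, submodule (P n)) -> forall n, W n `<=` addX x P W n.
Proof. by move=> hP [|n] //=; apply: addSl; exact: submodule_scS. Qed.

Lemma ev_gen_addX r P W : (forall n, submodule (P n)) ->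
  ev_gen r.+1 P W -> ev_gen r P (addX (a r) P W).
Proof.
move=> hP [n0 h]; exists n0 => n n0n x /(h _ n0n) [_ [w [[v [Pv ->]] Ww ->]]].
rewrite big_ord_recr /=; exists (\sum_(i < r) a i *: v i), (w + a r *: v r); split.
- by exists v.
- by exists w, (a r *: v r); split=> //; exists (v r).
- by rewrite -addrA [_ + w]addrC.
Qed.

(* Trailing coefficients with respect to the last operator x = a r reduce the
   chain condition to the families containing x P, on which x acts trivially. *)
Lemma graded_acc r (P W : nat -> set M) (N : nat -> nat -> set M) :
  (forall n, submodule (P n)) -> (forall n, submodule (W n)) ->
  graded r P -> ev_gen r P W ->
  (forall k n, submodule (N k n)) -> (forall k n, N k n `<=` P n) ->
  (forall k n, W n `<=` N k n) -> (forall k, graded r (N k)) ->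
  (forall k n, N k n `<=` N k.+1 n) ->
  exists K, forall k n, (K <= k)%N -> N k n `<=` N K n.
Proof.
elim: r P W N => [|r IH] P W N hP hW gP egP hN NP WN gN inc.
  have [n0 n0P] := egP.
  have [K KP] : exists K, forall n k, (n < n0.+1)%N -> (K <= k)%N -> forall k', N k' n `<=` N k n.
    apply: (@common_bound n0.+1 (fun n k => forall k', N k' n `<=` N k n)) => n.
    have [k kP] := hM (fun k => hN k n) (fun k => inc k n).
    exists k => m km k' x Nx; apply: (chain_leq (fun k => inc k n) km).
    have [h|h] := leqP k k'; first exact: (kP k').
    exact: (chain_leq (fun k => inc k n) (ltnW h)).
  exists K => k n Kk; have [le|lt] := leqP n n0; first exact: KP.
  case: n lt => // n lt x /NP /(n0P _ lt) [_ [w [[v [_ ->]] Ww ->]]].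
  by rewrite big_ord0 add0r; exact: WN.
set x := a r.
pose PP n : set M := if n is n'.+1 then P n' else [set 0].
have hPP n : submodule (PP n) by case: n => // ; exact: submodule_zero.
(* [L j U] is (U : x^j) + xP. It increases with j and with [U], and for the families [N k] it
   contains W + xP, which takes the place of [W] in the induction. *)
pose L (j : nat) (U : nat -> set M) (n : nat) : set M :=
  [set y | P n y /\ exists2 p, PP n p & U (n + j)%N (x ^+ j *: y - x ^+ j.+1 *: p)].
have hL j U : (forall n, submodule (U n)) -> forall n, submodule (L j U n).
  move=> hU n; split.
    split; first exact: sub0.
    by exists 0; [exact: sub0|rewrite !scaler0 subr0; exact: sub0].
  move=> c y y' [Py [p Pp h]] [Py' [p' Pp' h']]; split.
    by apply: subD => //; apply: subZ.
  exists (c *: p + p'); first by apply: subD => //; apply: subZ.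
  have -> : x ^+ j *: (c *: y + y') - x ^+ j.+1 *: (c *: p + p') =
    c *: (x ^+ j *: y - x ^+ j.+1 *: p) + (x ^+ j *: y' - x ^+ j.+1 *: p').
    by rewrite scalerBr !scalerDr !scalerA ![c * _]mulrC opprD addrACA.
  by apply: subD => //; apply: subZ.
have powN k n j y : N k n y -> N k (n + j)%N (x ^+ j *: y).
  move=> Ny; elim: j => [|j IHj]; first by rewrite addn0 scale1r.
  by rewrite addnS exprS -scalerA; exact: gN.
have [Linc1 Linc2] : (forall j k n, L j (N k) n `<=` L j (N k.+1) n) /\
    (forall j k n, L j (N k) n `<=` L j.+1 (N k) n).
  split=> j k n y [Py [p Pp h]]; split=> //; exists p => //; first exact: inc.
  rewrite addnS; have := gN k r _ _ (ltnSn r) h.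
  by rewrite scalerBr !scalerA -!exprS.
have gL j k : graded r (L j (N k)).
  move=> i n y ir [Py [p Pp h]]; split; first by apply: gP => //; exact: leqW.
  exists (a i *: p).
    case: n Pp {h Py} => [/= ->|n /= Pp]; first by rewrite scaler0; exact: sub0.
    by apply: gP => //; exact: leqW.
  have := gN k i _ _ (leqW ir) h.
  by rewrite scalerBr !scalerA addSn ![a i * _]mulrC.
have LW j k n : addX x P W n `<=` L j (N k) n.
  case: n => [|n] y /=.
    move=> Wy; split; first exact: (NP k _ _ (WN k _ _ Wy)).
    exists 0 => //; rewrite scaler0 subr0; apply: powN; exact: WN.
  move=> [w [_ [Ww [p Pp ->] ->]]]; split.
    by apply: subD => //; [exact: (NP k _ _ (WN k _ _ Ww))|apply: gP].
  exists p => //; rewrite scalerDr scalerA -exprSr addrK; apply: powN; exact: WN.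
have egP' : ev_gen r P (addX x P W) by exact: ev_gen_addX.
have gP' : graded r P by move=> i n y ir; apply: gP; exact: leqW.
have IHN := IH P (addX x P W) _ hP (submodule_addX x hP hW) gP' egP'.
have LP j k n : L j (N k) n `<=` P n by move=> y [].
have [K0 K0P] := IHN (fun k => L k (N k)) (fun k => hL k _ (hN k)) (fun k => LP k k)
  (fun k => LW k k) (fun k => gL k k) (fun k n y h => Linc1 k.+1 k n _ (Linc2 k k n _ h)).
have [K1 K1P] : exists K, forall j k, (j < K0)%N -> (K <= k)%N ->
    forall k' n, L j (N k') n `<=` L j (N k) n.
  apply: (@common_bound K0 (fun j k => forall k' n, L j (N k') n `<=` L j (N k) n)) => j.
  have [K KP] := IHN (fun k => L j (N k)) (fun k => hL j _ (hN k)) (fun k => LP j k)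
    (fun k => LW j k) (fun k => gL j k) (Linc1 j).
  exists K => k Kk k' n y Ly; apply: (chain_leq (fun k => Linc1 j k n) Kk).
  have [h|h] := leqP K k'; first exact: (KP k').
  exact: (chain_leq (fun k => Linc1 j k n) (ltnW h)).
pose K := maxn K0 K1; exists K => k n Kk z Nz.
have LK j m : L j (N k) m `<=` L j (N K) m.
  have [jK|K0j] := ltnP j K0; first by apply: K1P => //; exact: leq_maxr.
  move=> y Ly; have : L K0 (N K0) m y.
    pose kk := maxn j k; apply: (K0P kk); first by rewrite leq_max K0j.
    apply: (chain_leq (fun j => Linc2 j kk m) (leq_maxl j k)).
    exact: (chain_leq (fun k => Linc1 j k m) (leq_maxr j k)).
  move=> /(chain_leq (fun k => Linc1 K0 k m) (leq_maxl K0 K1)).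
  exact: (chain_leq (fun j => Linc2 j K m) K0j).
have kn : N K n `<=` N k n by exact: (chain_leq (fun k => inc k n) Kk).
(* Division by x: modulo [N K], z is congruent to x^j times an element of degree n - j. In degree 0
   the last coefficient drops out, since [PP 0] is 0. *)
have key j m : (m + j)%N = n -> exists2 p, P m p & N K n (z - x ^+ j *: p).
  elim: j m => [|j IHj] m mjn.
    exists z; first by rewrite -(addn0 m) mjn; exact: (NP k).
    by rewrite expr0 scale1r subrr; exact: sub0.
  have [|p Pp Np] := IHj m.+1; first by rewrite addSnnS.
  have [|_ [p' Pp' Np']] := LK j m.+1 p.
    split=> //; exists 0; first exact: sub0.
    rewrite scaler0 subr0 addSnnS mjn -(subKr z (_ *: p)).
    by apply: subB => //; exact: kn.
  exists p' => //; rewrite addSnnS mjn in Np'.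
  by rewrite -(subrK (x ^+ j *: p) z) -addrA; exact: subD.
have [p Pp Np] := key n 0%N (add0n n).
have [|_ [_ /= -> Np']] := LK n 0%N p.
  split=> //; exists 0 => //; rewrite scaler0 subr0 add0n -(subKr z (_ *: p)).
  by apply: subB => //; exact: kn.
rewrite scaler0 subr0 add0n in Np'.
by rewrite -(subrK (x ^+ n *: p) z); exact: subD.
Qed.

(** [NN k] is the family generated over [W] by the components of [N] of degree at most k. It
    increases with k, so it is stationary from some K on, and [N] is generated in degrees at most
    K. *)
Lemma graded_fg r (P W N : nat -> set M) :
  (forall n, submodule (P n)) -> (forall n, submodule (W n)) ->
  graded r P -> ev_gen r P W ->
  (forall n, submodule (N n)) -> (forall n, N n `<=` P n) ->
  (forall n, W n `<=` N n) -> graded r N -> ev_gen r N W.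
Proof.
move=> hP hW gP egP hN NP WN gN.
pose NN k := fix NN n : set M := if (n <= k)%N then N n else
  if n is n'.+1 then addS (IP a r (NN n')) (W n) else N 0%N.
have NNle k n : (n <= k)%N -> NN k n = N n by case: n => [//|n] /= ->.
have NNgt k n : (k <= n)%N -> NN k n.+1 = addS (IP a r (NN k n)) (W n.+1).
  by move=> /=; rewrite ltnNge => ->.
have hNN k n : submodule (NN k n).
  elim: n => [|n IH]; first by rewrite NNle.
  have [lt|le] := ltnP n k; first by rewrite NNle.
  by rewrite NNgt //; apply: submodule_addS => //; exact: submodule_IP.
have NNN k n : NN k n `<=` N n.
  elim: n => [|n IH]; first by rewrite NNle.
  have [lt|le] := ltnP n k; first by rewrite NNle.
  rewrite NNgt //; apply: addS_sub => //.
  by apply: IP_sub => // i x ir /IH; exact: gN.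
have WNN k n : W n `<=` NN k n.
  case: n => [|n]; first by rewrite NNle.
  have [lt|le] := ltnP n k; first by rewrite NNle.
  by rewrite NNgt //; apply: addSr; exact: submodule_IP.
have gNN k : graded r (NN k).
  move=> i n x ir NNx; have [lt|le] := ltnP n k.
    by rewrite NNle //; apply: gN => //; exact: NNN NNx.
  by rewrite NNgt //; apply: addSl => //; apply: IP_in.
have incN k n : NN k n `<=` NN k.+1 n.
  elim: n => [|n IH]; first by rewrite !NNle.
  have [lt|le] := leqP n k; first by rewrite [X in _ `<=` X]NNle //; exact: NNN.
  by rewrite !NNgt //; [apply: addSS => //; exact: IPS|exact: ltnW].
have [K KP] := graded_acc hP hW gP egP hNN (fun k n x h => NP n x (NNN k n x h)) WNN gNN incN.
exists K => n Kn x Nx.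
have : NN K n.+1 x by apply: (KP n.+1); [exact: leqW|rewrite NNle].
by rewrite NNgt //; apply: addSS => //; apply: IPS; exact: NNN.
Qed.

End Graded.
End Noetherian.

(** * Eventually polynomial functions *)

Definition evp (f : nat -> rat) (P : {poly rat}) : Prop :=
  exists n0, forall n, (n0 <= n)%N -> f n = P.[n%:R].

Lemma evpD f g P Q : evp f P -> evp g Q -> evp (fun n => f n + g n) (P + Q).
Proof.
move=> [n0 h0] [n1 h1]; exists (maxn n0 n1) => n; rewrite geq_max => /andP[a b].
by rewrite hornerD h0 // h1.
Qed.

Lemma evpN f P : evp f P -> evp (fun n => - f n) (- P).
Proof. by move=> [n0 h0]; exists n0 => n a; rewrite hornerN h0. Qed.

Lemma evpB f g P Q : evp f P -> evp g Q -> evp (fun n => f n - g n) (P - Q).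
Proof. by move=> hf hg; apply: evpD => //; exact: evpN. Qed.

Lemma evpS f P k : evp f P -> evp (fun n => f (n + k)%N) (P \Po ('X + k%:R%:P)).
Proof.
move=> [n0 h0]; exists n0 => n a; rewrite horner_comp hornerD hornerX hornerC h0.
  by rewrite natrD.
exact: leq_trans (leq_addr _ _).
Qed.

Lemma evp_ext f g P : (exists n0, forall n, (n0 <= n)%N -> f n = g n) ->
  evp f P -> evp g P.
Proof.
move=> [n1 h1] [n0 h0]; exists (maxn n0 n1) => n; rewrite geq_max => /andP[a b].
by rewrite -h1 // h0.
Qed.

Lemma poly_bound (P : {poly rat}) e : (size P <= e.+1)%N ->
  exists C : rat, forall n, (0 < n)%N -> `|P.[n%:R]| <= C * n%:R ^+ e.
Proof.
move=> sP; exists (\sum_(i < size P) `|P`_i|) => n n0.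
rewrite horner_coef (le_trans (ler_norm_sum _ _ _)) // mulr_suml.
apply: ler_sum => i _; rewrite normrM ler_wpM2l // normrX ger0_norm ?ler0n //.
apply: ler_weXn2l; first by rewrite ler1n.
by rewrite -ltnS; apply: leq_trans sP.
Qed.

(** For n beyond (C1 + C2) / |lead P|, the leading term of [P] exceeds the sum of the bounds for [Q]
    and for the remaining terms of [P]. *)
Lemma size_le_poly (P Q : {poly rat}) :
  (exists n0, forall n, (n0 <= n)%N -> 0 <= P.[n%:R] <= Q.[n%:R]) ->
  (size P <= size Q)%N.
Proof.
move=> [n0 h]; rewrite leqNgt; apply/negP => lt.
have nz : lead_coef P != 0 by rewrite lead_coef_eq0 -size_poly_gt0; apply: leq_ltn_trans lt.
case sP : (size P) lt => [//|e] lt.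
have [P' sP' PE] : exists2 P' : {poly rat}, (size P' <= e)%N &
    forall n : nat, P.[n%:R] = P'.[n%:R] + lead_coef P * n%:R ^+ e.
  exists (P - (lead_coef P)%:P * 'X^e); last first.
    by move=> n; rewrite -hornerXn -[lead_coef P in X in _ + X](hornerC _ n%:R) -hornerM -hornerD subrK.
  apply/leq_sizeP => j; rewrite leq_eqVlt => /orP[/eqP <-|ej].
    by rewrite coefB coefCM coefXn eqxx mulr1 lead_coefE sP subrr.
  by rewrite coefB coefCM coefXn gtn_eqF // mulr0 subr0; apply: nth_default; rewrite sP.
case: e sP sP' lt PE => [|e] sP sP' lt PE.
  have Q0 : Q = 0 by apply/eqP; rewrite -size_poly_eq0; rewrite ltnS leqn0 in lt.
  have P'0 : P' = 0 by apply/eqP; rewrite -size_poly_eq0; rewrite leqn0 in sP'.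
  have := h n0 (leqnn _); rewrite Q0 PE P'0 !horner0 add0r mulr1 -eq_le eq_sym.
  by rewrite (negbTE nz).
have [C1 h1] := poly_bound (lt : (size Q <= e.+1)%N).
have [C2 h2] := poly_bound sP'.
pose n := (Num.bound `|(C1 + C2) / `|lead_coef P| | + n0).+1.
have /andP[P0 PQ] := h n (leq_trans (leq_addl _ _) (leqnSn _)).
have npos : 0 < n%:R :> rat by rewrite ltr0n.
have : `|lead_coef P| * n%:R ^+ e.+1 <= (C1 + C2) * n%:R ^+ e.
  have -> : `|lead_coef P| * n%:R ^+ e.+1 = `|P.[n%:R] - P'.[n%:R]|.
    by rewrite PE addrC addKr normrM normrX (ger0_norm (ltW npos)).
  apply: (le_trans (ler_normB _ _)); rewrite mulrDl; apply: lerD; last exact: h2.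
  by apply: le_trans (h1 n _) => //; rewrite !ger0_norm //; apply: le_trans PQ.
rewrite exprS mulrA ler_pM2r ?exprn_gt0 // mulrC -ler_pdivlMr ?normr_gt0 //.
rewrite leNgt => /negP[]; apply: (lt_le_trans (y := (Num.bound `|(C1 + C2) / `|lead_coef P| |)%:R)).
  apply: le_lt_trans (ler_norm _) _; exact: (archi_boundP (normr_ge0 _)).
by rewrite ler_nat /n -addSn; apply: leq_trans (leqnSn _) (leq_addr _ _).
Qed.

Lemma evp_size f P g Q : evp f P -> evp g Q ->
  (exists n0, forall n, (n0 <= n)%N -> 0 <= f n <= g n) -> (size P <= size Q)%N.
Proof.
move=> [n0 h0] [n1 h1] [n2 h2]; apply: size_le_poly.
exists (maxn n0 (maxn n1 n2)) => n; rewrite !geq_max => /and3P[a b c].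
by rewrite -h0 // -h1 // h2.
Qed.

Lemma evp_uniq f P Q : evp f P -> evp f Q -> P = Q.
Proof.
move=> [n0 h0] [n1 h1]; apply/subr0_eq/eqP; rewrite -size_poly_eq0 -leqn0.
rewrite -(size_poly0 rat); apply: size_le_poly.
exists (maxn n0 n1) => n; rewrite geq_max => /andP[a b].
by rewrite hornerD hornerN -h0 // -h1 // subrr horner0 lexx.
Qed.

Lemma size_shift (P : {poly rat}) c : size (P \Po ('X + c%:P)) = size P.
Proof. by apply: size_comp_poly2; rewrite size_XaddC. Qed.

Lemma size_diff (P : {poly rat}) c : (size (P \Po ('X + c%:P) - P)%R <= (size P).-1)%N.
Proof.
have [->|nz] := eqVneq P 0; first by rewrite comp_poly0 subr0 size_poly0.
apply/leq_sizeP => j; rewrite leq_eqVlt => /orP[/eqP <-|ej].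
  have E : lead_coef (P \Po ('X + c%:P)) = lead_coef P.
    by rewrite lead_coef_comp ?size_XaddC // lead_coefXaddC expr1n mulr1.
  by rewrite coefB; move: E; rewrite !lead_coefE size_shift => ->; rewrite subrr.
have sj : (size P <= j)%N by move: ej; case: (size P).
rewrite coefB (nth_default _ sj) subr0; apply: nth_default; by rewrite size_shift.
Qed.

(** Induction on the size: for P of degree k, the difference of (lead P / (k+1)) X^(k+1) has the
    same leading term as [P]. *)
Lemma antidiff (P : {poly rat}) :
  exists S : {poly rat}, S \Po ('X + 1%:P) - S = P /\ (size S <= (size P).+1)%N.
Proof.
move: {2}(size P) (leqnn (size P)) => k.
elim: k P => [|k IH] P sP.
  exists 0; rewrite comp_poly0 subr0 size_poly0; split=> //.
  by apply/esym/eqP; rewrite -size_poly_leq0.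
have [sk|sk] := leqP (size P) k; first exact: IH.
have {sk} sP' : size P = k.+1 by apply/eqP; rewrite eqn_leq sP.
pose S0 := (lead_coef P / k.+1%:R)%:P * ('X^(k.+1)) : {poly rat}.
have k0 : k.+1%:R != 0 :> rat by rewrite pnatr_eq0.
have c0 : lead_coef P / k.+1%:R != 0.
  by rewrite mulf_neq0 ?invr_eq0 // lead_coef_eq0 -size_poly_gt0 sP'.
have sS0 : size S0 = k.+2 by rewrite size_Cmul // size_polyXn.
have D0 : S0 \Po ('X + 1%:P) - S0 =
    (lead_coef P / k.+1%:R)%:P * (('X + 1) ^+ k.+1 - ('X^(k.+1))).
  by rewrite comp_polyM comp_polyC comp_Xn_poly mulrBr.
pose R := P - (S0 \Po ('X + 1%:P) - S0).
have sR : (size R <= k)%N.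
  apply/leq_sizeP => j; rewrite leq_eqVlt => /orP[/eqP <-|kj].
    rewrite coefB D0 coefCM coefB ['X + 1]addrC exprDn coef_sum.
    rewrite (bigD1 (Ordinal (leqnSn k.+1)) ) //=.
    rewrite big1 ?addr0; last first.
      move=> i /negbTE; rewrite -val_eqE /= => ik.
      by rewrite expr1n mul1r coefMn coefXn eq_sym ik mul0rn.
    rewrite expr1n mul1r coefMn !coefXn eqxx ltn_eqF // subr0 binSn.
    by rewrite divfK // lead_coefE sP' subrr.
  rewrite coefB (nth_default _ (_ : (size P <= j)%N)) ?sP' // sub0r.
  rewrite (nth_default _ (_ : (size (S0 \Po ('X + 1%:P) - S0)%R <= j)%N)) ?oppr0 //.
  by apply: leq_trans (size_diff _ _) _; rewrite sS0.
have [S [SE sS]] := IH R sR.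
exists (S + S0); split.
  by rewrite comp_polyD opprD addrACA SE subrK.
apply: leq_trans (size_polyD _ _) _; rewrite geq_max sS0 sP' leqnn andbT.
by apply: leq_trans sS _; rewrite ltnS leqW.
Qed.

(** [P] and an antiderivative of its difference differ by a polynomial that is constant on the
    natural numbers, hence by a constant. *)
Lemma size_antidiff (P : {poly rat}) :
  (size P <= (size (P \Po ('X + 1%:P) - P)%R).+1)%N.
Proof.
have [S [SE sS]] := antidiff (P \Po ('X + 1%:P) - P).
pose T := P - S.
have TE n : T.[n%:R] = T.[0].
  elim: n => // n <-; have := congr1 (horner^~ n%:R) SE.
  rewrite /T !(hornerD, hornerN, horner_comp) hornerX hornerC -natr1 => E.
  by move: E; lra.
have -> : P = S + (T.[0])%:P.
  rewrite -[LHS](subrK S) addrC; congr (_ + _).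
  apply: (@evp_uniq (fun=> T.[0])); first by exists 0%N => n _; rewrite TE.
  by exists 0%N => n _; rewrite hornerC.
set d := size _ in sS *.
have -> : (S + T.[0]%:P) \Po ('X + 1%:P) - (S + T.[0]%:P) = S \Po ('X + 1%:P) - S.
  by rewrite comp_polyD comp_polyC opprD addrACA subrr addr0.
rewrite SE; apply: leq_trans (size_polyD _ _) _; rewrite geq_max sS /=.
by apply: leq_trans (size_polyC_leq1 _) _.
Qed.

Lemma evp_antidiff f P : evp (fun n => f n.+1 - f n) P -> exists Q, evp f Q.
Proof.
move=> [n0 h]; have [S [SE _]] := antidiff P.
exists (S + (f n0 - S.[n0%:R])%:P); exists n0 => n /subnKC <-.
elim: (n - n0)%N => [|k IH]; first by rewrite addn0 hornerD hornerC addrC subrK.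
have := h (n0 + k)%N (leq_addr _ _).
rewrite -SE IH !(hornerD, hornerN, horner_comp, hornerX, hornerC) addnS -[(n0 + k).+1%:R]natr1.
by lra.
Qed.

(** * Hilbert functions, the Artin-Rees lemma and Krull's intersection theorem *)

Section Filtration.
Variables (A : comNzRingType) (M : lmodType A) (hM : noeth M).
Variables (a : nat -> A) (r : nat).
Implicit Types (U V W : set M).

Definition fil_on U (n : nat) : set M := iter n (IP a r) U.
Definition fil (n : nat) : set M := fil_on setT n.

Lemma submodule_fil_on U n : submodule U -> submodule (fil_on U n).
Proof. by move=> hU; elim: n => //= n IH; exact: submodule_IP. Qed.

Lemma submodule_fil n : submodule (fil n).
Proof. by apply: submodule_fil_on; exact: submoduleT. Qed.

Lemma fil_dec n : fil n.+1 `<=` fil n.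
Proof. by apply: IP_sub => [|i x _ h]; [|apply: subZ => //]; exact: submodule_fil. Qed.

Lemma fil_leq n m : (n <= m)%N -> fil m `<=` fil n.
Proof.
move=> /subnKC <-; elim: (m - n)%N => [|k IH]; first by rewrite addn0.
by rewrite addnS => x /fil_dec /IH.
Qed.

Lemma fil_in i n x : (i < r)%N -> fil n x -> fil n.+1 (a i *: x).
Proof. by move=> ir; apply: IP_in => //; exact: submodule_fil. Qed.

Lemma addS_IP U V : submodule U -> submodule V ->
  IP a r (addS U V) `<=` addS U (IP a r V).
Proof.
move=> hU hV; apply: IP_sub; first by apply: submodule_addS => //; exact: submodule_IP.
move=> i x ir [u [v [Uu Vv ->]]]; exists (a i *: u), (a i *: v); split.
- exact: subZ.
- exact: IP_in.
- by rewrite scalerDr.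
Qed.

Lemma graded_addS_fil W : submodule W -> graded a r (fun n => addS W (fil n)).
Proof.
move=> hW i n x ir [w [p [Ww Pp ->]]]; exists (a i *: w), (a i *: p); split.
- exact: subZ.
- exact: fil_in.
- by rewrite scalerDr.
Qed.

Lemma submodule_addS_fil W n : submodule W -> submodule (addS W (fil n)).
Proof. by move=> hW; apply: submodule_addS => //; exact: submodule_fil. Qed.

Lemma ev_gen_addS_fil W V : submodule W -> W `<=` V ->
  ev_gen a r (fun n => addS W (fil n)) (fun=> V).
Proof.
move=> hW WV; exists 0%N => n _ x [w [p [Ww Pp ->]]].
exists p, w; split; [|exact: WV|by rewrite addrC].
by apply: IPS Pp; apply: addSr.
Qed.

(** The intersections of [U] with W + a^n M form a graded subfamily of n |-> W + a^n M, so they are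
    generated in bounded degree modulo the constant family [W]. This is the usual lemma for U/W in
    M/W. *)
Lemma artin_rees W U : submodule W -> submodule U -> W `<=` U ->
  exists k, forall n, U `&` addS W (fil (n + k)) `<=` addS W (fil_on U n).
Proof.
move=> hW hU WU.
have [n0 h] : ev_gen a r (fun n => U `&` addS W (fil n)) (fun=> W).
  apply: (graded_fg hM (P := fun n => addS W (fil n))) => //.
  - by move=> n; exact: submodule_addS_fil.
  - exact: graded_addS_fil.
  - exact: ev_gen_addS_fil.
  - by move=> n; apply: submoduleI => //; exact: submodule_addS_fil.
  - by move=> n x Wx; split; [exact: WU|apply: addSl => //; exact: submodule_fil].
  - move=> i n x ir [Ux Fx]; split; first exact: subZ.
    exact: graded_addS_fil.
exists n0; elim=> [|n IH] x [Ux Fx]; first by apply: addSr.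
have [u [w [Iu Ww ->]]] := h _ (leq_addl n n0) x (conj Ux Fx).
have [w' [u' [Ww' Iu' ->]]] : addS W (IP a r (fil_on U n)) u.
  by apply: addS_IP => //; [exact: submodule_fil_on|exact: IPS Iu].
by exists (w' + w), u'; split; [exact: subD| |rewrite addrAC].
Qed.

(** One generator at a time: multiplication by a_k maps P/W onto the k-th step of the filtration of
    (W' + (a_0, ..., a_(k-1))P)/W'. *)
Lemma fin_IP (W W' P : set M) k : submodule W -> submodule W' -> submodule P ->
  W `<=` P -> (forall i x, (i < k)%N -> W x -> W' (a i *: x)) -> fin W P ->
  fin W' (addS W' (IP a k P)).
Proof.
move=> hW hW' hP WP; elim: k => [|k IH] h f.
  exists 0%N => x [w [_ [Ww [v [_ ->]] ->]]].
  by rewrite big_ord0 addr0.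
have hV : submodule (addS W' (IP a k P)) by apply: submodule_addS => //; exact: submodule_IP.
have lin c (x y : M) : a k *: (c *: x + y) = c *: (a k *: x) + a k *: y.
  by rewrite scalerDr !scalerA mulrC.
have hV' : submodule (addS W' (IP a k.+1 P)) by apply: submodule_addS => //; exact: submodule_IP.
have VV' : addS W' (IP a k P) `<=` addS W' (IP a k.+1 P).
  apply: addSS => // x; apply: IP_sub; first exact: submodule_IP.
  by move=> i y ik; apply: IP_in => //; exact: leqW.
apply: (fin_add (U := addS W' (IP a k P))) => //.
- by apply: addSl; exact: submodule_IP.
- by apply: IH => // i x ik; apply: h; exact: leqW.
- suff [] : fin (addS W' (IP a k P)) (addS W' (IP a k.+1 P)) /\
      (ell (addS W' (IP a k P)) (addS W' (IP a k.+1 P)) <= ell W P)%N by [].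
  apply: (ell_surj (f := mklin lin)) => //.
  + by move=> x Wx; apply: addSl; [exact: submodule_IP|exact: h].
  + move=> _ [w [_ [Ww [v [Pv ->]] ->]]]; exists (v k) => //.
    rewrite big_ord_recr /= addrA addrK; exists w, (\sum_(i < k) a i *: v i).
    by split=> //; exists v.
Qed.

End Filtration.

Section HilbertSerre.
Variables (A : comNzRingType) (M : lmodType A) (hM : noeth M) (a : nat -> A).

(** Multiplication by the last operator x on P/W has kernel K/W and cokernel P/W', and x acts as
    zero on both, so that one operator less is left. The difference of the Hilbert function of P/W
    is that of P/W', shifted, minus that of K/W. *)
Lemma graded_hilbert r (P W : nat -> set M) :
  (forall n, submodule (P n)) -> (forall n, submodule (W n)) ->
  (forall n, W n `<=` P n) -> graded a r P -> graded a r W -> ev_gen a r P W ->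
  (forall n, fin (W n) (P n)) -> exists Q, evp (fun n => (ell (W n) (P n))%:R) Q.
Proof.
elim: r P W => [|r IH] P W hP hW WP gP gW egP f.
  exists 0; have [n0 h] := egP; exists n0.+1 => -[//|n] n0n.
  rewrite horner0 (_ : P n.+1 = W n.+1) ?ell_same //.
  apply/seteqP; split=> // x /(h _ n0n) [_ [w [[v [_ ->]] Ww ->]]].
  by rewrite big_ord0 add0r.
set x := a r.
pose W' := addX x P W; pose K n := P n `&` [set p | W n.+1 (x *: p)].
have hW' n : submodule (W' n) by exact: submodule_addX.
have hK n : submodule (K n).
  apply: submoduleI => //; split; first by rewrite /= scaler0; exact: sub0.
  move=> c y z /= Wy Wz; rewrite scalerDr scalerA mulrC -scalerA.
  by apply: subD => //; exact: subZ.
have xP n p : P n p -> P n.+1 (x *: p) by exact: gP.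
have W'P n : W' n `<=` P n.
  case: n => [|n] //=; apply: addS_sub => // _ [p Pp ->]; exact: xP.
have WK n : W n `<=` K n by move=> w Ww; split; [exact: WP|exact: gW].
have KP n : K n `<=` P n by move=> y [].
have WW' n : W n `<=` W' n by exact: addX_ge.
have gP' : graded a r P by move=> i n y ir; apply: gP; exact: leqW.
have gW'' : graded a r W by move=> i n y ir; apply: gW; exact: leqW.
have gW' : graded a r W'.
  move=> i [|n] y ir /= => [Wy|[w [_ [Ww [p Pp ->] ->]]]].
    by apply: addSl; [exact: submodule_scS|exact: gW''].
  exists (a i *: w), (x *: (a i *: p)); split; first exact: gW''.
    by exists (a i *: p) => //; exact: gP'.
  by rewrite scalerDr !scalerA mulrC.
have gK : graded a r.+1 K.
  move=> i n y ir [Py Wy]; split; first exact: gP.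
  by rewrite /= scalerA mulrC -scalerA; exact: gW.
have egK : ev_gen a r K W.
  have [n0 h] := graded_fg hM hP hW gP egP hK KP WK gK.
  exists n0 => n n0n y /(h _ n0n) [_ [w [[v [Kv ->]] Ww ->]]].
  rewrite big_ord_recr /=; exists (\sum_(i < r) a i *: v i), (x *: v r + w).
  split; first by exists v.
    by apply: subD => //; have [] := Kv r.
  by rewrite addrA.
have [Q1 h1] := IH P W' hP hW' W'P gP' gW' (ev_gen_addX hP egP)
  (fun n => fin_subl (WW' n) (W'P n) (f n)).
have gK' : graded a r K by move=> i n y ir; apply: gK; exact: leqW.
have [Q2 h2] := IH K W hK hW WK gK' gW'' egK (fun n => fin_subr (KP n) (f n)).
apply: (@evp_antidiff _ ((Q1 \Po ('X + 1%:R%:P)) - Q2)).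
apply: evp_ext (evpB (evpS 1 h1) h2); exists 0%N => n _; rewrite addn1.
rewrite (ell_add (hW n) (hK n) (hP n) (WK n) (KP n) (f n)).
rewrite (ell_add (hW _) (hW' _) (hP _) (WW' n.+1) (W'P _) (f _)).
suff [_ ->] : fin (K n) (P n) /\ ell (K n) (P n) = ell (W n.+1) (W' n.+1).
  by rewrite !natrD; ring.
have lin c (y z : M) : x *: (c *: y + z) = c *: (x *: y) + x *: z.
  by rewrite scalerDr !scalerA mulrC.
apply: (ell_iso (f := mklin lin)) => //.
- by move=> p Pp; apply: addSr => //; exists p.
- by move=> p Pp; split=> [Wp|[]].
- move=> _ [w [_ [Ww [p Pp ->] ->]]]; exists p => //=; by rewrite addrK.
- exact: fin_subr (W'P _) (f _).
Qed.

Variable r : nat.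

Lemma fin_fil (U : set M) n : submodule U -> fin (addS U (fil a r 1)) setT ->
  fin (addS U (fil a r n)) setT.
Proof.
move=> hU f; have hF k : submodule (addS U (fil a r k)) by exact: submodule_addS_fil.
suff step k : fin (addS U (fil a r k.+1)) (addS U (fil a r k)).
  elim: n => [|n IH]; first by exists 0%N => x _; apply: addSr.
  apply: (fin_add (U := addS U (fil a r n))) => //.
  by apply: addSS => //; exact: fil_dec.
elim: k => [|k IH]; first exact: fin_subr f.
have := @fin_IP _ _ a (addS U (fil a r k.+1)) (addS U (fil a r k.+2)) (addS U (fil a r k)) r
  (hF _) (hF _) (hF _).
case=> //.
- by apply: addSS => //; exact: fil_dec.
- by move=> i x ir; exact: graded_addS_fil.
- move=> n0 le; exists n0; apply: lenle_monor le => x [u [p [Uu [v [Pv ->]] ->]]].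
  exists u, (\sum_(i < r) a i *: v i); split.
  + by apply: addSl => //; exact: submodule_fil.
  + by exists v; split=> // i; apply: addSr => //; exact: Pv.
  + by [].
Qed.

Lemma hilbert_samuel (U : set M) : submodule U -> fin (addS U (fil a r 1)) setT ->
  exists Q, evp (fun n => (ell (addS U (fil a r n)) setT)%:R) Q.
Proof.
move=> hU f; have hF k : submodule (addS U (fil a r k)) by exact: submodule_addS_fil.
have dec k : addS U (fil a r k.+1) `<=` addS U (fil a r k).
  by apply: addSS => //; exact: fil_dec.
have [Q h] := @graded_hilbert r (fun n => addS U (fil a r n)) (fun n => addS U (fil a r n.+1))
  hF (fun n => hF n.+1) dec (graded_addS_fil hU) (fun i n => @graded_addS_fil _ _ a r _ hU i n.+1)
  (let: ex_intro n0 h := ev_gen_addS_fil a r hU (fun x h => h) in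
   ex_intro _ n0 (fun n n0n x Fx => let: ex_intro u (ex_intro v (And3 Iu Uv e)) := h n n0n x Fx in
    ex_intro _ u (ex_intro _ v (And3 Iu (addSl (@submodule_fil _ M a r n.+2) Uv) e))))
  (fun n => fin_subr (fun x _ => I) (fin_fil n.+1 hU f)).
apply: (@evp_antidiff _ Q); apply: evp_ext h; exists 0%N => n _.
rewrite (ell_add (hF _) (hF n) (@submoduleT _ _) (dec n) _ (fin_fil n.+1 hU f)) //.
by rewrite natrD addrK.
Qed.

End HilbertSerre.

(** * Local rings *)

Section Smul.
Variables (A : comNzRingType) (M : lmodType A).
Implicit Types (J : set A) (S U : set M).

Lemma smul_in J S a x : J a -> S x -> smul J S (a *: x).
Proof.
by move=> Ja Sx; exists 1%N, (fun=> a), (fun=> x); split=> //; rewrite big_ord1.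
Qed.

Lemma smul_min J S U : submodule U -> (forall a x, J a -> S x -> U (a *: x)) ->
  smul J S `<=` U.
Proof.
move=> hU h _ [n [a [x [ax ->]]]]; apply: sub_sum => // i _; apply: h; by case: (ax i).
Qed.

Lemma submodule_smul J S : (forall c x, S x -> S (c *: x)) -> submodule (smul J S).
Proof.
move=> hS; split; first by exists 0%N, (fun=> 0), (fun=> 0); split; [case|rewrite big_ord0].
move=> c _ _ [n [a [x [ax ->]]]] [n' [a' [x' [ax' ->]]]].
exists (n + n')%N, (fun i => match split i with inl j => a j | inr j => a' j end),
  (fun i => match split i with inl j => c *: x j | inr j => x' j end); split.
  move=> i; case: (split i) => j; last exact: ax'.
  by have [Ja Sx] := ax j; split=> //; exact: hS.
rewrite big_split_ord /= scaler_sumr; congr (_ + _); apply: eq_bigr => i _.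
  by rewrite (unsplitK (inl _ i)) !scalerA mulrC.
by rewrite (unsplitK (inr _ i)).
Qed.

Lemma submodule_smulT J : submodule (smul J (setT : set M)).
Proof. by apply: submodule_smul. Qed.

End Smul.

Definition gens (A : comNzRingType) (I : set A) (a : nat -> A) (r : nat) :=
  (forall i, I (a i)) /\
  forall x, I x -> exists c : nat -> A, x = \sum_(i < r) c i * a i.

Section Gens.
Variables (A : comNzRingType) (I : set A) (a : nat -> A) (r : nat).
Hypothesis (hg : gens I a r).

Lemma gens_exists (J : set A) : noetherian A -> ideal J -> exists b s, gens J b s.
Proof.
move=> /noeth_self hA hJ; have [s [b [Jb JE]]] := noeth_fg hA hJ.
by exists b, s; split=> // x; rewrite {1}JE => -[c ->]; exists c.
Qed.

Lemma smul_gens (M : lmodType A) (S : set M) : submodule S -> smul I S = IP a r S.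
Proof.
move=> hS; apply/seteqP; split.
  apply: smul_min; first exact: submodule_IP.
  move=> x s Ix Ss; have [c ->] := hg.2 x Ix.
  rewrite scaler_suml; exists (fun i => c i *: s); split; first by move=> i; exact: subZ.
  by apply: eq_bigr => i _; rewrite scalerA mulrC.
apply: IP_sub; first by apply: submodule_smul => c x; exact: subZ.
by move=> i x _ Sx; apply: smul_in => //; exact: hg.1.
Qed.

Lemma ideal_powE n : ideal_pow I n = fil a r n :> set A^o.
Proof.
elim: n => //= n ->; apply: smul_gens; exact: submodule_fil.
Qed.

Lemma smul_ideal_pow (M : lmodType A) n : smul (ideal_pow I n) (setT : set M) = fil a r n.
Proof.
rewrite ideal_powE; elim: n => [|n IH].
  by apply/seteqP; split=> // x _; rewrite -[x]scale1r; exact: smul_in.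
rewrite [RHS]/= -/(fil a r n) -IH; apply/seteqP; split.
  apply: smul_min; first by apply: submodule_IP; exact: submodule_smulT.
  move=> _ x [j [Fj ->]] _; rewrite scaler_suml.
  exists (fun i => j i *: x); split; first by move=> i; apply: smul_in => //; exact: Fj.
  by apply: eq_bigr => i _; rewrite scalerA.
apply: IP_sub; first exact: submodule_smulT.
move=> i x ir.
have lin c (y z : M) : a i *: (c *: y + z) = c *: (a i *: y) + a i *: z.
  by rewrite scalerDr !scalerA mulrC.
have hU := submodule_preim (mklin lin) (@submodule_smulT A M (fil a r n.+1 : set A^o)).
apply: (smul_min hU) => j y Fj _; rewrite /= scalerA; apply: smul_in => //.
by apply: (IP_in (M := A^o)) => //; exact: submodule_fil.
Qed.

Lemma fil_ideal (M : lmodType A) n c (x : M) : I c -> fil a r n x -> fil a r n.+1 (c *: x).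
Proof.
move=> Ic Fx; have := smul_in Ic Fx; rewrite smul_gens //; exact: submodule_fil.
Qed.

End Gens.

Section Local.
Variables (A : comNzRingType) (m : set A).
Hypotheses (hA : noetherian A) (hm : local_ring m).

Lemma m_ideal : submodule (m : set A^o). Proof. by case: hm. Qed.

Lemma mD x y : m x -> m y -> m (x + y). Proof. exact: subD m_ideal. Qed.
Lemma mN x : m x -> m (- x). Proof. exact: (subN m_ideal). Qed.
Lemma mB x y : m x -> m y -> m (x - y). Proof. exact: (subB m_ideal). Qed.
Lemma mMl x y : m y -> m (x * y). Proof. exact: (subZ x m_ideal). Qed.
Lemma mMr x y : m x -> m (x * y). Proof. by rewrite mulrC; exact: mMl. Qed.
Lemma m0 : m 0. Proof. exact: sub0 m_ideal. Qed.
Lemma m1 : ~ m 1. Proof. by case: hm. Qed.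

Lemma proper_sub_m (J : set A) : ideal J -> ~ J 1 -> J `<=` m.
Proof. by case: hm => _ _; apply. Qed.

Lemma local_unit x : ~ m x -> exists y, x * y = 1.
Proof.
move=> nmx; pose J : set A := [set z | exists y, z = x * y].
have hJ : ideal J.
  split; first by exists 0; rewrite mulr0.
  move=> c _ _ [y ->] [z ->]; exists (c * y + z).
  by rewrite /GRing.scale /= mulrDr mulrCA.
have [[y ->]|nJ1] := pselect (J 1); first by exists y.
by case: nmx; apply: (proper_sub_m hJ nJ1); exists 1; rewrite mulr1.
Qed.

Lemma local_unit1 x : m x -> exists y, (1 - x) * y = 1.
Proof.
move=> mx; apply: local_unit => h; apply: m1; rewrite -(subrK x 1); exact: mD.
Qed.

Lemma prime_m : prime_ideal m.
Proof.
split; [by case: hm|exact: m1|move=> a b mab].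
have [ma|nma] := pselect (m a); first by left.
have [y ay] := local_unit nma; right.
have -> : b = y * (a * b) by rewrite mulrA (mulrC y) ay mul1r.
exact: mMl.
Qed.

(** The generators of [U] are discarded one at a time, the last one first: modulo [W] and the
    earlier ones, g_k equals c g_k with c in m, and 1 - c is invertible. *)
Lemma nakayama (M : lmodType A) (U W : set M) : noeth M -> submodule U -> submodule W ->
  (forall x, U x -> addS W (smul m U) x) -> U `<=` W.
Proof.
move=> hM hU hW h; have [r [g [Ug UE]]] := noeth_fg hM hU.
have : U `<=` addS W (span g r) by rewrite UE; apply: addSr.
elim: r {UE} => [|k IH] Uk.
  by move=> x /Uk [w [_ [Ww [c ->] ->]]]; rewrite big_ord0 addr0.
apply: IH.
pose Sm : set M := [set x | exists c : nat -> A, (forall i, m (c i)) /\ x = \sum_(i < k.+1) c i *: g i].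
have hSm : submodule Sm.
  split; first by exists (fun=> 0); split; [move=> _; exact: m0|rewrite big1 // => i _; rewrite scale0r].
  move=> a _ _ [c [mc ->]] [c' [mc' ->]]; exists (fun i => a * c i + c' i); split.
    by move=> i; apply: mD => //; exact: mMl.
  by rewrite scaler_sumr -big_split; apply: eq_bigr => i _; rewrite /= scalerDl scalerA.
have sub : smul m U `<=` addS W Sm.
  apply: smul_min; first exact: submodule_addS.
  move=> a x ma /Uk [w [_ [Ww [c ->] ->]]]; exists (a *: w), (\sum_(i < k.+1) (a * c i) *: g i).
  split; first exact: subZ.
    by exists (fun i => a * c i); split=> // i; exact: mMr.
  by rewrite scalerDr scaler_sumr; congr (_ + _); apply: eq_bigr => i _; rewrite scalerA.
have hWk : submodule (addS W (span g k)) by apply: submodule_addS => //; exact: submodule_span.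
have gk : addS W (span g k) (g k).
  have [w [y [Ww /sub [w' [_ [Ww' [c [mc ->]] ->]]] gE]]] := h _ (Ug k).
  have [d cd] := local_unit1 (mc k).
  have E : (1 - c k) *: g k = (w + w') + \sum_(i < k) c i *: g i.
    by rewrite scalerBl scale1r {1}gE big_ord_recr /= !addrA addrK.
  have -> : g k = d *: ((1 - c k) *: g k) by rewrite scalerA mulrC cd scale1r.
  rewrite E; apply: subZ => //; exists (w + w'), (\sum_(i < k) c i *: g i).
  by split=> //; [exact: subD|exists c].
move=> x /Uk [w [_ [Ww [c ->] ->]]]; rewrite big_ord_recr /= addrA; apply: subD => //.
  by exists w, (\sum_(i < k) c i *: g i); split=> //; exists c.
exact: subZ.
Qed.

(** The intersection [U] of the W + a^n M satisfies U <= W + mU, by the Artin-Rees lemma with n = 1,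
    so that Nakayama's lemma applies. *)
Lemma krull (M : lmodType A) (W : set M) (a : nat -> A) r : noeth M -> submodule W ->
  (forall i, m (a i)) -> forall x, (forall n, addS W (fil a r n) x) -> W x.
Proof.
move=> hM hW ma.
pose U : set M := [set x | forall n, addS W (fil a r n) x].
have hU : submodule U.
  split=> [n|c x y Ux Uy n]; first by apply: sub0; exact: submodule_addS_fil.
  have hF := submodule_addS_fil a r n hW.
  by apply: subD => //; apply: subZ.
have WU : W `<=` U by move=> x Wx n; apply: addSl => //; exact: submodule_fil.
suff : U `<=` W by [].
apply: nakayama => // x Ux; have [k h] := artin_rees hM a r hW hU WU.
have [w [u [Ww Fu ->]]] := h 1%N x (conj Ux (Ux _)).
exists w, u; split=> //; apply: IP_sub Fu; first by apply: submodule_smul => c y; exact: subZ.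
by move=> i y _ Uy; exact: smul_in.
Qed.

End Local.

Lemma mul_lin (A : comNzRingType) (M : lmodType A) (y c : A) (u v : M) :
  y *: (c *: u + v) = c *: (y *: u) + y *: v.
Proof. by rewrite scalerDr !scalerA mulrC. Qed.

Definition mulm (A : comNzRingType) (M : lmodType A) (y : A) : {linear M -> M} :=
  mklin (@mul_lin A M y).

(** * Dimension theory through Hilbert-Samuel polynomials *)

Section Size.
Variables (A : comNzRingType) (m : set A).
Hypotheses (hA : noetherian A) (hm : local_ring m).
Variables (a : nat -> A) (r : nat) (hg : gens m a r).
Implicit Types (J : set A^o).

Let hV : noeth A^o := noeth_self hA.
Let F n : set A^o := fil a r n.
Let hF n : submodule (F n) := @submodule_fil A A^o a r n.

Lemma fil1 : F 1 = m.
Proof.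
rewrite /F /fil /fil_on /= -(smul_gens hg) //; apply/seteqP; split.
  apply: (smul_min (m_ideal hm)) => c x mc _; exact: (mMr hm).
move=> x mx; have := smul_in (M := A^o) mx (I : setT 1).
by rewrite /GRing.scale /= mulr1.
Qed.

Lemma fin_m J : submodule J -> fin (addS J (F 1)) setT.
Proof.
move=> hJ; exists 1%N => U hU WU [_ nTU] /=.
move=> x Ux; apply: addSr => //; change (F 1 x); rewrite fil1.
by apply: (proper_sub_m hm hU) Ux => U1; apply: nTU => y _; rewrite -[y]mulr1; exact: (subZ y hU U1).
Qed.

Definition hs J (n : nat) : nat := ell (addS J (F n)) setT.
Definition hsp J : {poly rat} := xget 0 [set P | evp (fun n => (hs J n)%:R) P].
(** The degree of the Hilbert-Samuel polynomial of A/J plus one, in effect dim A/J + 1, and 0 for J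
    = A. It stands in for the dimension; the link with chains of primes is [prime_chain_sz]. *)
Definition sz J : nat := size (hsp J).

Lemma hspP J : submodule J -> evp (fun n => (hs J n)%:R) (hsp J).
Proof.
move=> hJ; have [Q hQ] := hilbert_samuel hV hJ (fin_m hJ).
by rewrite /hsp; case: xgetP => [P -> //|/(_ Q)].
Qed.

Let fF J n : submodule J -> fin (addS J (F n)) setT.
Proof. by move=> hJ; apply: fin_fil => //; exact: fin_m. Qed.

Lemma hs_anti J J' n : submodule J -> submodule J' -> J `<=` J' -> (hs J' n <= hs J n)%N.
Proof.
move=> hJ hJ' JJ'; rewrite /hs.
rewrite (ell_add (W := addS J (F n)) (U := addS J' (F n))) ?leq_addl //.
- exact: submodule_addS.
- exact: submodule_addS.
- exact: addSS.
- exact: fF.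
Qed.

Lemma sz_anti J J' : submodule J -> submodule J' -> J `<=` J' -> (sz J' <= sz J)%N.
Proof.
move=> hJ hJ' JJ'; apply: (evp_size (hspP hJ') (hspP hJ)); exists 0%N => n _.
by rewrite ler0n ler_nat hs_anti.
Qed.

Definition addc J (c : A) : set A^o := addS J (scS c setT).

Lemma submodule_addc J c : submodule J -> submodule (addc J c).
Proof. by move=> hJ; apply: submodule_addS => //; apply: submodule_scS; exact: submoduleT. Qed.

Lemma addc_sub J c : submodule J -> J `<=` addc J c.
Proof. by move=> hJ; apply: addSl; apply: submodule_scS; exact: submoduleT. Qed.

Lemma addc_in J c x : submodule J -> addc J c (c * x).
Proof. by move=> hJ; apply: addSr => //; exists x. Qed.

Lemma addc_self J c : submodule J -> addc J c c.
Proof. by move=> hJ; rewrite -{2}[c]mulr1; exact: addc_in. Qed.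

Lemma addc_min J c J' : submodule J' -> J `<=` J' -> J' c -> addc J c `<=` J'.
Proof.
move=> hJ' JJ' J'c; apply: addS_sub => // _ [p _ ->].
by rewrite /GRing.scale /= mulrC; exact: (subZ p hJ' J'c).
Qed.

Let split_hs J c n : submodule J ->
  hs J n = (ell (addS J (F n)) (addS (addc J c) (F n)) + hs (addc J c) n)%N.
Proof.
move=> hJ; apply: ell_add => //.
- exact: submodule_addS.
- by apply: submodule_addS => //; exact: submodule_addc.
- by apply: addSS => //; exact: addc_sub.
- exact: fF.
Qed.

Let surj_c J c n y : submodule J -> addS (addc J c) (F n) y ->
  exists2 x, setT x & addS J (F n) (y - c *: x).
Proof.
move=> hJ [_ [f [[j [_ [Jj [x _ ->] ->]]] Ff ->]]]; exists x => //.
exists j, f; split=> //; by rewrite addrAC addrK.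
Qed.

(** As yc is in J, multiplication by y maps A/(J + (c)) onto (J + (y))/J. *)
Lemma hs_mul J y c n : submodule J -> J (y * c) ->
  (hs J n <= hs (addc J y) n + hs (addc J c) n)%N.
Proof.
move=> hJ Jyc; rewrite (split_hs y n hJ) addnC leq_add2l.
have hJc := submodule_addc c hJ; have hJy := submodule_addc y hJ.
suff [] : fin (addS J (F n)) (addS (addc J y) (F n)) /\
    (ell (addS J (F n)) (addS (addc J y) (F n)) <= hs (addc J c) n)%N by [].
apply: (ell_surj (f := mulm A^o y)) => //.
- exact: submodule_addS.
- exact: submodule_addS.
- exact: submodule_addS.
- by apply: addSS => //; exact: addc_sub.
- move=> _ [_ [f [[j [_ [Jj [x _ ->] ->]]] Ff ->]]].
  exists (y * j + x * (y * c)), (y * f); split.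
  + by apply: subD => //; exact: (subZ _ hJ).
  + exact: (subZ _ (hF n)).
  + by rewrite /= /GRing.scale /=; ring.
- by move=> z; exact: surj_c.
- exact: fF.
Qed.

Lemma sz_mul J y c : submodule J -> J (y * c) ->
  (sz J <= maxn (sz (addc J y)) (sz (addc J c)))%N.
Proof.
move=> hJ Jyc; apply: leq_trans (size_polyD _ _).
apply: (evp_size (hspP hJ)).
  exact: evpD (hspP (submodule_addc y hJ)) (hspP (submodule_addc c hJ)).
by exists 0%N => n _; rewrite ler0n -natrD ler_nat hs_mul.
Qed.

(** Multiplication by c maps A/(J + m^n) onto the kernel of A/(J + m^(n+1)) -> A/(J + (c) +
    m^(n+1)). Hence the difference of the Hilbert function of A/J is bounded by the Hilbert function
    of A/(J + (c)), and a difference loses at most one degree. *)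
Lemma sz_addc J c : submodule J -> m c -> (sz J <= (sz (addc J c)).+1)%N.
Proof.
move=> hJ mc; have hJc := submodule_addc c hJ.
apply: leq_trans (size_antidiff _) _; rewrite ltnS /sz -(size_shift (hsp (addc J c)) 1).
have h1 := evpS 1 (hspP hJ); have h2 := evpS 1 (hspP hJc).
apply: (evp_size (evpB h1 (hspP hJ)) h2); exists 0%N => n _; rewrite addn1.
have dec : addS J (F n.+1) `<=` addS J (F n) by apply: addSS => //; exact: fil_dec.
have mono : (hs J n <= hs J n.+1)%N.
  rewrite /hs (ell_add (W := addS J (F n.+1)) (U := addS J (F n))) ?leq_addl //.
  - exact: submodule_addS.
  - exact: submodule_addS.
  - exact: fF.
have le : (hs J n.+1 <= hs J n + hs (addc J c) n.+1)%N.
  rewrite (split_hs c n.+1 hJ) leq_add2r.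
  suff [] : fin (addS J (F n.+1)) (addS (addc J c) (F n.+1)) /\
    (ell (addS J (F n.+1)) (addS (addc J c) (F n.+1)) <= hs J n)%N by [].
  apply: (ell_surj (f := mulm A^o c)) => //.
  - exact: submodule_addS.
  - exact: submodule_addS.
  - exact: submodule_addS.
  - by apply: addSS => //; exact: addc_sub.
  - move=> _ [j [f [Jj Ff ->]]]; rewrite linearD; exists (c *: j), (c *: f); split=> //.
    + exact: (subZ c hJ).
    + exact: (fil_ideal hg mc Ff).
  - by move=> z; exact: surj_c.
  - exact: fF.
apply/andP; split; first by rewrite subr_ge0 ler_nat.
by rewrite lerBlDl -natrD ler_nat.
Qed.

(** By the Artin-Rees lemma, the multiples of c in A/(J + m^(n+k)) have length at least that of A/(J
    + m^n). The Hilbert function of A/(J + (c)) is thus bounded by a difference of that of A/J,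
    which has smaller degree. *)
Lemma sz_regular J c : submodule J -> (forall x, J (c * x) -> J x) ->
  (sz (addc J c) <= (sz J).-1)%N.
Proof.
move=> hJ creg; have hJc := submodule_addc c hJ.
have [k ar] := artin_rees hV a r hJ hJc (addc_sub c hJ).
rewrite /sz -(size_shift (hsp (addc J c)) k%:R).
apply: leq_trans (size_diff (hsp J) k%:R).
apply: (evp_size (evpS k (hspP hJc)) (evpB (evpS k (hspP hJ)) (hspP hJ))).
exists 0%N => n _; rewrite ler0n /= lerBrDr -natrD ler_nat.
rewrite [in leqRHS](split_hs c _ hJ) addnC leq_add2r /hs.
suff [] : fin (addS J (F n)) setT /\
    (ell (addS J (F n)) setT <= ell (addS J (F (n + k))) (addS (addc J c) (F (n + k))))%N by [].
apply: (ell_inj (f := mulm A^o c)) => //.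
- exact: submodule_addS.
- exact: submodule_addS.
- exact: submodule_addS.
- by apply: addSS => //; exact: addc_sub.
- by move=> x _; apply: (addSl (hF _)); exact: (addc_in c x hJ).
- move=> x _ Fcx.
  have [j [u [Jj Fu E]]] := ar n _ (conj (addc_in c x hJ) Fcx).
  have {Fu} [j' [f [Jj' Ff uE]]] : addS J (scS c (F n)) u.
    elim: n u Fu {Fcx E} => [|n IH] u Fu.
      by case: Fu => j' [_ [Jj' [p _ ->] ->]]; exists j', (c *: p); split=> //; exists p.
    have hS i : submodule (scS c (F i)) by apply: submodule_scS; exact: hF.
    have : IP a r (addS J (scS c (F n))) u by apply: IPS Fu => v; exact: IH.
    move=> /(addS_IP hJ (hS n)); apply: addSS => //.
    apply: IP_sub => [|i _ ir [p Fp ->]]; first exact: hS.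
    exists (a i *: p); first exact: fil_in.
    by rewrite !scalerA mulrC.
  case: Ff uE => p Fp -> uE; exists (x - p), p; split=> //; last by rewrite subrK.
  apply: creg; have -> : c * (x - p) = j + j'.
    rewrite mulrBr; apply/eqP; rewrite subr_eq; apply/eqP.
    by rewrite -addrA -uE.
  exact: subD.
- by apply: fin_subr (fF (n + k) hJ).
Qed.

Lemma sz_gt0 J : submodule J -> ~ J 1 -> (0 < sz J)%N.
Proof.
move=> hJ nJ1; rewrite lt0n; apply/negP => /eqP s0.
have [n0 h] := hspP hJ; have := h n0.+1 (leqnSn _).
move/eqP: s0; rewrite size_poly_eq0 => /eqP ->; rewrite horner0 => /eqP.
rewrite pnatr_eq0 => /eqP /ell_eq0 - /(_ (submodule_addS hJ (hF _)) _ (fF _ hJ)) h1.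
have [//|j [f [Jj Ff E]]] := h1 _ 1 I.
apply: (m1 hm); rewrite E; apply: (mD hm); first exact: (proper_sub_m hm hJ nJ1).
rewrite -fil1; exact: (@fil_leq _ _ a r 1 n0.+1).
Qed.

Lemma sz_m : (sz (m : set A^o) <= 1)%N.
Proof.
have hmi := m_ideal hm.
apply: leq_trans (size_polyC_leq1 (1 : rat)).
apply: (evp_size (g := fun=> 1) (hspP hmi)); first by exists 0%N => n _; rewrite hornerC.
exists 0%N => n _; rewrite ler0n (ler_nat _ _ 1).
have hmF := submodule_addS hmi (hF n).
have [_ ge] := ellP hmF (fun x _ => I) (fF n hmi).
apply: (lenge_leq ge) => U hU WU [_ nTU] /= x Ux; apply: addSl => //.
by apply: (proper_sub_m hm hU) Ux => U1; apply: nTU => y _; rewrite -[y]mulr1; exact: (subZ y hU U1).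
Qed.

(** An element of S_1 outside the prime S_0 is regular modulo S_0, so [sz] drops strictly along the
    chain. *)
Lemma prime_chain_sz n (S : nat -> set A) :
  (forall i, (i <= n)%N -> prime_ideal (S i)) ->
  (forall i, (i < n)%N -> S i `<` S i.+1) -> (n < sz (S 0%N))%N.
Proof.
elim: n S => [|n IH] S pS lt.
  by have [hS nS1 _] := pS 0%N (leqnn _); exact: sz_gt0.
have := IH (fun i => S i.+1) (fun i h => pS i.+1 h) (fun i h => lt i.+1 h).
have [hS0 n1 p0] := pS 0%N (leq0n _); have [hS1 _ _] := pS 1%N (ltn0Sn _).
have [S01 nS10] := lt 0%N (ltn0Sn _).
have [c [S1c nS0c]] : exists c, S 1%N c /\ ~ S 0%N c.
  by apply: contrapT => no; apply: nS10 => c S1c; apply: contrapT => nc; apply: no; exists c.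
have creg x : S 0%N (c * x) -> S 0%N x by move=> /p0 [].
have := sz_regular hS0 creg; have := sz_gt0 hS0 n1.
have : (sz (S 1%N) <= sz (addc (S 0%N) c))%N.
  by apply: sz_anti => //; [exact: submodule_addc|exact: addc_min].
rewrite /=; lia.
Qed.

End Size.

(** * Regular sequences *)

Section RegularSequences.
Variables (A : comNzRingType) (M : lmodType A).
Implicit Types (W : set M) (x : nat -> A).

(** W + (x_0, ..., x_(i-1))M. With it, [reg] below is regularity of the sequence on M/W, except that
    the last quotient may vanish. *)
Fixpoint Wx W x (i : nat) : set M :=
  if i is i'.+1 then addS (Wx W x i') (scS (x i') setT) else W.

Lemma submodule_Wx W x i : submodule W -> submodule (Wx W x i).
Proof.
move=> hW; elim: i => //= i IH; apply: submodule_addS => //.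
by apply: submodule_scS; exact: submoduleT.
Qed.

Lemma Wx_leq W x i j : submodule W -> (i <= j)%N -> Wx W x i `<=` Wx W x j.
Proof.
move=> hW /subnKC <-; elim: (j - i)%N => [|k IH]; first by rewrite addn0.
rewrite addnS => y /IH; apply: addSl; apply: submodule_scS; exact: submoduleT.
Qed.

Lemma Wx_in W x i j v : submodule W -> (j < i)%N -> Wx W x i (x j *: v).
Proof.
move=> hW ji; apply: (Wx_leq hW ji) => /=; apply: addSr; first exact: submodule_Wx.
by exists v.
Qed.

Lemma Wx_min W x i (U : set M) : submodule U -> W `<=` U ->
  (forall j v, (j < i)%N -> U (x j *: v)) -> Wx W x i `<=` U.
Proof.
move=> hU WU; elim: i => //= i IH h; apply: addS_sub => //.
  by apply: IH => j v ji; apply: h; exact: leqW.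
by move=> _ [v _ ->]; exact: h.
Qed.

Lemma WxP W x i v : Wx W x i v <->
  exists w (u : nat -> M), W w /\ v = w + \sum_(j < i) x j *: u j.
Proof.
split=> [|[w [u [Ww ->]]]].
  elim: i v => [|i IH] v /=; first by exists v, (fun=> 0); split=> //; rewrite big_ord0 addr0.
  move=> [_ [_ [/IH [w [u [Ww ->]]] [p _ ->] ->]]].
  exists w, (fun j => if j == i then p else u j); split=> //.
  rewrite big_ord_recr /= eqxx addrA; congr (_ + _ + _).
  by apply: eq_bigr => j _; rewrite ltn_eqF.
elim: i => [|i IH]; first by rewrite big_ord0 addr0.
by rewrite big_ord_recr /= addrA; exists (w + \sum_(j < i) x j *: u j), (x i *: u i); split=> //; exists (u i).
Qed.

Lemma eq_Wx W x y i : (forall j, (j < i)%N -> x j = y j) -> Wx W x i = Wx W y i.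
Proof.
elim: i => //= i IH h; rewrite IH ?h // => j ji; apply: h; exact: leqW.
Qed.

Definition reg W x (n : nat) := forall i v, (i < n)%N ->
  Wx W x i (x i *: v) -> Wx W x i v.

End RegularSequences.

(** * Suprema of sets of integers *)

Section SupInt.

(** [supremum] returns a default value unless a least upper bound exists; here one exists since
    bounded non-empty sets of integers have a maximum. *)
Lemma supremums_int (S : set (\bar int)) : S !=set0 -> supremums S !=set0.
Proof.
move=> [s Ss].
have [Soo|nSoo] := pselect (S +oo%E).
  by exists +oo%E; split=> [x _|y ub]; [exact: leey|exact: ub].
have [[n Sn]|no] := pselect (exists n : int, S n%:E); last first.
  exists -oo%E; split=> [x Sx|y _]; last exact: leNye.
  by case: x Sx => [n Sn|/nSoo//|//]; case: no; exists n.
have [[k kP]|nb] := pselect (exists k : nat, forall j : nat, S (n + j%:Z)%:E -> (j <= k)%N).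
  have e : exists j : nat, `[< S (n + j%:Z)%:E >] by exists 0%N; apply/asboolP; rewrite addr0.
  have b j : `[< S (n + j%:Z)%:E >] -> (j <= k)%N by move/asboolP/kP.
  case: (ex_maxnP e b) => j /asboolP Sj jmax; exists (n + j%:Z)%:E; split; last by move=> y; exact.
  move=> [z|/nSoo//|_]; last exact: leNye.
  move=> Sz; rewrite lee_fin; have [zn|nz] := leP z n; first by apply: le_trans zn _; lia.
  have zE : z = n + `|z - n|%N%:Z by lia.
  have := jmax `|z - n|%N; rewrite -zE => /(_ (asboolT Sz)) h; lia.
exists +oo%E; split=> [x _|[z|//|]]; first exact: leey.
  move=> ub; exfalso; apply: nb; exists `|z - n|%N => j /ub; rewrite lee_fin; lia.
by move=> /(_ _ Sn); rewrite leNgt ltNyr.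
Qed.

Lemma supz_ub (S : set (\bar int)) x : S x -> (x <= supz S)%E.
Proof. by move=> Sx; rewrite /supz; apply: ge_supremum_Nmem => //; apply: supremums_int; exists x. Qed.

Lemma supz_le (S : set (\bar int)) y : (forall x, S x -> (x <= y)%E) -> (supz S <= y)%E.
Proof.
move=> ub; have [->|/set0P ne] := eqVneq S set0; first by rewrite /supz supremum0 leNye.
have [z zS] := supremums_int ne.
rewrite /supz /supremum; case: ifPn => [_|_]; first exact: leNye.
by case: xgetP => [t -> [_]|/(_ z)//]; apply.
Qed.

Definition nats (T : set nat) : set (\bar int) := [set n%:Z%:E | n in T].

Lemma supz_nats (T : set nat) (D : nat) : supz (nats T) = D%:Z%:E -> T D.
Proof.
move=> e; have ub n : T n -> (n <= D)%N.
  move=> Tn; have : (n%:Z%:E <= supz (nats T))%E by apply: supz_ub; exists n.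
  by rewrite e lee_fin lez_nat.
apply: contrapT => nT.
have : (supz (nats T) <= (D%:Z - 1)%:E)%E.
  apply: supz_le => _ [n Tn <-]; rewrite lee_fin.
  have := ub n Tn; rewrite leq_eqVlt => /orP[/eqP nD|]; first by case: nT; rewrite -nD.
  lia.
by rewrite e lee_fin; lia.
Qed.

Lemma supz_nats_eq (T : set nat) (D : nat) : T D -> (forall n, T n -> (n <= D)%N) ->
  supz (nats T) = D%:Z%:E.
Proof.
move=> TD ub; apply/le_anti/andP; split; last by apply: supz_ub; exists D.
by apply: supz_le => _ [n Tn <-]; rewrite lee_fin lez_nat; exact: ub.
Qed.

Lemma supz_nats_le (T : set nat) (D : nat) n : supz (nats T) = D%:Z%:E -> T n -> (n <= D)%N.
Proof.
move=> e Tn; have : (n%:Z%:E <= supz (nats T))%E by apply: supz_ub; exists n.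
by rewrite e lee_fin lez_nat.
Qed.

End SupInt.

(** * A minimal set of generators of the maximal ideal of a regular local ring is a regular
    sequence *)

Section RegularLocal.
Variables (A : comNzRingType) (m : set A).
Hypotheses (hA : noetherian A) (hm : local_ring m).
Variables (x : nat -> A) (D : nat) (hg : gens m x D).

Let J i : set A^o := Wx [set 0] x i.
Let hJ i : submodule (J i). Proof. by apply: submodule_Wx; exact: submodule_zero. Qed.

Lemma Wx_gens : J D = m.
Proof.
apply/seteqP; split.
  apply: Wx_min; [exact: (m_ideal hm)|by move=> _ ->; exact: (m0 hm)|].
  by move=> j v _; apply: (mMr hm); exact: hg.1.
move=> z /(hg.2) [c ->]; apply/WxP; exists 0, c; split=> //.
by rewrite add0r; apply: eq_bigr => i _; rewrite /GRing.scale /= mulrC.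
Qed.

Let Jm i : (i <= D)%N -> J i `<=` m.
Proof. by move=> iD; rewrite -Wx_gens; apply: Wx_leq => //; exact: submodule_zero. Qed.

Variables (S : nat -> set A) (Sprime : forall i, (i <= D)%N -> prime_ideal (S i))
  (Slt : forall i, (i < D)%N -> S i `<` S i.+1).

Let szJ i : (i <= D)%N -> sz x D (J i) = (D - i).+1.
Proof.
(* [sz] drops by at most one per generator. The upper bound climbs down from J_D = m, where it is at
   most 1; the lower bound starts from sz J_0 > D, which the chain of primes gives. *)
have step k : (k < D)%N -> (sz x D (J k) <= (sz x D (J k.+1)).+1)%N.
  by move=> kD; apply: (sz_addc hA hm hg (hJ k)); exact: hg.1.
move=> iD; apply/eqP; rewrite eqn_leq; apply/andP; split.
  rewrite -{1}(subKn iD); move: (leq_subr i D); move: (D - i)%N => k.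
  elim: k => [_|k IH kD]; first by rewrite subn0 Wx_gens; exact: (sz_m hA hm hg).
  have lt : (D - k.+1 < D)%N by lia.
  have := step _ lt; have -> : (D - k.+1).+1 = (D - k)%N by lia.
  by have := IH (ltnW kD); lia.
have h0 : (D < sz x D (J 0))%N.
  apply: leq_trans (prime_chain_sz hA hm hg Sprime Slt) _.
  apply: (sz_anti hA hm hg) => //; first by have [] := Sprime (leq0n D).
  by move=> _ ->; have [h _ _] := Sprime (leq0n D); exact: sub0.
elim: i iD => [|i IH] iD; first by rewrite subn0.
have := IH (ltnW iD); have := step i iD; lia.
Qed.

Lemma sz_regular_local : sz x D ([set 0] : set A^o) = D.+1.
Proof. by have := szJ (leq0n D); rewrite subn0. Qed.

Let szpow i k : (i < D)%N -> (sz x D (addc (J i) (x i ^+ k.+1)) <= D - i)%N.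
Proof.
move=> iD; have hJi := submodule_addc (x i ^+ k.+1) (hJ i).
elim: k hJi => [|k IH] hJi.
  have -> : addc (J i) (x i ^+ 1) = J i.+1 by rewrite expr1.
  by rewrite szJ //; lia.
set J' := addc (J i) _ in hJi *.
have hJ'' := submodule_addc (x i ^+ k.+1) (hJ i).
have mem : J' (x i ^+ k.+1 * x i).
  by rewrite -exprSr -[_ ^+ _]mulr1; exact: addc_in.
apply: leq_trans (sz_mul hA hm hg hJi mem) _; rewrite geq_max; apply/andP; split.
  apply: leq_trans (IH hJ''); apply: (sz_anti hA hm hg) => //; first exact: submodule_addc.
  by apply: addSS => //; exact: addc_sub.
have -> : (D - i)%N = (D - i.+1).+1 by lia.
rewrite -(szJ iD); apply: (sz_anti hA hm hg) => //; first exact: submodule_addc.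
by apply: addSS => //; exact: addc_sub.
Qed.

(** For k > 0 and c outside J_(i+1), sz J_i = D - i + 1 would be at most the maximum of sz (J_i +
    (x_i^k)) <= D - i and sz (J_i + (c)) <= sz (J_(i+1) + (c)) + 1 <= D - i, the last bound because
    c is regular modulo the prime J_(i+1). *)
Let key i k c : (i < D)%N -> prime_ideal (J i.+1) -> J i (x i ^+ k * c) -> J i.+1 c.
Proof.
case: k => [|k] iD [_ _ pJ].
  by rewrite mul1r; apply: Wx_leq => //; exact: submodule_zero.
move=> Jxc; apply: contrapT => nJc.
have creg z : J i.+1 (c * z) -> J i.+1 z by move=> /pJ[].
have h1 := sz_regular hA hm hg (hJ i.+1) creg.
have h2 := sz_mul hA hm hg (hJ i) Jxc.
have h3 := sz_addc hA hm hg (submodule_addc c (hJ i)) (hg.1 i).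
have h4 : (sz x D (addc (addc (J i) c) (x i)) <= sz x D (addc (J i.+1) c))%N.
  apply: (sz_anti hA hm hg); [exact: submodule_addc|by apply: submodule_addc; exact: submodule_addc|].
  apply: addc_min; first by apply: submodule_addc; exact: submodule_addc.
    apply: addc_min; first by apply: submodule_addc; exact: submodule_addc.
      by move=> z Jz; apply: addc_sub; [exact: submodule_addc|exact: addc_sub].
    by apply: addc_self; exact: submodule_addc.
  by apply: addc_sub; [exact: submodule_addc|exact: addc_self].
have h5 := szpow k iD.
rewrite (szJ iD) in h1; rewrite (szJ (ltnW iD)) in h2; lia.
Qed.

Let pow i c : (i < D)%N -> prime_ideal (J i.+1) -> (forall j, addc (J i) (x i ^+ j) c) -> J i c.
Proof.
move=> iD pJ h; refine (@krull A m hm A^o (J i) x D (noeth_self hA) (hJ i) hg.1 c _) => n.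
move: (h n); apply: addSS => // _ [p _ ->].
elim: n => [|n IH]; first by [].
by rewrite exprS -scalerA; apply: (fil_ideal hg) => //; exact: hg.1.
Qed.

Let div i c : (i < D)%N -> prime_ideal (J i.+1) -> ~ J i c ->
  exists k c', J i (c - x i ^+ k * c') /\ ~ J i.+1 c'.
Proof.
move=> iD pJ nJc; apply: contrapT => no; apply: nJc; apply: (pow iD pJ).
suff h j : exists c', J i (c - x i ^+ j * c').
  move=> j; have [c' h'] := h j; exists (c - x i ^+ j * c'), (x i ^+ j * c'); split=> //.
    by exists c'.
  by rewrite subrK.
elim: j => [|j [c' h']]; first by exists c; rewrite mul1r subrr; exact: sub0.
have [[w [_ [Jw [p _ ->] E]]]|nJ] := pselect (J i.+1 c'); last by case: no; exists j, c'.
exists p; have -> : c - x i ^+ j.+1 * p = (c - x i ^+ j * c') + x i ^+ j * w.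
  by rewrite E exprSr /GRing.scale /=; ring.
by apply: subD => //; exact: (subZ _ (hJ i)).
Qed.

(** Descending induction from the prime ideal J_D = m. If J_(i+1) is prime, Krull's theorem writes
    an element outside J_i as x_i^k c' modulo J_i with c' outside J_(i+1); with [key], J_i is prime
    and x_i is regular modulo J_i. *)
Lemma regular_local_reg : reg ([set 0] : set A^o) x D.
Proof.
suff h k : (k <= D)%N -> prime_ideal (J (D - k)) /\
    forall i, (D - k <= i)%N -> (i < D)%N -> forall v, J i (x i * v) -> J i v.
  move=> i v iD; have [_ h'] := h D (leqnn D); by apply: h'; rewrite ?subnn.
elim: k => [_|k IH kD].
  by rewrite subn0 Wx_gens; split=> [|i]; [exact: (prime_m hm)|lia].
have [pJ hreg] := IH (ltnW kD).
set i0 := (D - k.+1)%N; have iD : (i0 < D)%N by rewrite /i0; lia.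
have E : (D - k)%N = i0.+1 by rewrite /i0; lia.
rewrite E in pJ hreg; split.
  split; first exact: hJ.
    by move=> /(Jm (ltnW iD)); exact: (m1 hm).
  move=> a b Jab; have [Ja|nJa] := pselect (J i0 a); first by left.
  have [Jb|nJb] := pselect (J i0 b); [by right|exfalso].
  have [k1 [a' [ha na]]] := div iD pJ nJa.
  have [k2 [b' [hb nb]]] := div iD pJ nJb.
  have [_ _ pp] := pJ.
  have : J i0.+1 (a' * b').
    apply: (key (k := (k1 + k2)%N) iD pJ).
    have -> : x i0 ^+ (k1 + k2) * (a' * b') = a * b - b * (a - x i0 ^+ k1 * a')
        - (x i0 ^+ k1 * a') * (b - x i0 ^+ k2 * b').
      by rewrite exprD; ring.
    by apply: (subB (hJ i0)); [apply: (subB (hJ i0)) => //|]; exact: (subZ _ (hJ i0)).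
  by move=> /pp[].
move=> i; rewrite leq_eqVlt => /orP[/eqP <-|lt] iD' v; last exact: hreg.
move=> Jxv; apply: (pow iD pJ) => j.
suff [c' h'] : exists c', J i0 (v - x i0 ^+ j * c').
  exists (v - x i0 ^+ j * c'), (x i0 ^+ j * c'); split=> //; first by exists c'.
  by rewrite subrK.
elim: j => [|j [c' h']]; first by exists v; rewrite mul1r subrr; exact: (sub0 (hJ i0)).
have : J i0.+1 c'.
  apply: (key (k := j.+1) iD pJ).
  have -> : x i0 ^+ j.+1 * c' = x i0 * v - x i0 * (v - x i0 ^+ j * c') by rewrite exprS; ring.
  by apply: (subB (hJ i0)) => //; exact: (subZ _ (hJ i0)).
move=> [w [_ [Jw [p _ ->] Ec]]].
exists p; have -> : v - x i0 ^+ j.+1 * p = (v - x i0 ^+ j * c') + x i0 ^+ j * w.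
  by rewrite Ec exprSr /GRing.scale /=; ring.
by apply: (subD (hJ i0)) => //; exact: (subZ _ (hJ i0)).
Qed.

End RegularLocal.

(** * Socles and depth *)

Section Depth.
Variables (A : comNzRingType) (m : set A).
Hypotheses (hA : noetherian A) (hm : local_ring m).

Lemma prime_prod (p : set A) s (y : nat -> A) : prime_ideal p ->
  p (\prod_(i < s) y i) -> exists2 i, (i < s)%N & p (y i).
Proof.
move=> [_ p1 pM]; elim: s => [|s IH]; first by rewrite big_ord0.
rewrite big_ord_recr /= => /pM[/IH[i lt py]|py]; first by exists i => //; exact: leqW.
by exists s.
Qed.

Lemma prime_avoidance s (P : nat -> set A) :
  (forall i, (i < s)%N -> prime_ideal (P i)) ->
  (forall i, (i < s)%N -> exists2 z, m z & ~ P i z) ->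
  exists2 z, m z & forall i, (i < s)%N -> ~ P i z.
Proof.
elim: s P => [|s IH] P pP mP; first by exists 0 => //; exact: (m0 hm).
have pP' i (lt : (i < s)%N) := pP i (leqW lt); have mP' i (lt : (i < s)%N) := mP i (leqW lt).
(* If P_j lies in P_s, it is dropped. Otherwise each P_j has an element outside P_s, and adding w
   times the product of these elements corrects a z that lies in P_s. *)
have [[j [js sub]]|no] := pselect (exists j, (j < s)%N /\ P j `<=` P s).
  pose P' i := if i == j then P s else P i.
  have [||z mz nz] := IH P'.
  - by move=> i lt; rewrite /P'; case: eqP => _; [exact: pP|exact: pP'].
  - by move=> i lt; rewrite /P'; case: eqP => _; [exact: mP|exact: mP'].
  exists z => // i; rewrite ltnS leq_eqVlt => /orP[/eqP ->|lt].
    by have := nz j js; rewrite /P' eqxx.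
  have := nz i lt; rewrite /P'; case: eqP => [->|//] h /sub; exact: h.
have [z mz nz] := IH P pP' mP'.
have [Psz|nPsz] := pselect (P s z); last first.
  by exists z => // i; rewrite ltnS leq_eqVlt => /orP[/eqP ->//|]; exact: nz.
have /choice[y yP] i : exists y, (i < s)%N -> P i y /\ ~ P s y.
  have [lt|] := ltnP i s; last by exists 0.
  have [y [Py nPy]] : exists y, P i y /\ ~ P s y.
    apply: contrapT => noy; apply: no; exists i; split=> // y Py.
    by apply: contrapT => nPy; apply: noy; exists y.
  by exists y.
have [w mw nw] := mP s (ltnSn s).
have [hPs Ps1 PsM] := pP s (ltnSn s).
exists (z + w * \prod_(i < s) y i); first by apply: (mD hm) => //; exact: (mMr hm).
move=> i; rewrite ltnS leq_eqVlt => /orP[/eqP -> Pz|lt Pz].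
  have /PsM[//|/(prime_prod (pP s (ltnSn s)))[j js]] : P s (w * \prod_(i < s) y i).
    by rewrite -(addKr z (w * _)) addrC; exact: (subB hPs).
  by have [_] := yP j js.
have [hPi _ _] := pP' i lt; apply: (nz i lt).
rewrite -(addrK (w * \prod_(i < s) y i) z); apply: (subB hPi) => //.
rewrite (bigD1 (Ordinal lt)) //= mulrCA mulrC; apply: (subZ _ hPi).
by have [] := yP i lt.
Qed.

Section Module.
Variables (M : lmodType A) (hM : noeth M).
Implicit Types (W : set M).

Definition annv W (v : M) : set A := [set a | W (a *: v)].
(** This says that m is an associated prime of M/W, that is, that M/W has depth 0. *)
Definition soc W := exists v, ~ W v /\ forall a, m a -> W (a *: v).

Lemma submodule_annv W v : submodule W -> submodule (annv W v : set A^o).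
Proof.
move=> hW; split; first by rewrite /annv /= scale0r; exact: sub0.
move=> a x y; rewrite /annv /= => Wx Wy; rewrite scalerDl -scalerA.
by apply: subD => //; exact: subZ.
Qed.

(* The g i have maximal annihilators among the elements of M/W. *)
Lemma zero_divisor_primes W : submodule W ->
  exists s (g : nat -> M), (forall i, (i < s)%N -> ~ W (g i) /\ prime_ideal (annv W (g i))) /\
    forall v, ~ W v -> exists2 i, (i < s)%N & annv W v `<=` annv W (g i).
Proof.
move=> hW.
pose good v := ~ W v /\ forall u, ~ W u -> annv W v `<=` annv W u -> annv W u `<=` annv W v.
have good_prime v : good v -> prime_ideal (annv W v).
  move=> [nWv mx]; split; first exact: submodule_annv.
    by rewrite /annv /= scale1r.
  move=> a b ab; have [Wb|nWb] := pselect (W (b *: v)); [by right|left].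
  apply: (mx (b *: v)) => // [c|]; rewrite /annv /= scalerA //.
  by move=> Wc; rewrite mulrC -scalerA; exact: subZ.
have dom v : ~ W v -> exists2 u, good u & annv W v `<=` annv W u.
  move=> nWv; pose F := [set J : set A^o | exists u, [/\ ~ W u, annv W v `<=` annv W u & J = annv W u]].
  have [| |J [[u [nWu vu ->]] mx]] := @noeth_max _ _ (noeth_self hA) F (annv W v).
  - by move=> J [u [_ _ ->]]; exact: submodule_annv.
  - by exists v; split.
  exists u => //; split=> // u' nWu' uu'; apply: mx => //.
  by exists u'; split=> // a /vu /uu'.
pose F := [set V : set M | exists s g, (forall i, (i < s)%N -> good (g i)) /\ V = span g s].
have [| |V [[s [g [gg ->]]] mx]] := noeth_max hM (F := F) (U0 := span (fun=> 0) 0).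
- by move=> V [s [g [_ ->]]]; exact: submodule_span.
- by exists 0%N, (fun=> 0).
exists s, g; split; first by move=> i /gg gi; split; [case: gi|exact: good_prime].
move=> v /dom [u gu vu].
have : span g s u.
  pose g' i := if (i < s)%N then g i else u.
  apply: (mx (span g' s.+1)).
  - exists s.+1, g'; split=> // i _; rewrite /g'; case: ifP => // /gg //.
  - apply: span_sub; first exact: submodule_span.
    by move=> i lt; have := @span_in _ _ g' s.+1 i (leqW lt); rewrite /g' lt.
  - by have := @span_in _ _ g' s.+1 s (ltnSn s); rewrite /g' ltnn.
move=> [c uE]; apply: contrapT => no.
(* If no annihilator of a g_i contained that of v, there would be y_i annihilating g_i but not u.
   Their product annihilates u, a combination of the g_i, although the annihilator of u is prime. *)
have /choice[y yP] i : exists y, (i < s)%N -> annv W (g i) y /\ ~ annv W u y.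
  have [lt|] := ltnP i s; last by exists 0.
  have [y [Wy nWy]] : exists y, annv W (g i) y /\ ~ annv W u y.
    apply: contrapT => noy; apply: no; exists i => // a /vu Wau.
    have sub : annv W (g i) `<=` annv W u.
      by move=> y Wy; apply: contrapT => nWy; apply: noy; exists y.
    by have [_ mxi] := gg i lt; apply: (mxi u) => //; case: gu.
  by exists y.
have [i lt] : exists2 i, (i < s)%N & annv W u (y i).
  apply: (prime_prod (good_prime _ gu)); rewrite /annv /= uE scaler_sumr.
  apply: sub_sum => // i _; rewrite (bigD1 i) //= mulrC -scalerA; apply: subZ => //.
  by rewrite scalerA mulrC -scalerA; apply: subZ => //; have [] := yP i (ltn_ord i).
by have [_ nW] := yP i lt.
Qed.

(** Prime avoidance for the maximal annihilators of all the quotients M/F_i at once: exchanging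
    regular sequences requires an element that is regular on several quotients. *)
Lemma regular_element k (F : nat -> set M) :
  (forall i, (i < k)%N -> submodule (F i)) -> (forall i, (i < k)%N -> ~ soc (F i)) ->
  exists2 z, m z & forall i v, (i < k)%N -> F i (z *: v) -> F i v.
Proof.
move=> hF ns.
suff [s [P [pP mP cov]]] : exists s (P : nat -> set A),
    [/\ forall i, (i < s)%N -> prime_ideal (P i),
        forall i, (i < s)%N -> exists2 z, m z & ~ P i z
      & forall i v, (i < k)%N -> ~ F i v -> exists2 j, (j < s)%N & annv (F i) v `<=` P j].
  have [z mz zP] := prime_avoidance pP mP; exists z => // i v lt Fzv.
  by apply: contrapT => nFv; have [j js h] := cov i v lt nFv; apply: (zP j js); exact: h.
elim: k hF ns => [|k IH] hF ns; first by exists 0%N, (fun=> set0); split.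
have [|i lt|s [P [pP mP cov]]] := IH; [by move=> i lt; apply: hF; exact: leqW|by apply: ns; exact: leqW|].
have hFk := hF k (ltnSn k).
have [s' [g [gP gcov]]] := zero_divisor_primes hFk.
exists (s + s')%N, (fun i => if (i < s)%N then P i else annv (F k) (g (i - s)%N)); split.
- move=> i lt; case: ltnP => h; first exact: pP.
  by have [|] := gP (i - s)%N; first lia.
- move=> i lt; case: ltnP => h; first exact: mP.
  have [|nF _] := gP (i - s)%N; first lia.
  apply: contrapT => no; apply: (ns k (ltnSn k)); exists (g (i - s)%N); split=> // a ma.
  by apply: contrapT => na; apply: no; exists a.
- move=> i v; rewrite ltnS leq_eqVlt => /orP[/eqP ->|lt] nFv.
    have [j js h] := gcov v nFv; exists (s + j)%N; first by rewrite ltn_add2l.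
    by rewrite ltnNge leq_addr /= addKn.
  by have [j js h] := cov i v lt nFv; exists j; [exact: ltn_addr|rewrite js].
Qed.

(** Both socles are Hom's into quotients of M/W by regular elements, hence Ext^1(A/m, M/W).
    Explicitly, a socle element v modulo x satisfies yv = xu modulo W, and u is the corresponding
    one modulo y. *)
Lemma soc_swap W x y : submodule W -> (forall v, W (x *: v) -> W v) ->
  (forall v, W (y *: v) -> W v) -> m y ->
  soc (addS W (scS x setT)) -> soc (addS W (scS y setT)).
Proof.
move=> hW xr yr my [v [nv mv]].
have [w [_ [Ww [u _ ->] E]]] := mv y my.
have hWx : submodule (addS W (scS x setT)).
  by apply: submodule_addS => //; apply: submodule_scS; exact: submoduleT.
have hWy : submodule (addS W (scS y setT)).
  by apply: submodule_addS => //; apply: submodule_scS; exact: submoduleT.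
exists u; split.
  move=> [w' [_ [Ww' [u' _ ->] uE]]]; apply: nv.
  have Wd : W (v - x *: u').
    apply: yr; rewrite scalerBr E uE scalerDr !scalerA [y * x]mulrC addrA addrK.
    by apply: subD => //; exact: subZ.
  by exists (v - x *: u'), (x *: u'); split=> //; [exists u'|rewrite subrK].
move=> a ma; have [w' [_ [Ww' [v' _ ->] av]]] := mv a ma.
have Wd : W (a *: u - y *: v').
  apply: xr; have -> : x *: (a *: u - y *: v') = y *: w' - a *: w.
    have e1 : x *: u = y *: v - w by rewrite E addrAC subrr add0r.
    have e2 : x *: v' = a *: v - w' by rewrite av addrAC subrr add0r.
    rewrite scalerBr !scalerA [x * a]mulrC [x * y]mulrC -!scalerA e1 e2.
    rewrite !scalerBr !scalerA [a * y]mulrC opprB addrC.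
    by rewrite addrA subrK.
  by apply: subB => //; exact: subZ.
by exists (a *: u - y *: v'), (y *: v'); split=> //; [exists v'|rewrite subrK].
Qed.

Lemma reg_soc W x n i : submodule W -> (i < n)%N -> reg W x n -> (forall j, (j < n)%N -> m (x j)) ->
  ~ soc (Wx W x i).
Proof. by move=> hW lt hr mx [v [nv mv]]; apply: nv; apply: (hr i v lt); apply: mv; exact: mx. Qed.

Lemma Wx_addS W z x i : submodule W ->
  Wx (addS W (scS z setT)) x i = addS (Wx W x i) (scS z setT).
Proof.
move=> hW; have hz : submodule (scS z setT : set M) by apply: submodule_scS; exact: submoduleT.
elim: i => //= i ->; apply/seteqP; split=> _ [_ [p [[w [q [Ww zq ->]]] xp ->]]].
  exists (w + p), q; split=> //; last by rewrite addrAC.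
  by exists w, p.
exists (w + p), q; split=> //; last by rewrite addrAC.
by exists w, p.
Qed.

(** If x_i v = zu modulo W_i, then u = x_i u' modulo W_i because z is regular modulo W_(i+1), and
    x_i can be cancelled from x_i (v - zu'). *)
Lemma reg_addS W z x n : submodule W -> reg W x n ->
  (forall i v, (i <= n)%N -> Wx W x i (z *: v) -> Wx W x i v) ->
  reg (addS W (scS z setT)) x n.
Proof.
move=> hW xr zr i v lt; rewrite !Wx_addS // => -[w [_ [Ww [u _ ->] E]]].
have hWi j : submodule (Wx W x j) by exact: submodule_Wx.
have [w' [_ [Ww' [u' _ ->] uE]]] : Wx W x i.+1 u.
  apply: zr => //=; exists (- w), (x i *: v); split; [exact: subN|by exists v|].
  by rewrite E addKr.
have Wd : Wx W x i (v - z *: u').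
  apply: xr => //; have -> : x i *: (v - z *: u') = w + z *: w'.
    rewrite scalerBr E uE scalerDr !scalerA [z * _]mulrC addrA addrK //.
  by apply: subD => //; exact: subZ.
by exists (v - z *: u'), (z *: u'); split=> //; [exists u'|rewrite subrK].
Qed.

(* Both sequences are exchanged against one starting with a common regular element z. *)
Lemma depth_unique n W x y : submodule W ->
  (forall i, (i < n)%N -> m (x i)) -> (forall i, (i < n)%N -> m (y i)) ->
  reg W x n -> reg W y n -> soc (Wx W x n) -> soc (Wx W y n).
Proof.
elim: n W => // n IH W hW mx my xr yr sx.
have hW' u i : submodule (Wx W u i) by exact: submodule_Wx.
pose F i := if (i <= n)%N then Wx W x i else Wx W y (i - n.+1)%N.
have [| |z mz zP] := @regular_element (n.+1 + n.+1)%N F.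
- by move=> i _; rewrite /F; case: ifP.
- move=> i lt; rewrite /F; case: leqP => h; first exact: (reg_soc hW _ xr mx).
  by apply: (reg_soc hW _ yr my); lia.
have zx i v : (i <= n)%N -> Wx W x i (z *: v) -> Wx W x i v.
  by move=> le; have := zP i v; rewrite /F le; apply; lia.
have zy i v : (i <= n)%N -> Wx W y i (z *: v) -> Wx W y i v.
  move=> le; have := zP (n.+1 + i)%N v; rewrite /F (_ : (n.+1 + i <= n)%N = false); last by lia.
  by rewrite addKn; apply; lia.
have mx' i (lt : (i < n)%N) := mx i (leqW lt); have my' i (lt : (i < n)%N) := my i (leqW lt).
have xr' : reg W x n by move=> i v lt; apply: xr; exact: leqW.
have yr' : reg W y n by move=> i v lt; apply: yr; exact: leqW.
apply: (soc_swap (hW' y n) (x := z) (y := y n)) => [v|v||].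
- exact: zy.
- exact: yr.
- exact: my.
rewrite -Wx_addS //; apply: (IH _ _ mx' my').
- by apply: submodule_addS => //; apply: submodule_scS; exact: submoduleT.
- exact: reg_addS.
- exact: reg_addS.
rewrite Wx_addS //; apply: (soc_swap (hW' x n) (x := x n)) => // v.
- exact: xr.
- exact: zx.
Qed.

(* Dropping the elements of a regular sequence one at a time yields ever smaller primes. *)
Lemma reg_prime_chain W x n : submodule W -> (forall i, (i < n)%N -> m (x i)) ->
  reg W x n -> (exists v, ~ Wx W x n v) ->
  exists S : nat -> set A, (forall i, (i <= n)%N -> prime_ideal (S i)) /\
    forall i, (i < n)%N -> S i `<` S i.+1.
Proof.
move=> hW mx xr [v0 nv0].
pose ann i : set A := [set a | forall v, Wx W x i (a *: v)].
have hann i : submodule (ann i : set A^o).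
  split=> [v|a b c ab ac v]; first by rewrite scale0r; apply: sub0; exact: submodule_Wx.
  rewrite scalerDl -scalerA; have hWi := submodule_Wx x i hW.
  by apply: subD => //; exact: subZ.
suff h k : (k <= n)%N -> exists S : nat -> set A,
    [/\ forall i, (i <= k)%N -> prime_ideal (S i),
        forall i, (i < k)%N -> S i `<` S i.+1 & ann (n - k)%N `<=` S 0%N].
  by have [S [h1 h2 _]] := h n (leqnn n); exists S.
elim: k => [_|k IH kn].
  exists (fun=> m); split=> // [i _|]; first exact: (prime_m hm).
  rewrite subn0; apply: (proper_sub_m hm (hann n)) => h1; apply: nv0.
  by rewrite -[v0]scale1r; exact: h1.
have [S [pS ltS annS]] := IH (ltnW kn).
set i := (n - k.+1)%N; have iE : (n - k)%N = i.+1 by rewrite /i; lia.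
have lt : (i < n)%N by rewrite /i; lia.
rewrite iE in annS.
have [hS0 S01 S0M] := pS 0%N (leq0n k).
have hWi := submodule_Wx x i hW.
(* An ideal containing [ann i] and maximal among those disjoint from the multiplicative set [T] is
   prime. It lies in S_0, since [T] contains the complement of S_0, and strictly so, since it misses
   x_i. *)
pose T : set A := [set t | exists e s, ~ S 0%N s /\ t = x i ^+ e * s].
have TM t t' : T t -> T t' -> T (t * t').
  move=> [e [s [ns ->]]] [e' [s' [ns' ->]]]; exists (e + e')%N, (s * s'); split.
    by move=> /S0M[].
  by rewrite exprD; ring.
pose F := [set J : set A^o | [/\ submodule J, ann i `<=` J & forall t, J t -> ~ T t]].
have annT t : ann i t -> ~ T t.
  move=> at_ [e [s [ns tE]]]; apply: ns; apply: annS => v.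
  apply: (Wx_leq (x := x) hW (leqnSn i)).
  have := at_ v; rewrite tE; elim: e {tE} => [|e IHe]; first by rewrite mul1r.
  by rewrite exprS -mulrA -scalerA => /(xr i _ lt).
have [| |P0 [[hP0 annP0 P0T] mx0]] := @noeth_max _ _ (noeth_self hA) F (ann i).
- by move=> J [].
- by split.
have T1 : T 1 by exists 0%N, 1; rewrite mulr1.
have notin a : ~ P0 a -> exists2 t, T t & exists p b, P0 p /\ t = p + b * a.
  move=> nPa; apply: contrapT => no.
  pose P1 : set A^o := addS P0 (scS a setT).
  have hP1 : submodule P1 by apply: submodule_addS => //; apply: submodule_scS; exact: submoduleT.
  have P01 : P0 `<=` P1 by apply: addSl; apply: submodule_scS; exact: submoduleT.
  apply: nPa; apply: (mx0 P1) => //; last first.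
    by apply: addSr => //; exists 1 => //; rewrite /GRing.scale /= mulr1.
  split=> //; first by move=> z /annP0 /P01.
  move=> t [p [_ [Pp [b _ ->] tE]]] Tt; apply: no; exists t => //; exists p, b; split=> //.
  by rewrite tE /GRing.scale /= mulrC.
have pP0 : prime_ideal P0.
  split=> // [/P0T //|a b Pab]; have [Pa|/notin[t Tt [p [c [Pp tE]]]]] := pselect (P0 a); first by left.
  have [Pb|/notin[t' Tt' [p' [c' [Pp' tE']]]]] := pselect (P0 b); [by right|exfalso].
  apply: (P0T (t * t')); last exact: TM.
  have -> : t * t' = t' * p + (c * a) * p' + (c * c') * (a * b) by rewrite tE tE'; ring.
  by apply: (subD hP0); [apply: (subD hP0)|]; exact: (subZ _ hP0).
exists (fun j => if j is j'.+1 then S j' else P0); split=> //.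
- by case=> // j; exact: pS.
- case=> [_|j]; last exact: ltS.
  split=> [a Pa|h].
    by apply: contrapT => na; apply: (P0T a Pa); exists 0%N, a; rewrite mul1r.
  have : P0 (x i) by apply: h; apply: annS => v; exact: (Wx_in _ v hW (ltnSn i)).
  by move/P0T; apply; exists 1%N, 1; rewrite mulr1 expr1.
Qed.

End Module.
End Depth.

(** * Completion *)

Definition mxin (A : comNzRingType) (I : set A) p q (X : 'M[A]_(p, q)) :=
  forall i j, I (X i j).

Section MxIn.
Variables (A : comNzRingType) (I : set A) (hI : ideal I).

Lemma mxin0 p q : mxin I (0 : 'M[A]_(p, q)).
Proof. by move=> i j; rewrite mxE; exact: (sub0 hI). Qed.

Lemma mxinD p q (X Y : 'M[A]_(p, q)) : mxin I X -> mxin I Y -> mxin I (X + Y).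
Proof. by move=> hX hY i j; rewrite mxE; exact: (subD hI). Qed.

Lemma mxinN p q (X : 'M[A]_(p, q)) : mxin I X -> mxin I (- X).
Proof. by move=> hX i j; rewrite mxE; exact: (subN hI). Qed.

Lemma mxinB p q (X Y : 'M[A]_(p, q)) : mxin I X -> mxin I Y -> mxin I (X - Y).
Proof. by move=> hX hY; apply: mxinD => //; exact: mxinN. Qed.

Lemma mxinMl p q s (X : 'M[A]_(p, q)) (Y : 'M[A]_(q, s)) : mxin I Y -> mxin I (X *m Y).
Proof.
by move=> hY i j; rewrite mxE; apply: (sub_sum _ hI) => k _; exact: (subZ _ hI).
Qed.

Lemma mxinMr p q s (X : 'M[A]_(p, q)) (Y : 'M[A]_(q, s)) : mxin I X -> mxin I (X *m Y).
Proof.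
move=> hX i j; rewrite mxE; apply: (sub_sum _ hI) => k _.
by rewrite mulrC; exact: (subZ _ hI).
Qed.

Lemma mxinZ p q c (X : 'M[A]_(p, q)) : I c -> mxin I (c *: X).
Proof. by move=> hc i j; rewrite mxE mulrC; exact: (subZ _ hI). Qed.

Lemma mxinZr p q c (X : 'M[A]_(p, q)) : mxin I X -> mxin I (c *: X).
Proof. by move=> hX i j; rewrite mxE; exact: (subZ _ hI). Qed.

Lemma mxinT p q (X : 'M[A]_(p, q)) : mxin I X -> mxin I X^T.
Proof. by move=> hX i j; rewrite mxE. Qed.

Lemma mxin_sum p q (T : Type) (s : seq T) (P : pred T) (F : T -> 'M[A]_(p, q)) :
  (forall k, P k -> mxin I (F k)) -> mxin I (\sum_(k <- s | P k) F k).
Proof.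
move=> h; elim/big_rec: _ => [|k x Pk hx]; first exact: mxin0.
by apply: mxinD => //; exact: h.
Qed.

Lemma mxin_addr p q (X Y : 'M[A]_(p, q)) : mxin I (X - Y) -> mxin I Y -> mxin I X.
Proof. by move=> h hY; rewrite -(subrK Y X); exact: mxinD. Qed.

Lemma mxin_subC p q (X Y : 'M[A]_(p, q)) : mxin I (X - Y) -> mxin I (Y - X).
Proof. by move=> h; rewrite -opprB; exact: mxinN. Qed.

Lemma mxin_trans p q (X Y Z : 'M[A]_(p, q)) : mxin I (X - Y) -> mxin I (Y - Z) -> mxin I (X - Z).
Proof. by move=> h h'; rewrite -(subrK Y X) -addrA; exact: mxinD. Qed.

End MxIn.

Lemma mxin_sub (A : comNzRingType) (I J : set A) p q (X : 'M[A]_(p, q)) :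
  I `<=` J -> mxin I X -> mxin J X.
Proof. by move=> h hX i j; exact: h. Qed.

Lemma mxin_mul (A : comNzRingType) (I J K : set A) p q s (X : 'M[A]_(p, q)) (Y : 'M[A]_(q, s)) :
  ideal K -> (forall x y, I x -> J y -> K (x * y)) -> mxin I X -> mxin J Y -> mxin K (X *m Y).
Proof.
by move=> hK h hX hY i j; rewrite mxE; apply: (sub_sum _ hK) => k _; exact: h.
Qed.

Lemma mx_rows (A : comNzRingType) p q s (X : 'M[A]_(p, q)) (D : 'M[A]_(s, q)) :
  (forall i, exists v, row i X = v *m D) -> exists Y, X = Y *m D.
Proof.
move=> /choice[f fP]; exists (\matrix_i f i).
by apply/row_matrixP => i; rewrite row_mul rowK fP.
Qed.

Lemma mx_rows_in (A : comNzRingType) (I J : set A) p q s (X : 'M[A]_(p, q)) (D : 'M[A]_(s, q)) :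
  (forall i, exists2 v, mxin J v & mxin I (row i X - v *m D)) ->
  exists2 Y, mxin J Y & mxin I (X - Y *m D).
Proof.
move=> h; have /choice[f fP] i : exists v, mxin J v /\ mxin I (row i X - v *m D).
  by have [v h1 h2] := h i; exists v.
exists (\matrix_i f i).
  by move=> i j; rewrite mxE; have [hJ _] := fP i; exact: hJ.
move=> i j; have [_ hI] := fP i.
have := hI 0 j; rewrite !mxE; congr (I (_ - _)); apply: eq_bigr => k _.
by rewrite mxE.
Qed.

Lemma fil_linear (A : comNzRingType) (M M' : lmodType A) (f : {linear M -> M'}) a r n x :
  fil a r n x -> fil a r n (f x).
Proof.
elim: n x => // n IH x [v [Fv ->]]; exists (f \o v); split; first by move=> i; exact: (IH _ (Fv i)).
by rewrite linear_sum; apply: eq_bigr => i _; rewrite linearZ.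
Qed.

Section Rows.
Variables (A : comNzRingType) (m : set A).
Hypotheses (hA : noetherian A) (hm : local_ring m).

Lemma ideal_pow_ideal n : ideal (ideal_pow m n).
Proof.
by have [a [r hg]] := gens_exists hA (m_ideal hm); rewrite (ideal_powE hg); exact: submodule_fil.
Qed.

Lemma ideal_pow_leq k n : (k <= n)%N -> ideal_pow m n `<=` ideal_pow m k.
Proof.
have [a [r hg]] := gens_exists hA (m_ideal hm).
by rewrite !(ideal_powE hg); exact: (@fil_leq A A^o a r k n).
Qed.

Lemma ideal_pow1 : ideal_pow m 1 = m.
Proof.
by have [a [r hg]] := gens_exists hA (m_ideal hm); rewrite (ideal_powE hg); exact: fil1.
Qed.

Lemma ideal_powM n x y : m x -> ideal_pow m n y -> ideal_pow m n.+1 (x * y).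
Proof. by move=> mx ny; exact: (smul_in (M := A^o)). Qed.

Lemma fil_rV a r q n (x : 'rV[A]_q) : gens m a r ->
  fil a r n x <-> mxin (ideal_pow m n) x.
Proof.
move=> hg; rewrite (ideal_powE hg); split.
  elim: n x => [|n IH] x; first by [].
  move=> [v [Fv ->]] i j; rewrite summxE; exists (fun k => v k i j); split.
    by move=> k; exact: (IH _ (Fv k) i j).
  by apply: eq_bigr => k _; rewrite mxE.
move=> hx; rewrite [x]row_sum_delta; apply: sub_sum => [|j _]; first exact: submodule_fil.
have lin c (y z : A^o) : (c *: y + z : A) *: delta_mx 0 j = c *: ((y : A) *: delta_mx 0 j)
    + (z : A) *: delta_mx 0 j :> 'rV[A]_q by rewrite scalerDl scalerA.
exact: (fil_linear (mklin lin) (hx 0 j)).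
Qed.

Lemma artin_rees_mx p q (D : 'M[A]_(p, q)) : exists k, forall n (u : 'rV[A]_p),
  mxin (ideal_pow m (n + k)) (u *m D) ->
  exists2 u', mxin (ideal_pow m n) u' & u' *m D = u *m D.
Proof.
have [a [r hg]] := gens_exists hA (m_ideal hm).
pose U : set 'rV[A]_q := [set x | exists u, x = u *m D].
have hU : submodule U.
  split; first by exists 0; rewrite mul0mx.
  by move=> c _ _ [u ->] [v ->]; exists (c *: u + v); rewrite mulmxDl scalemxAl.
have [|k ar] := artin_rees (@noeth_rV A q hA) a r (@submodule_zero _ _) hU.
  by move=> _ ->; exact: sub0.
exists k => n u /(fil_rV _ _ hg) Fu.
have [|z [y [-> Fy E]]] := ar n (u *m D).
  by split; [exists u|apply: addSr => //; exact: submodule_zero].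
suff [u' Fu' yE] : exists2 u', fil a r n u' & y = u' *m D.
  by exists u'; [apply/(fil_rV _ _ hg)|rewrite E yE add0r].
elim: n y Fy {Fu E} => [|n IH] y; first by move=> [u' ->]; exists u'.
move=> [v [Fv ->]]; have /choice[w wP] i : exists w, fil a r n w /\ v i = w *m D.
  by have [w ? ?] := IH _ (Fv i); exists w.
exists (\sum_(i < r) a i *: w i); first by exists w; split=> // i; have [] := wP i.
by rewrite mulmx_suml; apply: eq_bigr => i _; have [_ ->] := wP i; rewrite scalemxAl.
Qed.

Lemma krull_mx p q (D : 'M[A]_(p, q)) (v : 'rV[A]_q) :
  (forall n, exists w, mxin (ideal_pow m n) (v - w *m D)) -> exists w, v = w *m D.
Proof.
have [a [r hg]] := gens_exists hA (m_ideal hm); move=> h.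
pose U : set 'rV[A]_q := [set x | exists u, x = u *m D].
have hU : submodule U.
  split; first by exists 0; rewrite mul0mx.
  by move=> c _ _ [u ->] [v' ->]; exists (c *: u + v'); rewrite mulmxDl scalemxAl.
apply: (@krull A m hm _ U a r (@noeth_rV A q hA) hU hg.1 v) => n.
have [w /(fil_rV _ _ hg) Fw] := h n; exists (w *m D), (v - w *m D); split=> //; first by exists w.
by rewrite addrC subrK.
Qed.

End Rows.

(** * Faithful flatness of the completion *)

Section Completion.
Variables (A : comNzRingType) (m : set A) (B : comNzRingType).
Hypotheses (hA : noetherian A) (hm : local_ring m).
Variable t : B -> nat -> A.
Hypotheses (t1 : forall n, ideal_pow m n (t 1 n - 1))
  (tDM : forall b c n, ideal_pow m n (t (b + c) n - (t b n + t c n)) /\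
                      ideal_pow m n (t (b * c) n - t b n * t c n))
  (tS : forall b n, ideal_pow m n (t b n.+1 - t b n))
  (t_inj : forall b, (forall n, ideal_pow m n (t b n)) -> b = 0)
  (t_surj : forall a : nat -> A, (forall n, ideal_pow m n (a n.+1 - a n)) ->
          exists b, forall n, ideal_pow m n (t b n - a n)).

Let hI n : ideal (ideal_pow m n) := ideal_pow_ideal hA hm n.
Local Notation "x == y %[ n ]" := (ideal_pow m n (x - y)) (at level 70, n at level 10).

Let refl n x : x == x %[n]. Proof. by rewrite subrr; exact: (sub0 (hI n)). Qed.
Let sym n x y : x == y %[n] -> y == x %[n]. Proof. by move=> h; exact: (subBC (hI n)). Qed.
Let trans n x y z : x == y %[n] -> y == z %[n] -> x == z %[n].
Proof. by move=> h h'; rewrite -(subrK y x) -addrA; exact: (subD (hI n)). Qed.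
Let congrD n x y x' y' : x == y %[n] -> x' == y' %[n] -> x + x' == y + y' %[n].
Proof. by move=> h h'; rewrite opprD addrACA; exact: (subD (hI n)). Qed.
Let congrN n x y : x == y %[n] -> - x == - y %[n].
Proof. by move=> h; rewrite opprK addrC; exact: sym. Qed.
Let congrM n x y x' y' : x == y %[n] -> x' == y' %[n] -> x * x' == y * y' %[n].
Proof.
move=> h h'; have -> : x * x' - y * y' = x' * (x - y) + y * (x' - y') by ring.
by apply: (subD (hI n)); exact: (subZ _ (hI n)).
Qed.

Let t0 n : t 0 n == 0 %[n].
Proof.
have [h _] := tDM 0 0 n; rewrite addr0 in h; rewrite subr0.
by have := subN (hI n) h; rewrite opprB addrK.
Qed.
Let tN b n : t (- b) n == - t b n %[n].
Proof.
have [h _] := tDM b (- b) n; rewrite subrr in h.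
have := subB (hI n) (t0 n) h; rewrite subr0 opprB addrC addrNK opprK addrC //.
Qed.
Let tB b c n : t (b - c) n == t b n - t c n %[n].
Proof. by have [h _] := tDM b (- c) n; apply: trans h _; apply: congrD => //; exact: tN. Qed.
Let tM b c n : t (b * c) n == t b n * t c n %[n]. Proof. by have [] := tDM b c n. Qed.

Let t_eq b c : (forall n, t b n == t c n %[n]) -> b = c.
Proof.
move=> h; apply/subr0_eq/t_inj => n; rewrite -[t _ n]subr0.
by apply: trans (tB b c n) _; rewrite subr0; exact: h.
Qed.

Let phi_ex a : exists b, forall n, t b n == a %[n].
Proof. by apply: (t_surj (a := fun=> a)) => n; rewrite subrr; exact: (sub0 (hI n)). Qed.

(** The definition of a completion provides no map A -> B: the image of a is the element all of
    whose truncations are congruent to a. *)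
Definition phi_fun (a : A) : B := projT1 (cid (phi_ex a)).
Let phi_funP a n : t (phi_fun a) n == a %[n].
Proof. exact: (projT2 (cid (phi_ex a))). Qed.

Let phiB x y : phi_fun (x - y) = phi_fun x - phi_fun y.
Proof.
apply: t_eq => n; apply: trans (phi_funP _ n) _; apply: sym; apply: trans (tB _ _ n) _.
by apply: congrD; [|apply: congrN]; exact: phi_funP.
Qed.
Let phi1 : phi_fun 1 = 1.
Proof. by apply: t_eq => n; apply: trans (phi_funP _ n) _; apply: sym; exact: t1. Qed.
Let phiM x y : phi_fun (x * y) = phi_fun x * phi_fun y.
Proof.
apply: t_eq => n; apply: trans (phi_funP _ n) _; apply: sym; apply: trans (tM _ _ n) _.
by apply: congrM; exact: phi_funP.
Qed.

Definition phi : {rmorphism A -> B} := HB.pack phi_fun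
  (GRing.isZmodMorphism.Build A B phi_fun phiB)
  (GRing.isMonoidMorphism.Build A B phi_fun (phi1, phiM)).

Lemma t_phi a n : t (phi a) n == a %[n]. Proof. exact: phi_funP. Qed.

Definition tm p q (X : 'M[B]_(p, q)) n : 'M[A]_(p, q) := map_mx (t^~ n) X.

Let t_sum (I : Type) (s : seq I) (F : I -> B) (G : I -> A) n :
  (forall i, t (F i) n == G i %[n]) -> t (\sum_(i <- s) F i) n == \sum_(i <- s) G i %[n].
Proof.
move=> h; elim: s => [|i s IH]; first by rewrite !big_nil; exact: t0.
rewrite !big_cons; have [h' _] := tDM (F i) (\sum_(j <- s) F j) n.
by apply: trans h' _; exact: congrD.
Qed.

Lemma tm_mul p q s (X : 'M[B]_(p, q)) (D : 'M[A]_(q, s)) n :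
  mxin (ideal_pow m n) (tm (X *m map_mx phi D) n - tm X n *m D).
Proof.
move=> i j; rewrite !mxE; apply: t_sum => k; rewrite mxE; apply: trans (tM _ _ n) _.
by rewrite mxE; apply: congrM => //; exact: t_phi.
Qed.

Lemma tm_eq p q (X Y : 'M[B]_(p, q)) :
  (forall n, mxin (ideal_pow m n) (tm X n - tm Y n)) -> X = Y.
Proof.
move=> h; apply/matrixP => i j; apply: t_eq => n; have := h n i j; by rewrite !mxE.
Qed.

Let tm_leq p q (X : 'M[B]_(p, q)) n k : mxin (ideal_pow m n) (tm X (n + k) - tm X n).
Proof.
elim: k => [|k IH]; first by rewrite addn0 subrr; exact: mxin0.
apply: (mxin_trans (hI n)) IH => i j; rewrite addnS !mxE.
exact: (ideal_pow_leq hA hm (leq_addr k n)).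
Qed.

Lemma tm_lim p (s : nat -> 'rV[A]_p) : (forall n, mxin (ideal_pow m n) (s n.+1 - s n)) ->
  exists v : 'rV[B]_p, forall n, mxin (ideal_pow m n) (tm v n - s n).
Proof.
move=> h; have /choice[f fP] j : exists b, forall n, ideal_pow m n (t b n - s n 0 j).
  by apply: (t_surj (a := fun n => s n 0 j)) => n; have := h n 0 j; rewrite !mxE.
by exists (\row_j f j) => n i j; rewrite !mxE ord1; exact: fP.
Qed.

(* The image of a matrix over A is m-adically complete after tensoring with B. *)
Lemma completion_closed p q (D : 'M[A]_(p, q)) (u : 'rV[B]_q) :
  (forall n, exists w, mxin (ideal_pow m n) (tm u n - w *m D)) ->
  exists v, u = v *m map_mx phi D.
Proof.
move=> /choice[w wP]; pose z n := w n *m D.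
have zS n : mxin (ideal_pow m n) (z n.+1 - z n).
  apply: (mxin_trans (hI n) (Y := tm u n.+1)).
    apply: (mxin_subC (hI n)); apply: mxin_sub (wP n.+1).
    exact: (ideal_pow_leq hA hm (leqnSn n)).
  apply: (mxin_trans (hI n)) (wP n); have := tm_leq u n 1; by rewrite addn1.
have zk n k : mxin (ideal_pow m n) (z n - z (n + k)%N).
  elim: k => [|k IH]; first by rewrite addn0 subrr; exact: mxin0.
  apply: (mxin_trans (hI n)) IH _; rewrite addnS; apply: (mxin_subC (hI n)).
  by apply: mxin_sub (zS _); exact: (ideal_pow_leq hA hm (leq_addr k n)).
have [k ar] := artin_rees_mx hA hm D.
have /choice[y yP] n : exists y, mxin (ideal_pow m n) y /\ y *m D = z (n + k).+1 - z (n + k)%N.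
  have [|y y1 y2] := ar n (w (n + k).+1 - w (n + k)%N); first by rewrite mulmxBl; exact: zS.
  by exists y; split=> //; rewrite y2 mulmxBl.
pose s n := w k + \sum_(j < n) y j.
have sz n : s n *m D = z (n + k)%N.
  elim: n => [|n IH]; first by rewrite /s big_ord0 addr0.
  rewrite /s big_ord_recr /= addrA mulmxDl IH; have [_ ->] := yP n.
  by rewrite addrC subrK.
have [|v vP] := @tm_lim p s.
  by move=> n; rewrite /s big_ord_recr /= addrA [X in X - _]addrC addrK; have [] := yP n.
exists v; apply: tm_eq => n.
apply: (mxin_trans (hI n) (wP n)); apply: (mxin_trans (hI n) (zk n k)).
rewrite -sz; apply: (mxin_trans (hI n) (Y := tm v n *m D)).
  by rewrite -mulmxBl; apply: (mxinMr (hI n)); apply: (mxin_subC (hI n)); exact: vP.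
by apply: (mxin_subC (hI n)); exact: tm_mul.
Qed.

(** The truncations of [w] solve v = w D modulo every m^n, and Krull's theorem turns this into a
    solution over A. *)
Lemma completion_reflect p q (D : 'M[A]_(p, q)) (v : 'rV[A]_q) (w : 'rV[B]_p) :
  map_mx phi v = w *m map_mx phi D -> exists w', v = w' *m D.
Proof.
move=> E; apply: (krull_mx hA hm) => n; exists (tm w n).
apply: (mxin_trans (hI n)) (tm_mul w D n); rewrite -E => i j; rewrite !mxE.
by apply: sym; exact: t_phi.
Qed.

(** The truncations of [u] solve u D2 = 0 up to high powers of m. By the Artin-Rees lemma small
    changes make them exact solutions, which come from [D1], and the image of [D1] is closed. *)
Lemma completion_flat p q s (D1 : 'M[A]_(p, q)) (D2 : 'M[A]_(q, s)) :
  (forall u : 'rV_q, u *m D2 = 0 -> exists v, u = v *m D1) ->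
  forall u : 'rV[B]_q, u *m map_mx phi D2 = 0 -> exists v, u = v *m map_mx phi D1.
Proof.
move=> ex u uD; apply: completion_closed => n.
have [k ar] := artin_rees_mx hA hm D2.
have uD2 i : mxin (ideal_pow m i) (tm u i *m D2).
  have := mxin_subC (hI i) (tm_mul u D2 i); rewrite uD => h.
  apply: (mxin_addr (hI i)) h _ => j l; rewrite !mxE; have := t0 i; by rewrite subr0.
have [y my yD] := ar n (tm u (n + k)) (uD2 _).
have [w wE] : exists w, tm u (n + k) - y = w *m D1.
  by apply: ex; rewrite mulmxBl yD subrr.
exists w; rewrite -wE; have E : tm u n - (tm u (n + k) - y) = y - (tm u (n + k) - tm u n).
  by rewrite !opprB addrCA addrA.
by rewrite E; apply: (mxinB (hI n)) => //; exact: tm_leq.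
Qed.

(** * The completion as a quotient of Q: residue field and lengths *)

Section Quotient.
Variables (Q : comNzRingType) (mQ : set Q) (hQ : noetherian Q) (hmQ : local_ring mQ).
Variable (g : {rmorphism Q -> B}) (g_surj : forall b, exists q, g q = b).

Let ideal1 : ideal_pow m 1 = m := ideal_pow1 hA hm.

Let t_level b n : (0 < n)%N -> m (t b n) <-> m (t b 1).
Proof.
move=> n0; have : m (t b n - t b 1).
  rewrite -ideal1; case: n n0 => // n _.
  elim: n => [|n IH]; first by rewrite subrr; exact: (sub0 (hI 1)).
  apply: (trans (y := t b n.+1)) => //; exact: (ideal_pow_leq hA hm (ltn0Sn n)).
move=> h; split=> h'.
  by rewrite -(subKr (t b n) (t b 1)) ; exact: (mB hm).
by rewrite -(subrK (t b 1) (t b n)); exact: (mD hm).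
Qed.

(** The preimage of m in Q is a proper ideal, so it lies in [mQ]. Conversely, an element of [mQ]
    with image outside m would be invertible modulo that preimage, hence modulo [mQ]. *)
Lemma residue q : m (t (g q) 1) <-> mQ q.
Proof.
have cm n x y : x == y %[n.+1] -> m (x - y).
  by move=> h; rewrite -ideal1; exact: (ideal_pow_leq hA hm (ltn0Sn n)).
have eqm x y : m (x - y) -> m y -> m x by move=> h my; rewrite -(subrK y x); exact: (mD hm).
have sub : [set q | m (t (g q) 1)] `<=` mQ.
  apply: (proper_sub_m hmQ); last first.
    move=> /= h; apply: (m1 hm); apply: (eqm _ _ _ h); apply: (cm 0%N); rewrite rmorph1; exact: sym.
  split=> [|a x y]; rewrite /= ?rmorph0.
    by apply: (eqm _ 0); [exact: (cm 0%N)|exact: (m0 hm)].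
  move=> mx my; apply: (eqm _ (t (g a) 1 * t (g x) 1 + t (g y) 1)).
    apply: (cm 0%N); rewrite rmorphD rmorphM /=; have [h _] := tDM (g a * g x) (g y) 1.
    by apply: trans h _; apply: congrD => //; exact: tM.
  by apply: (mD hm) => //; exact: (mMl hm).
split; first exact: sub.
move=> mq; apply: contrapT => nm; have [b tb] := local_unit hm nm.
have [q' gq'] := g_surj (phi b).
have : mQ (q * q' - 1).
  apply: sub => /=; apply: (eqm _ (t (g q) 1 * t (g q') 1 - 1)).
    apply: (cm 0%N); rewrite rmorphB rmorphM rmorph1; apply: trans (tB _ _ 1) _.
    by apply: congrD; [exact: tM|apply: congrN; exact: t1].
  apply: (cm 0%N); rewrite -tb gq'; apply: congrM => //; exact: t_phi.
move=> h; apply: (m1 hmQ); rewrite -(subKr (q * q') 1).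
by apply: (mB hmQ) => //; exact: (mMr hmQ).
Qed.

Lemma residue_approx q : exists a q', g q' = phi a /\ mQ (q - q').
Proof.
have [q' gq'] := g_surj (phi (t (g q) 1)).
exists (t (g q) 1), q'; split=> //; apply/residue; rewrite rmorphB gq'.
set a := t (g q) 1; have h1 := tB (g q) (phi a) 1; have h2 := sym (t_phi a 1).
rewrite ideal1 in h1 h2; rewrite -(subrK (a - t (phi a) 1) (t _ 1)); exact: (mD hm).
Qed.

Lemma residue_phi a q : g q = phi a -> (mQ q <-> m a).
Proof.
move=> gq; rewrite -residue gq; have h := t_phi a 1; rewrite ideal1 in h.
split=> ma; first by rewrite -(subKr (t (phi a) 1) a); exact: (mB hm).
by rewrite -(subrK a (t (phi a) 1)); exact: (mD hm).
Qed.

(** All truncations of g q lie in the ideal m generated by the y_i, and the ideal that the y_i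
    generate in B is closed. *)
Lemma residue_gens s (y : nat -> A) q : gens m y s -> mQ q ->
  exists b : nat -> B, g q = \sum_(i < s) b i * phi (y i).
Proof.
move=> hg /residue mq.
pose D : 'M[A]_(s, 1) := \matrix_(i, j) y i.
have [n|v vE] := @completion_closed _ _ D ((g q)%:M).
  case: n => [|n]; first by exists 0 => i j.
  have /(hg.2) [c cE] : m (t (g q) n.+1) by apply/t_level.
  exists (\row_i c i) => i j; rewrite !mxE !ord1 eqxx mulr1n cE.
  rewrite (_ : \sum_(j0 < s) _ = \sum_(i < s) c i * y i) ?subrr; first exact: (sub0 (hI _)).
  by apply: eq_bigr => k _; rewrite !mxE.
exists (fun i => if insub i is Some k then v 0 k else 0).
have := congr1 (fun X : 'M_1 => X 0 0) vE; rewrite !mxE eqxx mulr1n => ->.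
by apply: eq_bigr => i _; rewrite !mxE valK.
Qed.

(* The truncations t _ n turn chains of ideals of A above m ^ n into chains of ideals of Q. *)
Lemma completion_length (J : set Q^o) n k : submodule J -> (forall q, J q -> g q = 0) ->
  (0 < n)%N ->
  lenle (addS J (ideal_pow mQ n : set Q^o)) setT k ->
  lenle (ideal_pow m n : set A^o) setT k.
Proof.
move=> hJ Jg n0.
have stable (U : set A^o) x y : submodule U -> ideal_pow m n `<=` U -> x == y %[n] -> U y -> U x.
  by move=> hU mU xy Uy; rewrite -(subrK y x); apply: (subD hU) => //; exact: mU.
have powt : forall j q, (j <= n)%N -> ideal_pow mQ j q -> ideal_pow m j (t (g q) n).
  move=> j q jn; have hJn j' (jn' : (j' <= n)%N) : submodule ([set q | ideal_pow m j' (t (g q) n)] : set Q^o).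
    have st x y : x == y %[n] -> ideal_pow m j' y -> ideal_pow m j' x.
      move=> xy Uy; rewrite -(subrK y x); apply: (subD (hI j')) => //.
      exact: (ideal_pow_leq hA hm jn').
    split=> [|a x y]; rewrite /= ?rmorph0; first by apply: (st _ 0) => //; exact: (sub0 (hI j')).
    move=> hx hy; apply: (st _ (t (g a) n * t (g x) n + t (g y) n)).
      rewrite rmorphD rmorphM /=; have [h _] := tDM (g a * g x) (g y) n.
      by apply: trans h _; apply: congrD => //; exact: tM.
    by apply: (subD (hI j')) => //; exact: (subZ _ (hI j')).
  elim: j jn q => [|j IH] jn q; first by [].
  apply: (smul_min (hJn _ jn)) => a x ma hx /=.
  have mt : m (t (g a) n) by apply/(t_level _ n0)/residue.
  rewrite -(subrK (t (g a) n * t (g x) n) (t _ n)); apply: (subD (hI j.+1)).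
    by apply: (ideal_pow_leq hA hm jn); rewrite rmorphM; exact: tM.
  by apply: (ideal_powM mt); exact: (IH (ltnW jn)).
apply: (@lenle_embed A Q A^o Q^o (ideal_pow m n) setT _ setT
  (fun U => [set q | U (t (g q) n)]) k) => //.
- exact: (hI n).
- move=> U [hU mU _]; split=> //.
    split=> [|a x y]; rewrite /= ?rmorph0; first by apply: (stable _ _ 0 hU mU) => //; exact: (sub0 hU).
    move=> hx hy; apply: (stable _ _ (t (g a) n * t (g x) n + t (g y) n) hU mU).
      rewrite rmorphD rmorphM /=; have [h _] := tDM (g a * g x) (g y) n.
      by apply: trans h _; apply: congrD => //; exact: tM.
    by apply: (subD hU) => //; exact: (subZ _ hU).
  move=> _ [j [f [Jj Ff ->]]] /=; rewrite rmorphD (Jg j Jj) add0r; apply: mU.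
  exact: powt.
- by move=> U V _ _ UV q; exact: UV.
- move=> U V [hU mU _] [hV mV _] h x Ux; have [q gq] := g_surj (phi x).
  have tx := t_phi x n; rewrite -gq in tx.
  apply: (stable _ _ _ hV mV (sym tx)); apply: h => /=.
  exact: (stable _ _ _ hU mU tx).
Qed.

End Quotient.
End Completion.

(** * Complete intersections *)

Lemma smul_seq (A : comNzRingType) (M : lmodType A) (xs : seq A) i : (i <= size xs)%N ->
  smul [set` take i xs] (setT : set M) = Wx [set 0] (nth 0 xs) i.
Proof.
move=> ile; apply/seteqP; split.
  apply: smul_min => [|a v /(nthP 0) [j]]; first by apply: submodule_Wx; exact: submodule_zero.
  rewrite size_takel // => ji <- _; rewrite nth_take //.
  by apply: Wx_in => //; exact: submodule_zero.
apply: Wx_min => [|_ ->|j v ji]; first exact: submodule_smulT.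
  by apply: sub0; exact: submodule_smulT.
apply: smul_in => //=; apply/(nthP 0); exists j; last by rewrite nth_take.
by rewrite size_takel.
Qed.

Lemma sub_rowspace (A : comNzRingType) q (U : set 'rV[A]_q) : noetherian A -> submodule U ->
  exists p (D : 'M[A]_(p, q)), forall u, U u <-> exists v, u = v *m D.
Proof.
move=> hA hU; have [p [g [Ug UE]]] := noeth_fg (@noeth_rV A q hA) hU.
exists p, (\matrix_(i < p) g i) => u; rewrite {1}UE; split=> [[c ->]|[v ->]].
  exists (\row_i c i); rewrite mulmx_sum_row; apply: eq_bigr => i _.
  by rewrite mxE rowK.
rewrite mulmx_sum_row; apply: sub_sum => [|i _]; first exact: submodule_span.
by rewrite rowK; apply: subZ; [exact: submodule_span|exact: span_in].
Qed.

Lemma submodule_kermx (A : comNzRingType) q s (D : 'M[A]_(q, s)) :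
  submodule ([set u | u *m D = 0] : set 'rV[A]_q).
Proof.
split=> [|c x y /= hx hy]; first by rewrite /= mul0mx.
by rewrite mulmxDl -scalemxAl hx hy scaler0 addr0.
Qed.

Lemma ker_fg (A : comNzRingType) q s (D : 'M[A]_(q, s)) : noetherian A ->
  exists p (D' : 'M[A]_(p, q)), forall u : 'rV_q, u *m D = 0 <-> exists v, u = v *m D'.
Proof. by move=> hA; exact: (sub_rowspace hA (submodule_kermx D)). Qed.

Lemma gens_ideal_gen (A : comNzRingType) (xs : seq A) :
  gens (ideal_gen xs) (nth 0 xs) (size xs).
Proof.
have E : ideal_gen xs = Wx [set 0] (nth 0 xs) (size xs) :> set A^o.
  by rewrite -smul_seq // take_size.
split=> [i|x].
  have [lt|le] := ltnP i (size xs); rewrite E.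
    have := @Wx_in _ A^o [set 0] (nth 0 xs) (size xs) i 1 (@submodule_zero _ _) lt.
    by rewrite /GRing.scale /= mulr1.
  by rewrite nth_default //; apply: (sub0 (@submodule_Wx _ A^o _ _ _ (@submodule_zero _ _))).
rewrite E => /WxP[_ [u [-> ->]]]; exists u; rewrite add0r.
by apply: eq_bigr => i _; rewrite /GRing.scale /= mulrC.
Qed.

(** * Regular sequences under faithfully flat maps *)

Section Transfer.
Variables (A B : comNzRingType) (phi : {rmorphism A -> B}) (hA : noetherian A).
Hypothesis flat : forall p q s (D1 : 'M[A]_(p, q)) (D2 : 'M[A]_(q, s)),
  (forall u : 'rV_q, u *m D2 = 0 -> exists v, u = v *m D1) ->
  forall u : 'rV[B]_q, u *m map_mx phi D2 = 0 -> exists v, u = v *m map_mx phi D1.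
Hypothesis reflect : forall p q (D : 'M[A]_(p, q)) (v : 'rV[A]_q) (w : 'rV[B]_p),
  map_mx phi v = w *m map_mx phi D -> exists w', v = w' *m D.
Variable x : nat -> A.

Let WA i : set A^o := Wx [set 0] x i.
Let WB i : set B^o := Wx [set 0] (phi \o x) i.

Lemma Wx_phi i a : WA i a -> WB i (phi a).
Proof.
move=> /WxP [_ [u [-> ->]]]; apply/WxP; exists 0, (phi \o u); split=> //.
by rewrite !add0r rmorph_sum; apply: eq_bigr => j _; rewrite /GRing.scale /= rmorphM.
Qed.

Lemma Wx_reflect i a : WB i (phi a) -> WA i a.
Proof.
move=> /WxP [_ [u [-> E]]].
have [|w wE] := @reflect i 1 (\col_j x j) a%:M (\row_j u j).
  rewrite map_scalar_mx E; apply/matrixP => j k; rewrite !ord1 !mxE eqxx mulr1n add0r.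
  by apply: eq_bigr => l _; rewrite !mxE /GRing.scale /= mulrC.
apply/WxP; exists 0, (fun j => if insub j is Some k then w 0 k else 0); split=> //.
have := congr1 (fun X : 'M_1 => X 0 0) wE; rewrite !mxE eqxx mulr1n add0r => ->.
by apply: eq_bigr => j _; rewrite !mxE valK /GRing.scale /= mulrC.
Qed.

(** A relation b x_i = sum_j u_j x_j over B is a row in the kernel of the column (x_i, x_0, ...,
    x_(i-1)). It is a combination of such rows over A, whose first entries lie in (x_0, ...,
    x_(i-1)). *)
Lemma reg_flat n : reg ([set 0%R] : set A^o) x n -> reg ([set 0%R] : set B^o) (phi \o x) n.
Proof.
move=> xr i b lt /WxP [_ [u [-> E]]].
pose D2 : 'M[A]_(1 + i, 1) := col_mx (x i)%:M (\col_j x j).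
have [p [D1 D1P]] := ker_fg D2 hA.
have row0 (w : 'rV[A]_(1 + i)) : w *m D2 = 0 -> WA i (w 0 (lshift i 0)).
  move=> wD; apply: xr => //; apply/WxP.
  exists 0, (fun j => if insub j is Some k then - w 0 (rshift 1 k) else 0); split=> //.
  move: wD => /(congr1 (fun X : 'M_1 => X 0 0)).
  rewrite [LHS]mxE big_split_ord /= big_ord1 col_mxEu !mxE eqxx mulr1n => /eqP.
  rewrite addr_eq0 mulrC add0r /GRing.scale /= => /eqP ->.
  rewrite -sumrN; apply: eq_bigr => j _.
  by rewrite valK col_mxEd mxE mulrN mulrC.
have row1 (v : 'rV[A]_p) : WA i ((v *m D1) 0 (lshift i 0)).
  by apply: row0; apply/D1P; exists v.
have [|v vE] := @flat p (1 + i) 1 D1 D2 (fun u h => proj1 (D1P u) h) (row_mx b%:M (- \row_j u j)).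
  rewrite map_col_mx mul_row_col map_scalar_mx mulNmx; apply/eqP; rewrite subr_eq0; apply/eqP.
  apply/matrixP => j k; rewrite !ord1 -scalar_mxM !mxE eqxx mulr1n.
  move: E; rewrite add0r /GRing.scale /= mulrC => ->.
  by apply: eq_bigr => l _; rewrite !mxE mulrC.
have := congr1 (fun X : 'M_(1, 1 + i) => X 0 (lshift i 0)) vE.
rewrite row_mxEl !mxE eqxx mulr1n => ->.
apply: (sub_sum _ (submodule_Wx _ _ (@submodule_zero B B^o))) => j _.
rewrite mxE; apply: (subZ _ (submodule_Wx _ _ (@submodule_zero B B^o))).
apply: Wx_phi; have := row1 (delta_mx 0 j); by rewrite -rowE mxE.
Qed.

End Transfer.

Lemma Wx_cat (A : comNzRingType) (M : lmodType A) (W : set M) x y c i :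
  (forall j, (j < c)%N -> y j = x j) ->
  Wx W y (c + i) = Wx (Wx W x c) (fun j => y (c + j)%N) i.
Proof.
move=> h; elim: i => [|i IH]; first by rewrite addn0; exact: eq_Wx.
by rewrite addnS /= IH.
Qed.

(** What is used of a complete intersection from here on: B = Q/(f); [phi] is faithfully flat,
    expressed by two statements on matrices; Q and A have the same residue field; [f] and the
    generators [X] of [mQ] are regular sequences. *)
Definition ci_structure (A : comNzRingType) (m : set A) (B Q : comNzRingType)
    (phi : {rmorphism A -> B}) (g : {rmorphism Q -> B}) (mQ : set Q)
    (f X : nat -> Q) (c D : nat) : Prop :=
  [/\ noetherian Q, local_ring mQ, forall b, exists q, g q = b
    & forall q, g q = 0 <-> Wx ([set 0%R] : set Q^o) f c q] /\
  [/\ forall p q s (D1 : 'M[A]_(p, q)) (D2 : 'M[A]_(q, s)),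
        (forall u : 'rV_q, u *m D2 = 0 -> exists v, u = v *m D1) ->
        forall u : 'rV[B]_q, u *m map_mx phi D2 = 0 -> exists v, u = v *m map_mx phi D1,
      forall p q (D : 'M[A]_(p, q)) (v : 'rV[A]_q) (w : 'rV[B]_p),
        map_mx phi v = w *m map_mx phi D -> exists w', v = w' *m D,
      forall q, exists a q', g q' = phi a /\ mQ (q - q')
    & forall a q, g q = phi a -> (mQ q <-> m a)] /\
  [/\ forall i, mQ (f i), reg ([set 0%R] : set Q^o) f c, gens mQ X D
    & reg ([set 0%R] : set Q^o) X D].

Section CI.
Variables (A : comNzRingType) (m : set A).
Hypotheses (hA : noetherian A) (hm : local_ring m).

Lemma prime_chain_le n (S : nat -> set A) a r N :
  gens m a r -> (sz a r ([set 0%R] : set A^o) <= N)%N ->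
  (forall i, (i <= n)%N -> prime_ideal (S i)) -> (forall i, (i < n)%N -> S i `<` S i.+1) ->
  (n < N)%N.
Proof.
move=> hg le pS lt; apply: leq_trans (prime_chain_sz hA hm hg pS lt) _.
apply: leq_trans le; apply: (sz_anti hA hm hg).
- exact: submodule_zero.
- by have [] := pS 0%N (leq0n n).
- by move=> _ ->; have [h _ _] := pS 0%N (leq0n n); exact: (sub0 h).
Qed.

(** The dimension of A is D - c. It is no larger because [sz] drops along [f] and lengths over A are
    bounded by lengths over Q. It is attained by a regular sequence, since a sequence that stopped
    earlier would contradict the depth D of Q. *)
Theorem complete_intersection_structure : complete_intersection m ->
  exists (B Q : comNzRingType) (phi : {rmorphism A -> B}) (g : {rmorphism Q -> B})
    (mQ : set Q) (f X : nat -> Q) (c D d : nat) (x : nat -> A),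
  ci_structure m phi g mQ f X c D /\
  [/\ ring_dim A = d%:Z%:E, forall i, m (x i), reg ([set 0%R] : set A^o) x d
    & soc m (Wx ([set 0%R] : set A^o) x d)].
Proof.
move=> [B [Q [mQ [fs [g [[t [t1 tDM tS t_inj t_surj]] [[hQ hmQ [xs [mQE dimQ]]] [[fsT fsr] gT kerg]]]]]]]].
have g_surj b : exists q, g q = b.
  by have : setT b by []; rewrite -gT => -[q _ <-]; exists q.
pose ph := phi hA hm t1 tDM t_inj t_surj.
set f := nth 0 fs; set c := size fs; set X := nth 0 xs; set D := size xs in dimQ.
have hgX : gens mQ X D by rewrite mQE; exact: gens_ideal_gen.
have [S [pS ltS]] : exists S : nat -> set Q, (forall i, (i <= D)%N -> prime_ideal (S i)) /\
    forall i, (i < D)%N -> S i `<` S i.+1.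
  by move: dimQ => /supz_nats.
have Xr := regular_local_reg hQ hmQ hgX pS ltS.
have hWf i : submodule (Wx ([set 0%R] : set Q^o) f i) by apply: submodule_Wx; exact: submodule_zero.
have fr : reg ([set 0%R] : set Q^o) f c.
  by move=> i v lt; have := fsr i lt v; rewrite (@smul_seq Q Q^o fs i (ltnW lt)).
have kerE q : g q = 0 <-> Wx ([set 0%R] : set Q^o) f c q.
  have -> : (g q = 0) = (ideal_gen fs q) by rewrite -kerg.
  by rewrite /ideal_gen -[fs in X in X <-> _]take_size smul_seq.
have fm i : mQ (f i).
  have [lt|le] := ltnP i c; last by rewrite /f nth_default //; exact: (m0 hmQ).
  apply: (proper_sub_m hmQ (hWf c)); last first.
    have := @Wx_in _ Q^o [set 0] f c i 1 (@submodule_zero _ _) lt.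
    by rewrite /GRing.scale /= mulr1.
  by move=> /kerE /eqP; rewrite rmorph1 oner_eq0.
have szf i : (i <= c)%N -> (sz X D (Wx ([set 0%R] : set Q^o) f i) + i <= D.+1)%N.
  elim: i => [_|i IH lt]; first by rewrite addn0 (sz_regular_local hQ hmQ hgX pS ltS).
  have := IH (ltnW lt).
  have := sz_regular hQ hmQ hgX (hWf i) (fun v => fr i v lt).
  have : (0 < sz X D (Wx ([set 0%R] : set Q^o) f i))%N.
    apply: (sz_gt0 hQ hmQ hgX (hWf i)) => h; apply: (m1 hmQ).
    move: h; apply: Wx_min; [exact: (m_ideal hmQ)|by move=> _ ->; exact: (m0 hmQ)|].
    by move=> j v _; exact: (mMr hmQ).
  rewrite /= -/(addc _ _); lia.
have cD : (c <= D)%N.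
  have := szf c (leqnn c); have : (0 < sz X D (Wx ([set 0%R] : set Q^o) f c))%N.
    by apply: (sz_gt0 hQ hmQ hgX (hWf c)) => /kerE /eqP; rewrite rmorph1 oner_eq0.
  lia.
have [a [r hg]] := gens_exists hA (m_ideal hm).
have szA : (sz a r ([set 0%R] : set A^o) <= (D - c).+1)%N.
  have : (sz X D (Wx ([set 0%R] : set Q^o) f c) <= (D - c).+1)%N by have := szf c (leqnn c); lia.
  apply: leq_trans.
  apply: (evp_size (hspP hA hm hg (@submodule_zero _ _)) (hspP hQ hmQ hgX (hWf c))).
  exists 1%N => n n0; rewrite ler0n ler_nat.
  have hFm : submodule (addS ([set 0%R] : set A^o) (fil a r n)).
    by apply: submodule_addS; [exact: submodule_zero|exact: submodule_fil].
  have fA : fin (addS ([set 0%R] : set A^o) (fil a r n)) setT.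
    by apply: fin_fil; [exact: submodule_zero|apply: (fin_m hm hg); exact: submodule_zero].
  have hFQ : submodule (addS (Wx ([set 0%R] : set Q^o) f c) (fil X D n)).
    by apply: submodule_addS => //; exact: submodule_fil.
  have fQ : fin (addS (Wx ([set 0%R] : set Q^o) f c) (fil X D n)) setT.
    by apply: fin_fil => //; apply: (fin_m hmQ hgX).
  have [leQ _] := ellP hFQ (fun x _ => I) fQ.
  have [_ geA] := ellP hFm (fun x _ => I) fA.
  apply: (lenge_leq geA).
  have E : addS ([set 0%R] : set A^o) (fil a r n) = ideal_pow m n.
    rewrite (ideal_powE hg); apply/seteqP; split=> [_ [z [y [-> Fy ->]]]|y Fy].
      by rewrite add0r.
    by apply: addSr => //; exact: submodule_zero.
  rewrite E; apply: (completion_length hA hm t1 tDM tS t_inj t_surj hmQ g_surj (hWf c)) => //.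
    by move=> q /kerE.
  by rewrite (ideal_powE hgX).
pose hphi := t_phi hA hm t1 tDM t_inj t_surj.
have hflat := @completion_flat A m B hA hm t t1 tDM tS t_inj t_surj.
have hrefl := @completion_reflect A m B hA hm t t1 tDM t_inj t_surj.
have hrap := residue_approx hA hm t1 tDM t_inj t_surj hmQ g_surj.
have hrph a0 q : g q = ph a0 -> (mQ q <-> m a0) := fun e => residue_phi hmQ g_surj e.
have hrg := residue_gens hA hm t1 tDM tS t_inj t_surj hmQ g_surj.
have st : ci_structure m ph g mQ f X c D by split=> //; split=> //; split.
suff build : exists x : nat -> A, (forall i, m (x i)) /\ reg ([set 0%R] : set A^o) x (D - c).
  have [x [xm xr]] := build.
  have properA y n : (forall i, (i < n)%N -> m (y i)) -> ~ Wx ([set 0%R] : set A^o) y n 1.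
    move=> ym h; apply: (m1 hm); move: h.
    apply: Wx_min; [exact: (m_ideal hm)|by move=> _ ->; exact: (m0 hm)|].
    by move=> j v lt; apply: (mMr hm); exact: ym.
  exists B, Q, ph, g, mQ, f, X, c, D, (D - c)%N, x; split=> //; split=> //.
    apply: supz_nats_eq.
      apply: (reg_prime_chain hA hm (@submodule_zero _ _) _ xr) => [i _|]; first exact: xm.
      by exists 1; apply: properA => i _; exact: xm.
    by move=> n [S' [pS' ltS']]; have := prime_chain_le hg szA pS' ltS'; rewrite ltnS.
  (* Without a socle the sequence could be extended to D - c + 1 elements, and it would give too
     long a chain of primes. *)
  apply: contrapT => ns.
  have [| |z mz zP] := @regular_element A m hA hm A^o (noeth_self hA) 1 (fun=> Wx [set 0] x (D - c)).
  - by move=> _ _; apply: submodule_Wx; exact: submodule_zero.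
  - by [].
  pose x' i := if (i < D - c)%N then x i else z.
  have x'm i : m (x' i) by rewrite /x'; case: ifP.
  have x'E i : (i <= D - c)%N -> Wx ([set 0%R] : set A^o) x' i = Wx [set 0] x i.
    by move=> le; apply: eq_Wx => j ji; rewrite /x' (leq_trans ji le).
  have x'r : reg ([set 0%R] : set A^o) x' (D - c).+1.
    move=> i v; rewrite ltnS => le; rewrite !x'E // /x'; case: ltnP => h; first exact: xr.
    have -> : i = (D - c)%N by apply/eqP; rewrite eqn_leq le.
    exact: (zP 0%N).
  have [|S' [pS' ltS']] := reg_prime_chain hA hm (@submodule_zero _ _) (fun i _ => x'm i) x'r.
    by exists 1; apply: properA => i _; exact: x'm.
  by have := prime_chain_le hg szA pS' ltS'; rewrite ltnn.
suff h n : (n <= D - c)%N -> exists x : nat -> A, (forall i, m (x i)) /\ reg ([set 0%R] : set A^o) x n.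
  exact: h.
elim: n => [_|n IH lt]; first by exists (fun=> 0); split=> // _; exact: (m0 hm).
have [x [xm xr]] := IH (ltnW lt).
have hWA : submodule (Wx ([set 0%R] : set A^o) x n) by apply: submodule_Wx; exact: submodule_zero.
have [[v [nv mv]]|ns] := pselect (soc m (Wx ([set 0%R] : set A^o) x n)); last first.
  have [| |z mz zP] := @regular_element A m hA hm A^o (noeth_self hA) 1 (fun=> Wx [set 0] x n).
  - by [].
  - by [].
  exists (fun i => if (i < n)%N then x i else z); split; first by move=> i; case: ifP.
  move=> i u; rewrite ltnS => le.
  rewrite (@eq_Wx _ _ _ _ x i); last by move=> j ji; rewrite (leq_trans ji le).
  case: ltnP => h; first exact: xr.
  have -> : i = n by apply/eqP; rewrite eqn_leq le.
  exact: (zP 0%N).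
exfalso.
have /choice[y0 y0P] i : exists q, g q = ph (x i) by exact: g_surj.
(* [f] followed by lifts of x is a regular sequence of length c + n < D in Q. A socle of A/(x)
   becomes one of Q modulo this sequence, whereas the longer regular sequence [X] excludes a socle
   after c + n steps. *)
pose y i := if (i < c)%N then f i else y0 (i - c)%N.
have yE j : y (c + j)%N = y0 j by rewrite /y ltnNge leq_addr /= addKn.
have yf j : (j < c)%N -> y j = f j by rewrite /y => ->.
have mem j q : Wx ([set 0%R] : set Q^o) y (c + j) q <-> Wx ([set 0%R] : set B^o) (ph \o x) j (g q).
  rewrite (@Wx_cat _ _ _ f _ _ _ yf); split.
    move=> /WxP [w [u [/kerE gw ->]]]; apply/WxP; exists 0, (g \o u); split=> //.
    rewrite rmorphD gw rmorph_sum; congr (_ + _); apply: eq_bigr => k _.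
    by rewrite /GRing.scale /= rmorphM yE y0P.
  move=> /WxP [_ [u [-> E]]]; have /choice[u0 u0P] k : exists q, g q = u k by exact: g_surj.
  apply/WxP; exists (q - \sum_(k < j) y (c + k)%N *: (u0 k : Q^o)), u0; split; last by rewrite subrK.
  apply/kerE; rewrite rmorphB E rmorph_sum add0r; apply/eqP; rewrite subr_eq0; apply/eqP.
  by apply: eq_bigr => k _; rewrite /GRing.scale /= rmorphM yE y0P u0P.
have ym i : mQ (y i).
  by rewrite /y; case: ifP => // _; exact: (proj2 (hrph _ _ (y0P _)) (xm _)).
have yr : reg ([set 0%R] : set Q^o) y (c + n).
  move=> i u; have [ic|ci] := ltnP i c => lti.
    rewrite (@eq_Wx _ _ _ _ f i); last by move=> j ji; apply: yf; exact: ltn_trans ic.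
    by rewrite yf //; exact: fr.
  have iE : i = (c + (i - c))%N by rewrite subnKC.
  rewrite iE => /mem h; apply/mem; move: h; rewrite yE /GRing.scale /= rmorphM y0P.
  apply: (reg_flat hA (phi := ph) hflat xr); lia.
have sy : soc mQ (Wx ([set 0%R] : set Q^o) y (c + n)).
  have [q gq] := g_surj (ph v); exists q; split.
    by move=> /mem; rewrite gq => /(Wx_reflect (phi := ph) hrefl).
  move=> z /(hrg _ _ _ hg) [b gz]; apply/mem; rewrite rmorphM gz gq mulr_suml.
  have hWB := @submodule_Wx B B^o [set 0] (ph \o x) n (@submodule_zero _ _).
  apply: (sub_sum _ hWB) => i _; rewrite -mulrA; apply: (subZ _ hWB).
  rewrite -rmorphM; apply: (Wx_phi ph); apply: mv; exact: hg.1.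
have ltD : (c + n < D)%N by lia.
apply: (reg_soc (@submodule_zero _ _) ltD Xr (fun j _ => hgX.1 j)).
apply: (depth_unique hQ hmQ (noeth_self hQ) (@submodule_zero _ _) _ _ yr) sy => //.
- by move=> i _; exact: hgX.1.
- by move=> i u lti; apply: Xr; exact: ltn_trans ltD.
Qed.

End CI.

(** * Complexes of free modules *)

Lemma mxin_row (R : comNzRingType) (I : set R) p q1 q2 (X : 'M[R]_(p, q1)) (Y : 'M[R]_(p, q2)) :
  mxin I (row_mx X Y) <-> mxin I X /\ mxin I Y.
Proof.
split=> [h|[hX hY] i j].
  by split=> i j; [have := h i (lshift q2 j); rewrite row_mxEl|have := h i (rshift q1 j); rewrite row_mxEr].
by rewrite mxE; case: (split j).
Qed.

Lemma mxin_col (R : comNzRingType) (I : set R) p1 p2 q (X : 'M[R]_(p1, q)) (Y : 'M[R]_(p2, q)) :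
  mxin I (col_mx X Y) <-> mxin I X /\ mxin I Y.
Proof.
split=> [h|[hX hY] i j].
  by split=> i j; [have := h (lshift p2 i) j; rewrite col_mxEu|have := h (rshift p1 i) j; rewrite col_mxEd].
by rewrite mxE; case: (split i).
Qed.

Lemma subr_row (R : comNzRingType) p q1 q2 (X X' : 'M[R]_(p, q1)) (Y Y' : 'M[R]_(p, q2)) :
  row_mx X Y - row_mx X' Y' = row_mx (X - X') (Y - Y').
Proof. by rewrite opp_row_mx add_row_mx. Qed.

Section Complexes.
Variable R : comNzRingType.
Implicit Types (b : nat -> nat) (J m : set R).

(** Exactness of the complex modulo [J] in degree n + 1; differentials act on rows. *)
Definition ex_at b J (d : forall n, 'M[R]_(b n.+1, b n)) n :=
  forall u : 'rV_(b n.+1), mxin J (u *m d n) -> exists v, mxin J (u - v *m d n.+1).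

Definition exact b (d : forall n, 'M[R]_(b n.+1, b n)) :=
  forall n (u : 'rV_(b n.+1)), u *m d n = 0 -> exists v, u = v *m d n.+1.

Definition cpx b (d : forall n, 'M[R]_(b n.+1, b n)) := forall n, d n.+1 *m d n = 0.

Definition chain b (d : forall n, 'M[R]_(b n.+1, b n)) (e : forall n, 'M[R]_(b n.+2, b n)) :=
  forall n, e n.+1 *m d n = d n.+2 *m e n.

Definition cone_rk b n := (b n + b n.+1)%N.

(* F_n + F_(n+1) with differential (u, v) |-> (u d + v eta, s u - v d). For s = 0
   and a chain map eta this is the mapping cone of eta. *)
Definition cone b (d : forall n, 'M[R]_(b n.+1, b n)) (e : forall n, 'M[R]_(b n.+2, b n)) (s : R)
  n : 'M[R]_(cone_rk b n.+1, cone_rk b n) := block_mx (d n) s%:M (e n) (- d n.+1).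

Section Cone.
Variables (b : nat -> nat) (d : forall n, 'M[R]_(b n.+1, b n)).
Variables (e : forall n, 'M[R]_(b n.+2, b n)) (s : R).

Lemma mul_row_cone n p (u : 'M_(p, b n.+1)) (v : 'M_(p, b n.+2)) :
  row_mx u v *m cone d e s n = row_mx (u *m d n + v *m e n) (s *: u - v *m d n.+1).
Proof. by rewrite mul_row_block mul_mx_scalar mulmxN. Qed.

Lemma mul_cone_col n p (x : 'M_(b n, p)) (y : 'M_(b n.+1, p)) :
  cone d e s n *m col_mx x y = col_mx (d n *m x + s *: y) (e n *m x - d n.+1 *m y).
Proof. by rewrite mul_block_col mul_scalar_mx mulNmx. Qed.

Lemma cone_sq n : cone d e s n.+1 *m cone d e s n =
  block_mx (d n.+1 *m d n + s *: e n) 0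
    (e n.+1 *m d n - d n.+2 *m e n) (d n.+2 *m d n.+1 + s *: e n.+1).
Proof.
rewrite mulmx_block !mul_mx_scalar !mul_scalar_mx !mulNmx !mulmxN opprK scalerN subrr.
by rewrite [s *: _ + _]addrC.
Qed.

End Cone.

Lemma exact_cone b (d : forall n, 'M[R]_(b n.+1, b n)) e :
  cpx d -> exact d -> chain d e -> exact (cone d e 0).
Proof.
move=> dd ex ch n w; rewrite -[w]hsubmxK mul_row_cone scale0r sub0r.
set u := lsubmx w; set v := rsubmx w => /eqP.
rewrite -[0](@row_mx0 R 1 (b n) (b n.+1)) => /eqP /eq_row_mx [h1 /eqP]; rewrite oppr_eq0 => /eqP h2.
have [v' vE] := ex _ _ h2.
have [|u' uE] := ex n (u + v' *m e n.+1).
  by rewrite mulmxDl -mulmxA ch mulmxA -vE.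
exists (row_mx u' (- v')); rewrite mul_row_cone scale0r sub0r !mulNmx opprK -uE -vE.
by rewrite addrK.
Qed.

Lemma cpx_cone b (d : forall n, 'M[R]_(b n.+1, b n)) e :
  cpx d -> chain d e -> cpx (cone d e 0).
Proof.
by move=> dd ch n; rewrite cone_sq !dd !scale0r !addr0 ch subrr block_mx0.
Qed.

(** * Homology modulo m and nilpotent operators *)

Section Nilpotent.
Variables (m : set R) (hm : ideal m).

(** Lifts to Q of complexes and chain maps over A keep their identities only modulo the f_j, hence
    modulo m. *)
Definition cpxm b (d : forall n, 'M[R]_(b n.+1, b n)) := forall n, mxin m (d n.+1 *m d n).
Definition chainm b (d : forall n, 'M[R]_(b n.+1, b n)) (e : forall n, 'M[R]_(b n.+2, b n)) :=
  forall n, mxin m (e n.+1 *m d n - d n.+2 *m e n).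

Definition bd b (d : forall n, 'M[R]_(b n.+1, b n)) n (z : 'rV_(b n)) :=
  exists y, mxin m (z - y *m d n).

Definition cyc b (d : forall n, 'M[R]_(b n.+1, b n)) n : 'rV_(b n) -> Prop :=
  match n return 'rV_(b n) -> Prop with
  | 0 => fun=> True | n'.+1 => fun z => mxin m (z *m d n') end.

(* The class of z in the homology modulo m is annihilated by T ^ k; this is void
   when T ^ k would lead to negative degrees. *)
Fixpoint killed b (d : forall n, 'M[R]_(b n.+1, b n)) (T : forall n, 'M[R]_(b n.+2, b n))
    (k : nat) : forall n, 'rV_(b n) -> Prop :=
  match k with
  | 0 => @bd b d
  | k'.+1 => fun n => match n return 'rV_(b n) -> Prop with
      | n'.+2 => fun z => @killed b d T k' n' (z *m T n')
      | _ => fun=> True end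
  end.

Definition nilp b (d : forall n, 'M[R]_(b n.+1, b n)) T :=
  exists k n0, forall n (z : 'rV_(b n)), (n0 <= n)%N -> cyc d z -> killed d T k z.

Section One.
Variables (b : nat -> nat) (d : forall n, 'M[R]_(b n.+1, b n)).
Implicit Types (T : forall n, 'M[R]_(b n.+2, b n)).

Lemma bdD n (z w : 'rV_(b n)) : bd d z -> bd d w -> bd d (z + w).
Proof.
by move=> [y hy] [y' hy']; exists (y + y'); rewrite mulmxDl opprD addrACA; exact: mxinD.
Qed.

Lemma bdN n (z : 'rV_(b n)) : bd d z -> bd d (- z).
Proof. by move=> [y hy]; exists (- y); rewrite mulNmx -opprD; exact: mxinN. Qed.

Lemma bd_in n (z : 'rV_(b n)) : mxin m z -> bd d z.
Proof. by move=> h; exists 0; rewrite mul0mx subr0. Qed.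

Lemma bd_im n (y : 'rV_(b n.+1)) : bd d (y *m d n).
Proof. by exists y; rewrite subrr; exact: mxin0. Qed.

Lemma cycD n (z w : 'rV_(b n)) : cyc d z -> cyc d w -> cyc d (z + w).
Proof. by case: n z w => //= n z w hz hw; rewrite mulmxDl; exact: mxinD. Qed.

Lemma bd_cyc n (z : 'rV_(b n)) : cpxm d -> bd d z -> cyc d z.
Proof.
case: n z => //= n z dd [y hy]; apply: (mxin_addr hm (Y := (y *m d n.+1) *m d n)).
  by rewrite -mulmxBl; exact: mxinMr.
by rewrite -mulmxA; exact: mxinMl.
Qed.

Lemma cyc_mul T n (z : 'rV_(b n.+2)) : chainm d T -> cyc d z -> cyc d (z *m T n).
Proof.
case: n z => //= n z ch hz; apply: (mxin_addr hm (Y := (z *m d n.+2) *m T n)).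
  by rewrite -!mulmxA -mulmxBr; exact: mxinMl.
exact: mxinMr.
Qed.

Lemma bd_mul T n (z : 'rV_(b n.+2)) : chainm d T -> bd d z -> bd d (z *m T n).
Proof.
move=> ch [y hy]; exists (y *m T n.+1).
apply: (mxin_trans hm (Y := (y *m d n.+2) *m T n)); first by rewrite -mulmxBl; exact: mxinMr.
by apply: (mxin_subC hm); rewrite -!mulmxA -mulmxBr; exact: mxinMl.
Qed.

Lemma killedD T k n (z w : 'rV_(b n)) : chainm d T ->
  killed d T k z -> bd d w -> killed d T k (z + w).
Proof.
move=> ch; elim: k n z w => [|k IH] n z w /=; first exact: bdD.
case: n z w => [|[|n]] z w //= hz hw; rewrite mulmxDl; apply: IH => //.
exact: bd_mul.
Qed.

(** An operator that is nilpotent and injective on homology in high degrees leaves none; n0 + 2k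
    leaves room for k applications of degree -2. *)
Lemma killed_bd T k n0 n (z : 'rV_(b n)) : chainm d T ->
  (forall n (v : 'rV_(b n.+2)), (n0 <= n)%N -> cyc d v -> bd d (v *m T n) -> bd d v) ->
  (n0 + 2 * k <= n)%N -> cyc d z -> killed d T k z -> bd d z.
Proof.
move=> ch inj; elim: k n z => [|k IH] n z //=.
case: n z => [|[|n]] z //; try lia.
by move=> le cz hz; apply: inj => //; [lia|apply: IH => //; [lia|exact: cyc_mul]].
Qed.

End One.

Section Extension.
Variables (b : nat -> nat) (d : forall n, 'M[R]_(b n.+1, b n)).
Variables (e : forall n, 'M[R]_(b n.+2, b n)) (s : R).
Hypotheses (hd : cpxm d) (he : chainm d e) (hs : m s).
Let G := cone d e s.

Lemma cyc_row n (u : 'rV_(b n.+1)) (v : 'rV_(b n.+2)) :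
  cyc G (row_mx u v : 'rV_(cone_rk b n.+1)) <->
  mxin m (u *m d n + v *m e n) /\ mxin m (v *m d n.+1).
Proof.
rewrite /cyc mul_row_cone mxin_row; split=> -[h1 h2]; split=> //.
  by rewrite -[v *m _](subKr (s *: u)); apply: mxinB => //; exact: mxinZ.
by apply: mxinB => //; exact: mxinZ.
Qed.

(** Adding a boundary moves (u, v) into the subcomplex when v bounds, at the price of the term y
    e. *)
Lemma bd_row n (u : 'rV_(b n)) (v : 'rV_(b n.+1)) :
  bd d v -> exists2 u', bd G (row_mx u v - row_mx u' 0 : 'rV_(cone_rk b n)) &
    exists y, u' = u + y *m e n /\ mxin m (v - y *m d n.+1).
Proof.
move=> [y hy]; exists (u + y *m e n); last by exists y.
exists (row_mx 0 (- y)); rewrite mul_row_cone scaler0 sub0r mul0mx add0r !mulNmx opprK.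
rewrite !subr_row subr0 opprK opprD addrA subrr sub0r addNr.
by apply/mxin_row; split=> //; exact: mxin0.
Qed.

Lemma bd_inl n (u : 'rV_(b n)) : bd d u -> bd G (row_mx u 0 : 'rV_(cone_rk b n)).
Proof.
move=> [y hy]; exists (row_mx y 0).
rewrite mul_row_cone !mul0mx addr0 subr0 subr_row sub0r; apply/mxin_row; split=> //.
by apply: mxinN => //; exact: mxinZ.
Qed.

Section Ext.
Variables (T : forall n, 'M[R]_(b n.+2, b n)) (U : forall n, 'M[R]_(b n.+3, b n)).
Hypothesis hT : chainm d T.

(** [T] acts on the subcomplex and on the quotient of the cone; in the applications the corner [U]
    is a coefficient of the commutator of [e] with [d]. *)
Definition cone_op n : 'M[R]_(cone_rk b n.+2, cone_rk b n) :=
  block_mx (T n) 0 (U n) (T n.+1).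
Hypothesis hT' : chainm G cone_op.

Lemma mul_cone_op n (u : 'rV_(b n.+2)) (v : 'rV_(b n.+3)) :
  row_mx u v *m cone_op n = row_mx (u *m T n + v *m U n) (v *m T n.+1).
Proof. by rewrite mul_row_block mulmx0 add0r. Qed.

Lemma cpxm_cone : cpxm G.
Proof.
move=> n i j; rewrite cone_sq.
suff : mxin m (block_mx (d n.+1 *m d n + s *: e n) 0
    (e n.+1 *m d n - d n.+2 *m e n) (d n.+2 *m d n.+1 + s *: e n.+1)) by [].
rewrite block_mxEv; apply/mxin_col; split; apply/mxin_row; split.
- by apply: mxinD => //; exact: mxinZ.
- exact: mxin0.
- exact: he.
- by apply: mxinD => //; exact: mxinZ.
Qed.

Lemma killed_inl k n (u : 'rV_(b n)) : killed d T k u ->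
  killed G cone_op k (row_mx u 0 : 'rV_(cone_rk b n)).
Proof.
elim: k n u => [|k IH] n u /=; first exact: bd_inl.
case: n u => [|[|n]] u //= h; rewrite mul_cone_op !mul0mx addr0; exact: IH.
Qed.

(** k applications kill the class of v in the quotient; what remains is homologous to a cycle of the
    subcomplex, which k' more applications kill. *)
Lemma killed_ext k k' n0 n (u : 'rV_(b n)) (v : 'rV_(b n.+1)) :
  (forall n (u : 'rV_(b n)), (n0 <= n)%N -> cyc d u -> killed d T k' u) ->
  (n0 + 2 * k <= n)%N -> cyc G (row_mx u v : 'rV_(cone_rk b n)) -> killed d T k v ->
  killed G cone_op (k + k') (row_mx u v : 'rV_(cone_rk b n)).
Proof.
move=> hk'; elim: k n u v => [|k IH] n u v le cz.
  move=> /= /(bd_row u) [u' hb [y [u'E hy]]].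
  rewrite add0n -(subrK (row_mx u' 0) (row_mx u v)) addrC.
  apply: killedD => //; apply: killed_inl; apply: hk'; first by lia.
  case: n u v le cz u' hb y u'E hy => // n u v le /cyc_row [h1 h2] u' _ y -> hy.
  rewrite /= mulmxDl; apply: (mxin_addr hm (Y := u *m d n + v *m e n)) => //.
  rewrite opprD addrACA subrr add0r; apply: (mxin_trans hm (Y := (y *m d n.+2) *m e n)).
    by rewrite -!mulmxA -mulmxBr; exact: mxinMl.
  by rewrite -mulmxBl; apply: mxinMr => //; exact: mxin_subC.
case: n u v le cz => [|[|n]] u v le cz //= hv.
have -> : row_mx u v *m cone_op n = row_mx (u *m T n + v *m U n) (v *m T n.+1).
  exact: mul_cone_op.
apply: IH => //; first by lia.
by rewrite -mul_cone_op; exact: cyc_mul.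
Qed.

Lemma cyc_snd n (u : 'rV_(b n)) (v : 'rV_(b n.+1)) : (0 < n)%N ->
  cyc G (row_mx u v : 'rV_(cone_rk b n)) -> cyc d v.
Proof. by case: n u v => // n u v _ /cyc_row []. Qed.

Lemma nilp_ext : nilp d T -> nilp G cone_op.
Proof.
move=> [k [n0 h]]; exists (k + k)%N, (n0 + 2 * k).+1 => n z le; rewrite -[z]hsubmxK => cz.
apply: (@killed_ext k k n0) => //; first by lia.
by apply: h; [lia|apply: cyc_snd cz; lia].
Qed.

(* T acts on the homology as e, which is null-homotopic on the cone of e. *)
Lemma nilp_self : (forall n (v : 'rV_(b n.+2)), cyc d v -> bd d (v *m T n - v *m e n)) ->
  nilp G cone_op.
Proof.
(* Two applications suffice: for a cycle (u, v), v e equals -u d modulo m, so v T bounds; then u' T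
   is homologous to u' e, and (u' e, 0) is the boundary of (0, u') in the cone up to m. *)
move=> hTe; exists 2%N, 5%N => n z le; rewrite -[z]hsubmxK.
case: n z le => [|[|[|[|n]]]] // z _ cz.
set u := lsubmx z in cz *; set v := rsubmx z in cz *.
have [c1 c2] : mxin m (u *m d n.+3 + v *m e n.+3) /\ mxin m (v *m d n.+4).
  by apply/cyc_row.
have bv : bd d (v *m T n.+3).
  have := bdD (hTe n.+3 v c2) (_ : bd d (v *m e n.+3)); rewrite subrK; apply.
  rewrite -[v *m _](addKr (u *m d n.+3)); apply: bdD => //; last exact: bd_in.
  by apply: bdN; exact: bd_im.
have cz' := cyc_mul hT' cz; rewrite mul_cone_op in cz'.
change (killed G cone_op 1 ((row_mx u v : 'rV_(cone_rk b n.+4)) *m cone_op n.+2)).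
rewrite mul_cone_op; set u1 := _ + _ in cz' *; set v1 := _ *m _ in bv cz' *.
have [u' hb [y [u'E hy]]] := bd_row u1 bv.
rewrite -(subrK (row_mx u' 0) (row_mx u1 v1)) addrC.
apply: killedD => //.
have cu' : cyc d u'.
  have /cyc_row[] : cyc G (row_mx u' 0 : 'rV_(cone_rk b n.+2)).
    have -> : row_mx u' 0 = row_mx u1 v1 - (row_mx u1 v1 - row_mx u' 0).
      by rewrite opprB addrC subrK.
    by apply: cycD => //; apply: bd_cyc; [exact: cpxm_cone|exact: bdN].
  by rewrite mul0mx addr0.
rewrite /= mul_cone_op !mul0mx addr0.
have -> : row_mx (u' *m T n) 0 = row_mx (u' *m T n - u' *m e n) 0 +
    row_mx (u' *m e n) 0 :> 'rV_(cone_rk b n).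
  by rewrite add_row_mx addr0 subrK.
apply: bdD; first by apply: bd_inl; exact: hTe.
exists (row_mx 0 u'); rewrite mul_row_cone mul0mx add0r scaler0 sub0r subr_row subrr sub0r opprK.
by apply/mxin_row; split=> //; exact: mxin0.
Qed.

End Ext.

(* The two halves of the long exact homology sequence of the cone. *)
Lemma cone_inj n (v : 'rV_(b n.+2)) : ex_at m G n -> cyc d v -> bd d (v *m e n) -> bd d v.
Proof.
move=> ex cv [x hx].
have [|w] := ex (row_mx (- x) v).
  by apply/cyc_row; split=> //; rewrite mulNmx addrC.
rewrite -[w]hsubmxK mul_row_cone subr_row => /mxin_row [_ h].
exists (- rsubmx w); rewrite mulNmx opprK.
have -> : v + rsubmx w *m d n.+2 = (v - (s *: lsubmx w - rsubmx w *m d n.+2)) + s *: lsubmx w.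
  by rewrite opprB addrA subrK.
by apply: mxinD => //; exact: mxinZ.
Qed.

Lemma cone_surj n (u : 'rV_(b n.+1)) : ex_at m G n -> cyc d u ->
  exists2 y : 'rV_(b n.+3), cyc d y & bd d (u - y *m e n.+1).
Proof.
move=> ex cu; have [|w] := ex (row_mx u 0).
  by apply/cyc_row; rewrite !mul0mx addr0; split=> //; exact: mxin0.
rewrite -[w]hsubmxK mul_row_cone subr_row => /mxin_row [h1 h2].
exists (rsubmx w).
  rewrite /= -[_ *m _](subKr (s *: lsubmx w)); apply: mxinB => //; first exact: mxinZ.
  by rewrite -[X in mxin m X]opprK; apply: (mxinN hm); rewrite -sub0r.
by exists (lsubmx w); rewrite -addrA -opprD [_ + lsubmx w *m _]addrC.
Qed.

End Extension.
End Nilpotent.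
End Complexes.

Lemma dep_choice (I : Type) (T : I -> Type) (P : forall i, T i -> Prop) :
  (forall i, exists x, P i x) -> exists f, forall i, P i (f i).
Proof.
by move=> h; exists (fun i => projT1 (cid (h i))) => i; exact: (projT2 (cid (h i))).
Qed.

Lemma sum_block (R : comNzRingType) p1 p2 q1 q2 i (f : nat -> R) (A : nat -> 'M[R]_(p1, q1))
    (C : nat -> 'M[R]_(p2, q1)) (D : nat -> 'M[R]_(p2, q2)) :
  \sum_(j < i) f j *: block_mx (A j) 0 (C j) (D j) =
  block_mx (\sum_(j < i) f j *: A j) 0 (\sum_(j < i) f j *: C j) (\sum_(j < i) f j *: D j).
Proof.
elim: i => [|i IH]; first by rewrite !big_ord0 block_mx0.
by rewrite !big_ord_recr /= IH scale_block_mx scaler0 add_block_mx addr0.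
Qed.

(** * Exact complexes modulo a regular sequence *)

Section RegularExact.
Variables (R : comNzRingType) (x : nat -> R) (D : nat).
Hypothesis xr : reg ([set 0] : set R^o) x D.
Let J i : set R^o := Wx [set 0] x i.
Let hJ i : submodule (J i). Proof. by apply: submodule_Wx; exact: submodule_zero. Qed.

Lemma mxin_WxS p q (Y : 'M[R]_(p, q)) i : mxin (J i.+1) Y ->
  exists W P, mxin (J i) W /\ Y = W + x i *: P.
Proof.
move=> h; have /choice[f fP] (k : 'I_p * 'I_q) : exists wp : R * R,
    J i wp.1 /\ Y k.1 k.2 = wp.1 + x i * wp.2.
  by have [w [_ [Jw [u _ ->] E]]] := h k.1 k.2; exists (w, u).
exists (\matrix_(k, l) (f (k, l)).1), (\matrix_(k, l) (f (k, l)).2); split.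
  by move=> k l; rewrite mxE; have [] := fP (k, l).
by apply/matrixP => k l; rewrite !mxE; have [_] := fP (k, l).
Qed.

Lemma mxin_Wx p q (Y : 'M[R]_(p, q)) i : mxin (J i) Y <->
  exists U : nat -> 'M[R]_(p, q), Y = \sum_(j < i) x j *: U j.
Proof.
split=> [|[U ->]]; last first.
  apply: (mxin_sum (hJ i)) => j _ k l; rewrite mxE.
  exact: (Wx_in _ _ (@submodule_zero _ _) (ltn_ord j)).
elim: i Y => [|i IH] Y h.
  by exists (fun=> 0); rewrite big_ord0; apply/matrixP => k l; rewrite (h k l) mxE.
have [W [P [/IH [U UE] ->]]] := mxin_WxS h.
exists (fun j => if j == i then P else U j); rewrite big_ord_recr /= eqxx UE; congr (_ + _).
by apply: eq_bigr => j _; rewrite ltn_eqF.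
Qed.

Lemma mxin_leq p q (Y : 'M[R]_(p, q)) i j : (i <= j)%N -> mxin (J i) Y -> mxin (J j) Y.
Proof. by move=> ij; apply: mxin_sub; apply: Wx_leq => //; exact: submodule_zero. Qed.

Lemma mx_reg p q (P : 'M[R]_(p, q)) i : (i < D)%N -> mxin (J i) (x i *: P) -> mxin (J i) P.
Proof. by move=> lt h k l; apply: (xr lt); have := h k l; rewrite mxE. Qed.

Lemma mxin_xZ p q (P : 'M[R]_(p, q)) i j : (i < j)%N -> mxin (J j) (x i *: P).
Proof. by move=> lt k l; rewrite mxE; exact: (Wx_in _ _ (@submodule_zero _ _) lt). Qed.

(** Each regular element costs one degree: writing u d = W + x_j P, regularity makes P a cycle
    modulo the earlier elements, and if P is the boundary of y there, u - x_j y is a cycle to which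
    induction applies. *)
Lemma ex_at_regular b (d : forall n, 'M[R]_(b n.+1, b n)) : cpx d -> exact d ->
  forall j n, (j <= D)%N -> (j <= n)%N -> ex_at (J j) d n.
Proof.
move=> dd ex; elim=> [|j IH] n jD jn u h.
  have [|v ->] := ex n u; first by apply/matrixP => k l; rewrite (h k l) mxE.
  by exists v; rewrite subrr; exact: (mxin0 (hJ 0)).
case: n jn u h => // n jn u /mxin_WxS [W [P [hW E]]].
have hP : mxin (J j) (P *m d n).
  apply: (mx_reg jD); rewrite scalemxAl.
  have -> : x j *: P = u *m d n.+1 - W by rewrite E addrC addKr.
  rewrite mulmxBl -mulmxA dd mulmx0 sub0r; apply: (mxinN (hJ j)); exact: (mxinMr (hJ j)).
have [y hy] := IH n (ltnW jD) jn P hP.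
have [|v hv] := IH n.+1 (ltnW jD) (leqW jn) (u - x j *: y).
  rewrite mulmxBl E -scalemxAl -addrA -scalerBr; apply: (mxinD (hJ j)) => //.
  exact: (mxinZr (hJ j)).
exists v; have -> : u - v *m d n.+2 = (u - x j *: y - v *m d n.+2) + x j *: y.
  by rewrite addrAC subrK.
apply: (mxinD (hJ j.+1)).
  exact: (mxin_leq (leqnSn j) hv).
exact: mxin_xZ.
Qed.

(** Regularity puts the last coefficient into (x_0, ..., x_(i-1)); substituting its expression
    leaves a shorter relation. *)
Lemma koszul_relation i (a : nat -> R) : (i <= D)%N -> \sum_(j < i) x j * a j = 0 ->
  forall j, (j < i)%N -> J i (a j).
Proof.
elim: i a => // i IH a iD; rewrite big_ord_recr /= => E.
have /WxP[_ [b [-> aE]]] : J i (a i).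
  apply: (xr iD); apply/WxP; exists 0, (fun j => - a j); split=> //.
  have E2 : x i * a i = - \sum_(j < i) x j * a j by apply/eqP; rewrite -addr_eq0 addrC E.
  rewrite add0r /GRing.scale /= E2 -sumrN; apply: eq_bigr => j _; by rewrite mulrN.
rewrite add0r in aE; move=> j; rewrite ltnS leq_eqVlt => /orP[/eqP ->|lt].
  rewrite aE; apply: (sub_sum _ (hJ i.+1)) => k _.
  by apply: (Wx_in _ _ (@submodule_zero _ _)); exact: ltnW (ltn_ord k).
have h : J i (a j + x i * b j).
  apply: (IH (fun j => a j + x i * b j)) => //; first exact: ltnW.
  rewrite -[RHS]E aE mulr_sumr -big_split /=; apply: eq_bigr => k _.
  by rewrite /GRing.scale /= mulrDr mulrCA.
rewrite -(addrK (x i * b j) (a j)); apply: (subB (hJ i.+1)).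
  by apply: (Wx_leq (@submodule_zero _ _) (leqnSn i)); exact: h.
exact: (Wx_in _ _ (@submodule_zero _ _) (ltnSn i)).
Qed.

Lemma mx_koszul_relation p q i (M : nat -> 'M[R]_(p, q)) : (i <= D)%N ->
  \sum_(j < i) x j *: M j = 0 -> forall j, (j < i)%N -> mxin (J i) (M j).
Proof.
move=> iD E j lt k l; apply: (koszul_relation (a := fun j => M j k l) iD) => //.
move/matrixP: E => /(_ k l); rewrite summxE [RHS]mxE => E; apply: etrans E.
by apply: eq_bigr => n _; rewrite mxE.
Qed.

End RegularExact.

(** * Minimal covers over a local ring *)

Section MinimalCover.
Variables (R : comNzRingType) (m : set R).
Hypothesis hm : local_ring m.

(** Unit entries of [D] are eliminated one at a time. The result is a minimal cover of the cokernel
    of [D]: [s] embeds R^b as a direct summand of R^q that maps onto the cokernel, with relations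
    [D *m y] in m. *)
Lemma mincover p q (D : 'M[R]_(p, q)) : exists b (s : 'M[R]_(b, q)) (y : 'M[R]_(q, b)) (S : 'M[R]_(q, p)),
  [/\ s *m y = 1%:M, 1%:M - y *m s = S *m D & mxin m (D *m y)].
Proof.
elim: q D => [|q IH] D.
  exists 0%N, 0, 0, 0; split; [|by apply/matrixP => -[]|by move=> i []].
  by apply/matrixP => -[].
have [mD|nmD] := pselect (mxin m D).
  exists q.+1, 1%:M, 1%:M, 0; split; first by rewrite mulmx1.
    by rewrite mulmx1 subrr mul0mx.
  by rewrite mulmx1.
have [i [j nm]] : exists i j, ~ m (D i j).
  by apply: contrapT => no; apply: nmD => i j; apply: contrapT => nm; apply: no; exists i, j.
have [y0 yE] := local_unit hm nm.
(* The relation [r] has entry 1 at j, so it expresses the j-th basis vector by the others; [Y] is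
   the projection along it. *)
pose r : 'rV[R]_q.+1 := y0 *: row i D.
have rj : r 0 j = 1 by rewrite !mxE mulrC.
pose S0 : 'M[R]_(q.+1, p) := delta_mx j 0 *m (y0 *: delta_mx 0 i : 'rV_p).
pose Y : 'M[R]_q.+1 := 1%:M - S0 *m D.
have S0D : S0 *m D = delta_mx j 0 *m r.
  by rewrite /S0 -mulmxA -scalemxAl -rowE.
have YE k : Y k j = 0.
  rewrite /Y S0D !mxE big_ord1 -[r]/(r) rj !mxE eqxx andbT mulr1.
  by case: (k == j); rewrite subrr.
pose pi : 'M[R]_(q.+1, q) := col' j Y.
pose io : 'M[R]_(q, q.+1) := row' j 1%:M.
have ioE n l : io n l = (lift j n == l)%:R by rewrite !mxE.
have iodelta : io *m delta_mx j (0 : 'I_1) = 0.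
  apply/matrixP => k l; rewrite -colE !mxE.
  by rewrite eq_sym (negbTE (neq_lift j k)).
have iopi : io *m pi = 1%:M.
  have -> : io *m pi = col' j (io *m Y).
    by apply/matrixP => k l; rewrite !mxE; apply: eq_bigr => n _; rewrite !mxE.
  rewrite mulmxBr mulmx1 S0D mulmxA iodelta mul0mx subr0.
  by apply/matrixP => k l; rewrite !mxE (inj_eq lift_inj).
have piio : pi *m io = Y.
  apply/matrixP => k l; rewrite mxE.
  have [->|lj] := eqVneq l j.
    by rewrite YE big1 // => n _; rewrite ioE eq_sym (negbTE (neq_lift j n)) mulr0.
  case: (unliftP j l) lj => [l' ->|->]; last by rewrite eqxx.
  move=> _; rewrite (bigD1 l') //= big1 ?addr0.
    by rewrite mxE ioE eqxx mulr1.
  by move=> n nl; rewrite ioE (inj_eq lift_inj) (negbTE nl) mulr0.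
have [b [s [y [S [sy ys my]]]]] := IH (D *m pi).
exists b, (s *m io), (pi *m y), (S0 + pi *m S *m (1%:M - D *m S0)); split.
- by rewrite mulmxA -(mulmxA s) iopi mulmx1.
- have -> : pi *m y *m (s *m io) = Y - pi *m S *m D *m Y.
    rewrite -piio -!mulmxA (mulmxA y) -[y *m s](subKr 1%:M) ys.
    by rewrite mulmxBl mulmxBr mul1mx !mulmxA.
  by rewrite opprB addrCA subKr mulmxDl -!mulmxA mulmxBl mul1mx -mulmxA mulmxBr mulmx1 addrC.
- by rewrite mulmxA.
Qed.

End MinimalCover.

Lemma mulVmx_local (R : comNzRingType) (m : set R) p q (mu : 'M[R]_p) (X : 'M[R]_(p, q)) :
  noetherian R -> local_ring m -> mxin m mu -> X = mu *m X -> X = 0.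
Proof.
move=> hR hm hmu E.
pose U : set 'rV[R]_q := [set z | exists u, z = u *m X].
have hU : submodule U.
  split; first by exists 0; rewrite mul0mx.
  by move=> c _ _ [u ->] [v ->]; exists (c *: u + v); rewrite mulmxDl scalemxAl.
have sub : U `<=` [set 0].
  apply: (nakayama hm (@noeth_rV R q hR) hU (@submodule_zero _ _)) => _ [u ->].
  apply: addSr; first exact: submodule_zero.
  rewrite E mulmx_sum_row; apply: sub_sum => [|i _].
    by apply: submodule_smul => c z Uz; exact: subZ.
  rewrite row_mul mulmx_sum_row scaler_sumr; apply: sub_sum => [|k _].
    by apply: submodule_smul => c z Uz; exact: subZ.
  rewrite scalerA; apply: smul_in; first by rewrite !mxE; apply: (mMl hm); exact: hmu.
  by exists (delta_mx 0 k); rewrite -rowE.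
apply/row_matrixP => i; rewrite row0; apply: sub.
by exists (delta_mx 0 i); rewrite -rowE.
Qed.

(** Acyclicity modulo m makes the cokernel of d_n free: the relations d_n y of its minimal cover
    satisfy d_n y = mu d_n y with mu in m, and vanish by Nakayama's lemma. *)
Lemma acyclic_split (R : comNzRingType) (m : set R) b (d : forall n, 'M[R]_(b n.+1, b n)) n :
  noetherian R -> local_ring m -> cpx d -> ex_at m d n ->
  exists s, d n *m s *m d n = d n.
Proof.
move=> hR hm dd ex; have [k [s [y [S [sy ys my]]]]] := mincover hm (d n).
suff E : d n *m y = 0.
  exists S; rewrite -mulmxA -ys mulmxBr mulmx1 mulmxA E mul0mx subr0 //.
have [mu hmu E] : exists2 mu, mxin m mu & d n *m y - mu *m (d n *m y) = 0.
  have [mu hmu hE] : exists2 mu : 'M_(b n.+1), mxin m mu & mxin [set 0] (d n *m y - mu *m (d n *m y)).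
    apply: mx_rows_in => i.
    pose z' : 'rV_(b n.+1) := row i (1%:M - d n *m S).
    have z'D : z' *m d n = row i (d n *m y) *m s.
      by rewrite -!row_mul mulmxBl mul1mx -[d n *m S *m d n]mulmxA -ys mulmxBr mulmx1 opprB addrCA subrr addr0 mulmxA.
    have [|v hv] := ex z'.
      by rewrite z'D; apply: (mxinMr (m_ideal hm)) => k0 j; rewrite mxE; exact: my.
    exists (z' - v *m d n.+1) => // k0 j.
    rewrite mulmxBl -!mulmxA [d n.+1 *m (d n *m y)]mulmxA dd mul0mx mulmx0 subr0.
    by rewrite mulmxA z'D -mulmxA sy mulmx1 subrr mxE.
  by exists mu => //; apply/matrixP => i j; rewrite (hE i j) mxE.
by apply: (mulVmx_local hR hm hmu); apply/subr0_eq.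
Qed.

(** * Twisted complexes over a regular local ring *)

Section Tower.
Variables (Q : comNzRingType) (m : set Q) (f X : nat -> Q) (c D : nat).
Hypotheses (hQ : noetherian Q) (hm : local_ring m) (fm : forall i, m (f i))
  (fr : reg ([set 0] : set Q^o) f c) (hgX : gens m X D) (Xr : reg ([set 0] : set Q^o) X D).

Let J i : set Q^o := Wx [set 0] f i.
Let hJ i : submodule (J i). Proof. by apply: submodule_Wx; exact: submodule_zero. Qed.
Let hmi : ideal m := m_ideal hm.

(* d lifts to Q a complex over Q/(f_0, ..., f_(i-1)); the T j are Eisenbud's operators. *)
Definition twisted i b (d : forall n, 'M[Q]_(b n.+1, b n)) (T : nat -> forall n, 'M[Q]_(b n.+2, b n)) :=
  forall n, d n.+1 *m d n = \sum_(j < i) f j *: T j n.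

Lemma J_m i : J i `<=` m.
Proof.
apply: Wx_min => [|z ->|j v _]; [exact: hmi|exact: (m0 hm)|].
by apply: (mMr hm); exact: fm.
Qed.

Lemma mxin_sum_f p q i (U : nat -> 'M[Q]_(p, q)) : mxin m (\sum_(j < i) f j *: U j).
Proof. by apply: (mxin_sum hmi) => j _; apply: (mxinZ hmi). Qed.

Section Twisted.
Variables (i : nat) (ic : (i <= c)%N) (b : nat -> nat) (d : forall n, 'M[Q]_(b n.+1, b n)).
Variables (T : nat -> forall n, 'M[Q]_(b n.+2, b n)) (tw : twisted i d T).

Lemma twisted_cpxm : cpxm m d.
Proof. by move=> n; rewrite tw; exact: (mxin_sum_f i (fun j => T j n)). Qed.

Lemma twisted_comm n : \sum_(j < i) f j *: (T j n.+1 *m d n - d n.+2 *m T j n) = 0.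
Proof.
under eq_bigr do rewrite scalerBr; rewrite sumrB.
under eq_bigr do rewrite scalemxAl; rewrite -mulmx_suml -tw.
under [X in _ - X]eq_bigr do rewrite scalemxAr; rewrite -mulmx_sumr -tw.
by rewrite mulmxA subrr.
Qed.

(** Computing d d d in two ways gives sum_j f_j [T_j, d] = 0, a relation on a regular sequence. *)
Lemma twisted_chain j n : (j < i)%N -> mxin (J i) (T j n.+1 *m d n - d n.+2 *m T j n).
Proof.
move=> ji; apply: (mx_koszul_relation (x := f) (D := c) fr ic
  (M := fun j => T j n.+1 *m d n - d n.+2 *m T j n)) => //.
exact: twisted_comm.
Qed.

Lemma twisted_chainm j : (j < i)%N -> chainm m d (T j).
Proof. by move=> ji n; apply: (mxin_sub (@J_m i)); exact: twisted_chain. Qed.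

End Twisted.

(* Passage from Q/(f_0, ..., f_i) to Q/(f_0, ..., f_(i-1)). *)
Section Down.
Variables (i : nat) (ic : (i < c)%N) (b : nat -> nat) (d : forall n, 'M[Q]_(b n.+1, b n)).
Variables (T : nat -> forall n, 'M[Q]_(b n.+2, b n)) (tw : twisted i.+1 d T).
Let G := cone d (T i) (- f i).

(** The entry -f_i cancels the term f_i T_i of d d. The corner of the square is [T_i, d]; f_i times
    it lies in (f_0, ..., f_(i-1)), hence so does [T_i, d] itself, and its coefficients are the
    [U j]. *)
Lemma down_ops : exists U : nat -> forall n, 'M[Q]_(b n.+3, b n),
  twisted i G (fun j => cone_op (T j) (U j)).
Proof.
have /dep_choice[U UP] n : exists U : nat -> 'M[Q]_(b n.+3, b n),
    T i n.+1 *m d n - d n.+2 *m T i n = \sum_(j < i) f j *: U j.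
  apply/mxin_Wx; apply: (mx_reg (x := f) fr ic).
  have := twisted_comm tw n; rewrite big_ord_recr /= => /eqP; rewrite addrC addr_eq0 => /eqP ->.
  apply: (mxinN (hJ i)); apply/mxin_Wx; exists (fun j => T j n.+1 *m d n - d n.+2 *m T j n).
  by [].
exists (fun j n => U n j) => n; rewrite cone_sq /cone_op (sum_block i f (fun j => T j n) (fun j => U n j) (fun j => T j n.+1)).
have E k : d k.+1 *m d k + - f i *: T i k = \sum_(j < i) f j *: T j k.
  by rewrite tw big_ord_recr /= scaleNr addrK.
by rewrite !E UP.
Qed.

(** For a cycle (u, v) of the cone, v is a cycle of [d] modulo f_0, ..., f_i. Writing it as a
    boundary v' d plus W + f_i P and dividing the cycle condition by f_i expresses u through P and
    v'. *)
Lemma down_exact : (forall n, ex_at (J i.+1) d n) -> forall n, ex_at (J i) G n.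
Proof.
move=> ex n w; rewrite -[w]hsubmxK; set u := lsubmx w; set v := rsubmx w.
rewrite mul_row_cone => /mxin_row [h1 h2].
have lt : (i < i.+1)%N by [].
have hv : mxin (J i.+1) (v *m d n.+1).
  rewrite -[v *m _](subKr (- f i *: u)); apply: (mxinB (hJ i.+1)).
    by rewrite scaleNr; apply: (mxinN (hJ i.+1)); exact: mxin_xZ.
  exact: (mxin_leq (leqnSn i)).
have [v' /mxin_WxS [W [P [hW vE]]]] := ex n.+1 v hv.
have {}vE : v = v' *m d n.+2 + (W + f i *: P) by rewrite -vE addrC subrK.
have hu : mxin (J i) (u + (P *m d n.+1 + v' *m T i n.+1)).
  apply: (mx_reg (x := f) fr ic).
  have -> : f i *: (u + (P *m d n.+1 + v' *m T i n.+1)) =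
      - (- f i *: u - v *m d n.+1) - W *m d n.+1 - v' *m \sum_(j < i) f j *: T j n.+1.
    have E : \sum_(j < i) f j *: T j n.+1 = d n.+2 *m d n.+1 - f i *: T i n.+1.
      by rewrite tw big_ord_recr /= addrK.
    rewrite E vE !mulmxDl mulmxBr -!scalemxAl -!scalemxAr mulmxA scaleNr !scalerDr.
    rewrite !opprD !opprK -!addrA; congr (_ + _).
    rewrite [RHS]addrCA addrC !addrA; apply/eqP; rewrite -subr_eq0; apply/eqP.
    by apply/matrixP => k l; rewrite !mxE; ring.
  apply: (mxinB (hJ i)); last first.
    by rewrite mulmx_sumr; apply: (mxin_sum (hJ i)) => j _; rewrite -scalemxAr; exact: mxin_xZ.
  by apply: (mxinB (hJ i)); [exact: (mxinN (hJ i))|exact: (mxinMr (hJ i))].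
exists (row_mx (- P) (- v')); rewrite mul_row_cone subr_row; apply/mxin_row; split.
  by rewrite !mulNmx -opprD opprK.
rewrite mulNmx opprK scalerN scaleNr opprK vE addrC opprD addrACA addrA addrK.
by rewrite addrC addrK.
Qed.

(** Acyclicity of the cone makes T_i injective on the homology of [d], where it is also
    nilpotent. *)
Lemma down_acyclic : chainm m d (T i) -> nilp m d (T i) ->
  (exists n0, forall n, (n0 <= n)%N -> ex_at m G n) ->
  exists n0, forall n, (n0 <= n)%N -> ex_at m d n.
Proof.
move=> ch [k [n1 nil]] [n0 ex]; have hs : m (- f i) by apply: (mN hm).
exists (n0 + n1 + 2 * k)%N => n le u hu.
have cpxd := twisted_cpxm tw.
have kill : killed m d (T i) k u by apply: nil => //; lia.
apply: (killed_bd hmi (n0 := n0) ch _ _ _ kill) => //; last by lia.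
move=> n' v le' cv hb; exact: (cone_inj hmi hs (ex _ le') cv hb).
Qed.

(** If d y = W + f_i P, the column (y, P) is a cocycle of the cone, and the first component of a
    preimage solves the problem modulo f_i. *)
Lemma down_dual :
  (exists n0, forall n, (n0 <= n)%N -> forall y : 'cV_(cone_rk b n.+1), mxin (J i) (G n.+1 *m y) ->
    exists y', mxin (J i) (y - G n *m y')) ->
  exists n0, forall n, (n0 <= n)%N -> forall y : 'cV_(b n.+1), mxin (J i.+1) (d n.+1 *m y) ->
    exists y', mxin (J i.+1) (y - d n *m y').
Proof.
move=> [n0 h]; exists n0 => n le y /mxin_WxS [W [P [hW E]]].
have [|z] := h n le (col_mx y P).
  rewrite mul_cone_col; apply/mxin_col; split.
    by rewrite E scaleNr addrK.
  apply: (mx_reg (x := f) fr ic).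
  have -> : f i *: (T i n.+1 *m y - d n.+2 *m P) =
      d n.+2 *m W - \sum_(j < i) f j *: (T j n.+1 *m y).
    have E1 : d n.+2 *m (d n.+1 *m y) = \sum_(j < i) f j *: (T j n.+1 *m y) + f i *: (T i n.+1 *m y).
      rewrite mulmxA tw mulmx_suml big_ord_recr /= -scalemxAl; congr (_ + _).
      by apply: eq_bigr => j _; rewrite scalemxAl.
    rewrite E mulmxDr -scalemxAr in E1; rewrite scalerBr.
    have -> : d n.+2 *m W = \sum_(j < i) f j *: (T j n.+1 *m y) + f i *: (T i n.+1 *m y)
      - f i *: (d n.+2 *m P) by rewrite -E1 addrK.
    by rewrite -[X in _ = X - _]addrA [RHS]addrC addKr.
  apply: (mxinB (hJ i)); first exact: (mxinMl (hJ i)).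
  by apply: (mxin_sum (hJ i)) => j _; exact: mxin_xZ.
rewrite -[z]vsubmxK mul_cone_col opp_col_mx add_col_mx => /mxin_col [h1 _].
exists (usubmx z); have -> : y - d n *m usubmx z =
   (y - (d n *m usubmx z + - f i *: dsubmx z)) - f i *: dsubmx z.
  by rewrite scaleNr opprD opprK addrA addrK.
apply: (mxinB (hJ i.+1)); first exact: (mxin_leq (leqnSn i)).
exact: mxin_xZ.
Qed.

End Down.

(** Induction on i, the remaining operators staying nilpotent on the cone. For i = 0 the complex is
    exact over Q, and modulo the regular sequence [X] it stays exact from degree D on. *)
Lemma twisted_acyclic i b (d : forall n, 'M[Q]_(b n.+1, b n)) T : (i <= c)%N -> twisted i d T ->
  (forall n, ex_at (J i) d n) -> (forall j, (j < i)%N -> nilp m d (T j)) ->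
  exists n0, forall n, (n0 <= n)%N -> ex_at m d n.
Proof.
elim: i b d T => [|i IH] b d T ic tw ex nil.
  have dd : cpx d by move=> n; rewrite tw big_ord0.
  have exd : exact d.
    move=> n u h; have [|v hv] := ex n u; first by rewrite h; exact: (mxin0 (hJ 0)).
    by exists v; apply/subr0_eq/matrixP => k l; rewrite (hv k l) mxE.
  exists D => n Dn; have := ex_at_regular Xr dd exd (leqnn D) Dn.
  by rewrite (Wx_gens hm hgX).
have [U twG] := down_ops ic tw.
have chT j : (j < i.+1)%N -> chainm m d (T j) by exact: (twisted_chainm ic tw).
have ic' := ltnW ic.
refine (down_acyclic ic tw (chT i _) (nil i _) _) => //.
apply: (IH _ _ _ ic' twG); first exact: (down_exact ic tw).
move=> j ji; refine (nilp_ext hmi (chT i _) _ (U := U j) _ (nil j _)) => //.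
- exact: (mN hm).
- exact: (twisted_chainm ic' twG ji).
- exact: ltnW.
Qed.

(** For i = 0 the complex is acyclic modulo m in high degrees, so it splits there, and split
    exactness passes to the transposes. *)
Lemma twisted_dual i b (d : forall n, 'M[Q]_(b n.+1, b n)) T : (i <= c)%N -> twisted i d T ->
  (forall n, ex_at (J i) d n) ->
  exists n0, forall n, (n0 <= n)%N -> forall y : 'cV_(b n.+1), mxin (J i) (d n.+1 *m y) ->
    exists y', mxin (J i) (y - d n *m y').
Proof.
elim: i b d T => [|i IH] b d T ic tw ex; last first.
  have [U twG] := down_ops ic tw; apply: (down_dual ic tw).
  exact: (IH _ _ _ (ltnW ic) twG (down_exact ic tw ex)).
have [|n0 acy] := @twisted_acyclic 0 b d T ic tw ex; first by [].
have dd : cpx d by move=> n; rewrite tw big_ord0.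
exists n0 => n le y hy.
have dy : d n.+1 *m y = 0 by apply/matrixP => k l; rewrite (hy k l) mxE.
have [s sE] := acyclic_split hQ hm dd (acy n le).
have [Y YE] : exists Y, 1%:M - d n *m s = Y *m d n.+1.
  apply: mx_rows => k; have [|v hv] := ex n (row k (1%:M - d n *m s)).
    by rewrite -row_mul mulmxBl mul1mx sE subrr row0; exact: (mxin0 (hJ 0)).
  by exists v; apply/subr0_eq/matrixP => k' l; rewrite (hv k' l) mxE.
exists (s *m y); rewrite mulmxA -{1}[y]mul1mx -mulmxBl YE -mulmxA dy mulmx0.
exact: (mxin0 (hJ 0)).
Qed.

End Tower.

(** * Chain maps and homotopies *)

Lemma seq_choice (T : nat -> Type) (I : forall n, T n -> Prop) (P : forall n, T n -> T n.+1 -> Prop)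
    (x0 : T 0%N) : I 0%N x0 -> (forall n x, I n x -> exists y, P n x y /\ I n.+1 y) ->
  exists f : forall n, T n, f 0%N = x0 /\ forall n, P n (f n) (f n.+1).
Proof.
move=> I0 step.
have /dep_choice[nxt nxtP] (s : {n : nat & {x : T n | I n x}}) :
    exists y : {y : T (projT1 s).+1 | I (projT1 s).+1 y},
      P (projT1 s) (sval (projT2 s)) (sval y).
  by case: s => n [x Ix]; have [y [Py Iy]] := step n x Ix; exists (exist _ y Iy).
pose g := fix g n : {x : T n | I n x} := match n with
  | 0%N => exist _ x0 I0 | n'.+1 => nxt (existT _ n' (g n')) end.
exists (fun n => sval (g n)); split=> // n.
exact: (nxtP (existT _ n (g n))).
Qed.

Section Lifting.
Variables (R : comNzRingType) (b b' : nat -> nat).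
Variables (d : forall n, 'M[R]_(b n.+1, b n)) (d' : forall n, 'M[R]_(b' n.+1, b' n)).
Hypotheses (ex : exact d) (dd' : cpx d').

Lemma exact_mx n p (X : 'M_(p, b n.+1)) : X *m d n = 0 -> exists Y, X = Y *m d n.+1.
Proof.
move=> h; apply: mx_rows => i; have [|v ->] := ex (u := row i X); last by exists v.
by rewrite -row_mul h row0.
Qed.

Lemma chain_extend (e0 : 'M_(b' 0, b 0)) : (exists z, z *m d 0 = d' 0 *m e0) ->
  exists e : forall n, 'M_(b' n, b n), e 0 = e0 /\ forall n, e n.+1 *m d n = d' n *m e n.
Proof.
move=> h0.
apply: (@seq_choice (fun n => 'M_(b' n, b n)) (fun n x => exists z, z *m d n = d' n *m x)
  (fun n x y => y *m d n = d' n *m x) e0 h0) => n x [z zE]; exists z; split=> //.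
have [|y yE] := @exact_mx n _ (d' n.+1 *m z); last by exists y.
by rewrite -mulmxA zE mulmxA dd' mul0mx.
Qed.

Lemma homotopy_extend (w : forall n, 'M_(b' n, b n)) (h0 : 'M_(b' 0, b 1)) :
  (forall n, w n.+1 *m d n = d' n *m w n) -> w 0 = h0 *m d 0 ->
  exists h : forall n, 'M_(b' n, b n.+1), h 0 = h0 /\
    forall n, w n.+1 = h n.+1 *m d n.+1 + d' n *m h n.
Proof.
move=> ch w0.
apply: (@seq_choice (fun n => 'M_(b' n, b n.+1)) (fun n h => (w n.+1 - d' n *m h) *m d n = 0)
  (fun n h h' => w n.+1 = h' *m d n.+1 + d' n *m h) h0).
  by rewrite mulmxBl ch -mulmxA -w0 subrr.
move=> n h /exact_mx [h' hE].
have E : w n.+1 = h' *m d n.+1 + d' n *m h by rewrite -hE subrK.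
exists h'; split=> //.
by rewrite mulmxBl ch -mulmxA -mulmxBr E [_ + d' n *m h]addrC addrK mulmxA dd' mul0mx.
Qed.

End Lifting.

(** * Lifting complexes to Q and making the operators nilpotent *)

Section Reduction.
Variables (A : comNzRingType) (m : set A) (hA : noetherian A) (hm : local_ring m).
Variables (B Q : comNzRingType) (phi : {rmorphism A -> B}) (g : {rmorphism Q -> B}) (mQ : set Q).
Variables (f X : nat -> Q) (c DX : nat).
Hypothesis st : ci_structure m phi g mQ f X c DX.

Let hQ : noetherian Q. Proof. by have [[]] := st. Qed.
Let hmQ : local_ring mQ. Proof. by have [[]] := st. Qed.
Let g_surj b : exists q, g q = b. Proof. by have [[]] := st. Qed.
Let g_ker q : g q = 0 <-> Wx ([set 0] : set Q^o) f c q. Proof. by have [[]] := st. Qed.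
Let flat p q s (D1 : 'M[A]_(p, q)) (D2 : 'M[A]_(q, s)) :
  (forall u : 'rV_q, u *m D2 = 0 -> exists v, u = v *m D1) ->
  forall u : 'rV[B]_q, u *m map_mx phi D2 = 0 -> exists v, u = v *m map_mx phi D1.
Proof. by have [_ [[h _ _ _] _]] := st; exact: h. Qed.
Let approx q : exists a q', g q' = phi a /\ mQ (q - q').
Proof. by have [_ [[_ _ h _] _]] := st; exact: h. Qed.
Let res a q : g q = phi a -> (mQ q <-> m a).
Proof. by have [_ [[_ _ _ h] _]] := st; exact: h. Qed.
Let fm i : mQ (f i). Proof. by have [_ [_ []]] := st. Qed.
Let fr : reg ([set 0] : set Q^o) f c. Proof. by have [_ [_ []]] := st. Qed.
Let hgX : gens mQ X DX. Proof. by have [_ [_ []]] := st. Qed.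
Let Xr : reg ([set 0] : set Q^o) X DX. Proof. by have [_ [_ []]] := st. Qed.
Let hmi : ideal mQ := m_ideal hmQ.

Lemma lift_mx p q (Y : 'M[B]_(p, q)) : exists Z, map_mx g Z = Y.
Proof.
have /choice[h hP] (k : 'I_p * 'I_q) : exists z, g z = Y k.1 k.2 by exact: g_surj.
by exists (\matrix_(i, j) h (i, j)); apply/matrixP => i j; rewrite !mxE hP.
Qed.

Lemma ker_mx p q (Z : 'M[Q]_(p, q)) : map_mx g Z = 0 <-> mxin (Wx ([set 0] : set Q^o) f c) Z.
Proof.
split=> [/matrixP h i j|h]; first by apply/g_ker; have := h i j; rewrite !mxE.
by apply/matrixP => i j; rewrite !mxE; apply/g_ker.
Qed.

Lemma ker_mx_m p q (Z : 'M[Q]_(p, q)) : map_mx g Z = 0 -> mxin mQ Z.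
Proof. by move=> /ker_mx; apply: mxin_sub; exact: (J_m hmQ fm). Qed.

Lemma res_mx p q (Y : 'M[A]_(p, q)) (Z : 'M[Q]_(p, q)) : map_mx g Z = map_mx phi Y ->
  (mxin mQ Z <-> mxin m Y).
Proof.
move=> /matrixP E; split=> h i j.
  by apply/(res (q := Z i j)) => //; have := E i j; rewrite !mxE.
by apply/(res (a := Y i j)) => //; have := E i j; rewrite !mxE.
Qed.

Lemma approx_mx p q (Z : 'M[Q]_(p, q)) : exists (Y : 'M[A]_(p, q)) Z',
  map_mx g Z' = map_mx phi Y /\ mxin mQ (Z - Z').
Proof.
have /choice[h hP] (k : 'I_p * 'I_q) : exists aq : A * Q,
    g aq.2 = phi aq.1 /\ mQ (Z k.1 k.2 - aq.2).
  by have [a [q' [h1 h2]]] := approx (Z k.1 k.2); exists (a, q').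
exists (\matrix_(i, j) (h (i, j)).1), (\matrix_(i, j) (h (i, j)).2); split.
  by apply/matrixP => i j; rewrite !mxE; have [] := hP (i, j).
by move=> i j; rewrite !mxE; have [] := hP (i, j).
Qed.

Definition lifted b (d : forall n, 'M[A]_(b n.+1, b n)) (D : forall n, 'M[Q]_(b n.+1, b n))
    (T : nat -> forall n, 'M[Q]_(b n.+2, b n)) :=
  (forall n, map_mx g (D n) = map_mx phi (d n)) /\ twisted f c D T.

Lemma twisted_exists b (d : forall n, 'M[A]_(b n.+1, b n)) (D : forall n, 'M[Q]_(b n.+1, b n)) :
  cpx d -> (forall n, map_mx g (D n) = map_mx phi (d n)) -> exists T, twisted f c D T.
Proof.
move=> dd DE; have /dep_choice[T TP] n : exists U : nat -> 'M[Q]_(b n.+2, b n),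
    D n.+1 *m D n = \sum_(j < c) f j *: U j.
  by apply/mxin_Wx/ker_mx; rewrite map_mxM !DE -map_mxM dd map_mx0.
by exists (fun j n => T n j).
Qed.

Lemma lifted_exists b (d : forall n, 'M[A]_(b n.+1, b n)) : cpx d -> exists D T, lifted d D T.
Proof.
move=> dd; have /dep_choice[D' DE] n : exists Z, map_mx g Z = map_mx phi (d n) by exact: lift_mx.
by have [T tw] := twisted_exists dd DE; exists D', T.
Qed.

Lemma lifted_exact b (d : forall n, 'M[A]_(b n.+1, b n)) D T : exact d -> lifted d D T ->
  forall n, ex_at (Wx ([set 0] : set Q^o) f c) D n.
Proof.
move=> ex [DE _] n u /ker_mx; rewrite map_mxM DE => h.
have [v vE] := flat (ex n) h; have [v' v'E] := lift_mx v.
by exists v'; apply/ker_mx; rewrite map_mxB map_mxM DE v'E vE subrr.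
Qed.

(** A preimage over Q may be replaced by one that comes from A and has the same residue. *)
Lemma lifted_acyclic b (d : forall n, 'M[A]_(b n.+1, b n)) D T n : lifted d D T ->
  ex_at mQ D n -> ex_at m d n.
Proof.
move=> [DE _] ex u hu; have [u' u'E] := lift_mx (map_mx phi u).
have [|v hv] := ex u'; first by apply/(res_mx (Y := u *m d n)); rewrite ?map_mxM ?u'E ?DE.
have [y [v' [v'E hv']]] := approx_mx v.
exists y; apply/(res_mx (Z := u' - v' *m D n.+1)); first by rewrite map_mxB map_mxM u'E v'E DE map_mxB map_mxM.
apply: (mxin_trans hmi hv); rewrite -mulmxBl; exact: (mxinMr hmi).
Qed.

Lemma flat_exact b (d : forall n, 'M[A]_(b n.+1, b n)) : exact d -> exact (fun n => map_mx phi (d n)).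
Proof. by move=> ex n u; apply: flat; exact: ex. Qed.

(* An operator T over Q is approximated, up to homotopy and modulo the maximal
   ideal, by a chain map over A: the truncated chain maps over B are generated by
   those over A, by flatness. *)
Lemma approximate_operator b (d : forall n, 'M[A]_(b n.+1, b n)) D (T : forall n, 'M[Q]_(b n.+2, b n)) :
  cpx d -> exact d -> (forall n, map_mx g (D n) = map_mx phi (d n)) ->
  (forall n, map_mx g (T n.+1 *m D n) = map_mx g (D n.+2 *m T n)) ->
  exists e, chain d e /\ exists Th, (forall n, map_mx g (Th n) = map_mx phi (e n)) /\
    forall n (v : 'rV_(b n.+2)), cyc mQ D v -> bd mQ D (v *m T n - v *m Th n).
Proof.
move=> dd ex DE TE.
(* The kernel of [S] consists of the truncated chain maps (e_0, e_1) with d_2 e_0 = e_1 d_0. Over A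
   it has finitely many generators, each of which extends to a chain map as [d] is exact; by
   flatness these generate the kernel over B, which contains the images of T_0 and T_1. *)
pose S : 'M[A]_(b 2 * b 0 + b 3 * b 1, b 3 * b 0) :=
  col_mx (lin_mx (mulmx (d 2))) (- lin_mx (mulmxr (d 0))).
have SE (u : 'M[A]_(b 2, b 0)) (v : 'M[A]_(b 3, b 1)) :
    row_mx (mxvec u) (mxvec v) *m S = mxvec (d 2 *m u - v *m d 0).
  by rewrite mul_row_col mulmxN !mul_vec_lin linearB.
have [p [D1 D1P]] := ker_fg S hA.
have /dep_choice[e eP] (k : 'I_p) : exists e : forall n, 'M[A]_(b n.+2, b n),
    e 0 = vec_mx (lsubmx (row k D1)) /\ chain d e.
  apply: (chain_extend (b' := fun n => b n.+2) (d' := fun n => d n.+2) ex) => [n|]; first exact: dd.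
  exists (vec_mx (rsubmx (row k D1))).
  have : row k D1 *m S = 0 by apply/D1P; exists (delta_mx 0 k); rewrite -rowE.
  rewrite -{1}[row k D1]hsubmxK -[lsubmx _]vec_mxK -[rsubmx _]vec_mxK SE => /eqP.
  by rewrite !vec_mxK mxvec_eq0 subr_eq0 => /eqP.
have SphiE : map_mx phi S = col_mx (lin_mx (mulmx (map_mx phi (d 2)))) (- lin_mx (mulmxr (map_mx phi (d 0)))).
  rewrite map_col_mx map_mxN; congr (col_mx _ (- _)); apply: map_lin_mx => v; exact: map_mxM.
have [|v vE] := flat (fun u h => proj1 (D1P u) h)
    (u := row_mx (mxvec (map_mx g (T 0))) (mxvec (map_mx g (T 1)))).
  rewrite SphiE mul_row_col mulmxN !mul_vec_lin /= -!DE -!map_mxM -TE subrr //.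
have T0E : map_mx g (T 0) = \sum_k v 0 k *: map_mx phi (e k 0).
  have := congr1 (fun x : 'rV_(b 2 * b 0 + b 3 * b 1) => vec_mx (lsubmx x)) vE.
  rewrite row_mxKl mxvecK => ->.
  rewrite mulmx_sum_row linear_sum linear_sum; apply: eq_bigr => k _.
  have [-> _] := eP k; rewrite !linearZ /= -map_row -map_lsubmx map_vec_mx //.
(* The coefficients in B are replaced by elements of A: [(q k).2] lifts v_k to Q, and [(q k).1.2]
   lifts the element [(q k).1.1] of A that has the same residue. *)
have /choice[q qP] (k : 'I_p) : exists aq : A * Q * Q,
    [/\ g aq.2 = v 0 k, g aq.1.2 = phi aq.1.1 & mQ (aq.2 - aq.1.2)].
  have [z gz] := g_surj (v 0 k); have [a [z' [h1 h2]]] := approx z.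
  by exists (a, z', z).
pose eta n := \sum_k (q k).1.1 *: e k n.
have ch_eta : chain d eta.
  move=> n; rewrite mulmx_suml mulmx_sumr; apply: eq_bigr => k _.
  by have [_ ch] := eP k; rewrite -scalemxAl ch scalemxAr.
exists eta; split=> //.
have /dep_choice[E EE] (k : 'I_p) : exists Z : forall n, 'M[Q]_(b n.+2, b n),
    forall n, map_mx g (Z n) = map_mx phi (e k n).
  exact: (dep_choice (T := fun n => 'M[Q]_(b n.+2, b n))
    (P := fun n Z => map_mx g Z = map_mx phi (e k n)) (fun n => lift_mx _)).
have /dep_choice[Th ThE] n : exists Z, map_mx g Z = map_mx phi (eta n) by exact: lift_mx.
exists Th; split=> //.
(* Over B, the operator and the combination of the e_k agree in degree 0, hence are homotopic. *)
pose w n : 'M[B]_(b n.+2, b n) := map_mx g (T n) - \sum_k v 0 k *: map_mx phi (e k n).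
have wch n : w n.+1 *m map_mx phi (d n) = map_mx phi (d n.+2) *m w n.
  rewrite mulmxBl mulmxBr -!DE -!map_mxM TE; congr (_ - _).
  rewrite mulmx_suml mulmx_sumr; apply: eq_bigr => k _; have [_ ch] := eP k.
  by rewrite !DE -scalemxAl -scalemxAr -!map_mxM ch.
have [n|||h [_ hE]] := @homotopy_extend B b (fun n => b n.+2) (fun n => map_mx phi (d n))
    (fun n => map_mx phi (d n.+2)) (flat_exact ex) _ w 0.
- by rewrite -map_mxM dd map_mx0.
- exact: wch.
- by rewrite mul0mx /w T0E subrr.
have /dep_choice[H HE] n : exists Z, map_mx g Z = h n by exact: lift_mx.
have key n : map_mx g (T n - Th n - \sum_k ((q k).2 - (q k).1.2) *: E k n) = w n.
  rewrite !map_mxB ThE /w /eta -addrA -opprD; congr (_ - _).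
  rewrite !raddf_sum /= -big_split; apply: eq_bigr => k _ /=; have [h1 h2 _] := qP k.
  rewrite !map_mxZ EE rmorphB h1 h2 -scalerDl addrC subrK //.
have mE n : mxin mQ (\sum_k ((q k).2 - (q k).1.2) *: E k n).
  by apply: (mxin_sum hmi) => k _; apply: (mxinZ hmi); have [] := qP k.
move=> n z cz; rewrite -mulmxBr.
case: n z cz => [|n] z cz.
  exists 0; rewrite mul0mx subr0; apply: (mxinMl hmi); apply: (mxin_addr hmi) (mE 0%N).
  by apply: ker_mx_m; rewrite key /w T0E subrr.
exists (z *m H n.+1); rewrite -mulmxA -mulmxBr.
have R : mxin mQ (T n.+1 - Th n.+1 - \sum_k ((q k).2 - (q k).1.2) *: E k n.+1
    - H n.+1 *m D n.+1 - D n.+2 *m H n).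
  by apply: ker_mx_m; rewrite map_mxB map_mxB key hE !map_mxM !HE !DE addrAC addrK subrr.
have -> : T n.+1 - Th n.+1 - H n.+1 *m D n.+1 =
   (T n.+1 - Th n.+1 - \sum_k ((q k).2 - (q k).1.2) *: E k n.+1
    - H n.+1 *m D n.+1 - D n.+2 *m H n) + \sum_k ((q k).2 - (q k).1.2) *: E k n.+1 + D n.+2 *m H n.
  set a := T n.+1 - Th n.+1; by rewrite [RHS]addrAC subrK [a - _ - _]addrAC subrK.
rewrite mulmxDr; apply: (mxinD hmi); last by rewrite mulmxA; exact: (mxinMr hmi).
by apply: (mxinMl hmi); apply: (mxinD hmi).
Qed.

(* Coning off a chain map that approximates the operator T i makes it nilpotent. *)
Lemma reduction_step b (d : forall n, 'M[A]_(b n.+1, b n)) D T i : (i < c)%N ->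
  lifted d D T -> cpx d -> exact d -> (forall j, (j < i)%N -> nilp mQ D (T j)) ->
  exists e, chain d e /\ exists D' T', lifted (cone d e 0) D' T' /\
    forall j, (j < i.+1)%N -> nilp mQ D' (T' j).
Proof.
move=> ic [DE tw] dd ex nil.
have cm := twisted_cpxm hmQ fm tw.
have chT j : (j < c)%N -> chainm mQ D (T j) by exact: (twisted_chainm hmQ fm fr (leqnn c) tw).
have TE n : map_mx g (T i n.+1 *m D n) = map_mx g (D n.+2 *m T i n).
  apply/subr0_eq; rewrite -map_mxB; apply/ker_mx.
  exact: (twisted_chain fr (leqnn c) tw).
have [e [ch [Th [ThE hTh]]]] := approximate_operator dd ex DE TE.
exists e; split=> //.
have /dep_choice[U UP] n : exists U : nat -> 'M[Q]_(b n.+3, b n),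
    Th n.+1 *m D n - D n.+2 *m Th n = \sum_(j < c) f j *: U j.
  by apply/mxin_Wx/ker_mx; rewrite map_mxB !map_mxM !ThE !DE -!map_mxM ch subrr.
exists (cone D Th 0), (fun j => cone_op (T j) (fun n => U n j)).
have cTh : chainm mQ D Th by move=> n; rewrite UP; exact: (mxin_sum_f hmQ fm c (fun j => U n j)).
have twG : twisted f c (cone D Th 0) (fun j => cone_op (T j) (fun n => U n j)).
  move=> n; rewrite cone_sq !scale0r !addr0 UP !tw /cone_op.
  by rewrite (sum_block c f (fun j => T j n) (fun j => U n j) (fun j => T j n.+1)).
split.
  split=> // n; rewrite /cone !map_block_mx !map_mxN !DE ThE; congr block_mx.
  by rewrite !map_scalar_mx /= !rmorph0.
have m0Q : mQ 0 by exact: (m0 hmQ).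
move=> j; rewrite ltnS leq_eqVlt => /orP[/eqP ->|ji].
  by apply: (nilp_self hmi cm cTh m0Q _ hTh); exact: (twisted_chainm hmQ fm fr (leqnn c) twG).
have jc := ltn_trans ji ic.
refine (nilp_ext hmi cTh m0Q (U := fun n => U n j) _ (nil j ji)).
exact: (twisted_chainm hmQ fm fr (leqnn c) twG jc).
Qed.

Definition ev_acyclic b (d : forall n, 'M[A]_(b n.+1, b n)) :=
  exists n0, forall n, (n0 <= n)%N -> ex_at m d n.

(** [F] is any property inherited by cones; it will carry the bound on the lengths of Tor. *)
Lemma reduction (F : forall b, (forall n, 'M[A]_(b n.+1, b n)) -> Prop) :
  (forall b (d : forall n, 'M[A]_(b n.+1, b n)) e,
     cpx d -> exact d -> chain d e -> F b d -> F _ (cone d e 0)) ->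
  forall b (d : forall n, 'M[A]_(b n.+1, b n)), cpx d -> exact d -> F b d -> ~ ev_acyclic d ->
  exists b (d : forall n, 'M[A]_(b n.+1, b n)) e,
    [/\ F b d, cpx d, exact d, chain d e & ~ ev_acyclic d] /\ ev_acyclic (cone d e 0).
Proof.
move=> Fcone.
(* Induction on the number k of operators not yet known to be nilpotent. *)
suff key k : forall i b (d : forall n, 'M[A]_(b n.+1, b n)) D T, (i + k)%N = c -> lifted d D T ->
    cpx d -> exact d -> (forall j, (j < i)%N -> nilp mQ D (T j)) -> F b d -> ~ ev_acyclic d ->
    exists b (d : forall n, 'M[A]_(b n.+1, b n)) e,
    [/\ F b d, cpx d, exact d, chain d e & ~ ev_acyclic d] /\ ev_acyclic (cone d e 0).
  move=> b d dd ex Fd nd; have [D [T l]] := lifted_exists dd.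
  exact: (key c 0%N b d D T (add0n c) l dd ex _ Fd nd).
elim: k => [|k IH] i b d D T ikc l dd ex nil Fd nd.
  exfalso; apply: nd; rewrite addn0 in ikc.
  have [n0 h] := twisted_acyclic hmQ fm fr hgX Xr (leqnn c) l.2 (lifted_exact ex l)
    (fun j jc => nil j (eq_ind_r (fun i => (j < i)%N) jc ikc)).
  by exists n0 => n /h; exact: (lifted_acyclic l).
have ic : (i < c)%N by lia.
have [e [ch [D' [T' [l' nil']]]]] := reduction_step ic l dd ex nil.
have [acy|nacy] := pselect (ev_acyclic (cone d e 0)); first by exists b, d, e; split.
apply: (IH i.+1 _ (cone d e 0) D' T') => //; first by lia.
- exact: cpx_cone.
- exact: exact_cone.
- exact: Fcone.
Qed.

(* Dualizing a periodic resolution is exact: A is Gorenstein. *)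
Lemma periodic_dual_exact p (d : 'M[A]_p) : d *m d = 0 ->
  (forall u : 'rV_p, u *m d = 0 -> exists v, u = v *m d) ->
  forall y : 'cV_p, d *m y = 0 -> exists y', y = d *m y'.
Proof.
move=> dd ex y dy.
(* In the constant complex, exactness of the dual in a single high degree is exactness
   everywhere. *)
pose b (n : nat) := p; pose dn (n : nat) : 'M[A]_(b n.+1, b n) := d.
have [D [T l]] := @lifted_exists b dn (fun _ => dd).
have exn : @exact A b dn by move=> n u; exact: ex.
have [n0 h] := twisted_dual hQ hmQ fm fr hgX Xr (leqnn c) l.2 (lifted_exact exn l).
have [y' y'E] := lift_mx (map_mx phi y).
have [|z /ker_mx] := h n0 (leqnn n0) y'.
  by apply/ker_mx; have [DE _] := l; rewrite map_mxM DE y'E -map_mxM dy map_mx0.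
have [DE _] := l; rewrite map_mxB map_mxM DE y'E => /subr0_eq E.
have [_ [[_ reflect _ _] _]] := st.
have [|w wE] := @reflect p p d^T y^T (map_mx g z)^T.
  by rewrite -!map_trmx -trmx_mul E.
by exists w^T; rewrite -[y]trmxK wE trmx_mul trmxK.
Qed.

End Reduction.

(** * Submodules and quotients as modules *)

Section SubModule.
Variables (A : comNzRingType) (M : lmodType A) (U : set M) (hU : submodule U).

(** The proof that [U] is a submodule is an argument of the type, so that the instances of the
    module structure can use it. *)
Definition subm_of (_ : submodule U) : Type := {x : M | U x}.
Local Notation T := (subm_of hU).

HB.instance Definition _ := gen_eqMixin T.
HB.instance Definition _ := gen_choiceMixin T.

Lemma subm_inj (x y : T) : sval x = sval y -> x = y.
Proof. by case: x y => [x hx] [y hy] /= e; subst y; congr exist; exact: Prop_irrelevance. Qed.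

Definition subm_zero : T := exist _ 0 (sub0 hU).
Definition subm_opp (x : T) : T := exist _ (- sval x) (subN hU (svalP x)).
Definition subm_add (x y : T) : T := exist _ (sval x + sval y) (subD hU (svalP x) (svalP y)).
Definition subm_scale (a : A) (x : T) : T := exist _ (a *: sval x) (subZ a hU (svalP x)).

Fact subm_addA : associative subm_add.
Proof. by move=> x y z; apply: subm_inj; exact: addrA. Qed.
Fact subm_addC : commutative subm_add.
Proof. by move=> x y; apply: subm_inj; exact: addrC. Qed.
Fact subm_add0 : left_id subm_zero subm_add.
Proof. by move=> x; apply: subm_inj; exact: add0r. Qed.
Fact subm_addN : left_inverse subm_zero subm_opp subm_add.
Proof. by move=> x; apply: subm_inj; exact: addNr. Qed.

HB.instance Definition _ := GRing.isZmodule.Build T subm_addA subm_addC subm_add0 subm_addN.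

Fact subm_scaleA (a c : A) (x : T) : subm_scale a (subm_scale c x) = subm_scale (a * c) x.
Proof. by apply: subm_inj; exact: scalerA. Qed.
Fact subm_scale1 : left_id 1 subm_scale.
Proof. by move=> x; apply: subm_inj; exact: scale1r. Qed.
Fact subm_scaleDr : right_distributive subm_scale +%R.
Proof. by move=> a x y; apply: subm_inj; exact: scalerDr. Qed.
Fact subm_scaleDl (x : T) : {morph subm_scale^~ x : a c / a + c}.
Proof. by move=> a c; apply: subm_inj; exact: scalerDl. Qed.

HB.instance Definition _ := GRing.Zmodule_isLmodule.Build A T
  subm_scaleA subm_scale1 subm_scaleDr subm_scaleDl.

Definition subm : lmodType A := T.

Fact incl_linear (a : A) (x y : subm) : sval (a *: x + y) = a *: sval x + sval y.
Proof. by []. Qed.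

Definition incl : {linear subm -> M} := mklin (f := fun x : subm => sval x) incl_linear.

Lemma incl_inj : injective incl. Proof. exact: subm_inj. Qed.

Lemma incl_range : range incl = U.
Proof.
apply/seteqP; split=> [_ [x _ <-]|x Ux]; first exact: svalP.
by exists (exist _ x Ux).
Qed.

Lemma incl_in (x : subm) : U (incl x). Proof. exact: svalP. Qed.

End SubModule.

Section QuotientModule.
Variables (A : comNzRingType) (M : lmodType A) (U : set M) (hU : submodule U).

(** The elements are the cosets as subsets of [M]; the operations go through chosen
    representatives. *)
Definition quo_of (_ : submodule U) : Type := {C : set M | exists x, C = [set y | U (y - x)]}.
Local Notation T := (quo_of hU).

HB.instance Definition _ := gen_eqMixin T.
HB.instance Definition _ := gen_choiceMixin T.

Definition cls (x : M) : T := exist _ [set y | U (y - x)] (ex_intro _ x erefl).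
Definition rep (c : T) : M := projT1 (cid (svalP c)).

Lemma clsP x y : cls x = cls y <-> U (x - y).
Proof.
split=> [/(congr1 sval) /= e|h].
  have : [set z | U (z - y)] x by rewrite -e /= subrr; exact: sub0.
  by [].
have E : [set z | U (z - x)] = [set z | U (z - y)].
  apply/seteqP; split=> z /= hz.
    by rewrite -(subrK x z) -addrA; exact: subD.
  by rewrite -(subrK y z) -addrA; apply: subD => //; exact: subBC.
rewrite /cls; move: (ex_intro _ x _) (ex_intro _ y _); rewrite E => p q.
by congr exist; exact: Prop_irrelevance.
Qed.

Lemma repK c : cls (rep c) = c.
Proof.
case: c => C hC; rewrite /rep; case: cid => x /= E; rewrite /cls.
move: (ex_intro _ x _); rewrite -E => p; by congr exist; exact: Prop_irrelevance.
Qed.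

Lemma rep_cls x : U (rep (cls x) - x).
Proof. by apply/clsP; rewrite repK. Qed.

Definition quo_zero : T := cls 0.
Definition quo_opp (x : T) : T := cls (- rep x).
Definition quo_add (x y : T) : T := cls (rep x + rep y).
Definition quo_scale (a : A) (x : T) : T := cls (a *: rep x).

Lemma cls_add x y : quo_add (cls x) (cls y) = cls (x + y).
Proof. by apply/clsP; rewrite opprD addrACA; apply: subD => //; exact: rep_cls. Qed.
Lemma cls_opp x : quo_opp (cls x) = cls (- x).
Proof. by apply/clsP; rewrite opprK addrC; apply: subBC => //; exact: rep_cls. Qed.
Lemma cls_scale a x : quo_scale a (cls x) = cls (a *: x).
Proof. by apply/clsP; rewrite -scalerBr; apply: subZ => //; exact: rep_cls. Qed.

Fact quo_addA : associative quo_add.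
Proof. by move=> x y z; rewrite -(repK x) -(repK y) -(repK z) !cls_add addrA. Qed.
Fact quo_addC : commutative quo_add.
Proof. by move=> x y; rewrite -(repK x) -(repK y) !cls_add addrC. Qed.
Fact quo_add0 : left_id quo_zero quo_add.
Proof. by move=> x; rewrite -(repK x) cls_add add0r. Qed.
Fact quo_addN : left_inverse quo_zero quo_opp quo_add.
Proof. by move=> x; rewrite -(repK x) cls_opp cls_add addNr. Qed.

HB.instance Definition _ := GRing.isZmodule.Build T quo_addA quo_addC quo_add0 quo_addN.

Fact quo_scaleA (a c : A) (x : T) : quo_scale a (quo_scale c x) = quo_scale (a * c) x.
Proof. by rewrite -(repK x) !cls_scale scalerA. Qed.
Fact quo_scale1 : left_id 1 quo_scale.
Proof. by move=> x; rewrite -(repK x) cls_scale scale1r. Qed.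
Fact quo_scaleDr : right_distributive quo_scale +%R.
Proof.
move=> a x y; change (quo_scale a (quo_add x y) = quo_add (quo_scale a x) (quo_scale a y)).
by rewrite -(repK x) -(repK y) cls_add !cls_scale cls_add scalerDr.
Qed.
Fact quo_scaleDl (x : T) : {morph quo_scale^~ x : a c / a + c}.
Proof. move=> a c; change (quo_scale (a + c) x = quo_add (quo_scale a x) (quo_scale c x)).
by rewrite -(repK x) !cls_scale cls_add scalerDl. Qed.

HB.instance Definition _ := GRing.Zmodule_isLmodule.Build A T
  quo_scaleA quo_scale1 quo_scaleDr quo_scaleDl.

Definition quo : lmodType A := T.

Fact proj_linear (a : A) (x y : M) : cls (a *: x + y) = a *: (cls x : quo) + (cls y : quo).
Proof. by rewrite -cls_add -cls_scale. Qed.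

Definition proj : {linear M -> quo} := mklin (f := fun x => cls x : quo) proj_linear.

Lemma proj_eq0 x : proj x = 0 <-> U x.
Proof. by split=> [/clsP|h]; [|apply/clsP]; rewrite subr0. Qed.

Lemma is_quotient_quo : is_quotient U quo.
Proof.
exists proj; split.
  by apply/seteqP; split=> // c _; exists (rep c) => //; exact: repK.
by apply/seteqP; split=> x /proj_eq0.
Qed.

End QuotientModule.

(** * Minimal resolutions *)

Section MinimalResolution.
Variables (A : comNzRingType) (m : set A) (hA : noetherian A) (hm : local_ring m).

Lemma min_cover_sub q (U : set 'rV[A]_q) : submodule U ->
  exists p (d : 'M[A]_(p, q)), (forall x, U x <-> exists v, x = v *m d) /\
    forall v : 'rV_p, v *m d = 0 -> mxin m v.
Proof.
move=> /(sub_rowspace hA) [p0 [D DP]]; have [r [K KP]] := ker_fg D hA.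
have [b [s [y [S [sy ys my]]]]] := mincover hm K.
have KD : K *m D = 0.
  by apply/row_matrixP => i; rewrite row_mul row0; apply/KP; exists (delta_mx 0 i); rewrite -rowE.
exists b, (s *m D); split=> [x|v].
  rewrite DP; split=> -[v ->]; last by exists (v *m s); rewrite mulmxA.
  exists (v *m y); rewrite mulmxA -(mulmxA v) -[y *m s](subKr 1%:M) ys.
  by rewrite mulmxBr mulmx1 mulmxBl -!mulmxA KD !mulmx0 subr0.
rewrite mulmxA => /KP [z zE].
have -> : v = z *m (K *m y) by rewrite mulmxA -zE -mulmxA sy mulmx1.
exact: (mxinMl (m_ideal hm)).
Qed.

Definition min_cpx b (d : forall n, 'M[A]_(b n.+1, b n)) :=
  [/\ cpx d, exact d & forall n, mxin m (d n)].

Lemma min_resolution_sub n (U : set 'rV[A]_n) : submodule U -> (forall v, U v -> mxin m v) ->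
  exists (b : nat -> nat) (d0 : 'M[A]_(b 0, n)) (d : forall k, 'M[A]_(b k.+1, b k)),
    [/\ mxin m d0, forall x, U x <-> exists v, x = v *m d0,
        forall u : 'rV_(b 0), u *m d0 = 0 <-> exists v, u = v *m d 0 & min_cpx d].
Proof.
move=> hU Um.
(* A state is a submodule of some A^q with entries in m; the next state is the kernel of its minimal
   cover. *)
pose st := {q : nat & {V : set 'rV[A]_q | submodule V /\ forall v, V v -> mxin m v}}.
have /dep_choice[pick pickP] (s : st) : exists pd : {p : nat & 'M[A]_(p, projT1 s)},
    (forall x, sval (projT2 s) x <-> exists v, x = v *m projT2 pd) /\
    forall v : 'rV_(projT1 pd), v *m projT2 pd = 0 -> mxin m v.
  by case: s => q [V [hV Vm]]; have [p [d dP]] := min_cover_sub hV; exists (existT _ p d).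
pose nxt (s : st) : st := existT _ (projT1 (pick s))
  (exist _ [set u : 'rV_(projT1 (pick s)) | u *m projT2 (pick s) = 0]
    (conj (submodule_kermx (projT2 (pick s))) (proj2 (pickP s)))).
pose s k := iter k nxt (existT _ n (exist _ U (conj hU Um)) : st).
pose b k := projT1 (s k.+1); pose d k : 'M[A]_(b k, projT1 (s k)) := projT2 (pick (s k)).
have dP k x : sval (projT2 (s k)) x <-> exists v, x = v *m d k by have [h _] := pickP (s k); exact: h.
have kerP k (u : 'rV_(b k)) : u *m d k = 0 <-> exists v, u = v *m d k.+1 by exact: (dP k.+1).
have min k : mxin m (d k).
  move=> i j; have [_ h] := svalP (projT2 (s k)).
  have : sval (projT2 (s k)) (row i (d k)) by apply/dP; exists (delta_mx 0 i); rewrite -rowE.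
  by move=> /h /(_ 0 j); rewrite mxE.
exists b, (d 0), (fun k => d k.+1); split=> //.
- exact: (dP 0%N).
- exact: (kerP 0%N).
split=> // [k|k u /kerP //].
by apply/row_matrixP => i; rewrite row_mul row0; apply/kerP; exists (delta_mx 0 i *m 1%:M); rewrite mulmx1 -rowE.
Qed.

Lemma submodule_ker (M M' : lmodType A) (f : {linear M -> M'}) : submodule (ker f).
Proof. exact: (submodule_preim f (@submodule_zero A M')). Qed.

(** The first cover is built apart because [M] is not given inside a free module; its kernel starts
    [min_resolution_sub]. *)
Lemma min_resolution (M : lmodType A) : fin_gen M ->
  exists (b : nat -> nat) (d : forall k, 'M[A]_(b k.+1, b k)) (p : {linear 'rV[A]_(b 0) -> M}),
    [/\ forall x, exists v, p v = x, forall u, p u = 0 <-> exists v, u = v *m d 0 & min_cpx d].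
Proof.
move=> [n0 [p0 p0T]]; have [r [K KP]] := sub_rowspace hA (submodule_ker p0).
have [n [s [y [S [sy ys my]]]]] := mincover hm K.
have lin (a : A) (u v : 'rV[A]_n) : p0 ((a *: u + v) *m s) = a *: p0 (u *m s) + p0 (v *m s).
  by rewrite mulmxDl -scalemxAl linearP.
pose p : {linear 'rV[A]_n -> M} := mklin lin.
have [||b [d0 [d [min0 Ud0 kd0 [dd ex min]]]]] := @min_resolution_sub n (ker p).
- exact: submodule_ker.
- move=> v; rewrite /ker /= => /KP [z zE].
  have -> : v = z *m (K *m y) by rewrite mulmxA -zE -mulmxA sy mulmx1.
  exact: (mxinMl (m_ideal hm)).
exists (fun k => if k is k'.+1 then b k' else n),
  (fun k => match k return 'M[A]_((if k.+1 is k'.+1 then b k' else n), (if k is k'.+1 then b k' else n))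
            with 0 => d0 | k'.+1 => d k' end), p; split.
- move=> x; have : setT x by []; rewrite -p0T => -[v _ <-]; exists (v *m y).
  rewrite /= -mulmxA -[y *m s](subKr 1%:M) ys mulmxBr mulmx1 linearB /=.
  have -> : p0 (v *m (S *m K)) = 0 by apply/KP; exists (v *m S); rewrite mulmxA.
  by rewrite subr0.
- exact: Ud0.
split=> [[|k]|[|k] u h|[|k]] //.
- by apply/row_matrixP => i; rewrite row_mul row0; apply/kd0; exists (delta_mx 0 i); rewrite -rowE.
- exact/kd0.
- exact: ex.
Qed.

End MinimalResolution.

(** * Lengths of Tor modules *)

Section Lengths.
Variables (A : comNzRingType) (M : lmodType A).

Lemma lenge_chain (W P : set M) n : submodule W -> submodule P -> lenge W P n ->
  exists S : nat -> set M, [/\ forall i, (i <= n)%N -> submodule (S i),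
    forall i, (i < n)%N -> S i `<` S i.+1 & S n = P].
Proof.
move=> hW; elim: n P => [|n IH] P hP /=; first by move=> _; exists (fun=> P).
move=> [U [hU WU UP /(IH _ hU) [S [S1 S2 S3]]]].
exists (fun i => if (i <= n)%N then S i else P); split=> [i|i|]; last by rewrite ltnn.
  by case: ifP => // /S1.
rewrite ltnS => h; rewrite h; case: ltnP => [/S2 //|h'].
by have -> : i = n by [lia]; rewrite S3.
Qed.

Lemma chain_lenge (W P : set M) n (S : nat -> set M) : submodule P ->
  (forall i, (i <= n)%N -> submodule (S i)) -> (forall i, (i < n)%N -> S i `<` S i.+1) ->
  W `<=` S 0%N -> S n `<=` P -> lenge W P n.
Proof.
move=> hP; elim: n P hP => [|n IH] P hP S1 S2 WS SP /=; first by move=> x /WS /SP.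
have [lt nlt] := S2 n (ltnSn n).
have h : lenge W (S n) n.
  by apply: IH => // [|i h|i h]; [exact: S1|apply: S1; lia|apply: S2; lia].
exists (S n); split=> //; [exact: S1|exact: (lenge_sub h)|].
by split=> [x /lt /SP //|PS]; apply: nlt => x /SP /PS.
Qed.

Lemma mod_length_fin : fin ([set 0] : set M) setT ->
  mod_length M = (ell ([set 0] : set M) setT)%:Z%:E.
Proof.
move=> hf; have [le ge] := ellP (@submodule_zero A M) (fun _ _ => I) hf.
apply: supz_nats_eq.
  by have [S [S1 S2 _]] := lenge_chain (@submodule_zero A M) (@submoduleT A M) ge; exists S.
move=> n [S [S1 S2]]; apply: (@lenge_leq _ _ ([set 0] : set M) setT) le.
by apply: (chain_lenge (@submoduleT A M) S1 S2) => // _ ->; exact: (sub0 (S1 0%N (leq0n n))).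
Qed.

Lemma fin_mod_length : (mod_length M < +oo)%E -> fin ([set 0] : set M) setT.
Proof.
move=> lt; apply: contrapT => nf.
have hge n : (n%:Z%:E <= mod_length M)%E.
  apply: supz_ub; exists n => //.
  have /(lenge_total (@submodule_zero A M) (fun _ _ => I)) : ~ lenle ([set 0] : set M) setT n.
    by move=> h; apply: nf; exists n.
  move=> /(lenge_chain (@submodule_zero A M) (@submoduleT A M)) [S [S1 S2 _]]; exists S.
  by split=> i h; [apply: S1|apply: S2]; lia.
case E: (mod_length M) lt hge => [z| |] // _ h; last by have := h 0%N.
by have := h (`|z|%N.+1); rewrite lee_fin; lia.
Qed.

End Lengths.

(** The part of [P] that falls into [W2] is covered by P1/W1, and the rest embeds into P2/W2. *)
Lemma ell_exact (A : comNzRingType) (V G V' : lmodType A) (io : {linear V -> G})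
    (pi : {linear G -> V'}) (W1 P1 : set V) (W P : set G) (W2 P2 : set V') :
  submodule W1 -> submodule P1 -> W1 `<=` P1 -> submodule W -> submodule P -> W `<=` P ->
  submodule W2 -> submodule P2 -> W2 `<=` P2 ->
  (forall x, W1 x -> W (io x)) -> (forall x, W x -> W2 (pi x)) -> (forall x, P x -> P2 (pi x)) ->
  (forall x, P x -> W2 (pi x) -> exists2 y, P1 y & W (x - io y)) ->
  fin W1 P1 -> fin W P -> fin W2 P2 -> (ell W P <= ell W1 P1 + ell W2 P2)%N.
Proof.
move=> hW1 hP1 WP1 hW hP WP hW2 hP2 WP2 io1 pi1 pi2 ex f1 f f2.
pose U := P `&` pi @^-1` W2.
have hU : submodule U by apply: submoduleI => //; exact: submodule_preim.
have WU : W `<=` U by move=> x Wx; split; [exact: WP|exact: pi1].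
have UP : U `<=` P by move=> x [].
rewrite (ell_add hW hU hP WU UP f) leq_add //.
  by case: (ell_surj hW1 hP1 WP1 hW hU WU io1 _ f1) => // y [/ex].
by case: (@ell_inj _ _ _ pi U P W2 P2) => // x Px W2x; split.
Qed.

(** * Homology modulo the powers of an ideal *)

Section Tau.
Variables (A : comNzRingType) (a : nat -> A) (r : nat).

(* The length of the homology of V2 / a^n V2 -> V1 / a^n V1 -> V0 / a^n V0. *)
Definition tau (V0 V1 V2 : lmodType A) (f1 : {linear V1 -> V0}) (f2 : {linear V2 -> V1}) n : nat :=
  ell (addS (range f2) (fil a r n)) (f1 @^-1` fil a r n).

Definition fin1 (V : lmodType A) := fin (fil a r 1 : set V) setT.

Lemma fin1_fil (V : lmodType A) n : fin1 V -> fin (fil a r n : set V) setT.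
Proof.
move=> h; have h0 := @submodule_zero A V.
have E k : addS ([set 0] : set V) (fil a r k) = fil a r k.
  apply/seteqP; split=> [_ [_ [v [-> h' ->]]]|]; first by rewrite add0r.
  exact: addSr.
by have := @fin_fil _ _ a r [set 0] n h0; rewrite !E; apply.
Qed.

Lemma fin_above (V : lmodType A) n (U P : set V) : fin1 V -> fil a r n `<=` U -> fin U P.
Proof.
move=> h lt; apply: (@fin_subr _ _ U P setT) => //.
by apply: fin_subl lt _ (fin1_fil n h).
Qed.

Variables (V0 V1 V2 : lmodType A) (f1 : {linear V1 -> V0}) (f2 : {linear V2 -> V1}).
Hypotheses (h0 : noeth V0) (h1 : noeth V1) (fi0 : fin1 V0) (fi1 : fin1 V1).
Hypothesis (ff : forall x, f1 (f2 x) = 0).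

Lemma submodule_range (W W' : lmodType A) (f : {linear W -> W'}) : submodule (range f).
Proof. exact: (submodule_im f (@submoduleT A W)). Qed.

Lemma submodule_bd n : submodule (addS (range f2) (fil a r n)).
Proof. by apply: submodule_addS; [exact: submodule_range|exact: submodule_fil]. Qed.

Lemma submodule_cy n : submodule (f1 @^-1` fil a r n).
Proof. by apply: submodule_preim; exact: submodule_fil. Qed.

Lemma bd_cy n : addS (range f2) (fil a r n) `<=` f1 @^-1` fil a r n.
Proof.
apply: addS_sub; first exact: submodule_cy.
  by move=> _ [x _ <-]; rewrite /= ff; exact: sub0 (@submodule_fil _ _ a r n).
by move=> x hx; exact: fil_linear.
Qed.

Lemma fin_tau n : fin (addS (range f2) (fil a r n)) (f1 @^-1` fil a r n).
Proof. by apply: (@fin_above V1 n) => //; apply: addSr; exact: submodule_range. Qed.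

(** V1 modulo the cycles is the image of f1 in V0/a^n V0. The value is therefore a combination of
    three Hilbert-Samuel functions, those of coker f2 and coker f1 minus that of V0. *)
Lemma tau_evp : exists P, evp (fun n => (tau f1 f2 n)%:R) P.
Proof.
have hr2 := submodule_range f2; have hr1 := submodule_range f1.
have [P2 e2] := hilbert_samuel h1 hr2 (@fin_above V1 1 _ _ fi1 (addSr hr2)).
have [P1 e1] := hilbert_samuel h0 hr1 (@fin_above V0 1 _ _ fi0 (addSr hr1)).
have z0 := @submodule_zero A V0.
have [P0 e0] := hilbert_samuel h0 z0 (@fin_above V0 1 _ _ fi0 (addSr z0)).
exists (P2 - (P0 - P1)); have := evpB e2 (evpB e0 e1); apply: evp_ext; exists 0%N => n _.
have E : addS ([set 0] : set V0) (fil a r n) = fil a r n.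
  apply/seteqP; split=> [_ [_ [v [-> h' ->]]]|]; first by rewrite add0r.
  exact: addSr.
rewrite E.
have hf0 := @submodule_fil _ V0 a r n.
have hU := submodule_addS hr1 hf0; have hT0 := @submoduleT A V0; have hT1 := @submoduleT A V1.
rewrite (ell_add hf0 hU hT0 (addSr hr1)) //; last exact: (@fin_above V0 n).
rewrite (ell_add (submodule_bd n) (submodule_cy n) hT1 (@bd_cy n)) //; last first.
  by apply: (@fin_above V1 n) => //; exact: addSr.
have [|||_ ->] := ell_iso (submodule_cy n) hT1 _ hf0 hU (addSr hr1) _ (fun x _ => iff_refl _) _
  (@fin_above V0 n _ _ fi0 (fun x h => h)) => //.
- by move=> x _; apply: addSl => //; exists x.
- by move=> _ [_ [v [[x _ <-] hv ->]]]; exists x => //; rewrite addrC addKr.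
by rewrite !natrD /tau addrK addrK.
Qed.

End Tau.

(** [al1] is injective on homology, since [be1] carries boundaries to boundaries and be1 al1 is
    homotopic to the identity. *)
Lemma tau_le (A : comNzRingType) (a : nat -> A) r (V0 V1 V2 V0' V1' V2' : lmodType A)
    (f1 : {linear V1 -> V0}) (f2 : {linear V2 -> V1})
    (f1' : {linear V1' -> V0'}) (f2' : {linear V2' -> V1'})
    (al0 : {linear V0 -> V0'}) (al1 : {linear V1 -> V1'}) (be1 : {linear V1' -> V1})
    (ho1 : V1 -> V2) (ho0 : {linear V0 -> V1}) n :
  fin1 a r V1' -> (forall x, f1 (f2 x) = 0) -> (forall x, f1' (f2' x) = 0) ->
  (forall x, f1' (al1 x) = al0 (f1 x)) ->
  (forall y, range f2 (be1 (f2' y))) ->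
  (forall x, x - be1 (al1 x) = f2 (ho1 x) + ho0 (f1 x)) ->
  (tau a r f1 f2 n <= tau a r f1' f2' n)%N.
Proof.
move=> fi ff ff' c1 c2 hom; rewrite /tau.
have hB := submodule_bd a r f2 n.
case: (@ell_inj _ _ _ al1 (addS (range f2) (fil a r n)) (f1 @^-1` fil a r n)
  (addS (range f2') (fil a r n)) (f1' @^-1` fil a r n)) => //.
- exact: submodule_cy.
- exact: bd_cy.
- exact: submodule_bd.
- exact: submodule_cy.
- exact: bd_cy.
- by move=> x; rewrite /= c1; exact: fil_linear.
- move=> x Zx [_ [v [[y _ <-] hv E]]].
  rewrite -(subrK (be1 (al1 x)) x) hom E linearD /=; apply: (subD hB).
    apply: (subD hB).
      by apply: addSl; [exact: submodule_fil|exists (ho1 x)].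
    by apply: addSr; [exact: submodule_range|exact: fil_linear].
  apply: (subD hB).
    by apply: addSl; [exact: submodule_fil|exact: c2].
  by apply: addSr; [exact: submodule_range|exact: fil_linear].
exact: fin_tau.
Qed.

(** * Tensoring matrices with a module *)

Section Tensor.
Variables (A : comNzRingType) (N : lmodType A).

Fact tensor_map_linear n1 n0 (d : 'M[A]_(n1, n0)) (c : A) (x y : {ffun 'I_n1 -> N}) :
  tensor_map d (c *: x + y) = c *: tensor_map d x + tensor_map d y.
Proof.
apply/ffunP => j; rewrite !ffunE scaler_sumr -big_split; apply: eq_bigr => i _.
by rewrite !ffunE scalerDr !scalerA mulrC.
Qed.

Definition tens n1 n0 (d : 'M[A]_(n1, n0)) : {linear {ffun 'I_n1 -> N} -> {ffun 'I_n0 -> N}} :=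
  mklin (tensor_map_linear d).

Lemma tensM n2 n1 n0 (c : 'M[A]_(n2, n1)) (d : 'M[A]_(n1, n0)) x :
  tens d (tens c x) = tens (c *m d) x.
Proof.
apply/ffunP => j; rewrite !ffunE.
under eq_bigr do rewrite ffunE scaler_sumr.
rewrite exchange_big; apply: eq_bigr => k _ /=; rewrite mxE scaler_suml.
by apply: eq_bigr => i _; rewrite scalerA mulrC.
Qed.

Lemma tensD n1 n0 (c d : 'M[A]_(n1, n0)) x : tens (c + d) x = tens c x + tens d x.
Proof.
apply/ffunP => j; rewrite !ffunE -big_split; apply: eq_bigr => i _.
by rewrite mxE scalerDl.
Qed.

Lemma tensDr n1 n0 (d : 'M[A]_(n1, n0)) x y : tens d (x + y) = tens d x + tens d y.
Proof. exact: linearD. Qed.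

Lemma tensBr n1 n0 (d : 'M[A]_(n1, n0)) x y : tens d (x - y) = tens d x - tens d y.
Proof. exact: linearB. Qed.

Lemma tensN n1 n0 (d : 'M[A]_(n1, n0)) x : tens (- d) x = - tens d x.
Proof.
apply/ffunP => j; rewrite !ffunE -sumrN; apply: eq_bigr => i _.
by rewrite mxE scaleNr.
Qed.

Lemma tens0 n1 n0 x : tens (0 : 'M[A]_(n1, n0)) x = 0.
Proof. by apply/ffunP => j; rewrite !ffunE big1 // => i _; rewrite mxE scale0r. Qed.

Lemma tens1 n x : tens (1%:M : 'M[A]_n) x = x.
Proof.
apply/ffunP => j; rewrite !ffunE (bigD1 j) //= mxE eqxx scale1r big1 ?addr0 // => i /negPf h.
by rewrite mxE h scale0r.
Qed.

Lemma tens_sq n0 n1 n2 (d1 : 'M[A]_(n1, n0)) (d2 : 'M[A]_(n2, n1)) : d2 *m d1 = 0 ->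
  forall x, tens d1 (tens d2 x) = 0.
Proof. by move=> h x; rewrite tensM h tens0. Qed.

End Tensor.
Arguments tens_sq [A] N [n0 n1 n2 d1 d2].

Section TensorFil.
Variables (A : comNzRingType) (a : nat -> A) (r : nat).

Lemma ffun_at_linear (N : lmodType A) n (i : 'I_n) (c : A) (x y : {ffun 'I_n -> N}) :
  (c *: x + y) i = c *: x i + y i.
Proof. by rewrite !ffunE. Qed.

Lemma fil_ffun (N : lmodType A) n k (x : {ffun 'I_n -> N}) :
  fil a r k x <-> forall i, fil a r k (x i).
Proof.
split=> [h i|h].
  exact: (@fil_linear A _ N (mklin (f := fun x : {ffun 'I_n -> N} => x i) (ffun_at_linear i))).
pose E (i : 'I_n) (y : N) : {ffun 'I_n -> N} := [ffun j => if j == i then y else 0].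
have lin i (c : A) y z : E i (c *: y + z) = c *: E i y + E i z.
  by apply/ffunP => j; rewrite !ffunE; case: eqP => _ //; rewrite scaler0 addr0.
have -> : x = \sum_i E i (x i).
  apply/ffunP => j; rewrite sum_ffunE (bigD1 j) //= ffunE eqxx big1 ?addr0 // => i /negPf ij.
  by rewrite ffunE eq_sym ij.
apply: sub_sum; first exact: submodule_fil.
by move=> i _; exact: (@fil_linear A _ _ (mklin (lin i)) a r k (x i) (h i)).
Qed.

Lemma fin1_ffun (N : lmodType A) n : fin1 a r N -> fin1 a r {ffun 'I_n -> N}.
Proof.
move=> hN; pose V := {ffun 'I_n -> N}.
pose U k : set V := [set x | forall i : 'I_n, (i < k)%N -> fil a r 1 (x i)].
have hU k : submodule (U k).
  split=> [i _|c x y hx hy i ik]; first by rewrite ffunE; exact: sub0 (@submodule_fil _ _ a r 1).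
  rewrite !ffunE; apply: subD; [exact: submodule_fil| |exact: hy].
  by apply: subZ; [exact: submodule_fil|exact: hx].
have dec k : U k.+1 `<=` U k by move=> x h i ik; apply: h; lia.
have E : fil a r 1 = U n.
  by apply/seteqP; split=> [x /fil_ffun h i _|x h]; [|apply/fil_ffun => i]; exact: h.
suff key k : (k <= n)%N -> fin (U k) setT by rewrite /fin1 E; exact: key.
elim: k => [_|k IH kn]; first by exists 0%N => x _ i.
apply: (@fin_add _ _ (U k.+1) (U k) setT) (IH (ltnW kn)) => //.
pose i0 := Ordinal kn.
case: (@ell_inj _ _ _ (mklin (f := fun x : V => x i0) (ffun_at_linear i0)) (U k.+1) (U k)
  (fil a r 1) setT) => //; first exact: submodule_fil.
move=> x Ukx /= hx i; rewrite ltnS leq_eqVlt => /orP[/eqP ik|]; last exact: Ukx.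
by have -> : i = i0 by apply/val_inj.
Qed.

Lemma ffun_map_linear (N Q : lmodType A) (p : {linear N -> Q}) n (c : A)
  (x y : {ffun 'I_n -> N}) :
  [ffun i => p ((c *: x + y) i)] = c *: [ffun i => p (x i)] + [ffun i => p (y i)] :> {ffun _}.
Proof. by apply/ffunP => i; rewrite !ffunE linearP. Qed.

End TensorFil.

(** * Lengths of Tor from an arbitrary presentation *)

Section Presentation.
Variable A : comNzRingType.

Definition presentation (M : lmodType A) (n0 n1 n2 : nat) (p : {linear 'rV[A]_n0 -> M})
    (d1 : 'M[A]_(n1, n0)) (d2 : 'M[A]_(n2, n1)) : Prop :=
  [/\ range p = setT,
      ker p = range (fun u : 'rV[A]_n1 => u *m d1)
    & [set u : 'rV[A]_n1 | u *m d1 = 0] = range (fun u : 'rV[A]_n2 => u *m d2)].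

Lemma presentation_sq (M : lmodType A) n0 n1 n2 (p : {linear 'rV[A]_n0 -> M}) d1 (d2 : 'M_(n2, n1)) :
  presentation p d1 d2 -> d2 *m d1 = 0.
Proof.
move=> [_ _ k]; apply/row_matrixP => i; rewrite row_mul row0.
have : range (fun u : 'rV[A]_n2 => u *m d2) (row i d2) by exists (delta_mx 0 i); rewrite -?rowE.
by rewrite -k.
Qed.

Lemma presentation_ker (M : lmodType A) n0 n1 n2 (p : {linear 'rV[A]_n0 -> M}) d1 (d2 : 'M_(n2, n1)) k
  (X : 'M_(k, n0)) :
  presentation p d1 d2 -> (forall u, p (u *m X) = 0) -> exists Y, X = Y *m d1.
Proof.
move=> [_ h _] pX; apply: mx_rows => i.
have : ker p (row i X) by rewrite /ker /= rowE.
by rewrite h => -[v _ <-]; exists v.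
Qed.

Lemma presentation_ker2 (M : lmodType A) n0 n1 n2 (p : {linear 'rV[A]_n0 -> M}) d1 (d2 : 'M_(n2, n1)) k
  (X : 'M_(k, n1)) :
  presentation p d1 d2 -> X *m d1 = 0 -> exists Y, X = Y *m d2.
Proof.
move=> [_ _ h] Xd; apply: mx_rows => i.
have : [set u : 'rV[A]_n1 | u *m d1 = 0] (row i X) by rewrite /= -row_mul Xd row0.
by rewrite h => -[v _ <-]; exists v.
Qed.

Lemma lift_free (M M' : lmodType A) n n' (p : {linear 'rV[A]_n -> M}) (p' : {linear 'rV[A]_n' -> M'})
    (f : {linear M -> M'}) : range p' = setT -> exists X, forall u, p' (u *m X) = f (p u).
Proof.
move=> h.
have /choice[v vP] (i : 'I_n) : exists v, p' v = f (p (delta_mx 0 i)).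
  by have : setT (f (p (delta_mx 0 i))) by []; rewrite -h => -[v _ <-]; exists v.
exists (\matrix_i v i) => u.
rewrite [in RHS](row_sum_delta u) mulmx_sum_row !linear_sum; apply: eq_bigr => i _.
by rewrite !linearZ rowK vP.
Qed.

Lemma presentation_lift (M M' : lmodType A) n0 n1 n2 n0' n1' n2' (p : {linear 'rV[A]_n0 -> M}) d1
    (d2 : 'M_(n2, n1)) (p' : {linear 'rV[A]_n0' -> M'}) d1' (d2' : 'M_(n2', n1')) (f : {linear M -> M'}) :
  presentation p d1 d2 -> presentation p' d1' d2' ->
  exists X0 X1 X2, [/\ forall u, p' (u *m X0) = f (p u), d1 *m X0 = X1 *m d1' & d2 *m X1 = X2 *m d2'].
Proof.
move=> h h'; have [X0 X0P] : exists X0, forall u, p' (u *m X0) = f (p u).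
  by apply: lift_free; case: h'.
have [|X1 X1P] := presentation_ker (X := d1 *m X0) h'.
  move=> u; rewrite mulmxA X0P.
  have -> : p (u *m d1) = 0; last by rewrite linear0.
  by have [_ k _] := h; rewrite -[_ = 0]/(ker p (u *m d1)) k; exists u.
have [|X2 X2P] := presentation_ker2 (X := d2 *m X1) h'.
  by rewrite -mulmxA -X1P mulmxA (presentation_sq h) mul0mx.
by exists X0, X1, X2.
Qed.

Variables (a : nat -> A) (r : nat) (N : lmodType A).

Definition tor_len n0 n1 n2 (d1 : 'M[A]_(n1, n0)) (d2 : 'M[A]_(n2, n1)) n : nat :=
  tau a r (tens N d1) (tens N d2) n.

Hypothesis (fN : fin1 a r N).

Lemma tor_len_le n0 n1 n2 n0' n1' n2' (d1 : 'M[A]_(n1, n0)) (d2 : 'M_(n2, n1))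
    (d1' : 'M[A]_(n1', n0')) (d2' : 'M_(n2', n1')) X0 X1 Y1 Y2 h0 h1 n :
  d2 *m d1 = 0 -> d2' *m d1' = 0 -> d1 *m X0 = X1 *m d1' -> d2' *m Y1 = Y2 *m d2 ->
  1%:M - X1 *m Y1 = h1 *m d2 + d1 *m h0 ->
  (tor_len d1 d2 n <= tor_len d1' d2' n)%N.
Proof.
move=> dd dd' cX cY hom.
apply: (@tau_le _ _ _ _ _ _ _ _ _ _ _ _ _ (tens N X0) (tens N X1) (tens N Y1) (tens N h1) (tens N h0)).
- exact: fin1_ffun.
- exact: (tens_sq N dd).
- exact: (tens_sq N dd').
- by move=> x; rewrite !tensM cX.
- by move=> y; exists (tens N Y2 y) => //; rewrite !tensM cY.
by move=> x; rewrite !tensM -tensD -hom tensD tens1 tensN.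
Qed.

(** Lifts of f and g to the presentations compose to a map homotopic to the identity of the first
    one. *)
Lemma tor_len_retract (M M' : lmodType A) n0 n1 n2 n0' n1' n2' (p : {linear 'rV[A]_n0 -> M}) d1
    (d2 : 'M_(n2, n1)) (p' : {linear 'rV[A]_n0' -> M'}) d1' (d2' : 'M_(n2', n1'))
    (f : {linear M -> M'}) (g : {linear M' -> M}) n :
  presentation p d1 d2 -> presentation p' d1' d2' -> (forall x, g (f x) = x) ->
  (tor_len d1 d2 n <= tor_len d1' d2' n)%N.
Proof.
move=> h h' gf.
have [X0 [X1 [X2 [cX0 cX1 cX2]]]] := presentation_lift f h h'.
have [Y0 [Y1 [Y2 [cY0 cY1 cY2]]]] := presentation_lift g h' h.
have [|h0 h0E] := presentation_ker (X := 1%:M - X0 *m Y0) h.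
  by move=> u; rewrite mulmxBr mulmx1 mulmxA linearB /= cY0 cX0 gf subrr.
have [|h1 h1E] := presentation_ker2 (X := 1%:M - X1 *m Y1 - d1 *m h0) h.
  rewrite !mulmxBl -[d1 *m h0 *m d1]mulmxA -h0E mul1mx mulmxBr mulmx1.
  by rewrite -mulmxA -cY1 mulmxA -cX1 mulmxA subrr.
apply: (tor_len_le n (presentation_sq h) (presentation_sq h') cX1 cY2 (h1 := h1) (h0 := h0)).
by rewrite -h1E subrK.
Qed.

Lemma tor_len_iso (M M' : lmodType A) n0 n1 n2 n0' n1' n2' (p : {linear 'rV[A]_n0 -> M}) d1
    (d2 : 'M_(n2, n1)) (p' : {linear 'rV[A]_n0' -> M'}) d1' (d2' : 'M_(n2', n1')) n :
  presentation p d1 d2 -> presentation p' d1' d2' -> isomorphic M M' ->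
  tor_len d1 d2 n = tor_len d1' d2' n.
Proof.
move=> h h' [f [g fg gf]].
have lin (c : A) x y : g (c *: x + y) = c *: g x + g y.
  by rewrite -[RHS]fg linearP !gf.
by apply/eqP; rewrite eqn_leq (tor_len_retract n h h' (g := mklin lin) fg)
  (tor_len_retract n h' h (f := mklin lin) gf).
Qed.

Variables (I : set A) (hI : gens I a r).

Lemma length_quotient (Z T : lmodType A) (W : set Z) : submodule W -> is_quotient W T ->
  fin W setT -> mod_length T = (ell W setT)%:Z%:E.
Proof.
move=> hW [q [qT qW]] fW.
have q0 x : q x = 0 <-> W x by rewrite -qW.
have z0 := @submodule_zero A T; have t0 := @submoduleT A T; have tZ := @submoduleT A Z.
have sj (y : T) : exists2 x : Z, setT x & [set 0] (y - q x).
  by have : setT y by []; rewrite -qT => -[x _ <-]; exists x => //=; rewrite subrr.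
have [f _] := ell_surj hW tZ (fun _ _ => Logic.I) z0 t0 (fun _ _ => Logic.I)
  (fun x (Wx : W x) => proj2 (q0 x) Wx) (fun y _ => sj y) fW.
rewrite (mod_length_fin f); congr (_%:Z%:E); symmetry.
by case: (ell_iso hW tZ (fun _ _ => Logic.I) z0 t0 (fun _ _ => Logic.I) (fun _ _ => Logic.I)
  (fun x _ => q0 x) (fun y _ => sj y) f).
Qed.

(** Along N^k -> Q^k, where Q = N/I^nN, cycles and boundaries pull back to the submodules that
    define [tor_len]; the length of Tor is thereby computed inside powers of N. *)
Lemma Tor1_length_tor_len (M : lmodType A) n (Q T : lmodType A) n0 n1 n2 (p : {linear 'rV[A]_n0 -> M})
    (d1 : 'M[A]_(n1, n0)) (d2 : 'M[A]_(n2, n1)) (Z : lmodType A) (i : {linear Z -> {ffun 'I_n1 -> Q}}) :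
  is_quotient (smul (ideal_pow I n) (setT : set N)) Q -> presentation p d1 d2 -> injective i ->
  range i = [set x | tensor_map d1 x = 0] ->
  is_quotient (i @^-1` range (@tensor_map A n2 n1 d2 Q)) T ->
  mod_length T = (tor_len d1 d2 n)%:Z%:E.
Proof.
move=> [q [qT qK]] pr i_inj iK hT; rewrite (smul_ideal_pow hI) in qK.
have dd := presentation_sq pr.
have q0 x : q x = 0 <-> fil a r n x by rewrite -qK.
have sq (y : Q) : exists x, q x = y by have : setT y by []; rewrite -qT => -[x _ <-]; exists x.
pose qq k : {linear {ffun 'I_k -> N} -> {ffun 'I_k -> Q}} := mklin (@ffun_map_linear A N Q q k).
have qqE k x (j : 'I_k) : qq k x j = q (x j) by rewrite ffunE.
have qq0 k x : qq k x = 0 <-> fil a r n x.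
  split=> [e|/fil_ffun h]; first by apply/fil_ffun => j; apply/q0; rewrite -qqE e ffunE.
  by apply/ffunP => j; rewrite qqE ffunE; apply/q0.
have sqq k (y : {ffun 'I_k -> Q}) : exists x, qq k x = y.
  have /choice[x xP] : forall j, exists x, q x = y j by move=> j; exact: sq.
  by exists [ffun j => x j]; apply/ffunP => j; rewrite qqE ffunE.
have qqt k l (d : 'M_(k, l)) x : tens Q d (qq k x) = qq l (tens N d x).
  apply/ffunP => j; rewrite qqE !ffunE linear_sum; apply: eq_bigr => j' _.
  by rewrite linearZ ffunE.
pose W := i @^-1` range (@tensor_map A n2 n1 d2 Q).
have hR : submodule (range (tens Q d2)) := submodule_range (tens Q d2).
have hW : submodule W by exact: (submodule_preim i hR).
pose ZQ : set {ffun 'I_n1 -> Q} := ker (tens Q d1).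
have hZQ : submodule ZQ := submodule_ker (tens Q d1).
have RZ : range (tens Q d2) `<=` ZQ by move=> _ [x _ <-]; exact: (tens_sq Q dd).
have hB := submodule_bd a r (tens N d2) n; have hC := submodule_cy a r (tens N d1) n.
have BC := @bd_cy A a r _ _ _ (tens N d1) (tens N d2) (tens_sq N dd) n.
have finC : fin (addS (range (tens N d2)) (fil a r n)) (tens N d1 @^-1` fil a r n).
  by apply: fin_tau; exact: fin1_ffun.
have toZ x : (tens N d1 @^-1` fil a r n) x -> ZQ (qq n1 x).
  by move=> h; have : tens Q d1 (qq n1 x) = 0 by [rewrite qqt; apply/qq0].
have toR x : range (tens Q d2) (qq n1 x) <-> addS (range (tens N d2)) (fil a r n) x.
  split=> [[y _ e]|[_ [v [[y _ <-] hv ->]]]].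
    have [y' y'E] := sqq _ y; exists (tens N d2 y'), (x - tens N d2 y'); split; [by exists y'| |].
      by apply/qq0; rewrite (linearB (qq n1)) -[X in _ - X]qqt y'E -e; exact: subrr.
    by rewrite addrC subrK.
  exists (qq n2 y) => //; apply: (etrans (qqt _ _ d2 y)).
  by rewrite (linearD (qq n1)) (proj2 (qq0 _ v) hv) addr0.
have surj y : ZQ y -> exists2 x, (tens N d1 @^-1` fil a r n) x & range (tens Q d2) (y - qq n1 x).
  move=> hy; have [x xE] := sqq _ y; exists x; last by rewrite xE subrr; exact: (sub0 hR).
  by apply/qq0; rewrite -qqt xE.
have [fQ _] := ell_surj hB hC BC hR hZQ RZ (fun x => proj2 (toR x)) surj finC.
have [_ eQ] := ell_iso hB hC BC hR hZQ RZ toZ (fun x _ => toR x) surj fQ.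
have iZ x : ZQ (i x) by have : range i (i x) by [exists x]; rewrite iK.
have sZ y : ZQ y -> exists2 x : Z, setT x & range (tens Q d2) (y - i x).
  move=> hy; have : [set x | tensor_map d1 x = 0] y by exact: hy.
  by rewrite -iK => -[x _ <-]; exists x => //; rewrite subrr; exact: (sub0 hR).
have tZ := @submoduleT A Z.
have [fW eW] := ell_iso hW tZ (fun _ _ => Logic.I) hR hZQ RZ (fun x _ => iZ x)
  (fun x _ => iff_refl _) sZ fQ.
by rewrite (length_quotient hW hT fW) eW -eQ.
Qed.

Lemma Tor1_lengthP (M : lmodType A) n0 n1 n2 (p : {linear 'rV[A]_n0 -> M}) (d1 : 'M[A]_(n1, n0))
    (d2 : 'M[A]_(n2, n1)) n l : presentation p d1 d2 ->
  Tor1_length I N M n l <-> l = tor_len d1 d2 n :> int.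
Proof.
move=> pr; split.
  move=> [Q [T [hQ [m0 [m1 [m2 [p' [d1' [d2' [pr' [Z [i [i1 i2 i3]]]]]]]]]] hl]]].
  have iso : isomorphic M M by exists (idfun : {linear M -> M}); exists id.
  have := Tor1_length_tor_len hQ pr' i1 i2 i3; rewrite hl (tor_len_iso n pr pr' iso).
  by case.
move=> ->.
have hU : submodule (smul (ideal_pow I n) (setT : set N)).
  by rewrite (smul_ideal_pow hI); exact: submodule_fil.
pose Q := quo hU; have hQ := is_quotient_quo hU : is_quotient _ Q.
have hZ := submodule_ker (tens Q d1).
have hR := submodule_preim (incl hZ) (submodule_range (tens Q d2)).
have hT := is_quotient_quo hR.
have iK : range (incl hZ) = [set x | tensor_map d1 x = 0] by exact: incl_range.
exists Q, (quo hR); split => //; last exact: (Tor1_length_tor_len hQ pr (@incl_inj _ _ _ hZ) iK hT).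
exists n0, n1, n2, p, d1, d2; split=> //.
by exists (subm hZ), (incl hZ); split=> //; exact: incl_inj.
Qed.

(** The length does not depend on the choices hidden in [Tor1_length], so the polynomial is unique
    and any presentation computes it. *)
Lemma r1E (M : lmodType A) n0 n1 n2 (p : {linear 'rV[A]_n0 -> M}) (d1 : 'M[A]_(n1, n0))
    (d2 : 'M[A]_(n2, n1)) P : presentation p d1 d2 ->
  evp (fun n => (tor_len d1 d2 n)%:R) P -> r1 I N M = (size P)%:Z - 1.
Proof.
move=> pr [k kP].
have hP : is_Tor1_poly I N M P.
  exists k => n kn; exists (tor_len d1 d2 n); split; first exact/(Tor1_lengthP _ _ pr).
  by rewrite -kP.
rewrite /r1; case: xgetP => [P' _ [k' h']|/(_ P) //]; suff -> : P' = P by [].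
apply: (@evp_uniq (fun n => (tor_len d1 d2 n)%:R : rat)); last by exists k.
exists k' => n /h' [l [/(Tor1_lengthP _ _ pr) -> ->]].
by [].
Qed.

End Presentation.

(** The cone is an extension that splits degree by degree, so it remains one after tensoring, and
    the homology sequence is exact in the middle. *)
Lemma tor_len_cone (A : comNzRingType) (a : nat -> A) r (N : lmodType A) b
    (d : forall n, 'M[A]_(b n.+1, b n)) e k n : fin1 a r N -> cpx d -> chain d e ->
  (tor_len a r N (cone d e 0 k) (cone d e 0 k.+1) n <=
   tor_len a r N (d k) (d k.+1) n + tor_len a r N (d k.+1) (d k.+2) n)%N.
Proof.
move=> fN dd ch; pose D := cone d e 0; have DD := cpx_cone dd ch.
pose io : 'M[A]_(b k.+1, b k.+1 + b k.+2) := row_mx 1%:M 0.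
pose io2 : 'M[A]_(b k.+2, b k.+1 + b k.+2) := row_mx 0 1%:M.
pose pi : 'M[A]_(b k.+1 + b k.+2, b k.+2) := col_mx 0 1%:M.
pose pi1 : 'M[A]_(b k.+1 + b k.+2, b k.+1) := col_mx 1%:M 0.
pose jo2 : 'M[A]_(b k.+2, b k.+2 + b k.+3) := row_mx 1%:M 0.
pose jo3 : 'M[A]_(b k.+3, b k.+2 + b k.+3) := row_mx 0 1%:M.
pose ho : 'M[A]_(b k, b k + b k.+1) := row_mx 1%:M 0.
pose hp : 'M[A]_(b k + b k.+1, b k) := col_mx 1%:M 0.
pose hq : 'M[A]_(b k + b k.+1, b k.+1) := col_mx 0 1%:M.
have E1 : d k.+1 *m io = jo2 *m D k.+1.
  by rewrite mul_row_cone mul_mx_row mul1mx mul0mx mulmx1 mulmx0 addr0 scale0r mul0mx subr0.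
have E2 : D k.+1 *m pi = - (col_mx 0 1%:M *m d k.+2).
  rewrite mul_cone_col !mulmx0 mulmx1 scale0r !add0r mul_col_mx mul0mx mul1mx.
  by rewrite opp_col_mx oppr0.
have E3 : pi *m d k.+1 = - (D k *m hq).
  rewrite mul_cone_col !mulmx0 mulmx1 scale0r !add0r mul_col_mx mul0mx mul1mx.
  by rewrite opp_col_mx oppr0 opprK.
have E4 : pi1 *m io + pi *m io2 = 1%:M.
  by rewrite !mul_col_row !mulmx1 !mulmx0 add_block_mx ?addr0 ?add0r -scalar_mx_block.
have E5 : io *m D k *m hp = d k.
  by rewrite mul_row_cone mul1mx !mul0mx addr0 mul_row_col mulmx1 mulmx0 addr0.
have E6 : jo3 *m D k.+1 *m pi = - d k.+2.
  by rewrite mul_row_cone mul_row_col mulmx0 mulmx1 add0r scaler0 sub0r mul1mx.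
have ffD := tens_sq N (DD k); have ff0 := tens_sq N (dd k); have ff1 := tens_sq N (dd k.+1).
apply: (@ell_exact _ _ _ _ (tens N io) (tens N pi)) => //.
all: try exact: submodule_bd.
all: try exact: submodule_cy.
all: try exact: bd_cy.
all: try (apply: fin_tau; exact: fin1_ffun).
- move=> _ [_ [v [[y _ <-] hv ->]]]; rewrite tensDr.
  apply: subD; first exact: submodule_bd.
    apply: addSl; first exact: submodule_fil.
    by exists (tens N jo2 y) => //; rewrite !tensM -E1.
  by apply: addSr; [exact: submodule_range|exact: fil_linear].
- move=> _ [_ [v [[y _ <-] hv ->]]]; rewrite tensDr.
  apply: subD; first exact: submodule_bd.
    apply: addSl; first exact: submodule_fil.
    by exists (tens N (- col_mx 0 1%:M) y) => //; rewrite !tensM E2 mulNmx.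
  by apply: addSr; [exact: submodule_range|exact: fil_linear].
- move=> x hx; rewrite -[(_ @^-1` _) _]/(fil a r n (tens N (d k.+1) (tens N pi x))) tensM E3 tensN -tensM; apply: subN; first exact: submodule_fil.
  exact: fil_linear.
move=> x hx [_ [v [[w _ <-] hv E]]].
have hBG := submodule_bd a r (tens N (D k.+1)) n; have hCG := submodule_cy a r (tens N (D k)) n.
(* Adding the boundary of (0, w) and removing v, which is 0 modulo a^n, makes the second component
   vanish. *)
pose x' := x + tens N (jo3 *m D k.+1) w - tens N io2 v.
have xE : x' = tens N io (tens N pi1 x').
  have h : tens N pi x' = 0.
    rewrite tensBr tensDr E !tensM E6 tensN.
    by rewrite [_ + v - _]addrAC subrr add0r mul_row_col mulmx0 mulmx1 add0r tens1 subrr.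
  by rewrite -[LHS](tens1 x') -E4 tensD -!tensM h (linear0 (tens N io2)) addr0.
have Cx' : (tens N (D k) @^-1` fil a r n) x'.
  apply: (subB hCG); last by apply: fil_linear; exact: fil_linear.
  apply: (subD hCG) => //; rewrite -[(_ @^-1` _) _]/(fil a r n (tens N (D k) (tens N (jo3 *m D k.+1) w))) tensM -mulmxA DD mulmx0 tens0.
  exact: sub0 (@submodule_fil _ _ a r n).
exists (tens N pi1 x').
  rewrite -[(_ @^-1` _) _]/(fil a r n (tens N (d k) (tens N pi1 x'))) -E5 -[tens N (io *m _ *m _) _]tensM -[tens N (io *m _) _]tensM -xE.
  exact: fil_linear.
have -> : x - tens N io (tens N pi1 x') = tens N io2 v - tens N (jo3 *m D k.+1) w.
  by rewrite -xE /x' opprB addrCA opprD [x + (_ - _)]addrA subrr sub0r.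
apply: (subB hBG).
  by apply: addSr; [exact: submodule_range|exact: fil_linear].
by apply: addSl; [exact: submodule_fil|exists (tens N jo3 w) => //; rewrite tensM].
Qed.

(** * Periodic modules *)

Lemma inj_surj_iso (A : comNzRingType) (M M' : lmodType A) (f : {linear M -> M'}) :
  injective f -> (forall y, exists x, f x = y) -> isomorphic M M'.
Proof.
move=> fi /choice[g gP]; exists f; exists g => // x.
by apply: fi; rewrite gP.
Qed.

Lemma iso_refl (A : comNzRingType) (M : lmodType A) : isomorphic M M.
Proof. by exists (idfun : {linear M -> M}); exists id. Qed.

Lemma iso_inverse (A : comNzRingType) (M M' : lmodType A) : isomorphic M M' ->
  exists (f : {linear M -> M'}) (g : {linear M' -> M}), cancel f g /\ cancel g f.
Proof.
move=> [f [g fg gf]].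
have lin (c : A) x y : g (c *: x + y) = c *: g x + g y.
  by rewrite -[RHS]fg linearP !gf.
by exists f, (mklin lin).
Qed.

Lemma iso_sym (A : comNzRingType) (M M' : lmodType A) : isomorphic M M' -> isomorphic M' M.
Proof. by move=> /iso_inverse [f [g [fg gf]]]; exists g; exists f. Qed.

Lemma factor_inj (A : comNzRingType) (K P X : lmodType A) (i : {linear K -> P}) (f : {linear X -> P}) :
  injective i -> (forall x, range i (f x)) -> exists h : {linear X -> K}, forall x, i (h x) = f x.
Proof.
move=> ii fi.
have /choice[h hP] x : exists k, i k = f x by have [k _ <-] := fi x; exists k.
have lin (c : A) x y : h (c *: x + y) = c *: h x + h y.
  by apply: ii; rewrite linearP !hP linearP.
by exists (mklin lin).
Qed.

Lemma syzygy_iso (A : comNzRingType) (m : set A) (M M' K : lmodType A) :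
  isomorphic M M' -> is_syzygy m M K -> is_syzygy m M' K.
Proof.
move=> /iso_inverse [f [g [fg gf]]] [n [i [p [[ii ip pT] pm]]]].
exists n, i, (f \o p : {linear 'rV[A]_n -> M'}); split; last first.
  by move=> v /= /(congr1 g); rewrite fg linear0; exact: pm.
split=> //.
  rewrite ip; apply/seteqP; split=> v; rewrite /ker /=; first by move=> ->; rewrite linear0.
  by move=> /(congr1 g); rewrite fg linear0.
apply/seteqP; split=> // y _; have : setT (g y) by [].
by rewrite -pT => -[v _ vE]; exists v => //=; rewrite vE gf.
Qed.

Lemma pairing_eq (A : comNzRingType) (D : lmodType A) (X : Type) (ev : D -> X -> A) :
  (forall a d e x, ev (a *: d + e) x = a * ev d x + ev e x) ->
  (forall d, (forall x, ev d x = 0) -> d = 0) ->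
  forall d e, (forall x, ev d x = ev e x) -> d = e.
Proof.
move=> el ei d e h; apply/eqP; rewrite -subr_eq0; apply/eqP; apply: ei => x.
by rewrite addrC -scaleN1r el h mulN1r addNr.
Qed.

Lemma dual_iso (A : comNzRingType) (X X' D D' : lmodType A) : isomorphic X X' ->
  is_dual X D -> is_dual X' D' -> isomorphic D D'.
Proof.
move=> /iso_inverse [f [g [fg gf]]] [ev [el ei es]] [ev' [el' ei' es']].
have /choice[h hP] d : exists d', forall x, ev' d' x = ev d (g x).
  exact: (es' (ev d \o g : {linear X' -> A^o})).
have evI := pairing_eq el ei; have evI' := pairing_eq el' ei'.
have lin (c : A) x y : h (c *: x + y) = c *: h x + h y.
  by apply: evI' => z; rewrite el' !hP el.
apply: (inj_surj_iso (f := mklin lin)) => [x y /= e|y].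
  by apply: evI => z; rewrite -(fg z) -!hP e.
have [d dE] := es (ev' y \o f : {linear X -> A^o}).
by exists d; apply: evI' => z; rewrite /= hP dE /= gf.
Qed.

Section Local.
Variables (A : comNzRingType) (m : set A) (hA : noetherian A) (hm : local_ring m).

Lemma mx_inverse_local p (X : 'M[A]_p) : mxin m (1%:M - X) ->
  exists Y, Y *m X = 1%:M /\ X *m Y = 1%:M.
Proof.
move=> h; pose W : set 'rV[A]_p := [set x | exists v, x = v *m X].
have hW : submodule W.
  split; first by exists 0; rewrite mul0mx.
  by move=> c _ _ [u ->] [v ->]; exists (c *: u + v); rewrite mulmxDl scalemxAl.
have sub : (setT : set 'rV[A]_p) `<=` W.
  apply: (nakayama hm (@noeth_rV A p hA) (@submoduleT _ _) hW) => u _.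
  exists (u *m X), (u *m (1%:M - X)); split; first by exists u.
    rewrite [u *m _]row_sum_delta; apply: sub_sum => [|i _].
      by apply: submodule_smul => *.
    by apply: smul_in => //; exact: (mxinMl (m_ideal hm)).
  by rewrite mulmxBr mulmx1 addrC subrK.
have [|Y YE] := @mx_rows A _ _ _ 1%:M X; first by move=> i; exact: sub.
by exists Y; split; [|apply: mulmx1C]; exact: esym.
Qed.

(** Lifts X, Y between two minimal covers have X Y and Y X congruent to 1 modulo m, hence
    invertible, and they identify the kernels. *)
Lemma syzygy_uniq (M K K' : lmodType A) : is_syzygy m M K -> is_syzygy m M K' -> isomorphic K K'.
Proof.
move=> [n [i [p [[ii ip pT] pm]]]] [n' [i' [p' [[ii' ip' pT'] pm']]]].
have [X XP] := lift_free p (idfun : {linear M -> M}) pT'.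
have [Y YP] := lift_free p' (idfun : {linear M -> M}) pT.
have inm k k' (q : {linear 'rV[A]_k -> M}) (q' : {linear 'rV[A]_k' -> M}) Z Z' :
    (forall v, q v = 0 -> forall j, m (v 0 j)) ->
    (forall u, q' (u *m Z) = q u) -> (forall u, q (u *m Z') = q' u) -> mxin m (1%:M - Z *m Z').
  move=> qm h h' a c; have := qm (row a (1%:M - Z *m Z')) _ c; rewrite mxE; apply.
  by rewrite rowE mulmxBr mulmx1 mulmxA linearB /= h' h subrr.
have [X' [_ XX']] : exists X', X' *m (X *m Y) = 1%:M /\ (X *m Y) *m X' = 1%:M.
  by apply: mx_inverse_local; exact: (inm _ _ p p').
have [Y' [Y'E _]] : exists Y', Y' *m (Y *m X) = 1%:M /\ (Y *m X) *m Y' = 1%:M.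
  by apply: mx_inverse_local; exact: (inm _ _ p' p).
have linX (c : A) u v : i (c *: u + v) *m X = c *: (i u *m X) + i v *m X.
  by rewrite linearP mulmxDl scalemxAl.
have [k|h hP] := @factor_inj A _ _ _ i' (mklin linX) ii'.
  rewrite ip' /ker /= XP; have : range i (i k) by exists k.
  by rewrite ip.
apply: (@inj_surj_iso _ _ _ h) => [k1 k2 e|k'].
  apply: ii; have /= e' : i k1 *m X = i k2 *m X by have := congr1 i' e; rewrite !hP.
  by rewrite -[i k1]mulmx1 -[i k2]mulmx1 -XX' !mulmxA e'.
have E : i' k' = i' k' *m (Y' *m Y) *m X by rewrite -!mulmxA Y'E mulmx1.
have : range i (i' k' *m (Y' *m Y)).
  rewrite ip; apply: etrans (esym (XP _)) _; rewrite -E; have : range i' (i' k') by exists k'.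
  by rewrite ip'.
by move=> [k _ kE]; exists k; apply: ii'; rewrite hP /= kE -E.
Qed.

Lemma submodule_image q s (D : 'M[A]_(q, s)) : submodule [set x : 'rV[A]_s | exists v, x = v *m D].
Proof.
split; first by exists 0; rewrite mul0mx.
by move=> a _ _ [u ->] [v ->]; exists (a *: u + v); rewrite mulmxDl scalemxAl.
Qed.

Definition image_mod q s (D : 'M[A]_(q, s)) : lmodType A := subm (submodule_image D).

Lemma image_cover q s (D : 'M[A]_(q, s)) : exists pr : {linear 'rV[A]_q -> image_mod D},
  (forall u, incl (submodule_image D) (pr u) = u *m D) /\ forall y, exists u, pr u = y.
Proof.
have lin (a : A) (u v : 'rV[A]_q) : (a *: u + v) *m D = a *: (u *m D) + v *m D.
  by rewrite mulmxDl scalemxAl.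
have [u|pr prE] := @factor_inj A _ _ _ (incl (submodule_image D)) (mklin lin) (@incl_inj _ _ _ _).
  by rewrite incl_range; exists u.
exists pr; split=> // y; have [u uE] := incl_in y; exists u.
by apply: (@incl_inj _ _ _ (submodule_image D)); rewrite prE; exact: esym.
Qed.

Section ImageComplex.
Variables (b : nat -> nat) (d : forall n, 'M[A]_(b n.+1, b n)).
Hypotheses (dd : cpx d) (ex : exact d).

(** A splitting gives S with S d_n = d_n and d_(n+1) S = 0. Then 1 - S factors through d_(n+1), so
    it has entries in m and is idempotent: it vanishes, and d_(n+1) = 0. Exactness then puts all of
    A^(b n.+2) into the image of d_(n+2), which has entries in m. *)
Lemma stably_zero_image n : (forall n, mxin m (d n)) -> stably_zero (image_mod (d n)) -> b n.+2 = 0%N.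
Proof.
move=> dm [k [f [g fg]]]; have [pr [prE prs]] := image_cover (d n).
have [|G GP] := @lift_free A _ _ _ _ (idfun : {linear 'rV[A]_k -> _}) pr g.
  by apply/seteqP; split=> // y _; have [u uE] := prs y; exists u.
rewrite /= in GP.
pose S : 'M[A]_(b n.+1) := \matrix_i (f (pr (delta_mx 0 i)) *m G).
have SE u : u *m S = f (pr u) *m G.
  rewrite [in RHS](row_sum_delta u) mulmx_sum_row !linear_sum mulmx_suml.
  by apply: eq_bigr => i _; rewrite !linearZ rowK /= scalemxAl.
have Sd : S *m d n = d n.
  by apply/row_matrixP => i; rewrite rowE mulmxA -prE SE GP fg prE -rowE.
have dS : d n.+1 *m S = 0.
  apply/row_matrixP => i; rewrite row_mul SE row0.
  have -> : pr (row i (d n.+1)) = 0; last by rewrite !linear0 mul0mx.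
  by apply: (@incl_inj _ _ _ (submodule_image (d n))); rewrite prE -row_mul dd row0.
have [T TE] : exists T, 1%:M - S = T *m d n.+1.
  by apply: mx_rows => i; apply: ex; rewrite -row_mul mulmxBl mul1mx Sd subrr row0.
have S1 : 1%:M - S = 0.
  apply: (mulVmx_local hA hm (mu := 1%:M - S)); first by rewrite TE; exact: (mxinMl (m_ideal hm)).
  by rewrite {2}TE -mulmxA mulmxBr mulmx1 dS subr0.
have d0 : d n.+1 = 0 by rewrite -[d n.+1]mulmx1 -(subr0 1%:M) -S1 subKr dS.
case E: (b n.+2) => [//|l]; pose i0 : 'I_(b n.+2) := cast_ord (esym E) ord0.
have [v vE] : exists v, (delta_mx 0 i0 : 'rV_(b n.+2)) = v *m d n.+2 by apply: ex; rewrite d0 mulmx0.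
exfalso; apply: (m1 hm); have <- : (delta_mx 0 i0 : 'rV[A]_(b n.+2)) 0 i0 = 1 by rewrite mxE !eqxx.
by rewrite vE; exact: (mxinMl (m_ideal hm)).
Qed.

(** A relation on the image lifts to the free module up to some v d_(n+1), and exactness modulo x_0,
    ..., x_i makes v a combination of these elements up to a boundary. That exactness requires the
    image to be a syzygy of order at least D. *)
Lemma image_reg n (x : nat -> A) D : (D <= n.+1)%N -> reg ([set 0] : set A^o) x D ->
  reg ([set 0] : set (image_mod (d n))) x D.
Proof.
move=> Dn xr i e iD; have [pr [prE prs]] := image_cover (d n).
pose io := incl (submodule_image (d n)).
have ioZ a y : io (a *: y) = a *: io y by exact: linearZ.
have [u0 u0E] := prs e; rewrite -u0E => /WxP [_ [w [-> E0]]].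
have /choice[w' w'E] (j : nat) : exists u, pr u = w j by exact: prs.
have E1 : (x i *: u0 - \sum_(j < i) x j *: w' j) *m d n = 0.
  rewrite mulmxBl -scalemxAl -prE -ioZ E0 add0r linear_sum mulmx_suml.
  apply/eqP; rewrite subr_eq0; apply/eqP; apply: eq_bigr => j _.
  by rewrite ioZ -w'E -scalemxAl -prE.
have [v vE] := ex E1.
have [|v'] := ex_at_regular xr dd ex iD (leq_trans iD Dn) (u := v).
  rewrite -vE; apply/mxin_Wx; exists (fun j => if j == i then u0 else - w' j).
  rewrite big_ord_recr /= eqxx addrC; congr (_ + _); rewrite -sumrN; apply: eq_bigr => j _.
  by rewrite ltn_eqF // scalerN.
move=> /mxin_Wx [U UE].
have E2 : x i *: (u0 - U i *m d n.+1) = \sum_(j < i) x j *: (w' j + U j *m d n.+1).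
  have : v *m d n.+1 = \sum_(j < i.+1) x j *: (U j *m d n.+1).
    rewrite -(subrK (v' *m d n.+2) v) mulmxDl -mulmxA dd mulmx0 addr0 UE mulmx_suml.
    by apply: eq_bigr => j _; rewrite scalemxAl.
  rewrite -vE big_ord_recr /= scalerBr => /eqP; rewrite subr_eq => /eqP ->.
  rewrite (addrAC (\sum_(j < i) _)) addrK -big_split.
  by apply: eq_bigr => j _; rewrite /= scalerDr addrC.
have : mxin (Wx ([set 0] : set A^o) x i) (u0 - U i *m d n.+1).
  apply: (mx_reg xr iD); rewrite E2; apply/mxin_Wx.
  by exists (fun j => w' j + U j *m d n.+1).
move=> /mxin_Wx [T TE].
apply/WxP; exists 0, (fun j => pr (T j)); split=> //; rewrite add0r.
apply: (@incl_inj _ _ _ (submodule_image (d n))); rewrite prE.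
rewrite -(subrK (U i *m d n.+1) u0) mulmxDl -mulmxA dd mulmx0 addr0 TE mulmx_suml linear_sum.
by apply: eq_bigr => j _; rewrite ioZ prE scalemxAl.
Qed.

End ImageComplex.

Lemma stably_zero_trivial (E : lmodType A) : (forall e : E, e = 0) -> stably_zero E.
Proof.
move=> h; exists 0%N, (mklin (f := fun=> 0) (fun _ _ _ => esym (etrans (addr0 _) (scaler0 _ _)))),
  (mklin (f := fun=> 0) (fun _ _ _ => esym (etrans (addr0 _) (scaler0 _ _)))) => x /=.
exact/esym.
Qed.

(** A regular sequence longer than D would give a chain of primes longer than dim A. *)
Lemma MCM_of_reg (E : lmodType A) (x : nat -> A) D : fin_gen E -> (exists e : E, e <> 0) ->
  ring_dim A = D%:Z%:E -> (forall i, m (x i)) -> reg ([set 0] : set E) x D -> MCM m E.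
Proof.
move=> fE [e0 e0N] dimA mx xr; split=> //; have hE : noeth E := noeth_fin_gen hA fE.
have proper y k : (forall i, (i < k)%N -> m (y i)) -> exists v : E, ~ Wx ([set 0] : set E) y k v.
  move=> my; apply: contrapT => h; apply: e0N.
  have : (setT : set E) `<=` [set 0].
    apply: (nakayama hm hE (@submoduleT _ _) (@submodule_zero _ _)) => v _.
    have : Wx ([set 0] : set E) y k v by apply: contrapT => nv; apply: h; exists v.
    apply: Wx_min; first by apply: submodule_addS; [exact: submodule_zero|exact: submodule_smulT].
      by apply: addSl; exact: submodule_smulT.
    move=> j w jk; apply: addSr; first exact: submodule_zero.
    by apply: smul_in => //; exact: my.
  by move=> /(_ e0 Logic.I).
have -> : depth m E = supz (nats [set n | exists2 xs : seq A,
    [set` xs] `<=` m /\ regular_seq E xs & size xs = n]).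
  congr supz; apply/seteqP; split=> z.
    by move=> [xs h <-]; exists (size xs) => //; exists xs.
  by move=> [n [xs h <-] <-]; exists xs.
rewrite dimA; apply: supz_nats_eq.
  pose xs := mkseq x D; have sxs : size xs = D by rewrite size_mkseq.
  have nx j : (j < D)%N -> nth 0 xs j = x j by move=> jD; rewrite nth_mkseq.
  have WE j : (j <= D)%N -> smul [set` take j xs] (setT : set E) = Wx [set 0] x j.
    move=> jD; rewrite smul_seq ?sxs //; apply: eq_Wx => k kj; apply: nx; lia.
  exists xs => //; split; first by move=> a /= /(nthP 0) [j jD <-]; rewrite sxs in jD; rewrite nx.
  split=> [e|i iD v].
    have [v nv] := proper x D (fun i _ => mx i); apply: nv.
    by rewrite -WE // -[X in take X]sxs take_size e.
  rewrite sxs in iD; rewrite !WE ?(ltnW iD) // nx //.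
  exact: xr.
move=> n [xs [xm [xT xreg]] <-]; have [v nv] : exists v : E, ~ Wx [set 0] (nth 0 xs) (size xs) v.
  by apply: proper => i ilt; apply: xm; exact: mem_nth.
have rg : reg ([set 0] : set E) (nth 0 xs) (size xs).
  by move=> i w lt; rewrite -!smul_seq ?(ltnW lt) //; exact: xreg.
have [S [S1 S2]] := reg_prime_chain hA hm (@submodule_zero _ _)
  (fun i lt => xm _ (mem_nth 0 lt)) rg (ex_intro _ v nv).
by apply: (supz_nats_le dimA); exists S.
Qed.

Section Periodic.
Variables (p : nat) (d : 'M[A]_p).

Definition periodic (d : 'M[A]_p) := [/\ d *m d = 0,
  forall u : 'rV_p, u *m d = 0 -> exists v, u = v *m d & mxin m d].

Hypothesis hd : periodic d.
Local Notation E := (image_mod d).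
Local Notation io := (incl (submodule_image d)).

Lemma periodic_presentation : exists pr : {linear 'rV[A]_p -> E}, presentation pr d d.
Proof.
have [dd ex _] := hd; have [pr [prE prs]] := image_cover d; exists pr; split.
- by apply/seteqP; split=> // y _; have [u uE] := prs y; exists u.
- apply/seteqP; split=> u; rewrite /ker /=.
    by move=> /(congr1 io); rewrite prE => /ex [v ->]; exists v.
  by move=> [v _ <-]; apply: (@incl_inj _ _ _ (submodule_image d)); rewrite prE -mulmxA dd mulmx0.
apply/seteqP; split=> u /=; first by move=> /ex [v ->]; exists v.
by move=> [v _ <-]; rewrite -mulmxA dd mulmx0.
Qed.

Lemma periodic_syzygy : is_syzygy m E E.
Proof.
have [dd ex dm] := hd; have [pr [h1 h2 h3]] := periodic_presentation.
exists p, io, pr; split.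
  split=> //; first exact: incl_inj.
  by rewrite incl_range h2; apply/seteqP; split=> [u [v ->]|u [v _ <-]]; exists v.
move=> v v0; have : ker pr v by []; rewrite h2 => -[u _ <-] j.
exact: (mxinMl (m_ideal hm)).
Qed.

Lemma periodic_iter_syzygy n X : iter_rel (is_syzygy m) n E X -> isomorphic E X.
Proof.
elim: n X => [|n IH] X //= [Y [/IH EY YX]].
exact: syzygy_uniq periodic_syzygy (syzygy_iso (iso_sym EY) YX).
Qed.

Lemma periodic_iter n : iter_rel (is_syzygy m) n E E.
Proof.
by elim: n => [|n IH]; [exact: iso_refl|exists E; split=> //; exact: periodic_syzygy].
Qed.

Lemma periodic_not_stably_zero : (0 < p)%N -> ~ stably_zero E.
Proof.
have [dd ex dm] := hd => p0 h.
have := @stably_zero_image (fun=> p) (fun=> d) (fun=> dd) (fun=> ex) 0 (fun=> dm) h.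
by move: p0; rewrite lt0n => /eqP.
Qed.

Lemma fin_gen_image q s (D : 'M[A]_(q, s)) : fin_gen (image_mod D).
Proof.
have [pr [_ prs]] := image_cover D; exists q, pr.
by apply/seteqP; split=> // y _; have [u uE] := prs y; exists u.
Qed.

Lemma MCM_image (b : nat -> nat) (dn : forall n, 'M[A]_(b n.+1, b n)) n (x : nat -> A) D :
  cpx dn -> exact dn -> ~ stably_zero (image_mod (dn n)) -> (D <= n.+1)%N ->
  ring_dim A = D%:Z%:E -> (forall i, m (x i)) -> reg ([set 0] : set A^o) x D -> MCM m (image_mod (dn n)).
Proof.
move=> dd ex ns Dn dimA mx xr; apply: MCM_of_reg dimA mx _.
- exact: fin_gen_image.
- apply: contrapT => h; apply/ns/stably_zero_trivial => e.
  by apply: contrapT => ne; apply: h; exists e.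
exact: image_reg.
Qed.

Lemma periodic_MCM (x : nat -> A) D : (0 < p)%N -> ring_dim A = D%:Z%:E -> (forall i, m (x i)) ->
  reg ([set 0] : set A^o) x D -> MCM m E.
Proof.
move=> p0; have [dd ex dm] := hd; have ns := periodic_not_stably_zero p0.
exact: (@MCM_image (fun=> p) (fun=> d) D x D (fun=> dd) (fun=> ex) ns (leqnSn D)).
Qed.

End Periodic.
End Local.

(** * Duals and cosyzygies of periodic modules *)

Section PeriodicDual.
Variables (A : comNzRingType) (m : set A) (hA : noetherian A) (hm : local_ring m).

Lemma lin_cV p (f : {linear 'rV[A]_p -> A^o}) : exists y : 'cV[A]_p, forall u, f u = (u *m y) 0 0.
Proof.
exists (\col_i f (delta_mx 0 i)) => u.
rewrite {1}(row_sum_delta u) linear_sum mxE; apply: eq_bigr => i _.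
by rewrite linearZ mxE.
Qed.

Lemma row_col_eq0 p (y : 'cV[A]_p) : (forall u : 'rV_p, (u *m y) 0 0 = 0) -> y = 0.
Proof.
move=> h; apply/row_matrixP => i; rewrite row0; apply/matrixP => j k.
by rewrite !ord1 rowE h mxE.
Qed.

(** The pairing sends u d and w d^T to u d w^T. A functional on the image of d is given on the cover
    by a column y with d y = 0, which has the form d y' by exactness of the transpose. *)
Lemma image_dual p (d : 'M[A]_p) : d *m d = 0 ->
  (forall u : 'rV_p, u *m d = 0 -> exists v, u = v *m d) ->
  (forall y : 'cV_p, d *m y = 0 -> exists y', y = d *m y') ->
  is_dual (image_mod d) (image_mod d^T).
Proof.
move=> dd ex exT; have [pr [prE prs]] := image_cover d.
have [prT [prTE prTs]] := image_cover d^T.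
pose io := incl (submodule_image d); pose ioT := incl (submodule_image d^T).
have /choice[w wE] : forall e, exists u, prT u = e by exact: prTs.
have lin e (a : A) x y : (io (a *: x + y) *m (w e)^T) 0 0 =
    a *: ((io x *m (w e)^T) 0 0 : A^o) + (io y *m (w e)^T) 0 0.
  by rewrite linearP mulmxDl -scalemxAl !mxE.
pose ev e : {linear image_mod d -> A^o} := 
  mklin (f := fun x => ((io x *m (w e)^T) 0 0 : A^o)) (lin e).
have evE e u : ev e (pr u) = (u *m (ioT e)^T) 0 0.
  rewrite -[LHS]/((io (pr u) *m (w e)^T) 0 0) prE -{2}(wE e) prTE -mulmxA.
  by rewrite trmx_mul trmxK.
exists ev; split=> [a e e' x|e h|f].
- have ioTP : ioT (a *: e + e') = a *: ioT e + ioT e' by exact: linearP.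
  have trP (y z : 'rV[A]_p) : (a *: y + z)^T = a *: y^T + z^T by rewrite linearP.
  have [u <-] := prs x; rewrite !evE ioTP trP mulmxDr -scalemxAr.
  by rewrite !mxE.
- apply: (@incl_inj _ _ _ (submodule_image d^T)); rewrite linear0 -/ioT.
  apply/trmx_inj; rewrite trmx0; apply: row_col_eq0 => u.
  by rewrite -evE h.
have [y yE] := lin_cV (f \o pr : {linear 'rV[A]_p -> A^o}).
have [|y' y'E] := exT y.
  apply: row_col_eq0 => u; rewrite mulmxA -yE /=.
  have -> : pr (u *m d) = 0; last by rewrite linear0.
  by apply: (@incl_inj _ _ _ (submodule_image d)); rewrite prE -mulmxA dd mulmx0.
exists (prT y'^T) => x; have [u <-] := prs x.
by rewrite evE prTE trmx_mul !trmxK -y'E -yE.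
Qed.

Variables (p : nat) (d : 'M[A]_p).
Hypotheses (hd : periodic m d).
Hypothesis (exT : forall y : 'cV_p, d *m y = 0 -> exists y', y = d *m y').

Lemma periodic_tr : periodic m d^T.
Proof.
have [dd ex dm] := hd; split; last exact: mxinT.
  by rewrite -trmx_mul dd trmx0.
move=> u h; have [|y yE] := exT (y := u^T).
  by apply: trmx_inj; rewrite trmx_mul trmxK h trmx0.
by exists y^T; apply: trmx_inj; rewrite trmx_mul !trmxK.
Qed.

Lemma periodic_cosyzygy Y X : isomorphic (image_mod d) Y -> is_cosyzygy m Y X ->
  isomorphic (image_mod d) X.
Proof.
have [dd ex dm] := hd; have hT := periodic_tr; have [ddT exTr _] := hT.
move=> EY [D [K [YD DK KX]]].
have ED : isomorphic D (image_mod d^T) := dual_iso (iso_sym EY) YD (image_dual dd ex exT).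
have KE : isomorphic (image_mod d^T) K.
  exact: (syzygy_uniq hA hm (periodic_syzygy hm hT) (syzygy_iso ED DK)).
have dT : is_dual (image_mod d^T) (image_mod d).
  rewrite -{2}[d]trmxK; apply: image_dual => // y h.
  have [|v vE] := ex y^T; first by apply: trmx_inj; rewrite trmx_mul trmxK h trmx0.
  by exists v^T; apply: trmx_inj; rewrite trmx_mul !trmxK.
exact: (dual_iso KE dT KX).
Qed.

Lemma periodic_Omega s X : is_Omega m s (image_mod d) X -> isomorphic (image_mod d) X.
Proof.
case: s => n; first exact: (periodic_iter_syzygy hA hm hd).
rewrite /is_Omega; elim: n.+1 X => [|k IH] X //= [Y [/IH EY]].
exact: periodic_cosyzygy.
Qed.

Lemma presentation_iso (M M' : lmodType A) n0 n1 n2 (q : {linear 'rV[A]_n0 -> M}) d1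
    (d2 : 'M_(n2, n1)) : presentation q d1 d2 -> isomorphic M M' ->
  exists q' : {linear 'rV[A]_n0 -> M'}, presentation q' d1 d2.
Proof.
move=> [qT qk k2] /iso_inverse [f [g [fg gf]]]; exists (f \o q : {linear 'rV[A]_n0 -> M'}).
split=> //.
  apply/seteqP; split=> // y _; have : setT (g y) by [].
  by rewrite -qT => -[x _ xE]; exists x => //=; rewrite xE gf.
rewrite -qk; apply/seteqP; split=> u; rewrite /ker /=.
  by move=> /(congr1 g); rewrite fg linear0.
by move=> ->; rewrite linear0.
Qed.

Lemma r_infty_periodic (a : nat -> A) r (I : set A) (N : lmodType A) :
  noeth N -> fin1 a r N -> gens I a r ->
  r_infty m I N (image_mod d) = (r1 I N (image_mod d))%:E.
Proof.
move=> hN fN hI; have [pr prP] := periodic_presentation hd.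
have sq := tens_sq N (presentation_sq prP).
have [P PP] := tau_evp (@noeth_ffun A N hN p) (@noeth_ffun A N hN p) (fin1_ffun p fN) (fin1_ffun p fN) sq.
apply/le_anti/andP; split.
  apply: supz_le => _ [s [X [/periodic_Omega EX ->]]].
  have [pr' prP'] := presentation_iso prP EX.
  by rewrite (r1E fN hI prP PP) (r1E fN hI prP' PP).
by apply: supz_ub; exists 0%Z, (image_mod d); split=> //; exact: iso_refl.
Qed.

End PeriodicDual.

(** * Resolutions of maximal Cohen-Macaulay modules *)

Section CommonRegular.
Variables (A : comNzRingType) (m : set A) (hA : noetherian A) (hm : local_ring m).
Variables (M : lmodType A) (fM : fin_gen M).
Variables (x y : nat -> A) (D : nat).
Hypotheses (mx : forall i, m (x i)) (my : forall i, (i < D)%N -> m (y i)).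
Hypotheses (xr : reg ([set 0] : set A^o) x D) (yr : reg ([set 0] : set M) y D).

(** A and M are joined into one module so that [regular_element] finds an element that is regular on
    quotients of both. *)
Lemma noeth_pair : noeth (A^o * M)%type.
Proof.
have [n [p pT]] := fM.
pose f (v : 'rV[A]_(1 + n)) : A^o * M := (v 0 (lshift n 0), p (rsubmx v)).
have lin (a : A) u v : f (a *: u + v) = a *: f u + f v.
  by rewrite /f linearP linearP /= !mxE.
apply: (@noeth_surj A _ _ (mklin lin)); last exact: noeth_rV.
move=> [c v]; have : setT v by []; rewrite -pT => -[u _ <-].
exists (row_mx (c%:M : 'rV_1) u); rewrite /= /f row_mxEl row_mxKr !mxE eqxx.
by [].
Qed.

(** For k < D, neither A nor M modulo the z_i chosen so far has a socle: x and y continue beyond k,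
    and [depth_unique] transfers this to z. *)
Lemma common_regular k : (k <= D)%N -> exists z, [/\ forall i, m (z i),
  reg ([set 0] : set A^o) z k & reg ([set 0] : set M) z k].
Proof.
have hM := noeth_fin_gen hA fM; have nA := noeth_self hA.
have zA := @submodule_zero A A^o; have zM := @submodule_zero A M.
elim: k => [_|k IH kD]; first by exists (fun=> 0); split=> //; move=> i; exact: m0 hm.
have [z [mz zrA zrM]] := IH (ltnW kD).
have nsA : ~ soc m (Wx ([set 0] : set A^o) z k).
  move=> s; apply: (reg_soc zA kD xr (fun i _ => mx i)).
  apply: (depth_unique hA hm nA zA (x := z)) => //.
  by move=> i v ik; apply: xr; lia.
have nsM : ~ soc m (Wx ([set 0] : set M) z k).
  move=> s; apply: (reg_soc zM kD yr my).
  apply: (depth_unique hA hm hM zM (x := z)) => //.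
    by move=> i ik; apply: my; lia.
  by move=> i v ik; apply: yr; lia.
pose F0 : set (A^o * M)%type := [set w | Wx ([set 0] : set A^o) z k w.1].
pose F1 : set (A^o * M)%type := [set w | Wx ([set 0] : set M) z k w.2].
have hWA := submodule_Wx z k zA; have hWM := submodule_Wx z k zM.
have [i|i|ze mze zeP] := @regular_element A m hA hm _ noeth_pair 2 (fun i => if i == 0%N then F0 else F1).
- move=> _; case: eqP => _.
    by split; [exact: (sub0 hWA)|move=> c u v hu hv; apply: hWA.2].
  by split; [exact: (sub0 hWM)|move=> c u v hu hv; apply: hWM.2].
- move=> _; case: eqP => _ [w [nw mw]]; first by apply: nsA; exists w.1.
  by apply: nsM; exists w.2.
pose z' i := if i == k then ze else z i.
have z'E i : (i < k)%N -> z' i = z i by rewrite /z' => ik; rewrite ltn_eqF.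
have WA i : (i <= k)%N -> Wx ([set 0] : set A^o) z' i = Wx [set 0] z i.
  by move=> ik; apply: eq_Wx => j ji; apply: z'E; lia.
have WM i : (i <= k)%N -> Wx ([set 0] : set M) z' i = Wx [set 0] z i.
  by move=> ik; apply: eq_Wx => j ji; apply: z'E; lia.
exists z'; split=> [i|i v|i v]; first by rewrite /z'; case: eqP.
- rewrite ltnS leq_eqVlt => /orP[/eqP ->|ik].
    by rewrite WA // /z' eqxx => h; have := zeP 0%N (v, 0) isT; apply.
  by rewrite WA ?(ltnW ik) // z'E //; exact: zrA.
rewrite ltnS leq_eqVlt => /orP[/eqP ->|ik].
  by rewrite WM // /z' eqxx => h; have := zeP 1%N (0, v) isT; apply.
by rewrite WM ?(ltnW ik) // z'E //; exact: zrM.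
Qed.

End CommonRegular.

Section Resolution.
Variables (A : comNzRingType) (m : set A) (hA : noetherian A) (hm : local_ring m).
Variables (M : lmodType A) (b : nat -> nat) (d : forall k, 'M[A]_(b k.+1, b k)).
Variable (p : {linear 'rV[A]_(b 0) -> M}).
Hypotheses (pT : forall x, exists v, p v = x) (pK : forall u, p u = 0 <-> exists v, u = v *m d 0).
Hypothesis (hd : min_cpx m d).

Lemma resolution_Omega n : exists (X : lmodType A) (q : {linear 'rV[A]_(b n) -> X}),
  is_Omega m n%:Z M X /\ presentation q (d n) (d n.+1).
Proof.
have [dd ex dm] := hd.
have ker2 k : [set u : 'rV[A]_(b k.+1) | u *m d k = 0] = range (fun u : 'rV[A]_(b k.+2) => u *m d k.+1).
  apply/seteqP; split=> u /=; first by move=> /ex [v ->]; exists v.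
  by move=> [v _ <-]; rewrite -mulmxA dd mulmx0.
elim: n => [|n [X [q [hX [qT qK _]]]]].
  exists M, p; split; first exact: iso_refl.
  split=> //; first by apply/seteqP; split=> // y _; have [v vE] := pT y; exists v.
  apply/seteqP; split=> u; rewrite /ker /=; first by move=> /pK [v ->]; exists v.
  by move=> [v _ <-]; apply/pK; exists v.
have qK' u : q u = 0 <-> exists v, u = v *m d n.
  split=> [h|[v ->]]; first by have : ker q u by []; rewrite qK => -[v _ <-]; exists v.
  by have : ker q (v *m d n) by rewrite qK; exists v.
have hK := submodule_ker q; pose K := subm hK.
have lin (a : A) (u v : 'rV[A]_(b n.+1)) : (a *: u + v) *m d n = a *: (u *m d n) + v *m d n.
  by rewrite mulmxDl -scalemxAl.
have [u|q' q'E] := @factor_inj A _ _ _ (incl hK) (mklin lin) (@incl_inj _ _ _ _).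
  by rewrite incl_range; apply/qK'; exists u.
exists K, q'; split.
  exists X; split=> //; exists (b n), (incl hK), q; split.
    by split=> //; [exact: incl_inj|rewrite incl_range].
  by move=> v /qK' [w ->] j; exact: (mxinMl (m_ideal hm)).
split=> //.
  apply/seteqP; split=> // y _; have /qK' [v vE] := incl_in y; exists v => //.
  by apply: (@incl_inj _ _ _ hK); rewrite q'E; exact: esym.
rewrite -ker2; apply/seteqP; split=> u; rewrite /ker /=.
  by move=> /(congr1 (incl hK)); rewrite q'E.
by move=> h; apply: (@incl_inj _ _ _ hK); rewrite q'E.
Qed.

(** Tor_i(M, A/(z_0, ..., z_(j-1))) vanishes for all i > 0. Unlike in [ex_at_regular] no degree is
    lost, because in the lowest degree the regularity of z on M replaces exactness. *)
Lemma resolution_mod_regular (z : nat -> A) D : reg ([set 0] : set A^o) z D ->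
  reg ([set 0] : set M) z D -> forall j n, (j <= D)%N -> ex_at (Wx ([set 0] : set A^o) z j) d n.
Proof.
move=> zr zrM; have [dd ex dm] := hd; elim=> [|j IH] n jD u h.
  have [|v ->] := ex n u; first by apply/matrixP => k l; rewrite (h k l) mxE.
  by exists v; rewrite subrr; exact: (mxin0 (submodule_Wx z 0 (@submodule_zero A A^o))).
have hJ k : ideal (Wx ([set 0] : set A^o) z k) by exact: (submodule_Wx z k (@submodule_zero A A^o)).
have [w [P [hw E]]] := mxin_WxS h.
have [v hv] : exists v, mxin (Wx ([set 0] : set A^o) z j) (P - v *m d n).
  case: n u h w P hw E => [|n] u h w P hw E.
    have /pK : p (u *m d 0) = 0 by apply/pK; exists u.
    have : Wx ([set 0] : set M) z j (p P).
      apply: (zrM j) => //; rewrite -linearZ /=.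
      have -> : z j *: P = u *m d 0 - w by rewrite E addrC addKr.
      have -> : p (u *m d 0 - w) = - p w.
        by rewrite linearB /= (proj2 (pK _) (ex_intro _ u erefl)) sub0r.
      apply: subN; first exact: (submodule_Wx z j (@submodule_zero A M)).
      have /mxin_Wx [U ->] := hw; apply/WxP; exists 0, (fun i => p (U i)); split=> //.
      by rewrite add0r linear_sum; apply: eq_bigr => i _; rewrite linearZ.
    move=> /WxP [_ [q [-> qE]]] _.
    have /choice[q' q'E] (i : nat) : exists v, p v = q i by exact: pT.
    have /pK [v vE] : p (P - \sum_(i < j) z i *: q' i) = 0.
      rewrite linearB linear_sum /= qE add0r; apply/eqP; rewrite subr_eq0; apply/eqP.
      by apply: eq_bigr => i _; rewrite linearZ q'E.
    exists v; apply/mxin_Wx; exists q'.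
    by rewrite -vE opprB addrCA subrr addr0.
  apply: (IH n (ltnW jD) P); apply: (mx_reg zr jD).
  rewrite scalemxAl; have -> : z j *: P = u *m d n.+1 - w by rewrite E addrC addKr.
  by rewrite mulmxBl -mulmxA dd mulmx0 sub0r; apply: (mxinN (hJ j)); exact: (mxinMr (hJ j)).
have [|v' hv'] := IH n (ltnW jD) (u - z j *: v).
  rewrite mulmxBl -scalemxAl E -addrA -scalerBr; apply: (mxinD (hJ j)) => //.
  exact: (mxinZr (hJ j)).
exists v'; rewrite -(addrNK (z j *: v) u) addrAC; apply: (mxinD (hJ j.+1)).
  by apply: mxin_sub hv' => c; exact: (@Wx_leq A A^o [set 0] z j j.+1 (@submodule_zero A A^o) (leqnSn j)).
by apply: (mxinZ (hJ j.+1)); have := @Wx_in A A^o [set 0] z j.+1 j 1 (@submodule_zero _ _) (ltnSn j);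
  rewrite -[_ *: _]/(_ * _) mulr1.
Qed.

(** A last nonzero term of the resolution is impossible in positive degree: the multiple of a basis
    vector by the socle element s is a cycle modulo z, as d has entries in m, so s would be 0 modulo
    z. *)
Lemma resolution_length (z : nat -> A) D : (forall i, m (z i)) -> reg ([set 0] : set A^o) z D ->
  reg ([set 0] : set M) z D -> soc m (Wx ([set 0] : set A^o) z D) ->
  forall n, b n.+1 = 0%N -> b 1%N = 0%N.
Proof.
move=> mz zr zrM [s [ns ms]]; have [dd ex dm] := hd.
elim=> // n IH bn; apply: IH; case E: (b n.+1) => [//|k].
have hJ : ideal (Wx ([set 0] : set A^o) z D) by exact: (submodule_Wx z D (@submodule_zero A A^o)).
pose i0 : 'I_(b n.+1) := cast_ord (esym E) ord0.
have [|v hv] := (@resolution_mod_regular z D zr zrM D n (leqnn D)) (s *: delta_mx 0 i0).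
  move=> i j; rewrite -scalemxAl mxE mulrC -rowE mxE; exact: (ms _ (dm n i0 j)).
exfalso; apply: ns; have := hv 0 i0; rewrite mxE [X in _ + X]mxE.
have -> : (v *m d n.+1) 0 i0 = 0.
  by rewrite mxE big1 // => l _; exfalso; case: l => l lb; move: (lb); rewrite bn.
by rewrite oppr0 addr0 !mxE !eqxx mulr1.
Qed.

Lemma stably_zero_resolution : b 1%N = 0%N -> stably_zero M.
Proof.
move=> b1; have pi : injective p.
  move=> u v e; apply/eqP; rewrite -subr_eq0; apply/eqP.
  have /pK [w ->] : p (u - v) = 0 by rewrite linearB /= e subrr.
  by apply/matrixP => i j; rewrite !mxE big1 // => l _; exfalso; case: l => l lb; move: (lb); rewrite b1.
have /iso_inverse [f [g [fg gf]]] := inj_surj_iso pi pT.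
by exists (b 0%N), g, f.
Qed.

Lemma ev_acyclic_rank : ev_acyclic m d -> exists n, b n.+1 = 0%N.
Proof.
have [dd ex dm] := hd; move=> [n0 h]; exists n0.
case E: (b n0.+1) => [//|k]; pose i0 : 'I_(b n0.+1) := cast_ord (esym E) ord0.
have [|v hv] := h n0 (leqnn _) (delta_mx 0 i0); first exact: (mxinMl (m_ideal hm)).
exfalso; apply: (m1 hm); have := hv 0 i0; rewrite mxE [X in _ + X]mxE !mxE !eqxx => h1.
have h2 : m ((v *m d n0.+1) 0 i0) by exact: (mxinMl (m_ideal hm)).
by rewrite -[1](subrK ((v *m d n0.+1) 0 i0)); apply: (mD hm) => //; rewrite mxE.
Qed.

Lemma MCM_regular D : MCM m M -> ring_dim A = D%:Z%:E -> exists y : nat -> A,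
  (forall i, (i < D)%N -> m (y i)) /\ reg ([set 0] : set M) y D.
Proof.
move=> [_ hdep] dimA.
have E : depth m M = supz (nats [set n | exists2 xs : seq A,
    [set` xs] `<=` m /\ regular_seq M xs & size xs = n]).
  congr supz; apply/seteqP; split=> z.
    by move=> [xs h <-]; exists (size xs) => //; exists xs.
  by move=> [n [xs h <-] <-]; exists xs.
rewrite E dimA in hdep; have [xs [xm [xT xreg]] sD] := supz_nats hdep.
exists (nth 0 xs); rewrite -sD; split=> [i lt|i v lt]; first by apply: xm; exact: mem_nth.
by rewrite -!smul_seq ?(ltnW lt) //; exact: xreg.
Qed.

Lemma MCM_not_ev_acyclic (x : nat -> A) D : MCM m M -> ~ stably_zero M ->
  ring_dim A = D%:Z%:E -> (forall i, m (x i)) -> reg ([set 0] : set A^o) x D ->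
  soc m (Wx ([set 0] : set A^o) x D) -> ~ ev_acyclic m d.
Proof.
move=> hM ns dimA mx xr sx /ev_acyclic_rank [n bn]; apply/ns/stably_zero_resolution.
have [y [my yr]] := MCM_regular hM dimA.
have [z [mz zr zrM]] := common_regular hA hm hM.1 mx my xr yr (leqnn D).
apply: (resolution_length mz zr zrM _ bn).
exact: (depth_unique hA hm (noeth_self hA) (@submodule_zero _ _) (fun i _ => mx i) (fun i _ => mz i) xr zr sx).
Qed.

End Resolution.

(** * A periodic module from an eventually acyclic cone *)

Section PeriodicOfCone.
Variables (A : comNzRingType) (m : set A) (hA : noetherian A) (hm : local_ring m).
Let hI : ideal m := m_ideal hm.
Variables (b : nat -> nat) (d : forall n, 'M[A]_(b n.+1, b n)) (e : forall n, 'M[A]_(b n.+2, b n)).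
Hypotheses (dd : cpx d) (ex : exact d) (ch : chain d e).

(** [al] and [be] compare the complex with a minimal model, whose homology modulo m is the whole
    term modulo m. Acyclicity of the cone makes the map induced by [e] bijective there, and the
    matrix is invertible by Nakayama's lemma. *)
Lemma eta_invertible j g0 g2 (al0 : 'M_(b j.+1, g0)) (be0 : 'M_(g0, b j.+1))
    (al2 : 'M_(b j.+3, g2)) (be2 : 'M_(g2, b j.+3)) H0 H0' H2 H2' :
  ex_at m (cone d e 0) j -> ex_at m (cone d e 0) j.+1 ->
  mxin m (be0 *m d j) -> mxin m (be2 *m d j.+2) ->
  mxin m (d j.+1 *m al0) -> mxin m (d j.+3 *m al2) ->
  mxin m (1%:M - be0 *m al0) -> mxin m (1%:M - be2 *m al2) ->
  1%:M - al0 *m be0 = H0 *m d j.+1 + d j *m H0' ->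
  1%:M - al2 *m be2 = H2 *m d j.+3 + d j.+2 *m H2' ->
  exists X, X *m (be2 *m e j.+1 *m al0) = 1%:M /\ (be2 *m e j.+1 *m al0) *m X = 1%:M.
Proof.
move=> exj exj1 b0 b2 a0 a2 m0' m2 hom0 hom2; pose et := be2 *m e j.+1 *m al0.
have z0 : m 0 by exact: m0 hm.
have surj (u : 'rV_g0) : exists x, mxin m (u - x *m et).
  have [|y cy [w hw]] := cone_surj hI z0 exj (u := u *m be0).
    by rewrite /cyc -mulmxA; exact: (mxinMl hI).
  exists (y *m al2).
  have h1 : mxin m ((u *m be0 - y *m e j.+1) *m al0).
    apply: (mxin_addr hI (Y := w *m d j.+1 *m al0)); last by rewrite -mulmxA; exact: (mxinMl hI).
    by rewrite -mulmxBl; exact: (mxinMr hI).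
  have h2 : mxin m (u - u *m be0 *m al0).
    by rewrite -mulmxA -{1}[u]mulmx1 -mulmxBr; exact: (mxinMl hI).
  have h3 : mxin m (y *m e j.+1 *m al0 - y *m al2 *m et).
    have -> : y *m e j.+1 *m al0 - y *m al2 *m et = y *m (1%:M - al2 *m be2) *m e j.+1 *m al0.
      by rewrite mulmxBr mulmx1 !mulmxBl /et !mulmxA.
    rewrite hom2 mulmxDr !mulmxDl !mulmxA; apply: (mxinD hI).
      by rewrite -(mulmxA _ (d j.+3)) -ch mulmxA -(mulmxA _ (d j.+1)); exact: (mxinMl hI).
    by do 3 apply: (mxinMr hI); exact: cy.
  apply: (mxin_trans hI h2); apply: (mxin_trans hI _ h3).
  by rewrite -mulmxBl.
have inj (v : 'rV_g2) : mxin m (v *m et) -> mxin m v.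
  move=> hv; have cv : mxin m (v *m be2 *m d j.+2) by rewrite -mulmxA; exact: (mxinMl hI).
  have [|w hw] := cone_inj hI z0 exj1 (v := v *m be2) cv.
    exists (v *m be2 *m e j.+1 *m H0).
    apply: (mxin_addr hI (Y := v *m be2 *m e j.+1 *m d j *m H0')); last first.
      rewrite -(mulmxA _ (e j.+1)) ch mulmxA; do 2 apply: (mxinMr hI); exact: cv.
    rewrite -addrA -opprD -!(mulmxA _ _ H0') -!(mulmxA _ H0) -mulmxDr -hom0 mulmxBr mulmx1 subKr.
    by rewrite !mulmxA; apply: (mxinMr hI); move: hv; rewrite /et !mulmxA.
  have h : mxin m (v *m be2 *m al2).
    apply: (mxin_addr hI (Y := w *m d j.+3 *m al2)); last by rewrite -mulmxA; exact: (mxinMl hI).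
    by rewrite -mulmxBl; exact: (mxinMr hI).
  apply: (mxin_addr hI _ h); rewrite -mulmxA -{1}[v]mulmx1 -mulmxBr; exact: (mxinMl hI).
have [|X0 _ hX0] := @mx_rows_in A m setT _ _ _ 1%:M et.
  by move=> i; have [x hx] := surj (row i 1%:M); exists x.
have [T [TX _]] := mx_inverse_local hA hm hX0.
exists (T *m X0); rewrite -/et; have Xet : T *m X0 *m et = 1%:M by rewrite -mulmxA.
split=> //; apply/esym/eqP; rewrite -subr_eq0; apply/eqP.
have E : (1%:M - et *m (T *m X0)) *m et = 0 by rewrite mulmxBl mul1mx -mulmxA Xet mulmx1 subrr.
apply: (mulVmx_local hA hm (mu := 1%:M - et *m (T *m X0))).
  move=> i k; have := inj (row i (1%:M - et *m (T *m X0))); rewrite -row_mul E row0.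
  by move=> /(_ (@mxin0 A m hI 1 g0)) /(_ 0 k); rewrite mxE.
by rewrite mulmxBr mulmx1 [_ *m (et *m _)]mulmxA E mul0mx subr0.
Qed.

Lemma tor_len_min (a : nat -> A) r (N : lmodType A) (g : nat -> nat)
    (dg : forall n, 'M[A]_(g n.+1, g n)) (bs : nat -> nat) (ds : forall n, 'M[A]_(bs n.+1, bs n))
    (al : forall n, 'M_(bs n, g n)) (be : forall n, 'M_(g n, bs n)) h j n :
  fin1 a r N -> cpx dg -> cpx ds -> (forall n, al n.+1 *m dg n = ds n *m al n) ->
  (forall n, be n.+1 *m ds n = dg n *m be n) ->
  1%:M - be j.+1 *m al j.+1 = h j.+1 *m dg j.+1 + dg j *m h j ->
  (tor_len a r N (dg j) (dg j.+1) n <= tor_len a r N (ds j) (ds j.+1) n)%N.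
Proof.
move=> fN gg ss ca cb hom.
exact: (tor_len_le fN n (gg j) (ss j) (esym (cb j)) (esym (ca j.+1)) hom).
Qed.

Section Delta.
Variables (g : nat -> nat) (dg : forall n, 'M[A]_(g n.+1, g n)) (et : forall n, 'M[A]_(g n.+2, g n)).
Hypotheses (hg : min_cpx m dg) (cg : chain dg et) (X0 : 'M[A]_(g 0, g 2)) (X1 : 'M[A]_(g 1, g 3)).
Hypotheses (X0e : X0 *m et 0 = 1%:M) (eX0 : et 0 *m X0 = 1%:M) (X1e : X1 *m et 1 = 1%:M)
  (eX1 : et 1 *m X1 = 1%:M).

(** The 2-periodic resolution folded to period one: [dg 1] leads from the second summand to the
    first, and [dg 2], preceded by the inverse [X1] of [et 1], leads back. *)
Definition delta : 'M[A]_(g 1 + g 2) := block_mx 0 (X1 *m dg 2) (dg 1) 0.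

Lemma delta_comm : X1 *m dg 2 = dg 0 *m X0.
Proof.
rewrite -[dg 2]mulmx1 -eX0 [dg 2 *m _]mulmxA -cg !mulmxA X1e mul1mx.
by [].
Qed.

Lemma delta_periodic : periodic m delta.
Proof.
have [gg exg gm] := hg; split.
- rewrite mulmx_block !mulmx0 !mul0mx !addr0 !add0r -mulmxA gg mulmx0 delta_comm mulmxA gg mul0mx.
  exact: block_mx0.
- move=> w; rewrite -[w]hsubmxK mul_row_block !mulmx0 addr0 add0r.
  set u := lsubmx w; set v := rsubmx w => /eqP.
  rewrite -[0](@row_mx0 A 1 (g 1) (g 2)) => /eqP /eq_row_mx [/exg [v' ->] h2].
  have [|u' ->] := exg 0%N u.
    rewrite -[u *m _]mulmx1 -X0e; move: h2; rewrite delta_comm !mulmxA => ->.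
    by rewrite mul0mx.
  exists (row_mx (v' *m et 1) u'); rewrite mul_row_block !mulmx0 addr0 add0r.
  by rewrite mulmxA -(mulmxA v') eX1 mulmx1.
move=> i k; rewrite mxE; case: (split i) => i'; rewrite mxE; case: (split k) => k'.
- by rewrite mxE; exact: m0 hm.
- exact: (mxinMl hI).
- exact: gm.
- by rewrite mxE; exact: m0 hm.
Qed.

(** Up to the periodicity isomorphisms, [delta] is the direct sum of the resolution and its shift,
    that is, the cone of the zero chain map. *)
Lemma tor_len_delta (a : nat -> A) r (N : lmodType A) n : fin1 a r N ->
  (tor_len a r N delta delta n <=
   tor_len a r N (dg 1) (dg 2) n + tor_len a r N (dg 2) (dg 3) n)%N.
Proof.
move=> fN; have [gg exg gm] := hg.
pose z k : 'M[A]_(g k.+2, g k) := 0.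
have cz : chain dg z by move=> k; rewrite /z mul0mx mulmx0.
apply: leq_trans (tor_len_cone 1 n fN gg cz).
have [sq _ _] := delta_periodic; have DD := cpx_cone gg cz.
pose th : 'M[A]_(g 1 + g 2, g 2 + g 3) := block_mx 0 (- X1) 1%:M 0.
pose Y1 : 'M[A]_(g 2 + g 3, g 1 + g 2) := block_mx 0 1%:M (- et 1) 0.
pose Y2 : 'M[A]_(g 3 + g 4, g 1 + g 2) := block_mx (et 1) 0 0 (et 2).
have s0 k : 0%:M = 0 :> 'M[A]_k by exact: raddf0.
have c0 : delta *m 1%:M = th *m cone dg z 0 1.
  rewrite mulmx1 mulmx_block s0 !mul0mx !mulmx0 !addr0 !add0r !mul1mx mulNmx mulmxN opprK.
  by [].
have c2 : cone dg z 0 2 *m Y1 = Y2 *m delta.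
  rewrite !mulmx_block s0 !mul0mx !mulmx0 !addr0 !add0r !mulmx1 mulNmx mulmxN opprK mulmxA eX1 mul1mx.
  by rewrite cg.
apply: (@tor_len_le A a r N fN _ _ _ _ _ _ delta delta (cone dg z 0 1) (cone dg z 0 2)
  1%:M th Y1 Y2 0 0 n sq (DD 1%N) c0 c2).
rewrite mul0mx mulmx0 addr0 mulmx_block !mul0mx !mulmx0 !addr0 !add0r mulNmx mulmxN opprK X1e mul1mx.
by rewrite -scalar_mx_block subrr.
Qed.

End Delta.

End PeriodicOfCone.

Section PeriodicOfCone2.
Variables (A : comNzRingType) (m : set A) (hA : noetherian A) (hm : local_ring m).
Let hI : ideal m := m_ideal hm.

Lemma periodic_of_cone b (d : forall n, 'M[A]_(b n.+1, b n)) (e : forall n, 'M[A]_(b n.+2, b n)) :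
  cpx d -> exact d -> chain d e -> ~ ev_acyclic m d -> ev_acyclic m (cone d e 0) ->
  exists p (dl : 'M[A]_p) k, [/\ (0 < p)%N, periodic m dl &
    forall (a : nat -> A) r (N : lmodType A) n, fin1 a r N -> (tor_len a r N dl dl n <=
      tor_len a r N (d k) (d k.+1) n + tor_len a r N (d k.+1) (d k.+2) n)%N].
Proof.
move=> dd ex ch nd [n0 hc].
(* The failure of acyclicity beyond n0 will make the size of the periodic matrix positive. *)
have [k [n0k nk]] : exists k, (n0 <= k)%N /\ ~ ex_at m d k.+2.
  apply: contrapT => h; apply: nd; exists n0.+2 => -[//|[//|n]] lt; apply: contrapT => nx.
  by apply: h; exists n.
have [pr [prE prs]] := image_cover (d k).
have prT : range pr = setT by apply/seteqP; split=> // y _; have [u uE] := prs y; exists u.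
have prK u : pr u = 0 <-> u *m d k = 0.
  rewrite -prE; split=> [->|h]; first exact: linear0.
  by apply: (@incl_inj _ _ _ (submodule_image (d k))); rewrite h.
have fg : fin_gen (image_mod (d k)) by exists (b k.+1), pr.
(* The complex [d] need not be minimal: its shift [ds] is compared with the minimal resolution of
   the image of d_k. *)
have [g [dg [q [qs qK hg]]]] := min_resolution hA hm fg; have [gg exg gm] := hg.
have qT : range q = setT by apply/seteqP; split=> // y _; have [u uE] := qs y; exists u.
pose bs n := b (n + k.+1)%N; pose ds n : 'M[A]_(bs n.+1, bs n) := d (n + k.+1)%N.
have ss : cpx ds by move=> n; exact: dd.
have exs : exact ds by move=> n u; exact: ex.
have [al0 al0E] := lift_free pr (idfun : {linear image_mod (d k) -> _}) qT.
have [be0 be0E] := lift_free q (idfun : {linear image_mod (d k) -> _}) prT.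
have [|al [alE ca]] := chain_extend exg ss (e0 := al0).
  have [|z zE] := @mx_rows A _ _ _ (ds 0 *m al0) (dg 0); last by exists z.
  move=> i; apply/qK; rewrite row_mul al0E /=; apply/prK.
  by rewrite -row_mul -[d k]/(d k) dd row0.
have [|be [beE cb]] := chain_extend exs gg (e0 := be0).
  have [|z zE] := @mx_rows A _ _ _ (dg 0 *m be0) (ds 0); last by exists z.
  move=> i; apply: (ex k); apply/prK; rewrite row_mul be0E /=; apply/qK.
  by exists (delta_mx 0 i); rewrite -rowE.
have [h0 h0E] : exists h0, 1%:M - al 0%N *m be 0%N = h0 *m ds 0.
  apply: mx_rows => i; apply: (ex k); apply/prK; rewrite rowE mulmxBr mulmx1 linearB /=.
  by rewrite mulmxA beE alE be0E /= al0E subrr.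
have [h0' h0E'] : exists h0, 1%:M - be 0%N *m al 0%N = h0 *m dg 0.
  apply: mx_rows => i; apply/qK; rewrite rowE mulmxBr mulmx1 linearB /=.
  by rewrite mulmxA beE alE al0E /= be0E subrr.
have [n|h [hE homF]] := homotopy_extend exs ss (w := fun n => 1%:M - al n *m be n) _ h0E.
  by rewrite mulmxBl mulmxBr mul1mx mulmx1 -mulmxA cb mulmxA ca mulmxA.
have [n|h' [hE' homG]] := homotopy_extend exg gg (w := fun n => 1%:M - be n *m al n) _ h0E'.
  by rewrite mulmxBl mulmxBr mul1mx mulmx1 -mulmxA ca mulmxA cb mulmxA.
have min n : mxin m (1%:M - be n *m al n).
  case: n => [|n]; first by rewrite h0E'; exact: (mxinMl hI).
  by rewrite homG; apply: (mxinD hI); [exact: (mxinMl hI)|exact: (mxinMr hI)].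
pose et n : 'M[A]_(g n.+2, g n) := be n.+2 *m e (n + k.+1)%N *m al n.
have cg : chain dg et.
  move=> n; rewrite /et -!mulmxA ca.
  rewrite (mulmxA (e _)) -[ds n]/(d (n + k.+1)%N) (ch (n + k.+1)%N) !mulmxA.
  by rewrite -[d (n + k.+1).+2]/(ds n.+2) cb.
have inv n : exists X, X *m et n.+1 = 1%:M /\ et n.+1 *m X = 1%:M.
  apply: (@eta_invertible A m hA hm b d e ch (n + k.+1)%N _ _ (al n.+1) (be n.+1) (al n.+3) (be n.+3)
    (h n.+1) (h n) (h n.+3) (h n.+2)).
  - by apply: hc; lia.
  - by apply: hc; lia.
  - suff: mxin m (be n.+1 *m ds n) by []. by rewrite cb; exact: (mxinMr hI).
  - suff: mxin m (be n.+3 *m ds n.+2) by []. by rewrite cb; exact: (mxinMr hI).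
  - suff: mxin m (ds n.+1 *m al n.+1) by []. by rewrite -ca; exact: (mxinMl hI).
  - suff: mxin m (ds n.+3 *m al n.+3) by []. by rewrite -ca; exact: (mxinMl hI).
  - exact: min.
  - exact: min.
  - exact: (homF n).
  - exact: (homF n.+2).
have [X0 [X0e eX0]] := inv 0%N; have [X1 [X1e eX1]] := inv 1%N.
(* The index is shifted because [inv] covers only the [et n.+1]. *)
pose g' n := g n.+1; pose dg' n : 'M[A]_(g' n.+1, g' n) := dg n.+1.
pose et' n : 'M[A]_(g' n.+2, g' n) := et n.+1.
have hg' : min_cpx m dg' by split=> n; [exact: gg|move=> u; exact: exg|exact: gm].
have cg' : chain dg' et' by move=> n; exact: cg.
exists (g 2 + g 3)%N, (delta dg' X1), k.+3; split.
(* If g 2 = 0, the homotopy writes u as a boundary plus u ds_1 h_1, so [d] would be exact modulo m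
   at k + 2. *)
- rewrite addn_gt0 lt0n; apply/orP; left; apply/eqP => g2; apply: nk => u hu.
  have uE : u = u *m (1%:M - al 2%N *m be 2%N).
    rewrite mulmxBr mulmx1 mulmxA.
    have -> : u *m al 2%N = 0 by apply/matrixP => i j; exfalso; case: j => j jb; move: (jb); rewrite g2.
    by rewrite mul0mx subr0.
  exists (u *m h 2%N).
  have -> : u - u *m h 2%N *m d k.+3 = u *m ds 1%N *m h 1%N.
    by rewrite {1}uE (homF 1%N) mulmxDr !mulmxA [X in X - _]addrC addrK.
  exact: (mxinMr hI).
- exact: (delta_periodic hm hg' cg' X0e eX0 X1e eX1).
move=> a r N n fN; apply: leq_trans (tor_len_delta hm hg' cg' X0e eX0 X1e eX1 n fN) _.
apply: leq_add; first exact: (tor_len_min n fN gg ss ca cb (homG 2%N)).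
exact: (tor_len_min n fN gg ss ca cb (homG 3%N)).
Qed.

End PeriodicOfCone2.

(** * Minimality *)

Lemma infz_min (S : set (\bar int)) x : S x -> (forall y, S y -> (x <= y)%E) -> infz S = x.
Proof.
move=> Sx lb; rewrite /infz /infimum; case: ifPn => [/eqP e|_]; first by move: Sx; rewrite e.
case: xgetP => [y -> [ly uy]|/(_ x) []]; last by split=> // y; apply.
by apply/le_anti/andP; split; [exact: ly|exact: uy].
Qed.

Section Below.
Variables (A : comNzRingType) (m : set A) (hA : noetherian A) (hm : local_ring m).
Variables (B Q : comNzRingType) (phi : {rmorphism A -> B}) (g : {rmorphism Q -> B}) (mQ : set Q).
Variables (f X : nat -> Q) (c DX : nat).
Hypothesis st : ci_structure m phi g mQ f X c DX.
Variables (x : nat -> A) (D : nat).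
Hypotheses (dimA : ring_dim A = D%:Z%:E) (mx : forall i, m (x i)).
Hypotheses (xr : reg ([set 0] : set A^o) x D) (sx : soc m (Wx ([set 0] : set A^o) x D)).
Variables (N : lmodType A) (hN : noeth N) (a : nat -> A) (r : nat) (fN : fin1 a r N).
Variables (I : set A) (hI : gens I a r).

Lemma tor_len_evp n0 n1 n2 (d1 : 'M[A]_(n1, n0)) (d2 : 'M[A]_(n2, n1)) : d2 *m d1 = 0 ->
  exists P, evp (fun n => (tor_len a r N d1 d2 n)%:R) P.
Proof.
move=> sq; apply: tau_evp.
- exact: (@noeth_ffun A N hN n0).
- exact: (@noeth_ffun A N hN n1).
- exact: fin1_ffun.
- exact: fin1_ffun.
- exact: tens_sq.
Qed.

Lemma size_evp_le2 (u v w : nat -> nat) P1 P2 P : evp (fun n => (v n)%:R) P1 ->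
  evp (fun n => (w n)%:R) P2 -> evp (fun n => (u n)%:R) P -> (forall n, (u n <= v n + w n)%N) ->
  (size P <= maxn (size P1) (size P2))%N.
Proof.
move=> h1 h2 h le; apply: leq_trans (size_polyD P1 P2).
apply: (evp_size h (evpD h1 h2)); exists 0%N => n _.
by rewrite ler0n -natrD ler_nat le.
Qed.

Lemma periodic_below (M : lmodType A) : MCM m M -> ~ stably_zero M ->
  exists p (d : 'M[A]_p), [/\ (0 < p)%N, periodic m d &
    ((r1 I N (image_mod d))%:E <= r_infty m I N M)%E].
Proof.
move=> hM ns; have [b [d [q [qs qK hd]]]] := min_resolution hA hm hM.1.
pose small (P : {poly rat}) := (((size P)%:Z - 1)%:E <= r_infty m I N M)%E.
pose F b (d : forall n, 'M[A]_(b n.+1, b n)) := forall n, exists P,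
  evp (fun k => (tor_len a r N (d n) (d n.+1) k)%:R) P /\ small P.
have small2 (P1 P2 P : {poly rat}) : small P1 -> small P2 -> (size P <= maxn (size P1) (size P2))%N -> small P.
  move=> s1 s2 le; rewrite /small.
  have [h|h] := leqP (size P1) (size P2).
    by apply: le_trans s2; rewrite lee_fin; move: le; rewrite (maxn_idPr h); lia.
  by apply: le_trans s1; rewrite lee_fin; move: le; rewrite (maxn_idPl (ltnW h)); lia.
(* The pair (d_n, d_(n+1)) presents the n-th syzygy of M, so its polynomial has degree r_1 of that
   syzygy. *)
have Fd : F b d.
  move=> n; have [X' [q' [hX pX]]] := resolution_Omega hm qs qK hd n.
  have [P hP] := tor_len_evp (presentation_sq pX); exists P; split=> //.
  rewrite /small -(r1E fN hI pX hP); apply: supz_ub.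
  by exists n%:Z, X'.
have nac := MCM_not_ev_acyclic hA hm qs qK hd hM ns dimA mx xr sx.
have [dd ex dm] := hd.
have Fcone b0 (d0 : forall n, 'M[A]_(b0 n.+1, b0 n)) e0 :
    cpx d0 -> exact d0 -> chain d0 e0 -> F b0 d0 -> F _ (cone d0 e0 0).
  move=> dd0 ex0 ch0 F0 n; have [P1 [h1 s1]] := F0 n; have [P2 [h2 s2]] := F0 n.+1.
  have [P hP] := tor_len_evp (cpx_cone dd0 ch0 n); exists P; split=> //.
  apply: (small2 _ _ _ s1 s2); apply: (size_evp_le2 h1 h2 hP) => k.
  exact: tor_len_cone.
have [b' [d' [e' [[Fd' dd' ex' ch' nac'] ac']]]] := reduction hA st Fcone dd ex Fd nac.
have [p [dl [k [p0 hdl le]]]] := periodic_of_cone hA hm dd' ex' ch' nac' ac'.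
exists p, dl; split=> //.
have [pr hpr] := periodic_presentation hdl.
have [P hP] := tor_len_evp (presentation_sq hpr).
have [P1 [h1 s1]] := Fd' k; have [P2 [h2 s2]] := Fd' k.+1.
rewrite (r1E fN hI hpr hP); apply: (small2 _ _ _ s1 s2).
by apply: (size_evp_le2 h1 h2 hP) => n; exact: le.
Qed.

Lemma minimal_periodic (M0 : lmodType A) : MCM m M0 -> ~ stably_zero M0 ->
  exists E : lmodType A,
    [/\ MCM m E,
        exists X : lmodType A, is_Omega m 2%:Z E X /\ isomorphic X E
      & (r1 I N E)%:E =
        infz [set r | exists M : lmodType A,
                [/\ MCM m M, ~ stably_zero M & r = r_infty m I N M]]].
Proof.
move=> hM0 ns0.
(* k is the size of the polynomial, r_1 + 1: a natural number, so that a minimum is attained. *)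
pose R k := exists p (d : 'M[A]_p), [/\ (0 < p)%N, periodic m d &
  r1 I N (image_mod d) = k%:Z - 1].
have RP p (d : 'M[A]_p) : (0 < p)%N -> periodic m d -> exists k, R k /\ r1 I N (image_mod d) = k%:Z - 1.
  move=> p0 hd; have [pr hpr] := periodic_presentation hd.
  have [P hP] := tor_len_evp (presentation_sq hpr).
  have e := r1E fN hI hpr hP; exists (size P); split=> //.
  by exists p, d.
have Rex : exists k, `[< R k >].
  have [p [d [p0 hd _]]] := periodic_below hM0 ns0; have [k [Rk _]] := RP p d p0 hd.
  by exists k; apply/asboolP.
have [k /asboolP[p [d [p0 hd e]]] kmin] := ex_minnP Rex.
have [dd ex dm] := hd.
have rE : r_infty m I N (image_mod d) = (r1 I N (image_mod d))%:E.
  exact: (r_infty_periodic hA hm hd (periodic_dual_exact st dd ex) hN fN hI).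
have hE := periodic_MCM hA hm hd p0 dimA mx xr.
have nE := periodic_not_stably_zero hA hm hd p0.
exists (image_mod d); split=> //.
  by exists (image_mod d); split; [exact: periodic_iter|exact: iso_refl].
symmetry; apply: infz_min; first by exists (image_mod d).
move=> _ [M [hM nM ->]]; have [p' [d' [p0' hd' le]]] := periodic_below hM nM.
apply: le_trans le; have [k' [Rk' ->]] := RP p' d' p0' hd'.
by rewrite e lee_fin lerD2r lez_nat; apply: kmin; apply/asboolP.
Qed.

End Below.

(** * A non-free maximal Cohen-Macaulay module *)

Section Koszul.
Variables (A : comNzRingType) (m : set A) (hA : noetherian A) (hm : local_ring m).
Let hI : ideal m := m_ideal hm.
Local Notation m2 := (ideal_pow m 2).
Local Notation Y y k := (Wx ([set 0] : set A^o) y k).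

Lemma m2_ideal : ideal m2. Proof. exact: (ideal_pow_ideal hA hm). Qed.

Lemma mxin_m2 p q s (U : 'M[A]_(p, q)) (V : 'M[A]_(q, s)) : mxin m U -> mxin m V -> mxin m2 (U *m V).
Proof.
apply: mxin_mul; first exact: m2_ideal.
by move=> a c ma mc; apply: ideal_powM => //; rewrite (ideal_pow1 hA hm).
Qed.

(* In other words, the y_j are linearly independent modulo m ^ 2. *)
Definition independent (y : nat -> A) k := forall j a, (j < k)%N ->
  addS (Y y j) (m2 : set A^o) (a * y j) -> m a.

(** If k <= D elements cannot be extended, they generate m modulo m^2, hence m by Nakayama's lemma,
    and A would be regular. *)
Lemma independent_exists D : ~ regular_local m -> ring_dim A = D%:Z%:E ->
  exists y, (forall i, m (y i)) /\ independent y D.+1.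
Proof.
move=> nr dimA; have zA := @submodule_zero A A^o.
suff key k : (k <= D.+1)%N -> exists y, (forall i, m (y i)) /\ independent y k by exact: key.
elim: k => [_|k IH kD]; first by exists (fun=> 0); split=> // _; exact: m0 hm.
have [y [my iy]] := IH (ltnW kD).
have hY := submodule_Wx y k zA; have hY2 : submodule (addS (Y y k) (m2 : set A^o)).
  by apply: submodule_addS => //; exact: m2_ideal.
have [w mw nw] : exists2 w, m w & ~ addS (Y y k) (m2 : set A^o) w.
  apply: contrapT => h; apply: nr.
  (* [regular_local] asks for exactly D generators, whence the padding with zeros. *)
  pose y' i := if (i < k)%N then y i else 0.
  have my' i : m (y' i) by rewrite /y'; case: ifP => // _; exact: m0 hm.
  exists (mkseq y' D); rewrite size_mkseq; split=> //.
  rewrite /ideal_gen -[mkseq y' D]take_size smul_seq // size_mkseq.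
  have -> : Y (nth 0 (mkseq y' D)) D = Y y' D.
    by apply: eq_Wx => j jD; rewrite nth_mkseq.
  apply/seteqP; split; last first.
    apply: (Wx_min hI) => [_ ->|j v _]; first exact: m0 hm.
    by rewrite -[_ *: _]/(y' j * v); apply: (mMr hm).
  have sub : (m : set A^o) `<=` Y y k.
    apply: (nakayama hm (noeth_self hA) hI hY) => z mz.
    have : addS (Y y k) (m2 : set A^o) z by apply: contrapT => nz; apply: h; exists z.
    have m2E : (m2 : set A^o) = smul m (m : set A^o).
      by rewrite /ideal_pow iterS -/(ideal_pow m 1) (ideal_pow1 hA hm).
    by rewrite m2E.
  by move=> z /sub; rewrite -(@eq_Wx A A^o [set 0] y' y k) => [|j jk]; [exact: Wx_leq|rewrite /y' jk].
pose y' i := if i == k then w else y i.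
have yE i : (i < k)%N -> y' i = y i by rewrite /y' => ik; rewrite ltn_eqF.
exists y'; split=> [i|j a]; first by rewrite /y'; case: eqP.
have YE i : (i <= k)%N -> Y y' i = Y y i by move=> ik; apply: eq_Wx => l li; apply: yE; lia.
rewrite ltnS leq_eqVlt => /orP[/eqP ->|jk]; last by rewrite YE ?(ltnW jk) // yE //; exact: iy.
rewrite YE // /y' eqxx => h; apply: contrapT => /(local_unit hm) [c ac]; apply: nw.
by have := subZ c hY2 h; rewrite -[_ *: _]/(c * (a * w)) mulrA [c * a]mulrC ac mul1r.
Qed.

Definition pred_rk (b : nat -> nat) n := if n is n'.+1 then b n' else 0%N.

Definition pred_cpx (b : nat -> nat) (d : forall n, 'M[A]_(b n.+1, b n)) n :
    'M[A]_(pred_rk b n.+1, pred_rk b n) :=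
  match n with 0 => 0 | n'.+1 => d n' end.

(* The cone of multiplication by y, now in the usual homological degrees. *)
Definition koszul_cone b (d : forall n, 'M[A]_(b n.+1, b n)) (y : A) n :
    'M[A]_(b n.+1 + pred_rk b n.+1, b n + pred_rk b n) :=
  block_mx (d n) 0 (y%:M : 'M_(b n)) (- pred_cpx d n).

(** The Koszul complex, one cone at a time. Its differential is injective from coefficients in A/m
    to coefficients in m/m^2: in the lowest degree by independence, above by induction on the two
    halves of the cone. *)
Lemma koszul_exists y k : (forall i, m (y i)) -> independent y k ->
  exists (b : nat -> nat) (d : forall n, 'M[A]_(b n.+1, b n)),
    [/\ cpx d, b 0%N = 1%N & (0 < b k)%N] /\
    [/\ mxin (Y y k) (d 0%N) &
      forall n (u : 'rV_(b n.+1)), mxin m2 (u *m d n) -> mxin m u].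
Proof.
move=> my; have zA := @submodule_zero A A^o; have m2I := m2_ideal.
elim: k => [_|k IH iy].
  exists (fun n => (n == 0)%N : nat), (fun n => 0); split; split=> //.
  - by move=> n; rewrite mul0mx.
  - by move=> i j; rewrite mxE.
  by move=> n u _ i [].
have [|b [d [[dd b0 bk] [d0 inj]]]] := IH.
  by move=> j a jk; apply: iy; exact: leqW.
have hY : ideal (Y y k) := submodule_Wx (y : nat -> A) k zA.
exists (fun n => b n + pred_rk b n)%N, (koszul_cone d (y k)); split; split.
- move=> n; rewrite /koszul_cone mulmx_block !mul0mx !mulmx0 !addr0 add0r dd.
  rewrite mul_scalar_mx mulNmx mul_mx_scalar subrr mulNmx mulmxN opprK.
  by case: n => [|n]; rewrite /= ?mulmx0 ?dd block_mx0.
- by rewrite b0.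
- by rewrite /= addn_gt0 bk orbT.
- move=> i j; rewrite /koszul_cone mxE; case: (split i) => i'; rewrite mxE; case: (split j) => [j'|[]//].
    by apply: (@Wx_leq A A^o [set 0] y k k.+1 zA (leqnSn k)); exact: d0.
  rewrite mxE; case: eqP => _; last by rewrite mulr0n; exact: (sub0 (submodule_Wx (y : nat -> A) k.+1 zA)).
  have := @Wx_in A A^o [set 0] y k.+1 k 1 zA (ltnSn k).
  by rewrite -[_ *: _]/(y k * 1) mulr1 mulr1n.
move=> n w; rewrite -[w]hsubmxK /koszul_cone; move: (lsubmx w) (rsubmx w) => {w} u v.
rewrite mul_row_block mulmx0 add0r mulmxN mul_mx_scalar mxin_row => -[h1 h2].
have mv : mxin m v.
  case: n u v h1 h2 => [|n] u v h1 h2.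
    move=> i j; apply: (iy k _ (ltnSn k)); have := h1 i j; rewrite mxE [X in _ + X]mxE => h.
    exists (- (u *m d 0%N) i j), ((u *m d 0%N) i j + y k * v i j); split=> //.
      by apply: (subN hY); exact: (mxinMl hY).
    by rewrite addKr mulrC.
  by apply: inj; rewrite -[_ *m _]opprK; exact: (mxinN m2I).
apply/mxin_row; split=> //; apply: inj; rewrite -(addrK (y k *: v) (u *m d n)).
apply: (mxinB m2I) => //; move=> i j; rewrite mxE; apply: ideal_powM => //.
by rewrite (ideal_pow1 hA hm).
Qed.

Lemma split_mod_m p q (X : 'M[A]_(p, q)) : (forall u : 'rV_p, mxin m (u *m X) -> mxin m u) ->
  exists Z, X *m Z = 1%:M.
Proof.
move=> inj; have [b [s [z [S [sz zs Xz]]]]] := mincover hm X.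
have [|T [_ XT]] := @mx_inverse_local A m hA hm p (X *m S).
  move=> i j; have := inj (row i (1%:M - X *m S)) _ 0 j; rewrite mxE; apply.
  rewrite -row_mul mulmxBl mul1mx.
  have -> : X - X *m S *m X = X *m z *m s.
    by rewrite -mulmxA -zs mulmxBr mulmx1 subKr mulmxA.
  by move=> a c; rewrite mxE; exact: (mxinMr hI).
by exists (S *m T); rewrite mulmxA.
Qed.

(** Serre's argument: if u al_(n+1) is in m, then u dK al_n = u al_(n+1) d is in m^2; as al_n
    splits, u dK is in m^2, so u is in m. *)
Lemma koszul_inj (bK b : nat -> nat) (dK : forall n, 'M[A]_(bK n.+1, bK n))
    (d : forall n, 'M[A]_(b n.+1, b n)) (al : forall n, 'M_(bK n, b n)) :
  (forall n (u : 'rV_(bK n.+1)), mxin m2 (u *m dK n) -> mxin m u) ->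
  (forall n, mxin m (d n)) -> (forall n, al n.+1 *m d n = dK n *m al n) ->
  (forall u : 'rV_(bK 0), mxin m (u *m al 0%N) -> mxin m u) ->
  forall n (u : 'rV_(bK n)), mxin m (u *m al n) -> mxin m u.
Proof.
move=> injK dm ca inj0; elim=> // n IH u hu; apply: injK.
have [Z ZE] := split_mod_m IH.
rewrite -[_ *m _]mulmx1 -ZE [_ *m (al n *m _)]mulmxA -(mulmxA u) -ca (mulmxA u).
by apply: (mxinMr m2_ideal); exact: mxin_m2.
Qed.

Lemma residue_rank (b : nat -> nat) (d : forall n, 'M[A]_(b n.+1, b n))
    (p : {linear 'rV[A]_(b 0) -> quo hI}) D :
  (forall x, exists v, p v = x) -> (forall u, p u = 0 <-> exists v, u = v *m d 0) ->
  min_cpx m d -> ~ regular_local m -> ring_dim A = D%:Z%:E -> b D.+1 <> 0%N.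
Proof.
move=> pT pK [dd ex dm] nr dimA bD.
have [y [my iy]] := independent_exists nr dimA.
have [bK [dK [[ddK bK0 bKD] [dK0 injK]]]] := koszul_exists my iy.
have [v0 v0E] := pT (proj hI (1 : A^o)).
have projZ (c : A) (z : A^o) : c *: proj hI z = proj hI (c * z : A^o).
  by apply: esym; exact: linearZ.
have kill (c : A) : p (c *: v0) = 0 <-> m c.
  rewrite linearZ /= v0E projZ -[c in m c]mulr1.
  exact: proj_eq0.
(* As bK 0 = 1, this is the single row v0, a lift of 1 to the cover of the residue field. *)
pose al0 : 'M[A]_(bK 0, b 0) := \matrix_(i, j) v0 0 j.
have al0E (u : 'rV_(bK 0)) : u *m al0 = (\sum_i u 0 i) *: v0.
  apply/matrixP => i j; rewrite !ord1 !mxE mulr_suml; apply: eq_bigr => l _.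
  by rewrite mxE.
have sumE (u : 'rV[A]_(bK 0)) i : \sum_l u 0 l = u 0 i.
  rewrite (bigD1 i) //= big1 ?addr0 // => l /eqP; case; apply/val_inj => /=.
  by case: l i => [l hl] [i hi] /=; move: hl hi; rewrite bK0; lia.
have pm (w : 'rV[A]_(b 0)) : mxin m w -> p w = 0.
  move=> hw; rewrite (row_sum_delta w) linear_sum big1 // => i _.
  rewrite linearZ /= -[p _]repK -[cls _ _]/(proj hI _) projZ; apply/proj_eq0.
  exact: (mMr hm).
have inj0 (u : 'rV_(bK 0)) : mxin m (u *m al0) -> mxin m u.
  by move=> h i j; rewrite ord1 -(sumE u j); apply/kill; rewrite -al0E; exact: pm.
have [|al [alE ca]] := chain_extend ex ddK (e0 := al0).
  have [|z zE] := @mx_rows A _ _ _ (dK 0%N *m al0) (d 0%N); last by exists z.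
  move=> i; apply/pK; rewrite row_mul al0E; apply/kill.
  apply: (sub_sum _ hI) => l _; rewrite mxE.
  have sub : Y y D.+1 `<=` m; last by apply: sub; exact: dK0.
  apply: (Wx_min hI) => [_ ->|j v _]; first exact: m0 hm.
  by rewrite -[_ *: _]/(y j * v); apply: (mMr hm).
have inj := koszul_inj injK dm ca; rewrite alE in inj.
have key (u : 'rV_(bK D.+1)) : mxin m u.
  apply: (inj inj0) => i j; exfalso; case: j => j jb; move: (jb); rewrite bD.
  by [].
apply: (m1 hm); pose i0 : 'I_(bK D.+1) := Ordinal bKD.
have := key (delta_mx 0 i0) 0 i0; rewrite mxE !eqxx; apply.
Qed.

Lemma exists_nonfree D (x : nat -> A) : ~ regular_local m -> ring_dim A = D.+1%:Z%:E ->
  (forall i, m (x i)) -> reg ([set 0] : set A^o) x D.+1 ->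
  exists M : lmodType A, MCM m M /\ ~ stably_zero M.
Proof.
move=> nr dimA mx xr.
have fg : fin_gen (quo hI).
  have lin (a : A) (u v : 'rV[A]_1) : proj hI ((a *: u + v) 0 0) =
      a *: proj hI (u 0 0 : A^o) + proj hI (v 0 0 : A^o).
    by rewrite !mxE linearD -[_ * _]/(a *: (u 0 0 : A^o)) linearZ.
  exists 1%N, (mklin (f := fun u : 'rV[A]_1 => proj hI (u 0 0 : A^o)) lin).
  apply/seteqP; split=> // c _; exists ((rep c : A)%:M) => //.
  by rewrite /= mxE eqxx mulr1n; exact: repK.
have [b [d [p [pT pK hd]]]] := min_resolution hA hm fg; have [dd ex dm] := hd.
have nz := residue_rank pT pK hd nr dimA.
(* The image of d_D is the syzygy of order D + 1 = dim A of the residue field, and the term of index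
   D + 2 of the resolution is nonzero. *)
have ns : ~ stably_zero (image_mod (d D)) by move=> /(stably_zero_image hA hm dd ex dm).
exists (image_mod (d D)); split=> //.
exact: (MCM_image hA hm dd ex ns (leqnn D.+1) dimA mx xr).
Qed.

End Koszul.

Lemma fin1_of_definition (A : comNzRingType) (m I : set A) (N : lmodType A) a r :
  gens I a r -> ideal_of_definition m N I -> fin1 a r N.
Proof.
move=> hg [_ _ [Q [[q [qT qK]] /fin_mod_length fQ]]].
have E : smul I (setT : set N) = fil a r 1 by rewrite (smul_gens hg) //; exact: submoduleT.
rewrite E in qK; have q0 x : q x = 0 <-> fil a r 1 x by rewrite -qK.
have hF := @submodule_fil A N a r 1.
have sq (y : Q) : (setT : set Q) y -> exists2 x : N, setT x & [set 0] (y - q x).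
  by rewrite -qT => -[x _ <-]; exists x => //=; rewrite subrr.
by have [] := ell_iso hF (@submoduleT A N) (fun _ _ => Logic.I) (@submodule_zero A Q)
  (@submoduleT A Q) (fun _ _ => Logic.I) (fun _ _ => Logic.I) (fun x _ => q0 x) sq fQ.
Qed.

Theorem mainTheorem4 (A : comNzRingType) (m : set A) (N : lmodType A)
    (I : set A) :
  noetherian A -> local_ring m ->
  complete_intersection m -> ~ regular_local m -> (1%:Z%:E <= ring_dim A)%E ->
  perfect m N -> (1%:Z%:E <= mod_dim N)%E ->
  ideal_of_definition m N I ->
  exists E : lmodType A,
    [/\ MCM m E,
        exists X : lmodType A, is_Omega m 2%:Z E X /\ isomorphic X E
      & (r1 I N E)%:E =
        infz [set r | exists M : lmodType A,
                [/\ MCM m M, ~ stably_zero M & r = r_infty m I N M]]].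
Proof.
move=> hA hm ci nr dim1 [fN _ _ _] _ hI.
have [B [Q [phi [g [mQ [f [X [c [DX [D [x [st [dimA mx xr sx]]]]]]]]]]]]] :=
  complete_intersection_structure hA hm ci.
have [idI _ _] := hI; have [a [r hg]] := gens_exists hA idI.
have [D' DE] : exists D', D = D'.+1.
  by case: D dimA {xr sx} => [|D'] dimA; [rewrite dimA in dim1|exists D'].
have [M [hM ns]] : exists M : lmodType A, MCM m M /\ ~ stably_zero M.
  by apply: (@exists_nonfree A m hA hm D' x) => //; rewrite -DE.
exact: (minimal_periodic hA hm st dimA mx xr sx (noeth_fin_gen hA fN)
  (fin1_of_definition hg hI) hg hM ns).
Qed.
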